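(* Let $g$ be a $C^2$ Riemannian metric on $\overline{D}_2$ and let $\bar u\in C^1(\overline{D}_2,\mathbb{R}^3)$ be a short immersion of $(\overline{D}_2,g)$. For every $\delta\in(0,\tfrac15)$ and every $\varepsilon>0$ there is an isometric immersion $u\in C^{1,\frac15-\delta}(\overline{D}_1,\mathbb{R}^3)$ of $(\overline{D}_1,g)$ into $\mathbb{R}^3$ such that $\|\bar u-u\|_{C^0}<\varepsilon$ (the $C^0$ norm being taken on $\overline{D}_1$).
   Context: $\overline{D}_r\subset\mathbb{R}^2$ denotes the closed disk of radius $r$ centered at $0$. A $C^1$ immersion $u:\overline{D}_r\to\mathbb{R}^3$ is isometric with respect to the metric $g$ if $\partial_i u\cdot\partial_j u=g_{ij}$ for all $i,j\in\{1,2\}$ on $\overline{D}_r$. It is short if $0<(\partial_i u\cdot\partial_j u)_{ij}<(g_{ij})_{ij}$ in the sense of quadratic forms at every point of $\overline{D}_r$. $C^{1,\beta}$ denotes the usual Hölder space of $C^1$ maps with $\beta$-Hölder first derivatives. *)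

(* Defs.v *)
From HB Require Import structures.
From mathcomp Require Import all_boot all_order all_algebra.
From mathcomp Require Import all_classical all_reals all_analysis.

Set Implicit Arguments.
Unset Strict Implicit.
Unset Printing Implicit Defensive.

Import Order.TTheory GRing.Theory Num.Theory.
Import numFieldNormedType.Exports.

Local Open Scope classical_set_scope.
Local Open Scope ring_scope.

(* The library norm on ['rV[R]_n] is the sup norm, so the Euclidean structure *)
(* is introduced explicitly; both norms induce the same topology.             *)
Definition dot (R : realType) (n : nat) (x y : 'rV[R]_n) : R :=
  \sum_(k < n) x 0 k * y 0 k.

Definition enorm (R : realType) (n : nat) (x : 'rV[R]_n) : R :=
  Num.sqrt (dot x x).

Definition odisk (R : realType) (r : R) : set 'rV[R]_2 :=
  [set x | enorm x < r].

Definition cdisk (R : realType) (r : R) : set 'rV[R]_2 :=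
  [set x | enorm x <= r].

(* Functions on the closed disk are represented by total functions of which   *)
(* only the values on the disk matter.  [pd r i f] is the extension to the    *)
(* closed disk, by limits from the open disk, of the [i]-th partial           *)
(* derivative of [f].  When that derivative is continuous on the open disk,   *)
(* the limit at an interior point is its value there.                         *)
Definition pd (R : realType) (V : normedModType R) (r : R) (i : 'I_2)
    (f : 'rV[R]_2 -> V) (x : 'rV[R]_2) : V :=
  lim ('D_(delta_mx 0 i) f y @[y --> within (odisk r) (nbhs x)]).

(* Being [C^1] up to the boundary: the partial derivatives exist in the open  *)
(* disk and extend continuously to the closed disk.  The neighbourhoods are   *)
(* not punctured, so the last clause at an interior [x] is continuity of the  *)
(* partial derivative at [x].                                                 *)
Definition C1 (R : realType) (V : normedModType R) (r : R)
    (f : 'rV[R]_2 -> V) : Prop :=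
  [/\ {within cdisk r, continuous f},
      forall x (i : 'I_2), odisk r x -> derivable f x (delta_mx 0 i)
    & forall x (i : 'I_2), cdisk r x ->
        cvg ('D_(delta_mx 0 i) f y @[y --> within (odisk r) (nbhs x)])].

Definition C2 (R : realType) (V : normedModType R) (r : R)
    (f : 'rV[R]_2 -> V) : Prop :=
  C1 r f /\ forall i : 'I_2, C1 r (pd r i f).

Definition C1_holder (R : realType) (r beta : R)
    (u : 'rV[R]_2 -> 'rV[R]_3) : Prop :=
  C1 r u /\
  exists K : R, forall (i : 'I_2) x y, cdisk r x -> cdisk r y ->
    enorm (pd r i u x - pd r i u y) <= K * enorm (x - y) `^ beta.

Definition posdef (R : realType) (n : nat) (A : 'M[R]_n) : Prop :=
  forall v : 'rV[R]_n, v != 0 -> 0 < (v *m A *m v^T) 0 0.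

Definition C2_metric (R : realType) (r : R)
    (g : 'rV[R]_2 -> 'M[R]_2) : Prop :=
  C2 r g /\ forall x, cdisk r x -> (g x)^T = g x /\ posdef (g x).

Definition jacobian (R : realType) (r : R) (u : 'rV[R]_2 -> 'rV[R]_3)
    (x : 'rV[R]_2) : 'M[R]_(2, 3) :=
  \matrix_(i < 2, k < 3) pd r i u x 0 k.

Definition C1_immersion (R : realType) (r : R)
    (u : 'rV[R]_2 -> 'rV[R]_3) : Prop :=
  C1 r u /\ forall x, cdisk r x -> row_free (jacobian r u x).

Definition induced_metric (R : realType) (r : R) (u : 'rV[R]_2 -> 'rV[R]_3)
    (x : 'rV[R]_2) : 'M[R]_2 :=
  \matrix_(i < 2, j < 2) dot (pd r i u x) (pd r j u x).

Definition isometric_immersion (R : realType) (r : R)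
    (g : 'rV[R]_2 -> 'M[R]_2) (u : 'rV[R]_2 -> 'rV[R]_3) : Prop :=
  C1_immersion r u /\
  forall x (i j : 'I_2), cdisk r x -> dot (pd r i u x) (pd r j u x) = g x i j.

Definition short_immersion (R : realType) (r : R)
    (g : 'rV[R]_2 -> 'M[R]_2) (u : 'rV[R]_2 -> 'rV[R]_3) : Prop :=
  C1_immersion r u /\
  forall x, cdisk r x ->
    posdef (induced_metric r u x) /\ posdef (g x - induced_metric r u x).

Definition C0norm (R : realType) (r : R) (f : 'rV[R]_2 -> 'rV[R]_3) : \bar R :=
  ereal_sup [set (enorm (f x))%:E | x in cdisk r].

(* Main.v *)
(** Convex integration in codimension one, after Nash, Kuiper and
    De Lellis-Inauen-Szekelyhidi.

    One primitive step adds to [u] a corrugation [(sqrt 2 a / la) sin (la xi.z)] along the unit normal,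
    plus a tangential correction of double frequency, and thereby adds [a^2 xi xi^T] to the metric up to
    an error [O(s^2 mu / la + s^3)], where [s] is the size of [a], [mu] the frequency of [u] and [la] the new
    one.  A general metric defect on a surface would need three such steps per stage.  The (1,1)-step is
    made almost free: it only has to produce the off-diagonal entry of the defect, and all other errors it
    makes are removed from that entry by iterating on the amplitude and by repeated integration by parts,
    at the price of a diagonal contribution.  It therefore works with the small frequency ratio [ka],
    where [ka^J = K], and the diagonal part of the defect is then cancelled by two ordinary steps with ratio
    [K].  Up to the factor [ka] a stage costs [K^2] in frequency and gains [K^(-1/2)] in amplitude, and
    interpolation between [|D v - D u| <= C s] and the second derivatives gives convergence in
    [C^(1, al)] for every [al < 1 / (5 + 2 / J)].

    To start the iteration the short map is mollified, and its defect, less a small multiple of a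
    fixed metric, is written as a finite sum of terms [a^2 xi xi^T]; each term is added in [N] portions of
    size [1 / N], so that the cubic errors add up to [O(N^(-1/2))]. *)

Require Import Defs.
From HB Require Import structures.
From mathcomp Require Import all_boot all_order all_algebra.
From mathcomp Require Import all_classical all_reals all_analysis.
From mathcomp Require Import ring lra zify.

Set Implicit Arguments.
Unset Strict Implicit.
Unset Printing Implicit Defensive.

Import Order.TTheory GRing.Theory Num.Theory.
Import numFieldNormedType.Exports.

Local Open Scope classical_set_scope.
Local Open Scope ring_scope.

(** * Pointwise calculus and derivative bounds *)

Section Calculus.
Context {R : realType}.
Local Notation pt := 'rV[R]_2.
Implicit Types (f g : pt -> R) (z : pt) (b : bool) (S : set pt).

(** The (1,1)-step is cheap because its tangential field has the single component [W true]. It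
    enters the off-diagonal entry only through [dd false (W true)], so every oscillating remainder
    there is a derivative up to any chosen power of [mu / la]. The price, [dd true (W true)], falls
    on a diagonal entry, where an error of full size [sg ^ 2] is harmless: the two coordinate steps
    come later and, as one component of each direction vanishes, do not disturb the off-diagonal
    entry to leading order. What must be guaranteed is that the diagonal defect stays positive,
    whence the one-sided bound in [offdiag_exists] and the entry [1 / 4] of [Hres]. Constants must
    not depend on the stage. Estimates are therefore stated as [famO], a big-O along a filter on the
    type of all admissible configurations; a constant extracted from it is uniform by construction.
    Since a stage uses a number of derivatives fixed by [J], repeated averaging over segments serves
    as mollifier: each average pays for one derivative. *)

Lemma rV_norm_leP (r : R) z : 0 <= r -> (`|z| <= r) <-> (forall j, `|z 0 j| <= r).
Proof.
move=> r0; rewrite [`|z|]mx_normrE; split.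
  move=> /bigmax_leP[_ h] j; exact: (h (0, j)).
by move=> h; apply/bigmax_leP; split => // -[i j] _ /=; rewrite ord1.
Qed.

Definition ebas b : pt := delta_mx 0 (if b then 1 else 0).

Definition dd b f z : R := 'D_(ebas b) f z.

Lemma ebasE b (j : 'I_2) : ebas b 0 j = (j == if b then 1 else 0 :> 'I_2)%:R.
Proof. by rewrite /ebas mxE eqxx. Qed.

Lemma norm_ebas b (t : R) : `|t *: ebas b| = `|t|.
Proof.
apply/eqP; rewrite eq_le; apply/andP; split.
  apply/rV_norm_leP => // j; rewrite mxE ebasE; case: eqP => _.
    by rewrite mulr1.
  by rewrite mulr0 normr0.
have := (@rV_norm_leP `|t *: ebas b| (t *: ebas b) (normr_ge0 _)).1 (lexx _).
by move=> /(_ (if b then 1 else 0)); rewrite mxE ebasE eqxx mulr1.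
Qed.

(** The two difference quotients agree literally. This makes the one-variable chain rule, mean value
    theorem and fundamental theorem available along coordinate lines. *)
Lemma is_derive_line f z v (df : R) :
  is_derive z v f df <-> is_derive (0:R) (1:R) (fun t : R => f (t *: v + z)) df.
Proof.
have e : (fun h : R => h^-1 *: ((f \o shift z) (h *: v) - f z)) =
  (fun h : R => h^-1 *: (((fun t : R => f (t *: v + z)) \o shift 0) (h *: (1:R)) - f (0 *: v + z))).
  by rewrite funeqE => h /=; rewrite addr0 scale0r add0r [_%:A]mulr1.
split => -[h1 h2]; split; move: h1 h2; rewrite /derivable /derive.
- by rewrite e.
- by rewrite e.
- by rewrite -e.
- by rewrite -e.
Qed.

Lemma is_derive_comp1 (h : R -> R) f z v (df dh : R) :
  is_derive (f z) 1 h dh -> is_derive z v f df ->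
  is_derive z v (fun w => h (f w)) (dh * df).
Proof.
move=> hh /is_derive_line hf; apply/is_derive_line.
have := @is_derive1_comp R h (fun t : R => f (t *: v + z)) 0 dh df.
by apply => //; rewrite scale0r add0r.
Qed.

Lemma derivable_dd f z b : derivable f z (ebas b) -> is_derive z (ebas b) f (dd b f z).
Proof. exact: derivableP. Qed.

Lemma is_derive_dd f z b (d : R) : is_derive z (ebas b) f d -> dd b f z = d.
Proof. by case. Qed.

Lemma is_derive_derivable f z v (d : R) : is_derive z v f d -> derivable f z v.
Proof. by case. Qed.

Lemma is_derive_add f g z v (df dg : R) : is_derive z v f df -> is_derive z v g dg ->
  is_derive z v (fun w => f w + g w) (df + dg).
Proof. by move=> hf hg; apply: is_deriveD. Qed.

Lemma is_derive_opp f z v (df : R) : is_derive z v f df ->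
  is_derive z v (fun w => - f w) (- df).
Proof. by move=> hf; apply: is_deriveN. Qed.

Lemma is_derive_mul f g z v (df dg : R) : is_derive z v f df -> is_derive z v g dg ->
  is_derive z v (fun w => f w * g w) (f z * dg + g z * df).
Proof. by move=> hf hg; apply: (@is_deriveM _ _ f g). Qed.

Lemma is_derive_const (c : R) z v : is_derive z v (fun=> c) 0.
Proof. exact: is_derive_cst. Qed.

Lemma is_derive_inv f z v (df : R) : f z != 0 -> is_derive z v f df ->
  is_derive z v (fun w => (f w)^-1) (- ((f z)^-1 * (f z)^-1) * df).
Proof.
move=> f0 hf; split; first by apply: derivableV => //; case: hf.
rewrite deriveV //.
case: hf => _ ->; rewrite /GRing.scale /= -expr2 exprVn.
by [].
Qed.

Lemma is_derive_sqrtc f z v (df : R) : 0 < f z -> is_derive z v f df ->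
  is_derive z v (fun w => Num.sqrt (f w)) (2^-1 * (Num.sqrt (f z))^-1 * df).
Proof.
move=> f0 hf; rewrite -invfM.
by apply: is_derive_comp1 => //; exact: is_derive1_sqrt.
Qed.

Lemma is_derive_coord (j : 'I_2) z b :
  is_derive z (ebas b) (fun w => w 0 j) (j == if b then 1 else 0 :> 'I_2)%:R.
Proof.
apply/is_derive_line.
rewrite [X in is_derive _ _ X _](_ : _ = (fun t : R => (j == if b then 1 else 0 :> 'I_2)%:R * t + z 0 j)); last first.
  by rewrite funeqE => t; rewrite mxE [X in X + _]mxE ebasE mulrC.
rewrite -[X in is_derive _ _ _ X]addr0; apply: is_deriveD.
rewrite -[X in is_derive _ _ _ X]mulr1; exact: is_deriveZ.
Qed.

(** A weighted [C^k] bound: partial derivatives of order [j <= k], taken in any order, are at most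
    [C * mu ^+ j] on [S]. So [C] is an amplitude and [mu] a frequency. *)
Fixpoint Bd k S (C mu : R) f : Prop :=
  [/\ 0 <= C, forall z, S z -> `|f z| <= C &
   if k is k'.+1 then forall b, (forall z, S z -> derivable f z (ebas b)) /\
      Bd k' S (C * mu) mu (dd b f)
   else True].

Lemma Bd_ge0 k S C mu f : Bd k S C mu f -> 0 <= C.
Proof. by case: k => [|k] []. Qed.

Lemma Bd_bound k S C mu f z : Bd k S C mu f -> S z -> `|f z| <= C.
Proof. by case: k => [|k] [_ + _]; apply. Qed.

Lemma Bd_derivable k S C mu f z b : Bd k.+1 S C mu f -> S z -> derivable f z (ebas b).
Proof. by move=> [_ _ /(_ b)[+ _]]; apply. Qed.

Lemma Bd_is_derive k S C mu f z b : Bd k.+1 S C mu f -> S z ->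
  is_derive z (ebas b) f (dd b f z).
Proof. by move=> h Sz; apply: derivable_dd; apply: Bd_derivable h Sz. Qed.

Lemma Bd_dd k S C mu f b : Bd k.+1 S C mu f -> Bd k S (C * mu) mu (dd b f).
Proof. by move=> [_ _ /(_ b)[]]. Qed.

Lemma Bd_leC k S C C' mu f : 0 <= mu -> C <= C' -> Bd k S C mu f -> Bd k S C' mu f.
Proof.
move=> mu0; elim: k C C' f => [|k IH] C C' f CC' /= [C0 h1 h2]; split => //; try exact: le_trans CC'.
- by move=> z /h1 h; exact: le_trans CC'.
- by move=> z /h1 h; exact: le_trans CC'.
- by move=> b; have [h3 h4] := h2 b; split => //; apply: IH h4; exact: ler_wpM2r.
Qed.

Lemma Bd_lemu k S C mu mu' f : 0 <= mu -> mu <= mu' -> Bd k S C mu f -> Bd k S C mu' f.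
Proof.
move=> mu0 mm; elim: k C f => [|k IH] C f //= [C0 h1 h2]; split => // b.
have [h3 h4] := h2 b; split => //.
apply: (@Bd_leC _ _ (C * mu)); [exact: le_trans mm|exact: ler_wpM2l|exact: IH].
Qed.

Lemma Bd_lek k k' S C mu f : (k' <= k)%N -> Bd k S C mu f -> Bd k' S C mu f.
Proof.
elim: k k' C f => [|k IH] [|k'] C f //; first by move=> _ [].
by rewrite ltnS => kk [C0 h1 h2]; split => // b; have [h3 h4] := h2 b; split => //; exact: IH.
Qed.

Lemma Bd_sub k S S' C mu f : S' `<=` S -> Bd k S C mu f -> Bd k S' C mu f.
Proof.
move=> SS; elim: k C f => [|k IH] C f /= [C0 h1 h2]; split => //.
- by move=> z /SS /h1.
- by move=> z /SS /h1.
- by move=> b; have [h3 h4] := h2 b; split; [move=> z /SS /h3|exact: IH].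
Qed.

Lemma open_near_eq S f g z : open S -> {in S, f =1 g} -> S z -> {near z, f =1 g}.
Proof.
move=> oS fg Sz; apply: filterS (open_nbhs_nbhs (conj oS Sz)) => w Sw.
by apply: fg; rewrite inE.
Qed.

Lemma dd_ext S f g b z : open S -> {in S, f =1 g} -> S z -> dd b f z = dd b g z.
Proof. by move=> oS fg Sz; exact: near_eq_derive (open_near_eq oS fg Sz). Qed.

Lemma Bd_ext k S C mu f g : open S -> {in S, f =1 g} -> Bd k S C mu f -> Bd k S C mu g.
Proof.
move=> oS; elim: k C f g => [|k IH] C f g fg /= [C0 h1 h2]; split => //.
- by move=> z Sz; rewrite -fg ?inE //; exact: h1.
- by move=> z Sz; rewrite -fg ?inE //; exact: h1.
- move=> b; have [h3 h4] := h2 b; split.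
    move=> z Sz; exact: near_eq_derivable (open_near_eq oS fg Sz) (h3 z Sz).
  by apply: IH h4 => z; rewrite inE => Sz; exact: (dd_ext b oS fg Sz).
Qed.

(** Supplying the derivatives in closed form replaces computations with [dd]. Openness of [S] is
    what lets the higher derivatives of [dd b f] be read off from [D b]. *)
Lemma Bd_intro k S C mu f (D : bool -> pt -> R) : open S -> 0 <= C ->
  (forall z, S z -> `|f z| <= C) ->
  (forall b z, S z -> is_derive z (ebas b) f (D b z)) ->
  (forall b, Bd k S (C * mu) mu (D b)) -> Bd k.+1 S C mu f.
Proof.
move=> oS C0 h1 h2 h3; split => // b; split.
  by move=> z Sz; exact: is_derive_derivable (h2 b z Sz).
apply: Bd_ext (h3 b) => // z; rewrite inE => Sz.
by rewrite (is_derive_dd (h2 b z Sz)).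
Qed.

Lemma Bd_const k S (c mu : R) : open S -> 0 <= mu -> Bd k S `|c| mu (fun=> c).
Proof.
move=> oS mu0.
have Bd0 j C : 0 <= C -> Bd j S C mu (fun=> 0).
  elim: j C => [|j IH] C C0; first by split => // z _; rewrite normr0.
  apply: (Bd_intro (D := fun _ _ => 0)) => //.
  - by move=> z _; rewrite normr0.
  - by move=> b; apply: IH; rewrite mulr_ge0.
case: k => [|k]; first by split.
apply: (Bd_intro (D := fun _ _ => 0)) => //.
by move=> b; apply: Bd0; rewrite mulr_ge0.
Qed.

Lemma Bd_add k S C C' mu f g : open S -> Bd k S C mu f -> Bd k S C' mu g ->
  Bd k S (C + C') mu (fun z => f z + g z).
Proof.
move=> oS; elim: k C C' f g => [|k IH] C C' f g hf hg.
  split; first by rewrite addr_ge0 ?(Bd_ge0 hf) ?(Bd_ge0 hg).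
    move=> z Sz; apply: le_trans (ler_normD _ _) _.
    by apply: lerD; [exact: Bd_bound hf Sz|exact: Bd_bound hg Sz].
  by [].
apply: (Bd_intro (D := fun b z => dd b f z + dd b g z)) => //.
- by rewrite addr_ge0 ?(Bd_ge0 hf) ?(Bd_ge0 hg).
- move=> z Sz; apply: le_trans (ler_normD _ _) _.
  by apply: lerD; [exact: Bd_bound hf Sz|exact: Bd_bound hg Sz].
- by move=> b z Sz; exact: is_derive_add (Bd_is_derive _ hf Sz) (Bd_is_derive _ hg Sz).
- by move=> b; rewrite mulrDl; apply: IH; exact: Bd_dd.
Qed.

Lemma Bd_opp k S C mu f : open S -> Bd k S C mu f -> Bd k S C mu (fun z => - f z).
Proof.
move=> oS; elim: k C f => [|k IH] C f hf.
  by case: hf => C0 h _; split => // z /h; rewrite normrN.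
apply: (Bd_intro (D := fun b z => - dd b f z)) => //.
- exact: Bd_ge0 hf.
- by move=> z Sz; rewrite normrN; exact: Bd_bound hf Sz.
- by move=> b z Sz; apply: is_derive_opp; exact: Bd_is_derive hf Sz.
- by move=> b; apply: IH; exact: Bd_dd.
Qed.

(** The factor [2 ^+ k] counts the Leibniz terms of order [k]. *)
Lemma Bd_mul k S C C' mu f g : open S -> 0 <= mu -> Bd k S C mu f -> Bd k S C' mu g ->
  Bd k S (2 ^+ k * (C * C')) mu (fun z => f z * g z).
Proof.
move=> oS mu0; elim: k C C' f g => [|k IH] C C' f g hf hg.
  split; first by rewrite mul1r mulr_ge0 ?(Bd_ge0 hf) ?(Bd_ge0 hg).
    move=> z Sz; rewrite normrM mul1r.
    by apply: ler_pM => //; [exact: Bd_bound hf Sz|exact: Bd_bound hg Sz].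
  by [].
have C0 := Bd_ge0 hf; have C'0 := Bd_ge0 hg.
apply: (Bd_intro (D := fun b z => f z * dd b g z + g z * dd b f z)) => //.
- by rewrite mulr_ge0 ?mulr_ge0.
- move=> z Sz; rewrite normrM; apply: (@le_trans _ _ (C * C')).
    by apply: ler_pM => //; [exact: Bd_bound hf Sz|exact: Bd_bound hg Sz].
  rewrite ler_peMl ?mulr_ge0 //; apply: exprn_ege1; lra.
- by move=> b z Sz; exact: is_derive_mul (Bd_is_derive _ hf Sz) (Bd_is_derive _ hg Sz).
- move=> b; have -> : 2 ^+ k.+1 * (C * C') * mu = 2 ^+ k * (C * (C' * mu)) + 2 ^+ k * (C' * (C * mu)).
    by rewrite exprS; ring.
  apply: Bd_add => //; apply: IH.
  + exact: Bd_lek hf.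
  + exact: Bd_dd.
  + exact: Bd_lek hg.
  + exact: Bd_dd.
Qed.

Lemma Bd_scale k S C (c mu : R) f : open S -> 0 <= mu -> Bd k S C mu f ->
  Bd k S (`|c| * C) mu (fun z => c * f z).
Proof.
move=> oS mu0; elim: k C f => [|k IH] C f hf.
  case: hf => C0 h _; split => //; first by rewrite mulr_ge0.
  by move=> z /h; rewrite normrM => h1; rewrite ler_wpM2l.
apply: (Bd_intro (D := fun b z => c * dd b f z)) => //.
- by rewrite mulr_ge0 ?(Bd_ge0 hf).
- by move=> z Sz; rewrite normrM ler_wpM2l // (Bd_bound hf Sz).
- move=> b z Sz; rewrite -[X in is_derive _ _ _ X]addr0 -[X in _ + X](mulr0 (f z)).
  exact: is_derive_mul (is_derive_const _ _ _) (Bd_is_derive _ hf Sz).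
- by move=> b; rewrite -mulrA; apply: IH; exact: Bd_dd.
Qed.

(** The derivative of [1 / f] is [- (1 / f)^2 df], so order [k] for the inverse yields order
    [k + 1]. The order of quantifiers is the point: [C'] depends on [k], [C] and [c], but neither on
    the domain nor on the frequency. *)
Lemma Bd_inv k (C c : R) : 0 < c -> exists2 C', 0 <= C' & forall S mu f, open S -> 0 <= mu ->
  Bd k S C mu f -> (forall z, S z -> c <= f z) -> Bd k S C' mu (fun z => (f z)^-1).
Proof.
move=> c0; elim: k => [|k [C1 C10 IH]].
  exists c^-1; first by rewrite invr_ge0 ltW.
  move=> S mu f oS mu0 hf fc; split; rewrite ?invr_ge0 ?(ltW c0) // => z Sz.
  have fz := lt_le_trans c0 (fc z Sz).
  rewrite gtr0_norm ?invr_gt0 //; rewrite lef_pV2 ?posrE //; exact: fc.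
pose C' := c^-1 + 2 ^+ k * ((2 ^+ k * (C1 * C1)) * `|C|).
have C'0 : 0 <= C' by rewrite addr_ge0 ?invr_ge0 ?(ltW c0) // !mulr_ge0.
exists C' => // S mu f oS mu0 hf fc.
have fz z : S z -> 0 < f z by move=> Sz; exact: lt_le_trans c0 (fc z Sz).
have hi : Bd k S C1 mu (fun z => (f z)^-1) by apply: IH => //; exact: Bd_lek hf.
apply: (Bd_intro (D := fun b z => - ((f z)^-1 * (f z)^-1) * dd b f z)) => //.
- move=> z Sz; rewrite gtr0_norm ?invr_gt0 ?fz //.
  apply: (@le_trans _ _ c^-1); first by rewrite lef_pV2 ?fc ?posrE ?fz.
  by rewrite /C' lerDl !mulr_ge0.
- by move=> b z Sz; apply: is_derive_inv; [rewrite gt_eqF // fz|exact: Bd_is_derive hf Sz].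
- move=> b; apply: (@Bd_leC _ _ (2 ^+ k * ((2 ^+ k * (C1 * C1)) * (`|C| * mu)))) => //.
    rewrite /C' mulrDl -!mulrA lerDr mulr_ge0 // invr_ge0 ltW //.
  apply: Bd_mul => //; first by apply: Bd_opp => //; exact: Bd_mul.
  apply: Bd_leC (Bd_dd b hf) => //.
  by rewrite ler_wpM2r // ler_norm.
Qed.

(** The same bootstrap as for inverses: the derivative is [df / (2 sqrt f)], and [Bd_inv] applies to
    [sqrt f], which stays above [sqrt c]. *)
Lemma Bd_sqrt k (C c : R) : 0 < c -> exists2 C', 0 <= C' & forall S mu f, open S -> 0 <= mu ->
  Bd k S C mu f -> (forall z, S z -> c <= f z) -> Bd k S C' mu (fun z => Num.sqrt (f z)).
Proof.
move=> c0; elim: k => [|k [C1 C10 IH]].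
  exists (Num.sqrt C) => // S mu f oS mu0 hf fc; split => // z Sz.
  rewrite ger0_norm // ler_wsqrtr //; apply: le_trans (ler_norm _) _; exact: Bd_bound hf Sz.
have sc0 : 0 < Num.sqrt c by rewrite sqrtr_gt0.
have [C2 C20 hinv] := Bd_inv k C1 sc0.
pose C' := Num.sqrt C + 2 ^+ k * ((`|2^-1| * C2) * `|C|).
have C'0 : 0 <= C' by rewrite addr_ge0 // !mulr_ge0.
exists C' => // S mu f oS mu0 hf fc.
have fz z : S z -> 0 < f z by move=> Sz; exact: lt_le_trans c0 (fc z Sz).
have hs : Bd k S C1 mu (fun z => Num.sqrt (f z)) by apply: IH => //; exact: Bd_lek hf.
have hi := hinv S mu _ oS mu0 hs (fun z Sz => ler_wsqrtr (fc z Sz)).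
apply: (Bd_intro (D := fun b z => 2^-1 * (Num.sqrt (f z))^-1 * dd b f z)) => //.
- move=> z Sz; rewrite ger0_norm //; apply: (@le_trans _ _ (Num.sqrt C)).
    rewrite ler_wsqrtr //; apply: le_trans (ler_norm _) _; exact: Bd_bound hf Sz.
  by rewrite /C' lerDl !mulr_ge0.
- by move=> b z Sz; apply: is_derive_sqrtc; [exact: fz|exact: Bd_is_derive hf Sz].
- move=> b; apply: (@Bd_leC _ _ (2 ^+ k * ((`|2^-1| * C2) * (`|C| * mu)))) => //.
    by rewrite /C' mulrDl -!mulrA lerDr mulr_ge0.
  apply: Bd_mul => //; first exact: Bd_scale.
  by apply: Bd_leC (Bd_dd b hf) => //; rewrite ler_wpM2r // ler_norm.
Qed.

Definition phase (x : bool -> R) z : R := x false * z 0 0 + x true * z 0 1.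

Lemma is_derive_phase x z b : is_derive z (ebas b) (phase x) (x b).
Proof.
rewrite -[X in is_derive _ _ _ X](_ : (x false * (0 == if b then 1 else 0 :> 'I_2)%:R + z 0 0 * 0) + (x true * (1 == if b then 1 else 0 :> 'I_2)%:R + z 0 1 * 0) = _).
  by apply: is_derive_add; apply: is_derive_mul; (exact: is_derive_const || exact: is_derive_coord).
by case: b => /=; ring.
Qed.

Lemma is_derive_sin_phase l x z b :
  is_derive z (ebas b) (fun w => sin (l * phase x w)) (cos (l * phase x z) * (l * x b)).
Proof.
apply: is_derive_comp1.
rewrite -[X in is_derive _ _ _ X]addr0 -[X in _ + X](mulr0 (phase x z)).
exact: is_derive_mul (is_derive_const _ _ _) (is_derive_phase _ _ _).
Qed.

Lemma is_derive_cos_phase l x z b :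
  is_derive z (ebas b) (fun w => cos (l * phase x w)) (- sin (l * phase x z) * (l * x b)).
Proof.
apply: is_derive_comp1.
rewrite -[X in is_derive _ _ _ X]addr0 -[X in _ + X](mulr0 (phase x z)).
exact: is_derive_mul (is_derive_const _ _ _) (is_derive_phase _ _ _).
Qed.

Lemma Bd_trig k S (l X : R) x : open S -> 0 <= l -> 0 <= X -> (forall b, `|x b| <= X) ->
  Bd k S 1 (l * X) (fun z => sin (l * phase x z)) /\ Bd k S 1 (l * X) (fun z => cos (l * phase x z)).
Proof.
move=> oS l0 X0 xX; elim: k => [|k [IH1 IH2]].
  by split; split => // z _; rewrite ler_norml ?sin_geN1 ?sin_le1 ?cos_geN1 ?cos_le1.
have h b : 1 * `|l * x b| <= 1 * (l * X) by rewrite !mul1r normrM ger0_norm // ler_wpM2l.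
split.
- apply: (Bd_intro (D := fun b z => cos (l * phase x z) * (l * x b))) => //.
  + by move=> z _; rewrite ler_norml ?sin_geN1 ?sin_le1.
  + by move=> b z _; exact: is_derive_sin_phase.
  + move=> b; apply: Bd_leC (h b) _; first by rewrite mulr_ge0.
    rewrite mulrC; apply: (Bd_ext (f := fun z => (l * x b) * cos (l * phase x z))) => //.
      by move=> z _; rewrite mulrC.
    by apply: Bd_scale => //; rewrite mulr_ge0.
- apply: (Bd_intro (D := fun b z => - sin (l * phase x z) * (l * x b))) => //.
  + by move=> z _; rewrite ler_norml ?cos_geN1 ?cos_le1.
  + by move=> b z _; exact: is_derive_cos_phase.
  + move=> b; apply: Bd_leC (h b) _; first by rewrite mulr_ge0.
    rewrite mulrC; apply: (Bd_ext (f := fun z => (l * x b) * - sin (l * phase x z))) => //.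
      by move=> z _; rewrite mulrC.
    by apply: Bd_scale => //; [rewrite mulr_ge0|exact: Bd_opp].
Qed.

End Calculus.

(** * Families of functions with uniform derivative bounds *)

(** A bounded factor in the frequency can be moved into the constant at the price of its [k]-th
    power. It absorbs the length of the direction vector of a phase. *)
Lemma Bd_freqZ {R : realType} k (S : set 'rV[R]_2) (B l X : R) g : 0 <= l -> 1 <= X ->
  Bd k S B (l * X) g -> Bd k S (B * X ^+ k) l g.
Proof.
move=> l0 X1; elim: k B g => [|k IH] B g [B0 h1 h2] /=; first by rewrite expr0 mulr1; split.
have Xk : 1 <= X ^+ k.+1 by exact: exprn_ege1.
split; first by rewrite mulr_ge0 // (le_trans ler01).
  by move=> z /h1 h; apply: le_trans h _; rewrite ler_peMr.
move=> b; have [h3 h4] := h2 b; split => //.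
rewrite (_ : B * X ^+ k.+1 * l = B * (l * X) * X ^+ k); last by rewrite exprS; ring.
exact: IH.
Qed.

Section Families.
Context {R : realType} {T : Type} (F : set_system T) {FF : Filter F}.
Local Notation pt := 'rV[R]_2.
Variable S : T -> set pt.
Hypothesis oS : forall t, open (S t).
Implicit Types (e l : T -> R) (f g : T -> pt -> R).

(** [f t = O(e t)] at frequency [l t], with one constant for all [t] near the filter and all
    derivatives up to order [k]. *)
Definition famO k e l f := exists2 C : R, 0 <= C &
  \forall t \near F, 0 <= l t /\ Bd k (S t) (C * e t) (l t) (f t).

Lemma famO_bound k e l f : famO k e l f -> exists2 C : R, 0 <= C &
  \forall t \near F, forall z, S t z -> `|f t z| <= C * e t.
Proof.
by case=> C C0 h; exists C => //; apply: filterS h => t [_ h] z; exact: Bd_bound h.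
Qed.

Lemma famO_derivable k e l f b : famO k.+1 e l f ->
  \forall t \near F, forall z, S t z -> is_derive z (ebas b) (f t) (dd b (f t) z).
Proof. by case=> C _ h; apply: filterS h => t [_ h] z Sz; exact: Bd_is_derive h Sz. Qed.

Lemma famO_le c k e e' l f : 0 <= c -> (\forall t \near F, e t <= c * e' t) ->
  famO k e l f -> famO k e' l f.
Proof.
move=> c0 he [C C0 h]; exists (C * c); first by rewrite mulr_ge0.
apply: filterS2 he h => t et [l0 h]; split => //; apply: Bd_leC h => //.
by rewrite -mulrA ler_wpM2l.
Qed.

Lemma famO_le1 k e e' l f : (\forall t \near F, e t <= e' t) -> famO k e l f -> famO k e' l f.
Proof. by move=> h; apply: (@famO_le 1) => //; apply: filterS h => t; rewrite mul1r. Qed.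

Lemma famO_freq k e l l' f : (\forall t \near F, l t <= l' t) -> famO k e l f -> famO k e l' f.
Proof.
move=> hl [C C0 h]; exists C => //; apply: filterS2 hl h => t ll [l0 h].
by split; [exact: le_trans ll|exact: Bd_lemu h].
Qed.

Lemma famO_lek k k' e l f : (k' <= k)%N -> famO k e l f -> famO k' e l f.
Proof.
by move=> kk [C C0 h]; exists C => //; apply: filterS h => t [l0 h]; split => //; exact: Bd_lek h.
Qed.

Lemma famO_ext k e l f g : (\forall t \near F, {in S t, f t =1 g t}) ->
  famO k e l f -> famO k e l g.
Proof.
move=> fg [C C0 h]; exists C => //; apply: filterS2 fg h => t fg [l0 h].
by split => //; exact: Bd_ext fg h.
Qed.

Lemma famO_add k e l f g : famO k e l f -> famO k e l g ->
  famO k e l (fun t z => f t z + g t z).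
Proof.
move=> [C C0 h] [C' C'0 h']; exists (C + C'); first by rewrite addr_ge0.
apply: filterS2 h h' => t [l0 h] [_ h']; split => //.
by rewrite mulrDl; exact: Bd_add.
Qed.

Lemma famO_opp k e l f : famO k e l f -> famO k e l (fun t z => - f t z).
Proof.
by move=> [C C0 h]; exists C => //; apply: filterS h => t [l0 h]; split => //; exact: Bd_opp.
Qed.

Lemma famO_sub k e l f g : famO k e l f -> famO k e l g ->
  famO k e l (fun t z => f t z - g t z).
Proof. by move=> hf hg; apply: famO_add => //; exact: famO_opp. Qed.

Lemma famO_mul k e e' l f g : famO k e l f -> famO k e' l g ->
  famO k (fun t => e t * e' t) l (fun t z => f t z * g t z).
Proof.
move=> [C C0 h] [C' C'0 h']; exists (2 ^+ k * (C * C')); first by rewrite !mulr_ge0.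
apply: filterS2 h h' => t [l0 h] [_ h']; split => //.
have -> : 2 ^+ k * (C * C') * (e t * e' t) = 2 ^+ k * ((C * e t) * (C' * e' t)) by ring.
exact: Bd_mul.
Qed.

Lemma famO_scale k e l f (c : T -> R) : famO k e l f ->
  famO k (fun t => `|c t| * e t) l (fun t z => c t * f t z).
Proof.
move=> [C C0 h]; exists C => //; apply: filterS h => t [l0 h]; split => //.
by rewrite mulrCA; exact: Bd_scale.
Qed.

Lemma famO_zscale k e l f (c : R) : famO k e l f -> famO k e l (fun t z => c * f t z).
Proof.
move=> h; apply: (@famO_le `|c|) (famO_scale (fun=> c) h) => //.
by apply: nearW => t; exact: lexx.
Qed.

Lemma famO_cst k l (c : T -> R) : (\forall t \near F, 0 <= l t) ->
  famO k (fun t => `|c t|) l (fun t _ => c t).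
Proof.
move=> h; exists 1 => //; apply: filterS h => t l0; split => //.
by rewrite mul1r; exact: Bd_const.
Qed.

Lemma famO_dd k e l f b : famO k.+1 e l f ->
  famO k (fun t => e t * l t) l (fun t => dd b (f t)).
Proof.
move=> [C C0 h]; exists C => //; apply: filterS h => t [l0 h]; split => //.
by rewrite mulrA; exact: Bd_dd.
Qed.

Lemma famO_inv k l f c : 0 < c -> (\forall t \near F, forall z, S t z -> c <= f t z) ->
  famO k (fun=> 1) l f -> famO k (fun=> 1) l (fun t z => (f t z)^-1).
Proof.
move=> c0 hc [C C0 h]; have [C' C'0 H] := Bd_inv k C c0.
exists C' => //; apply: filterS2 hc h => t hc [l0]; rewrite !mulr1 => h; split => //.
exact: H.
Qed.

Lemma famO_sqrt k l f c : 0 < c -> (\forall t \near F, forall z, S t z -> c <= f t z) ->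
  famO k (fun=> 1) l f -> famO k (fun=> 1) l (fun t z => Num.sqrt (f t z)).
Proof.
move=> c0 hc [C C0 h]; have [C' C'0 H] := Bd_sqrt k C c0.
exists C' => //; apply: filterS2 hc h => t hc [l0]; rewrite !mulr1 => h; split => //.
exact: H.
Qed.

Lemma famO_sin_cos k l (X : R) (x : T -> bool -> R) : (\forall t \near F, 0 <= l t) ->
  0 <= X -> (\forall t \near F, forall b, `|x t b| <= X) ->
  famO k (fun=> 1) (fun t => l t * X) (fun t z => sin (l t * phase (x t) z)) /\
  famO k (fun=> 1) (fun t => l t * X) (fun t z => cos (l t * phase (x t) z)).
Proof.
move=> hl X0 hx; split; exists 1 => //; apply: filterS2 hl hx => t l0 hx;
  (split; first by rewrite mulr_ge0); rewrite mulr1;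
  by have [] := Bd_trig k (@oS t) l0 X0 hx.
Qed.

Lemma famO_freqZ k e l f (X : R) : 1 <= X -> famO k e (fun t => l t * X) f -> famO k e l f.
Proof.
move=> X1 [C C0 h]; have X0 : 0 < X by exact: lt_le_trans X1.
exists (C * X ^+ k); first by rewrite mulr_ge0 // exprn_ge0 // ltW.
apply: filterS h => t [lX h]; have l0 : 0 <= l t by rewrite -(pmulr_lge0 _ X0).
by split => //; rewrite -mulrA (mulrC _ (e t)) mulrA; exact: Bd_freqZ.
Qed.

(** Size 1 for the function, but the separate size [d] for its gradient. A tangent vector of the
    current map is of this kind with [d = sg * mu], since it varies by [sg] at frequency [mu];
    recording only size 1 at frequency [mu] would lose the factor [sg] on which the cubic metric
    error depends. *)
Definition famOD k (d l : T -> R) f :=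
  famO k.+1 (fun=> 1) l f /\ forall b, famO k d l (fun t => dd b (f t)).

Lemma famOD_add k d l f g : famOD k d l f -> famOD k d l g ->
  famOD k d l (fun t z => f t z + g t z).
Proof.
move=> [f1 f2] [g1 g2]; split => [|b]; first exact: famO_add.
apply: famO_ext (famO_add (f2 b) (g2 b)).
apply: filterS2 (famO_derivable b f1) (famO_derivable b g1) => t hf hg z; rewrite inE => Sz.
by rewrite (is_derive_dd (is_derive_add (hf z Sz) (hg z Sz))).
Qed.

Lemma famOD_opp k d l f : famOD k d l f -> famOD k d l (fun t z => - f t z).
Proof.
move=> [f1 f2]; split => [|b]; first exact: famO_opp.
apply: famO_ext (famO_opp (f2 b)).
apply: filterS (famO_derivable b f1) => t hf z; rewrite inE => Sz.
by rewrite (is_derive_dd (is_derive_opp (hf z Sz))).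
Qed.

Lemma famOD_sub k d l f g : famOD k d l f -> famOD k d l g ->
  famOD k d l (fun t z => f t z - g t z).
Proof. by move=> hf hg; apply: famOD_add => //; exact: famOD_opp. Qed.

Lemma famO_mul1 k e l f g : famO k (fun=> 1) l f -> famO k e l g ->
  famO k e l (fun t z => f t z * g t z).
Proof.
by move=> hf hg; apply: famO_le1 (famO_mul hf hg); apply: nearW => t; rewrite mul1r.
Qed.

Lemma famOD_mul k d l f g : famOD k d l f -> famOD k d l g ->
  famOD k d l (fun t z => f t z * g t z).
Proof.
move=> [f1 f2] [g1 g2]; split => [|b]; first exact: famO_mul1.
apply: famO_ext (famO_add (famO_mul1 (famO_lek (leqnSn _) f1) (g2 b))
   (famO_mul1 (famO_lek (leqnSn _) g1) (f2 b))).
apply: filterS2 (famO_derivable b f1) (famO_derivable b g1) => t hf hg z; rewrite inE => Sz.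
by rewrite (is_derive_dd (is_derive_mul (hf z Sz) (hg z Sz))).
Qed.

Lemma famOD_inv k d l f c : 0 < c -> (\forall t \near F, forall z, S t z -> c <= f t z) ->
  famOD k d l f -> famOD k d l (fun t z => (f t z)^-1).
Proof.
move=> c0 hc [f1 f2]; have fi := famO_inv c0 hc f1; split => [//|b].
have fi' := famO_lek (leqnSn _) fi.
apply: famO_ext (famO_mul1 (famO_opp (famO_mul1 fi' fi')) (f2 b)).
apply: filterS2 (famO_derivable b f1) hc => t hf hc1 z; rewrite inE => Sz.
by rewrite (is_derive_dd (is_derive_inv _ (hf z Sz))) // gt_eqF // (lt_le_trans c0) // hc1.
Qed.

Lemma famOD_sqrt k d l f c : 0 < c -> (\forall t \near F, forall z, S t z -> c <= f t z) ->
  famOD k d l f -> famOD k d l (fun t z => Num.sqrt (f t z)).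
Proof.
move=> c0 hc [f1 f2]; have fi := famO_sqrt c0 hc f1; split => [//|b].
have sc0 : 0 < Num.sqrt c by rewrite sqrtr_gt0.
have hsc : \forall t \near F, forall z, S t z -> Num.sqrt c <= Num.sqrt (f t z).
  by apply: filterS hc => t h z Sz; rewrite ler_wsqrtr // h.
have fi' := famO_lek (leqnSn _) (famO_inv sc0 hsc fi).
apply: famO_ext (famO_mul1 (famO_zscale 2^-1 fi') (f2 b)).
apply: filterS2 (famO_derivable b f1) hc => t hf hc1 z; rewrite inE => Sz.
by rewrite (is_derive_dd (is_derive_sqrtc _ (hf z Sz))) // (lt_le_trans c0) // hc1.
Qed.

End Families.

(** * Vectors of three-space and families of vector fields *)

Inductive ax3 := ax_x | ax_y | ax_z.

Definition dot3 {R : realType} (p q : ax3 -> R) : R :=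
  p ax_x * q ax_x + p ax_y * q ax_y + p ax_z * q ax_z.

Definition cross3 {R : realType} (p q : ax3 -> R) (i : ax3) : R :=
  match i with
  | ax_x => p ax_y * q ax_z - p ax_z * q ax_y
  | ax_y => p ax_z * q ax_x - p ax_x * q ax_z
  | ax_z => p ax_x * q ax_y - p ax_y * q ax_x
  end.

Definition dv {R : realType} (b : bool) (u : 'rV[R]_2 -> ax3 -> R) (z : 'rV[R]_2) (i : ax3) : R :=
  dd b (fun w => u w i) z.

Section VectorFamilies.
Context {R : realType} {T : Type} (F : set_system T) {FF : Filter F}.
Local Notation pt := 'rV[R]_2.
Variable S : T -> set pt.
Hypothesis oS : forall t, open (S t).
Implicit Types (e l d : T -> R) (v w : T -> pt -> ax3 -> R).

Definition famOv k e l v := forall i, famO F S k e l (fun t z => v t z i).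
Definition famODv k d l v := forall i, famOD F S k d l (fun t z => v t z i).

Lemma famO_dot k e e' l v w : famOv k e l v -> famOv k e' l w ->
  famO F S k (fun t => e t * e' t) l (fun t z => dot3 (v t z) (w t z)).
Proof. by move=> hv hw; do ?apply: famO_add => //; exact: famO_mul. Qed.

Lemma famOD_dot k d l v w : famODv k d l v -> famODv k d l w ->
  famOD F S k d l (fun t z => dot3 (v t z) (w t z)).
Proof. by move=> hv hw; do ?apply: famOD_add => //; exact: famOD_mul. Qed.

Lemma famOD_cross k d l v w : famODv k d l v -> famODv k d l w ->
  famODv k d l (fun t z => cross3 (v t z) (w t z)).
Proof. by move=> hv hw [] /=; apply: famOD_sub => //; exact: famOD_mul. Qed.

End VectorFamilies.

(** * Corrugations along the normal *)

Section Frame.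
Context {R : realType}.
Local Notation pt := 'rV[R]_2.
Implicit Types (u : pt -> ax3 -> R) (z : pt).

Definition met u a b z : R := dot3 (dv a u z) (dv b u z).
Definition nvec u z := cross3 (dv false u z) (dv true u z).
Definition nsq u z : R := dot3 (nvec u z) (nvec u z).
Definition unorm u z i := nvec u z i * (Num.sqrt (nsq u z))^-1.
(** The tangent frame dual to [dv false u] and [dv true u], written with cross products; dividing by
    [nsq u] normalises the triple product. *)
Definition tfr u (c : bool) z i :=
  (if c then cross3 (nvec u z) (dv false u z) else cross3 (dv true u z) (nvec u z)) i * (nsq u z)^-1.
(** The tangential displacement is given by its covariant components: its product with [dv b u] is
    [W b], so to leading order it changes the metric by [dd a (W b) + dd b (W a)]. *)
Definition corrug u (phi : pt -> R) (W : bool -> pt -> R) z i :=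
  u z i + (phi z * unorm u z i + (W false z * tfr u false z i + W true z * tfr u true z i)).
(** For smooth [u] this is minus twice the second fundamental form, because the normal is orthogonal
    to the tangents. *)
Definition bend u a b z : R :=
  dot3 (dv a u z) (dv b (unorm u) z) + dot3 (dv b u z) (dv a (unorm u) z).

Lemma dot3C (p q : ax3 -> R) : dot3 p q = dot3 q p.
Proof. by rewrite /dot3; ring. Qed.

Lemma dot_cross_sq (p q : ax3 -> R) :
  dot3 (cross3 p q) (cross3 p q) = dot3 p p * dot3 q q - dot3 p q ^+ 2.
Proof.
rewrite /dot3 /=; move: (p ax_x) (p ax_y) (p ax_z) (q ax_x) (q ax_y) (q ax_z) => ? ? ? ? ? ?.
by ring.
Qed.

Lemma dot_cross_l (p q : ax3 -> R) : dot3 (cross3 p q) p = 0.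
Proof.
rewrite /dot3 /=; move: (p ax_x) (p ax_y) (p ax_z) (q ax_x) (q ax_y) (q ax_z) => ? ? ? ? ? ?.
by ring.
Qed.

Lemma dot_cross_r (p q : ax3 -> R) : dot3 (cross3 p q) q = 0.
Proof.
rewrite /dot3 /=; move: (p ax_x) (p ax_y) (p ax_z) (q ax_x) (q ax_y) (q ax_z) => ? ? ? ? ? ?.
by ring.
Qed.

Lemma dot_cross_cycle (p q r : ax3 -> R) : dot3 (cross3 p q) r = dot3 p (cross3 q r).
Proof.
rewrite /dot3 /=; move: (p ax_x) (p ax_y) (p ax_z) (q ax_x) (q ax_y) (q ax_z) => ? ? ? ? ? ?.
move: (r ax_x) (r ax_y) (r ax_z) => ? ? ?.
by ring.
Qed.

Lemma dot3Zl (p q : ax3 -> R) c : dot3 (fun i => p i * c) q = dot3 p q * c.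
Proof.
rewrite /dot3; move: (p ax_x) (p ax_y) (p ax_z) (q ax_x) (q ax_y) (q ax_z) => ? ? ? ? ? ?.
by ring.
Qed.

(** Lagrange's identity. Nondegeneracy of the immersion can thus be read off the metric, which is
    what the construction controls. *)
Lemma nsqE u z : nsq u z = met u false false z * met u true true z - met u false true z ^+ 2.
Proof. exact: dot_cross_sq. Qed.

Lemma unorm_unorm u z : 0 < nsq u z -> dot3 (unorm u z) (unorm u z) = 1.
Proof.
move=> n0; rewrite dot3Zl dot3C dot3Zl -/(nsq u z); set s := Num.sqrt _.
have s0 : s != 0 by rewrite gt_eqF // sqrtr_gt0.
have -> : nsq u z = s * s by rewrite -expr2 sqr_sqrtr // ltW.
by rewrite mulfK // mulfV.
Qed.

Lemma unorm_dv u z b : dot3 (unorm u z) (dv b u z) = 0.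
Proof. by rewrite dot3Zl; case: b; rewrite ?dot_cross_l ?dot_cross_r mul0r. Qed.

Lemma unorm_tfr u z c : dot3 (unorm u z) (tfr u c z) = 0.
Proof.
rewrite dot3Zl dot3C dot3Zl; case: c; first by rewrite dot_cross_l !mul0r.
by rewrite dot_cross_r !mul0r.
Qed.

Lemma tfr_dv u z c b : 0 < nsq u z -> dot3 (tfr u c z) (dv b u z) = (c == b)%:R.
Proof.
move=> n0; have nn : nsq u z != 0 by rewrite gt_eqF.
rewrite dot3Zl; suff -> : dot3 (if c then cross3 (nvec u z) (dv false u z)
  else cross3 (dv true u z) (nvec u z)) (dv b u z) = (c == b)%:R * nsq u z by rewrite mulfK.
rewrite /nsq; case: c; case: b; rewrite /= ?mul1r ?mul0r.
- exact: dot_cross_cycle.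
- by rewrite dot_cross_r.
- by rewrite dot_cross_l.
- by rewrite dot3C -dot_cross_cycle.
Qed.

(** [ra] and [rb] are the parts of the displacement's derivatives beyond the leading normal terms
    [fa N] and [fb N]. The subtracted bracket holds the terms that a step exploits; on the right
    remain frame derivatives paired with tangents or normal, and the product of the two
    remainders. *)
Lemma metric_expand (pa pb N E0 E1 dNa dNb E0a E0b E1a E1b : ax3 -> R)
  (fa fb f w0 w1 w0a w0b w1a w1b : R) :
  dot3 N N = 1 -> dot3 N pa = 0 -> dot3 N pb = 0 -> dot3 N E0 = 0 -> dot3 N E1 = 0 ->
  dot3 N dNa = 0 -> dot3 N dNb = 0 ->
  let ra i := f * dNa i + (w0a * E0 i + w0 * E0a i + (w1a * E1 i + w1 * E1a i)) in
  let rb i := f * dNb i + (w0b * E0 i + w0 * E0b i + (w1b * E1 i + w1 * E1b i)) in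
  dot3 (fun i => pa i + (fa * N i + ra i)) (fun i => pb i + (fb * N i + rb i)) - dot3 pa pb
  - (fa * fb + (w0b * dot3 E0 pa + w1b * dot3 E1 pa) + (w0a * dot3 E0 pb + w1a * dot3 E1 pb)
     + f * (dot3 pa dNb + dot3 pb dNa)) =
  (w0 * (dot3 pa E0b + dot3 pb E0a) + w1 * (dot3 pa E1b + dot3 pb E1a))
  + ((w0 * (fa * dot3 N E0b + fb * dot3 N E0a) + w1 * (fa * dot3 N E1b + fb * dot3 N E1a))
  + dot3 ra rb).
Proof.
move=> h1 h2 h3 h4 h5 h6 h7 ra rb.
rewrite -[RHS]addr0.
(* This combination of the orthogonality relations vanishes; once it is added, the two sides agree
   as polynomials in the coordinates. *)
rewrite -[in RHS](_ : fa * fb * (dot3 N N - 1) + fb * dot3 N pa + fa * dot3 N pb +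
  (fa * w0b + fb * w0a) * dot3 N E0 + (fa * w1b + fb * w1a) * dot3 N E1 +
  f * fb * dot3 N dNa + f * fa * dot3 N dNb = 0); last first.
  by rewrite h1 h2 h3 h4 h5 h6 h7; ring.
by rewrite /ra /rb /dot3; ring.
Qed.

Lemma dot3_derive (v w : pt -> ax3 -> R) b z :
  (forall i, derivable (fun t => v t i) z (ebas b)) ->
  (forall i, derivable (fun t => w t i) z (ebas b)) ->
  is_derive z (ebas b) (fun t => dot3 (v t) (w t)) (dot3 (dv b v z) (w z) + dot3 (v z) (dv b w z)).
Proof.
move=> hv hw; rewrite /dot3.
have hm i : is_derive z (ebas b) (fun t => v t i * w t i) (v z i * dv b w z i + w z i * dv b v z i).
  by apply: is_derive_mul; exact: derivable_dd.
apply: (is_derive_eq (is_derive_add (is_derive_add (hm ax_x) (hm ax_y)) (hm ax_z))).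
by rewrite /dot3; ring.
Qed.

End Frame.

Lemma near_bool {T : Type} {F : set_system T} {FF : Filter F} (P : bool -> T -> Prop) :
  (forall b, \forall t \near F, P b t) -> \forall t \near F, forall b, P b t.
Proof. by move=> h; apply: filterS2 (h true) (h false) => t ? ? []. Qed.

Lemma near_ax3 {T : Type} {F : set_system T} {FF : Filter F} (P : ax3 -> T -> Prop) :
  (forall i, \forall t \near F, P i t) -> \forall t \near F, forall i, P i t.
Proof. by move=> h; apply: filterS3 (h ax_x) (h ax_y) (h ax_z) => t ? ? ? []. Qed.

Lemma nearI {T : Type} {F : set_system T} {FF : Filter F} (P Q : T -> Prop) :
  (\forall t \near F, P t) -> (\forall t \near F, Q t) -> \forall t \near F, P t /\ Q t.
Proof. exact: filterI. Qed.

Section Step.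
Context {R : realType} {T : Type} (F : set_system T) {FF : Filter F}.
Local Notation pt := 'rV[R]_2.
Variable S : T -> set pt.
Hypothesis oS : forall t, open (S t).
Variables (u : T -> pt -> ax3 -> R) (phi : T -> pt -> R) (W : T -> bool -> pt -> R).
Variables (sg mu la : T -> R) (k : nat) (c0 : R).
Hypothesis hpar : \forall t \near F, [/\ 0 < sg t, sg t <= 1, 0 < mu t & mu t <= la t].
Hypothesis hu : \forall t \near F, forall i b z, S t z -> derivable (fun w => u t w i) z (ebas b).
Hypothesis hp : forall b, famODv F S k.+1 (fun t => sg t * mu t) mu (fun t => dv b (u t)).
Hypothesis c0_gt0 : 0 < c0.
Hypothesis hn : \forall t \near F, forall z, S t z -> c0 <= nsq (u t) z.

Lemma nvec_famOD : famODv F S k.+1 (fun t => sg t * mu t) mu (fun t => nvec (u t)).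
Proof. exact: (famOD_cross oS (hp false) (hp true)). Qed.

Lemma unorm_famOD : famODv F S k.+1 (fun t => sg t * mu t) mu (fun t => unorm (u t)).
Proof.
have hns : famOD F S k.+1 (fun t => sg t * mu t) mu (fun t => nsq (u t)).
  exact: (famOD_dot oS nvec_famOD nvec_famOD).
move=> i; rewrite /unorm; apply: (famOD_mul oS (nvec_famOD i)).
have sc0 : 0 < Num.sqrt c0 by rewrite sqrtr_gt0.
apply: (famOD_inv oS sc0).
  by apply: filterS hn => t h z Sz; rewrite ler_wsqrtr // h.
exact: (famOD_sqrt oS c0_gt0 hn hns).
Qed.

Lemma tfr_famOD c : famODv F S k.+1 (fun t => sg t * mu t) mu (fun t => tfr (u t) c).
Proof.
have hns : famOD F S k.+1 (fun t => sg t * mu t) mu (fun t => nsq (u t)).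
  exact: (famOD_dot oS nvec_famOD nvec_famOD).
move=> i; rewrite /tfr; apply: (famOD_mul oS _ (famOD_inv oS c0_gt0 hn hns)).
by case: c; [exact: (famOD_cross oS nvec_famOD (hp false))|exact: (famOD_cross oS (hp true) nvec_famOD)].
Qed.

Lemma bend_famO a b : famO F S k.+1 (fun t => sg t * mu t) mu (fun t => bend (u t) a b).
Proof.
have h a' b' : famO F S k.+1 (fun t => 1 * (sg t * mu t)) mu
  (fun t z => dot3 (dv a' (u t) z) (dv b' (unorm (u t)) z)).
  apply: (famO_dot oS (e := fun=> 1) (e' := fun t => sg t * mu t)) => i.
    by have [h _] := hp a' i; exact: (famO_lek (leqnSn _) h).
  by have [_] := unorm_famOD i; apply.
rewrite /bend; apply: (famO_le1 _ (famO_add oS (h a b) (h b a))).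
by apply: nearW => t; rewrite mul1r.
Qed.

Hypothesis hphi : famO F S k.+2 (fun t => sg t / la t) la phi.
Hypothesis hW : forall c, famO F S k.+2 (fun t => sg t ^+ 2 / la t) la (fun t => W t c).

(** The derivative of the displacement without [dd b (phi t)] times the normal: what remains is of
    order [sg ^ 2], whereas the omitted term is of order [sg]. *)
Let rho b t z i := phi t z * dv b (unorm (u t)) z i +
  ((dd b (W t false) z * tfr (u t) false z i + W t false z * dv b (tfr (u t) false) z i) +
   (dd b (W t true) z * tfr (u t) true z i + W t true z * dv b (tfr (u t) true) z i)).

Let near_unorm : \forall t \near F, forall i b z, S t z ->
  is_derive z (ebas b) (fun w => unorm (u t) w i) (dv b (unorm (u t)) z i).
Proof.
apply: near_ax3 => i; apply: near_bool => b; exact: famO_derivable (unorm_famOD i).1.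
Qed.

Let near_tfr c : \forall t \near F, forall i b z, S t z ->
  is_derive z (ebas b) (fun w => tfr (u t) c w i) (dv b (tfr (u t) c) z i).
Proof.
apply: near_ax3 => i; apply: near_bool => b; exact: famO_derivable (tfr_famOD c i).1.
Qed.

Let near_phi : \forall t \near F, forall b z, S t z ->
  is_derive z (ebas b) (phi t) (dd b (phi t) z).
Proof. by apply: near_bool => b; exact: famO_derivable hphi. Qed.

Let near_W c : \forall t \near F, forall b z, S t z ->
  is_derive z (ebas b) (W t c) (dd b (W t c) z).
Proof. by apply: near_bool => b; exact: famO_derivable (hW c). Qed.

Lemma corrug_derive : \forall t \near F, forall i b z, S t z ->
  is_derive z (ebas b) (fun w => corrug (u t) (phi t) (W t) w i)
    (dv b (u t) z i + (dd b (phi t) z * unorm (u t) z i + rho b t z i)).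
Proof.
apply: filterS (nearI (nearI hu near_unorm) (nearI (nearI near_phi (near_W false))
  (nearI (near_W true) (nearI (near_tfr false) (near_tfr true))))) => t [[h1 h2] [[h3 h4] [h5 [h6 h7]]]] i b z Sz.
apply: (is_derive_eq (is_derive_add (derivable_dd (h1 i b z Sz))
  (is_derive_add (is_derive_mul (h3 b z Sz) (h2 i b z Sz)) (is_derive_add
    (is_derive_mul (h4 b z Sz) (h6 i b z Sz)) (is_derive_mul (h5 b z Sz) (h7 i b z Sz)))))).
rewrite /rho -/(dv b (u t) z i); congr (_ + _); move: (dd b _ z) (dv b _ z i) => x y.
move: (dv b (tfr (u t) false) z i) (dv b (tfr (u t) true) z i) => x1 x2.
move: (dd b (W t true) z) (dd b (W t false) z) => x3 x4.
by ring.
Qed.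

Let le_rules : \forall t \near F,
  [/\ sg t / la t * (sg t * mu t) <= sg t ^+ 2, sg t ^+ 2 / la t * (sg t * mu t) <= sg t ^+ 3,
      sg t / la t * la t = sg t, sg t ^+ 2 / la t * la t = sg t ^+ 2 &
      [/\ 0 < sg t, sg t <= 1, 0 < mu t, mu t <= la t & 0 < la t]].
Proof.
apply: filterS hpar => t [s0 s1 m0 ml]; have l0 := lt_le_trans m0 ml.
have ml1 : mu t / la t <= 1 by rewrite ler_pdivrMr // mul1r.
split => //.
- rewrite (_ : _ * _ = sg t ^+ 2 * (mu t / la t)); last by rewrite expr2; ring.
  by rewrite ler_piMr // exprn_ge0 // ltW.
- rewrite (_ : _ * _ = sg t ^+ 3 * (mu t / la t)); last by rewrite !exprS; ring.
  by rewrite ler_piMr // exprn_ge0 // ltW.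
- by rewrite divfK // gt_eqF.
- by rewrite divfK // gt_eqF.
Qed.

Let mula : \forall t \near F, mu t <= la t.
Proof. by apply: filterS hpar => t []. Qed.

Let hE c i : famO F S k.+1 (fun=> 1) la (fun t z => tfr (u t) c z i).
Proof. by have [h _] := tfr_famOD c i; apply: (famO_freq mula); exact: famO_lek h. Qed.

Let hdE c b i : famO F S k.+1 (fun t => sg t * mu t) la (fun t z => dv b (tfr (u t) c) z i).
Proof. by have [_ h] := tfr_famOD c i; apply: (famO_freq mula); exact: h. Qed.

Let hN i : famO F S k.+1 (fun=> 1) la (fun t z => unorm (u t) z i).
Proof. by have [h _] := unorm_famOD i; apply: (famO_freq mula); exact: famO_lek h. Qed.

Let hdN b i : famO F S k.+1 (fun t => sg t * mu t) la (fun t z => dv b (unorm (u t)) z i).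
Proof. by have [_ h] := unorm_famOD i; apply: (famO_freq mula); exact: h. Qed.

Let hp1 b i : famO F S k.+1 (fun=> 1) la (fun t z => dv b (u t) z i).
Proof. by have [h _] := hp b i; apply: (famO_freq mula); exact: famO_lek h. Qed.

Let hdphi b : famO F S k.+1 sg la (fun t => dd b (phi t)).
Proof.
apply: famO_le1 (famO_dd b hphi) => //.
by apply: filterS le_rules => t [_ _ -> _ _].
Qed.

Let hdW b c : famO F S k.+1 (fun t => sg t ^+ 2) la (fun t => dd b (W t c)).
Proof.
apply: famO_le1 (famO_dd b (hW c)) => //.
by apply: filterS le_rules => t [_ _ _ -> _].
Qed.

Let hW1 c : famO F S k.+1 (fun t => sg t ^+ 2 / la t) la (fun t => W t c).
Proof. exact: famO_lek (hW c). Qed.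

Lemma rho_famO b i : famO F S k.+1 (fun t => sg t ^+ 2) la (fun t z => rho b t z i).
Proof.
have hphi1 : famO F S k.+1 (fun t => sg t / la t) la phi by exact: famO_lek hphi.
have hc c : famO F S k.+1 (fun t => sg t ^+ 2) la
  (fun t z => dd b (W t c) z * tfr (u t) c z i + W t c z * dv b (tfr (u t) c) z i).
  apply: famO_add => //.
    apply: famO_le1 (famO_mul oS (hdW b c) (hE c i)) => //.
    by apply: nearW => t; rewrite mulr1.
  apply: famO_le1 (famO_mul oS (hW1 c) (hdE c b i)) => //.
  apply: filterS le_rules => t [_ h _ _ [s0 s1 _ _ _]]; apply: le_trans h _.
  by rewrite exprS ler_piMl // exprn_ge0 // ltW.
apply: famO_add => //; last by apply: famO_add.
apply: famO_le1 (famO_mul oS hphi1 (hdN b i)) => //.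
by apply: filterS le_rules => t [].
Qed.

Lemma corrug_dv_sub b i : famO F S k.+1 sg la
  (fun t z => dv b (corrug (u t) (phi t) (W t)) z i - dv b (u t) z i).
Proof.
apply: (famO_ext oS (f := fun t z => dd b (phi t) z * unorm (u t) z i + rho b t z i)).
  apply: filterS corrug_derive => t h z; rewrite inE => Sz.
  by rewrite /dv (is_derive_dd (h i b z Sz)) [RHS]addrC addKr.
apply: famO_add => //.
  by apply: famO_le1 (famO_mul oS (hdphi b) (hN i)) => //; apply: nearW => t; rewrite mulr1.
apply: famO_le1 (rho_famO b i) => //.
by apply: filterS hpar => t [s0 s1 _ _]; rewrite expr2 ler_piMl // ltW.
Qed.

Lemma corrug_sub i : famO F S k.+1 (fun t => sg t / la t) la
  (fun t z => corrug (u t) (phi t) (W t) z i - u t z i).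
Proof.
have hc c : famO F S k.+1 (fun t => sg t / la t) la (fun t z => W t c z * tfr (u t) c z i).
  apply: famO_le1 (famO_mul oS (hW1 c) (hE c i)).
  apply: filterS le_rules => t [_ _ _ _ [s0 s1 m0 _ l0]].
  by rewrite mulr1 ler_pM2r ?invr_gt0 // expr2 ler_piMl // ltW.
apply: (famO_ext oS (f := fun t z => phi t z * unorm (u t) z i +
   (W t false z * tfr (u t) false z i + W t true z * tfr (u t) true z i))).
  by apply: nearW => t z _; rewrite /corrug [RHS]addrC addKr.
apply: famO_add => //; last by apply: famO_add.
apply: famO_le1 (famO_mul oS (famO_lek (leqnSn _) hphi) (hN i)).
by apply: nearW => t; rewrite mulr1.
Qed.

Lemma corrug_derivable : \forall t \near F, forall i b z, S t z ->
  derivable (fun w => corrug (u t) (phi t) (W t) w i) z (ebas b).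
Proof. by apply: filterS corrug_derive => t h i b z Sz; case: (h i b z Sz). Qed.

(** The output has the form of hypothesis [hp] with [la] in place of [mu] and one derivative less,
    so that steps can be chained. *)
Lemma corrug_famOD b : famODv F S k (fun t => sg t * la t) la
  (fun t => dv b (corrug (u t) (phi t) (W t))).
Proof.
have hd i := corrug_dv_sub b i.
have sgl : \forall t \near F, sg t <= 1 by apply: filterS hpar => t [].
move=> i; have [h1 h2] := hp b i.
split => [|c].
  apply: (famO_ext oS _ (famO_add oS (hp1 b i) (famO_le1 sgl (hd i)))).
  by apply: nearW => t z _; rewrite addrC subrK.
have h3 : famO F S k (fun t => sg t * la t) la (fun t => dd c (fun z => dv b (u t) z i)).
  apply: famO_le1 (famO_freq mula (famO_lek (leqnSn k) (h2 c))) => //.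
  by apply: filterS hpar => t [s0 s1 m0 ml]; rewrite ler_wpM2l // ltW.
apply: (famO_ext oS _ (famO_add oS h3 (famO_dd c (hd i)))).
apply: filterS2 (famO_derivable c h1) (famO_derivable c (hd i)) => t g1 g2 z; rewrite inE => Sz.
rewrite -(is_derive_dd (is_derive_add (g1 z Sz) (g2 z Sz))).
by congr (dd c _ z); rewrite funeqE => w; rewrite addrC subrK.
Qed.

(** Every remaining term of [metric_expand] is cubic: [W] against a frame derivative is at most
    [(sg^2 / la) * sg * mu <= sg^3], and the product of the remainders is of order [sg^4]. *)
Lemma corrug_met a b : famO F S k.+1 (fun t => sg t ^+ 3) la (fun t z =>
  met (corrug (u t) (phi t) (W t)) a b z - met (u t) a b z
  - (dd a (phi t) z * dd b (phi t) z + dd b (W t a) z + dd a (W t b) z + phi t z * bend (u t) a b z)).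
Proof.
pose X c a b t z := dot3 (dv a (u t) z) (dv b (tfr (u t) c) z).
pose Y c b t z := dot3 (unorm (u t) z) (dv b (tfr (u t) c) z).
apply: (famO_ext oS (f := fun t z =>
  (W t false z * (X false a b t z + X false b a t z) + W t true z * (X true a b t z + X true b a t z))
  + ((W t false z * (dd a (phi t) z * Y false b t z + dd b (phi t) z * Y false a t z)
     + W t true z * (dd a (phi t) z * Y true b t z + dd b (phi t) z * Y true a t z))
  + dot3 (rho a t z) (rho b t z)))).
  apply: filterS (nearI corrug_derive (nearI hn near_unorm)) => t [h1 [h2 h3]] z; rewrite inE => Sz.
  have n0 w : S t w -> 0 < nsq (u t) w by move=> Sw; exact: lt_le_trans c0_gt0 (h2 w Sw).
  (* The unit normal has constant square on the open set [S t]; differentiating gives the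
     orthogonality of the normal to its own derivatives. *)
  have NdN c : dot3 (unorm (u t) z) (dv c (unorm (u t)) z) = 0.
    have d : is_derive z (ebas c) (fun w => dot3 (unorm (u t) w) (unorm (u t) w))
       (dot3 (dv c (unorm (u t)) z) (unorm (u t) z) + dot3 (unorm (u t) z) (dv c (unorm (u t)) z)).
      by apply: dot3_derive => i; case: (h3 i c z Sz).
    have e : dd c (fun w => dot3 (unorm (u t) w) (unorm (u t) w)) z = dd c (fun=> 1) z.
      by apply: (dd_ext c (@oS t)) => // w; rewrite inE => Sw; apply: unorm_unorm; exact: n0.
    rewrite (is_derive_dd d) (is_derive_dd (is_derive_const 1 _ _)) dot3C in e.
    by move: e; set x := dot3 _ _; lra.
  have E v : dv v (corrug (u t) (phi t) (W t)) z = fun i => dv v (u t) z i + (dd v (phi t) z * unorm (u t) z i + rho v t z i).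
    by rewrite funeqE => i; rewrite /dv (is_derive_dd (h1 i v z Sz)).
  rewrite {1}/met !E /met /bend.
  have := @metric_expand R (dv a (u t) z) (dv b (u t) z) (unorm (u t) z) (tfr (u t) false z)
   (tfr (u t) true z) (dv a (unorm (u t)) z) (dv b (unorm (u t)) z) (dv a (tfr (u t) false) z)
   (dv b (tfr (u t) false) z) (dv a (tfr (u t) true) z) (dv b (tfr (u t) true) z)
   (dd a (phi t) z) (dd b (phi t) z) (phi t z) (W t false z) (W t true z)
   (dd a (W t false) z) (dd b (W t false) z) (dd a (W t true) z) (dd b (W t true) z).
  move=> /(_ (unorm_unorm (n0 z Sz)) (unorm_dv _ _ _) (unorm_dv _ _ _) (unorm_tfr _ _ _)
    (unorm_tfr _ _ _) (NdN a) (NdN b)) /= <-.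
  congr (_ - _ - (_ + _)).
  have := n0 z Sz => n1.
  by rewrite !(tfr_dv _ _ n1); case: (a); case: (b); rewrite /= ?(mulr0, mulr1, add0r, addr0) ?addrA.
have hX c a' b' : famO F S k.+1 (fun t => sg t * mu t) la (X c a' b').
  apply: famO_le1 (famO_dot oS (v := fun t => dv a' (u t)) (fun i => hp1 a' i) (fun i => hdE c b' i)) => //.
  by apply: nearW => t; rewrite mul1r.
have hY c b' : famO F S k.+1 (fun t => sg t * mu t) la (Y c b').
  apply: famO_le1 (famO_dot oS (v := fun t => unorm (u t)) (fun i => hN i) (fun i => hdE c b' i)) => //.
  by apply: nearW => t; rewrite mul1r.
have hWX c f : famO F S k.+1 (fun t => sg t * mu t) la f ->
  famO F S k.+1 (fun t => sg t ^+ 3) la (fun t z => W t c z * f t z).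
  move=> hf; apply: famO_le1 (famO_mul oS (hW1 c) hf) => //.
  by apply: filterS le_rules => t [].
have hphiY b' f : famO F S k.+1 (fun t => sg t * mu t) la f ->
  famO F S k.+1 (fun t => sg t * mu t) la (fun t z => dd b' (phi t) z * f t z).
  move=> hf; apply: famO_le1 (famO_mul oS (hdphi b') hf) => //.
  apply: filterS le_rules => t [_ _ _ _ [s0 s1 m0 _ _]].
  by rewrite ler_piMl // mulr_ge0 // ltW.
apply: famO_add => //; first by apply: famO_add => //; apply: hWX; apply: famO_add.
apply: famO_add => //; first by apply: famO_add => //; apply: hWX; apply: famO_add => //; exact: hphiY.
apply: famO_le1 (famO_dot oS (fun i => rho_famO a i) (fun i => rho_famO b i)) => //.
apply: filterS hpar => t [s0 s1 _ _]; by rewrite -exprD -[(2 + 2)%N]/(3.+1) exprS ler_piMl // exprn_ge0 // ltW.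
Qed.

End Step.

(** * Primitive steps *)

Section Oscillation.
Context {R : realType} {T : Type} (F : set_system T) {FF : Filter F}.
Local Notation pt := 'rV[R]_2.
Variable S : T -> set pt.
Hypothesis oS : forall t, open (S t).
Variables (la : T -> R) (x : T -> bool -> R) (X : R).
Hypothesis la_gt0 : \forall t \near F, 0 < la t.
Hypothesis X_ge1 : 1 <= X.
Hypothesis xX : \forall t \near F, forall b, `|x t b| <= X.

Definition sosc (c : R) (r : T -> pt -> R) t z := c / la t * (r t z * sin (la t * phase (x t) z)).
Definition cosc (c : R) (r : T -> pt -> R) t z := c / la t * (r t z * cos (la t * phase (x t) z)).

Lemma is_derive_sosc c r t z b : la t != 0 -> is_derive z (ebas b) (r t) (dd b (r t) z) ->
  is_derive z (ebas b) (sosc c r t)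
   (c * x t b * (r t z * cos (la t * phase (x t) z)) + c / la t * (dd b (r t) z * sin (la t * phase (x t) z))).
Proof.
move=> l0 hr; apply: (is_derive_eq (is_derive_mul (is_derive_const (c / la t) z (ebas b))
  (is_derive_mul hr (is_derive_sin_phase (la t) (x t) z b)))).
by rewrite mulr0 addr0; field.
Qed.

Lemma is_derive_cosc c r t z b : la t != 0 -> is_derive z (ebas b) (r t) (dd b (r t) z) ->
  is_derive z (ebas b) (cosc c r t)
   (- c * x t b * (r t z * sin (la t * phase (x t) z)) + c / la t * (dd b (r t) z * cos (la t * phase (x t) z))).
Proof.
move=> l0 hr; apply: (is_derive_eq (is_derive_mul (is_derive_const (c / la t) z (ebas b))
  (is_derive_mul hr (is_derive_cos_phase (la t) (x t) z b)))).
by rewrite mulr0 addr0; field.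
Qed.

Let la_ge0 : \forall t \near F, 0 <= la t.
Proof. by apply: filterS la_gt0 => t /ltW. Qed.

Lemma sin_famO k : famO F S k (fun=> 1) la (fun t z => sin (la t * phase (x t) z)).
Proof.
have [h _] := famO_sin_cos oS k la_ge0 (le_trans ler01 X_ge1) xX.
exact: famO_freqZ X_ge1 h.
Qed.

Lemma cos_famO k : famO F S k (fun=> 1) la (fun t z => cos (la t * phase (x t) z)).
Proof.
have [_ h] := famO_sin_cos oS k la_ge0 (le_trans ler01 X_ge1) xX.
exact: famO_freqZ X_ge1 h.
Qed.

Lemma famO_divla k e l c f : famO F S k e l f ->
  famO F S k (fun t => e t / la t) l (fun t z => c / la t * f t z).
Proof.
move=> hf; apply: (famO_le (normr_ge0 c) _ (famO_scale oS (fun t => c / la t) hf)).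
apply: filterS la_gt0 => t l0.
rewrite normrM normfV (gtr0_norm l0); suff -> : `|c| / la t * e t = `|c| * (e t / la t) by exact: lexx.
by field; rewrite gt_eqF.
Qed.

Lemma sosc_famO k e c r : famO F S k e la r -> famO F S k (fun t => e t / la t) la (sosc c r).
Proof.
move=> hr; apply: famO_divla; apply: (famO_le1 _ (famO_mul oS hr (sin_famO k))).
by apply: nearW => t; rewrite mulr1.
Qed.

Lemma cosc_famO k e c r : famO F S k e la r -> famO F S k (fun t => e t / la t) la (cosc c r).
Proof.
move=> hr; apply: famO_divla; apply: (famO_le1 _ (famO_mul oS hr (cos_famO k))).
by apply: nearW => t; rewrite mulr1.
Qed.

Lemma famO_mulsin k e r : famO F S k e la r ->
  famO F S k e la (fun t z => r t z * sin (la t * phase (x t) z)).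
Proof.
move=> hr; apply: (famO_le1 _ (famO_mul oS hr (sin_famO k))).
by apply: nearW => t; rewrite mulr1.
Qed.

Lemma famO_mulcos k e r : famO F S k e la r ->
  famO F S k e la (fun t z => r t z * cos (la t * phase (x t) z)).
Proof.
move=> hr; apply: (famO_le1 _ (famO_mul oS hr (cos_famO k))).
by apply: nearW => t; rewrite mulr1.
Qed.

End Oscillation.

Section Corrugation.
Context {R : realType} {T : Type} (F : set_system T) {FF : Filter F}.
Local Notation pt := 'rV[R]_2.
Variable S : T -> set pt.
Hypothesis oS : forall t, open (S t).
Variables (a : T -> pt -> R) (x : T -> bool -> R) (X : R).
Variables (sg mu la : T -> R) (k : nat).
Hypothesis hpar : \forall t \near F, [/\ 0 < sg t, sg t <= 1, 0 < mu t & mu t <= la t].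
Hypothesis X_ge1 : 1 <= X.
Hypothesis xX : \forall t \near F, forall b, `|x t b| <= X.
Hypothesis ha : famO F S k.+2 sg mu a.

Local Notation sq2 := (Num.sqrt (2 : R)).
(** The factor [sqrt 2] compensates the mean [1 / 2] of [cos ^ 2]: averaged over the phase, the
    product of the derivatives in directions [b] and [c] is [a^2 * x b * x c] to leading order. *)
Definition ruffle t z := sosc la x sq2 a t z.
Local Notation theta t z := (la t * phase (x t) z).

Lemma par_la_gt0 : \forall t \near F, 0 < la t.
Proof. by apply: filterS hpar => t [_ _ m0 ml]; exact: lt_le_trans ml. Qed.

Lemma par_mula : \forall t \near F, mu t <= la t.
Proof. by apply: filterS hpar => t []. Qed.

Lemma ruffle_famO : famO F S k.+2 (fun t => sg t / la t) la ruffle.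
Proof. exact: (sosc_famO oS par_la_gt0 X_ge1 xX _ (famO_freq par_mula ha)). Qed.

Lemma famO_scaleX m e l (c : T -> R) (B : R) f : 0 <= B -> (\forall t \near F, `|c t| <= B) ->
  famO F S m e l f -> famO F S m e l (fun t z => c t * f t z).
Proof.
move=> B0 hB [C C0 hf]; exists (B * C); first by rewrite mulr_ge0.
apply: filterS2 hB hf => t cB [l0 h]; split => //.
apply: Bd_leC (Bd_scale (c t) (@oS t) l0 h) => //.
by rewrite -mulrA ler_wpM2r // (Bd_ge0 h).
Qed.

Lemma ruffle_dd : \forall t \near F, forall b z, S t z ->
  dd b (ruffle t) z = sq2 * x t b * (a t z * cos (theta t z)) + sq2 / la t * (dd b (a t) z * sin (theta t z)).
Proof.
apply: filterS (nearI par_la_gt0 (near_bool (fun b => famO_derivable b ha))) => t [l0 h] b z Sz.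
by rewrite (is_derive_dd (is_derive_sosc _ _ _ (h b z Sz))) // gt_eqF.
Qed.

Lemma a_dd_famO b : famO F S k.+1 (fun t => sg t * mu t) la (fun t => dd b (a t)).
Proof. exact: famO_freq par_mula (famO_dd b ha). Qed.

Lemma a_famO : famO F S k.+2 sg la a.
Proof. exact: famO_freq par_mula ha. Qed.

Lemma sqr_sq2 : sq2 * sq2 = 2.
Proof. by rewrite -expr2 sqr_sqrtr. Qed.

(** Each derivative splits into [P], where the phase is differentiated, and [Q], where the amplitude
    is. The product of two [P] is the explicit term, and every product containing a [Q] gains the
    factor [mu / la]. *)
Lemma ruffle_ruffle b c : famO F S k.+1 (fun t => sg t ^+ 2 * mu t / la t) la (fun t z =>
  dd b (ruffle t) z * dd c (ruffle t) z - 2 * x t b * x t c * (a t z ^+ 2 * cos (theta t z) ^+ 2)).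
Proof.
pose P b t z := sq2 * x t b * (a t z * cos (theta t z)).
pose Q b t z := sq2 / la t * (dd b (a t) z * sin (theta t z)).
have hP d : famO F S k.+1 sg la (P d).
  rewrite /P; apply: (@famO_scaleX _ _ _ (fun t => sq2 * x t d) (sq2 * X)).
  - by rewrite mulr_ge0 // (le_trans ler01).
  - by apply: filterS xX => t h; rewrite normrM ger0_norm // ler_wpM2l.
  - exact: (famO_mulcos oS par_la_gt0 X_ge1 xX (famO_lek (leqnSn _) a_famO)).
have hQ d : famO F S k.+1 (fun t => sg t * mu t / la t) la (Q d).
  by rewrite /Q; apply: (famO_divla oS par_la_gt0); exact: (famO_mulsin oS par_la_gt0 X_ge1 xX (a_dd_famO d)).
apply: (famO_ext oS (f := fun t z => (P b t z * Q c t z + P c t z * Q b t z) + Q b t z * Q c t z)).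
  apply: filterS ruffle_dd => t h z; rewrite inE => Sz; rewrite !(h _ z Sz) -/(P b t z) -/(P c t z) -/(Q b t z) -/(Q c t z).
  have -> : 2 * x t b * x t c * (a t z ^+ 2 * cos (theta t z) ^+ 2) = P b t z * P c t z.
    rewrite -sqr_sq2 /P; move: sq2 (a t z) (cos _) (x t b) (x t c) => *; ring.
  by move: (P b t z) (P c t z) (Q b t z) (Q c t z) => *; ring.
have hPQ d d' : famO F S k.+1 (fun t => sg t ^+ 2 * mu t / la t) la (fun t z => P d t z * Q d' t z).
  apply: famO_le1 (famO_mul oS (hP d) (hQ d')); apply: nearW => t.
  by rewrite !mulrA -expr2.
apply: famO_add => //; first exact: famO_add.
apply: famO_le1 (famO_mul oS (hQ b) (hQ c)).
apply: filterS hpar => t [s0 s1 m0 ml]; have l0 := lt_le_trans m0 ml.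
have -> : sg t * mu t / la t * (sg t * mu t / la t) = sg t ^+ 2 * mu t / la t * (mu t / la t) by rewrite expr2; field; rewrite gt_eqF.
rewrite ler_piMr //; last by rewrite ler_pdivrMr // mul1r.
by rewrite divr_ge0 ?mulr_ge0 ?exprn_ge0 // ltW.
Qed.

Lemma sqr_dd_famO b : famO F S k.+1 (fun t => sg t ^+ 2 * mu t) la (fun t => dd b (fun z => a t z ^+ 2)).
Proof.
apply: (famO_ext oS (f := fun t z => 2 * (a t z * dd b (a t) z))).
  apply: filterS (famO_derivable b ha) => t h z; rewrite inE => Sz.
  rewrite (_ : (fun z => a t z ^+ 2) = (fun z => a t z * a t z)); last by rewrite funeqE => w; rewrite expr2.
  by rewrite (is_derive_dd (is_derive_mul (h z Sz) (h z Sz))) mulr_natl mulr2n.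
apply: famO_zscale => //; apply: famO_le1 (famO_mul oS (famO_lek (leqnSn _) a_famO) (a_dd_famO b)).
by apply: nearW => t; rewrite mulrA -expr2.
Qed.

Lemma sqr_famO : famO F S k.+2 (fun t => sg t ^+ 2) la (fun t z => a t z ^+ 2).
Proof.
apply: (famO_ext oS (f := fun t z => a t z * a t z)); first by apply: nearW => t z _; rewrite expr2.
by apply: famO_le1 (famO_mul oS a_famO a_famO); apply: nearW => t; rewrite expr2.
Qed.

End Corrugation.

Section PrimitiveStep.
Context {R : realType} {T : Type} (F : set_system T) {FF : Filter F}.
Local Notation pt := 'rV[R]_2.
Variable S : T -> set pt.
Hypothesis oS : forall t, open (S t).
Variables (u : T -> pt -> ax3 -> R) (a : T -> pt -> R) (x : T -> bool -> R) (X : R).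
Variables (sg mu la : T -> R) (k : nat) (c0 : R).
Hypothesis hpar : \forall t \near F, [/\ 0 < sg t, sg t <= 1, 0 < mu t & mu t <= la t].
Hypothesis hu : \forall t \near F, forall i b z, S t z -> derivable (fun w => u t w i) z (ebas b).
Hypothesis hp : forall b, famODv F S k.+1 (fun t => sg t * mu t) mu (fun t => dv b (u t)).
Hypothesis c0_gt0 : 0 < c0.
Hypothesis hn : \forall t \near F, forall z, S t z -> c0 <= nsq (u t) z.
Hypothesis X_ge1 : 1 <= X.
Hypothesis xX : \forall t \near F, forall b, `|x t b| <= X.
Hypothesis ha : famO F S k.+2 sg mu a.

(** With phase [2 x] and coefficient [- 1 / 4], the leading part of [dd b (prim_tan t c)] is
    [- 1 / 2 * x b * x c * a^2 cos (2 theta)]. The two symmetric derivatives together cancel the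
    oscillating part of [2 a^2 x b x c cos^2 theta]. *)
Definition prim_tan (t : T) (c : bool) (z : pt) : R :=
  x t c * sosc la (fun t b => 2 * x t b) (- 4^-1) (fun t z => a t z ^+ 2) t z.

Definition prim_step t := corrug (u t) (ruffle a x la t) (prim_tan t).

Let la0 := par_la_gt0 hpar.
Let x2X : \forall t \near F, forall b, `|2 * x t b| <= 2 * X.
Proof. by apply: filterS xX => t h b; rewrite normrM ger0_norm // ler_wpM2l. Qed.
Let X2_ge1 : 1 <= 2 * X.
Proof. by move: X_ge1; lra. Qed.

Lemma prim_tan_famO c : famO F S k.+2 (fun t => sg t ^+ 2 / la t) la (fun t => prim_tan t c).
Proof.
apply: (famO_scaleX oS (le_trans ler01 X_ge1)); first by apply: filterS xX => t; apply.
exact: (sosc_famO oS la0 X2_ge1 x2X _ (sqr_famO oS hpar ha)).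
Qed.

Lemma prim_tan_dd b c : famO F S k.+1 (fun t => sg t ^+ 2 * mu t / la t) la (fun t z =>
  dd b (prim_tan t c) z + 2^-1 * x t b * x t c * (a t z ^+ 2 * cos (2 * (la t * phase (x t) z)))).
Proof.
apply: (famO_ext oS (f := fun t z => x t c * ((- 4^-1) / la t *
  (dd b (fun z => a t z ^+ 2) z * sin (la t * phase (fun b => 2 * x t b) z))))).
  apply: filterS (nearI la0 (famO_derivable b (sqr_famO oS hpar ha))) => t [l0 h] z; rewrite inE => Sz.
  have l1 : la t != 0 by rewrite gt_eqF.
  rewrite (is_derive_dd (is_derive_mul (is_derive_const (x t c) _ _)
    (is_derive_sosc (fun t b => 2 * x t b) (- 4^-1) l1 (h z Sz)))) mulr0 addr0.
  rewrite (_ : la t * phase (fun b => 2 * x t b) z = 2 * (la t * phase (x t) z)); last by rewrite /phase; ring.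
  by field.
apply: (famO_scaleX oS (le_trans ler01 X_ge1)); first by apply: filterS xX => t; apply.
apply: (famO_divla oS la0); exact: (famO_mulsin oS la0 X2_ge1 x2X (sqr_dd_famO oS hpar ha b)).
Qed.

Lemma prim_step_met b c : famO F S k.+1 (fun t => sg t ^+ 2 * mu t / la t + sg t ^+ 3) la (fun t z =>
  met (prim_step t) b c z - met (u t) b c z - a t z ^+ 2 * (x t b * x t c)).
Proof.
have e1 : \forall t \near F, sg t ^+ 2 * mu t / la t <= sg t ^+ 2 * mu t / la t + sg t ^+ 3.
  by apply: filterS hpar => t [s0 _ _ _]; rewrite lerDl exprn_ge0 // ltW.
have e2 : \forall t \near F, sg t ^+ 3 <= sg t ^+ 2 * mu t / la t + sg t ^+ 3.
  apply: filterS hpar => t [s0 _ m0 ml]; have l0 := lt_le_trans m0 ml.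
  by rewrite lerDr ltW // divr_gt0 // mulr_gt0 // exprn_gt0.
pose proof (corrug_met oS hpar hu hp c0_gt0 hn (ruffle_famO oS hpar X_ge1 xX ha) prim_tan_famO b c) as h1.
pose proof (ruffle_ruffle oS hpar X_ge1 xX ha b c) as h2.
have h3 : famO F S k.+1 (fun t => sg t ^+ 2 * mu t / la t) la (fun t z => ruffle a x la t z * bend (u t) b c z).
  pose proof (famO_freq (par_mula hpar) (bend_famO oS hp c0_gt0 hn b c)) as hb.
  apply: famO_le1 (famO_mul oS (famO_lek (leqnSn _) (ruffle_famO oS hpar X_ge1 xX ha)) hb).
  by apply: nearW => t; rewrite expr2 le_eqVlt; apply/orP; left; apply/eqP; ring.
apply: (famO_ext oS _ (famO_add oS (famO_le1 e2 h1) (famO_le1 e1 (famO_add oS (famO_add oS h2 h3)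
  (famO_add oS (prim_tan_dd b c) (prim_tan_dd c b)))))).
apply: nearW => t z _; rewrite /prim_step.
(* Doubling the angle rewrites [2 cos^2] as [1 + cos] of twice the phase: the constant is the
   desired increment and the oscillation is what [prim_tan] removes. *)
have -> : cos (2 * (la t * phase (x t) z)) = 2 * cos (la t * phase (x t) z) ^+ 2 - 1.
  by rewrite !mulr_natl cos_mulr2n.
move: (met _ _ _ _) (met _ _ _ _) (dd _ _ _) (dd _ _ _) (dd _ _ _) (dd _ _ _) (bend _ _ _ _) (ruffle _ _ _ _ _) (cos _) => *.
by field.
Qed.

Lemma prim_exists : exists u1 : T -> pt -> ax3 -> R,
  [/\ \forall t \near F, forall i b z, S t z -> derivable (fun w => u1 t w i) z (ebas b),
      forall b, famODv F S k (fun t => sg t * la t) la (fun t => dv b (u1 t)),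
      forall b i, famO F S k.+1 sg la (fun t z => dv b (u1 t) z i - dv b (u t) z i),
      forall i, famO F S k.+1 (fun t => sg t / la t) la (fun t z => u1 t z i - u t z i) &
      forall b c, famO F S k.+1 (fun t => sg t ^+ 2 * mu t / la t + sg t ^+ 3) la (fun t z =>
        met (u1 t) b c z - met (u t) b c z - a t z ^+ 2 * (x t b * x t c))].
Proof.
pose proof (ruffle_famO oS hpar X_ge1 xX ha) as hphi; pose proof prim_tan_famO as hW.
exists prim_step; split.
- exact: (corrug_derivable oS hu hp c0_gt0 hn hphi hW).
- by move=> b; exact: (corrug_famOD oS hpar hu hp c0_gt0 hn hphi hW).
- by move=> b i; exact: (corrug_dv_sub oS hpar hu hp c0_gt0 hn hphi hW).
- by move=> i; exact: (corrug_sub oS hpar hp c0_gt0 hn hphi hW).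
- exact: prim_step_met.
Qed.

End PrimitiveStep.

(** * Integration by parts and amplitudes *)

Section IterateAmplitude.
Context {R : realType} {T : Type} (F : set_system T) {FF : Filter F}.
Local Notation pt := 'rV[R]_2.
Variable S : T -> set pt.
Hypothesis oS : forall t, open (S t).
Variables (sg mu la : T -> R).
Hypothesis hpar : \forall t \near F, [/\ 0 < sg t, sg t <= 1, 0 < mu t & mu t <= la t].
Hypothesis hka : forall e : R, 0 < e -> \forall t \near F, mu t / la t <= e.

Lemma famO_inv_scaled k c f : 0 < c -> (\forall t \near F, forall z, S t z -> c * sg t <= f t z) ->
  famO F S k sg mu f -> famO F S k (fun t => (sg t)^-1) mu (fun t z => (f t z)^-1).
Proof.
move=> c0 hc hf.
have h1 : famO F S k (fun=> 1) mu (fun t z => (sg t)^-1 * f t z).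
  apply: famO_le1 (famO_scale oS (fun t => (sg t)^-1) hf).
  by apply: filterS hpar => t [s0 _ _ _]; rewrite gtr0_norm ?invr_gt0 // mulVf // gt_eqF.
have h2 : famO F S k (fun=> 1) mu (fun t z => ((sg t)^-1 * f t z)^-1).
  apply: (famO_inv oS c0) h1; apply: filterS2 hpar hc => t [s0 _ _ _] h z Sz.
  by rewrite mulrC ler_pdivlMr // h.
apply: (famO_ext oS (f := fun t z => (sg t)^-1 * ((sg t)^-1 * f t z)^-1)).
  apply: filterS2 hpar hc => t [s0 _ _ _] h z; rewrite inE => Sz.
  by rewrite invfM invrK mulrA mulVf ?mul1r // gt_eqF.
apply: famO_le1 (famO_scale oS (fun t => (sg t)^-1) h2).
by apply: filterS hpar => t [s0 _ _ _]; rewrite mulr1 gtr0_norm ?invr_gt0.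
Qed.

Lemma famO_sqrt_scaled k c f : 0 < c -> (\forall t \near F, forall z, S t z -> c * sg t ^+ 2 <= f t z) ->
  famO F S k (fun t => sg t ^+ 2) mu f -> famO F S k sg mu (fun t z => Num.sqrt (f t z)).
Proof.
move=> c0 hc hf.
have h1 : famO F S k (fun=> 1) mu (fun t z => (sg t ^+ 2)^-1 * f t z).
  apply: famO_le1 (famO_scale oS (fun t => (sg t ^+ 2)^-1) hf).
  by apply: filterS hpar => t [s0 _ _ _]; rewrite gtr0_norm ?invr_gt0 ?exprn_gt0 // mulVf // gt_eqF // exprn_gt0.
have h2 : famO F S k (fun=> 1) mu (fun t z => Num.sqrt ((sg t ^+ 2)^-1 * f t z)).
  apply: (famO_sqrt oS c0) h1; apply: filterS2 hpar hc => t [s0 _ _ _] h z Sz.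
  by rewrite mulrC ler_pdivlMr ?exprn_gt0 // h.
apply: (famO_ext oS (f := fun t z => sg t * Num.sqrt ((sg t ^+ 2)^-1 * f t z))).
  apply: filterS hpar => t [s0 _ _ _] z _.
  have s2 : 0 <= (sg t ^+ 2)^-1 by rewrite invr_ge0 exprn_ge0 // ltW.
  rewrite sqrtrM // sqrtrV ?exprn_ge0 ?(ltW s0) // sqrtr_sqr gtr0_norm // mulrA mulfV ?mul1r // gt_eqF //.
apply: famO_le1 (famO_scale oS sg h2).
by apply: filterS hpar => t [s0 _ _ _]; rewrite mulr1 gtr0_norm.
Qed.

Variables (A : T -> pt -> R) (h : R).
Hypothesis h_gt0 : 0 < h.
Hypothesis hA : \forall t \near F, forall z, S t z -> h * sg t ^+ 2 <= A t z.

(** The phase average of [(2 / la^2) * d0 a * d1 a * sin^2], the product of the amplitude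
    derivatives in the two partials of the corrugation. It does not oscillate, so integration by
    parts cannot remove it and the amplitude has to compensate for it. *)
Definition cross_term (a : T -> pt -> R) t z := (la t ^+ 2)^-1 * (dd false (a t) z * dd true (a t) z).

Let la0 := par_la_gt0 hpar.

Lemma cross_term_famO m (e e' : T -> R) a a' :
  famO F S m.+1 e mu a -> famO F S m.+1 e' mu a' ->
  famO F S m (fun t => e t * e' t * (mu t / la t) ^+ 2) mu
    (fun t z => (la t ^+ 2)^-1 * (dd false (a t) z * dd true (a' t) z)).
Proof.
move=> ha ha'; apply: famO_le1 (famO_scale oS (fun t => (la t ^+ 2)^-1)
  (famO_mul oS (famO_dd false ha) (famO_dd true ha'))).
apply: filterS la0 => t l0; rewrite gtr0_norm ?invr_gt0 ?exprn_gt0 //.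
by rewrite le_eqVlt; apply/orP; left; apply/eqP; rewrite expr_div_n; field; rewrite gt_eqF.
Qed.

(* Each pass replaces [a] by [sqrt (A - la^-2 d1 a d2 a)] and gains the factor [(mu / la)^2]. *)
Lemma amplitude_exists j m : famO F S (m + j).+1 (fun t => sg t ^+ 2) mu A ->
  exists a : T -> pt -> R, [/\ famO F S m.+1 sg mu a,
    exists2 c, 0 < c & \forall t \near F, forall z, S t z -> c * sg t <= a t z &
    famO F S m (fun t => sg t ^+ 2 * (mu t / la t) ^+ (2 * j.+1)) mu
      (fun t z => a t z ^+ 2 + cross_term a t z - A t z)].
Proof.
elim: j m => [|j IH] m hAm.
  rewrite addn0 in hAm.
  exists (fun t z => Num.sqrt (A t z)); have ha := famO_sqrt_scaled h_gt0 hA hAm; split => //.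
    exists (Num.sqrt h); first by rewrite sqrtr_gt0.
    apply: filterS2 hpar hA => t [s0 _ _ _] hz z Sz.
    rewrite -[sg t]gtr0_norm // -sqrtr_sqr -sqrtrM ?(ltW h_gt0) //.
    by rewrite ler_wsqrtr // hz.
  apply: (famO_ext oS _ (famO_le1 _ (cross_term_famO ha ha))); last first.
    by apply: nearW => t; rewrite muln1 expr2 lexx.
  apply: filterS2 hpar hA => t [s0 _ _ _] hz z; rewrite inE => Sz.
  rewrite sqr_sqrtr /cross_term; first by rewrite addrAC subrr add0r.
  by apply: le_trans (hz z Sz); rewrite mulr_ge0 ?exprn_ge0 // ltW.
have [|a [ha [c c0 hc] hr]] := IH m.+1; first by rewrite addSnnS.
pose B t z := A t z - cross_term a t z.
have hX : famO F S m.+1 (fun t => sg t * sg t * (mu t / la t) ^+ 2) mu (cross_term a).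
  exact: cross_term_famO.
have ml1 : \forall t \near F, 0 <= mu t / la t <= 1.
  apply: filterS hpar => t [_ _ m0 ml]; have l0 := lt_le_trans m0 ml.
  by rewrite ltW ?divr_gt0 //= ler_pdivrMr // mul1r.
have hB : famO F S m.+1 (fun t => sg t ^+ 2) mu B.
  apply: famO_sub => //; first by apply: famO_lek hAm; rewrite ltnS leq_addr.
  apply: famO_le1 hX; apply: filterS2 hpar ml1 => t [s0 _ _ _] /andP[x0 x1].
  by rewrite -expr2 ler_piMr ?exprn_ge0 ?(ltW s0) // exprn_ile1.
have h2 : 0 < h / 2 by rewrite divr_gt0.
have hBc : \forall t \near F, forall z, S t z -> h / 2 * sg t ^+ 2 <= B t z.
  have [C C0 hC] := famO_bound hX.
  have e0 : 0 < h / 2 / (C + 1) by rewrite divr_gt0 // ltr_wpDl.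
  apply: filterS3 (nearI hpar hA) (nearI hC ml1) (hka e0) => t [[s0 _ _ _] hz] [hCz /andP[x0 x1]] me z Sz.
  have := hCz z Sz; rewrite ler_norml => /andP[_ hle].
  have := hz z Sz; rewrite /B; set X := cross_term a t z in hle *.
  suff : X <= h / 2 * sg t ^+ 2 by move=> ? ?; nra.
  have : mu t / la t * (C + 1) <= h / 2 by rewrite -ler_pdivlMr // ltr_wpDl.
  move: (mu t / la t) x0 x1 hle => y y0 y1 hle hy; apply: le_trans hle _; rewrite -expr2.
  have -> : C * (sg t ^+ 2 * y ^+ 2) = C * y ^+ 2 * sg t ^+ 2 by ring.
  rewrite ler_pM2r ?exprn_gt0 //.
  have : C * y * y <= C * y by rewrite ler_piMr // mulr_ge0.
  by rewrite expr2 mulrA; lra.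
have ha' := famO_sqrt_scaled h2 hBc hB.
exists (fun t z => Num.sqrt (B t z)); split => //.
  exists (Num.sqrt (h / 2)); first by rewrite sqrtr_gt0.
  apply: filterS2 hpar hBc => t [s0 _ _ _] hz z Sz.
  rewrite -[sg t]gtr0_norm // -sqrtr_sqr -sqrtrM ?(ltW h2) //.
  by rewrite ler_wsqrtr // hz.
set a' := fun t z => Num.sqrt (B t z) in ha' *.
pose E t := sg t ^+ 2 * (mu t / la t) ^+ (2 * j.+1).
(* [a'^2 - a^2] is minus the old residual; dividing by [a' + a], which is at least [c * sg],
   transfers its smallness to [a' - a]. *)
have hd : famO F S m.+1 (fun t => E t * (sg t)^-1) mu (fun t z => a' t z - a t z).
  have hs : famO F S m.+1 (fun t => (sg t)^-1) mu (fun t z => (a' t z + a t z)^-1).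
    apply: (famO_inv_scaled c0); last by apply: famO_add => //; exact: famO_lek ha.
    by apply: filterS hc => t hz z Sz; rewrite ler_wpDl // ?sqrtr_ge0 ?hz.
  apply: (famO_ext oS _ (famO_opp oS (famO_mul oS hr hs))).
  apply: filterS3 hpar hc hBc => t [s0 _ _ _] hz hb z; rewrite inE => Sz.
  have a0 : 0 < a t z by apply: lt_le_trans (hz z Sz); rewrite mulr_gt0.
  have B0 : 0 <= B t z by apply: le_trans (hb z Sz); rewrite mulr_ge0 ?exprn_ge0 // ltW.
  have s1 : a' t z + a t z != 0 by rewrite gt_eqF // ltr_wpDl // sqrtr_ge0.
  apply: (mulIf s1); rewrite mulNr mulfVK //.
  have : a' t z ^+ 2 = A t z - cross_term a t z by rewrite sqr_sqrtr.
  by move=> e; rewrite -subr_sqr e; ring.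
have hE : \forall t \near F, [/\ 0 < sg t, 0 <= mu t / la t & E t * (sg t)^-1 * sg t * (mu t / la t) ^+ 2 = 
    sg t ^+ 2 * (mu t / la t) ^+ (2 * j.+2)].
  apply: filterS2 hpar ml1 => t [s0 _ _ _] /andP[x0 _]; split => //.
  rewrite mulfVK ?gt_eqF // /E (_ : (2 * j.+2 = 2 * j.+1 + 2)%N); last by rewrite mulnS addnC.
  by rewrite exprD mulrA.
(* The new residual is the cross term of [a'] minus that of [a]. By bilinearity each summand has a
   factor [a' - a], and its two derivatives bring the gain [(mu / la)^2]. *)
apply: (famO_ext oS (f := fun t z => (la t ^+ 2)^-1 * (dd false (fun w => a' t w - a t w) z * dd true (a' t) z)
   + (la t ^+ 2)^-1 * (dd false (a t) z * dd true (fun w => a' t w - a t w) z))).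
  apply: filterS3 (nearI hpar hBc) (near_bool (fun b => famO_derivable b ha'))
    (near_bool (fun b => famO_derivable b ha)) => t [[s0 _ _ _] hb] d' d z; rewrite inE => Sz.
  have B0 : 0 <= B t z by apply: le_trans (hb z Sz); rewrite mulr_ge0 ?exprn_ge0 // ltW.
  have e b : dd b (fun w => a' t w - a t w) z = dd b (a' t) z - dd b (a t) z.
    by rewrite (is_derive_dd (is_derive_add (d' b z Sz) (is_derive_opp (d b z Sz)))).
  have -> : a' t z ^+ 2 = A t z - cross_term a t z by rewrite sqr_sqrtr.
  rewrite !e /cross_term.
  by move: (dd _ _ _) (dd _ _ _) (dd _ _ _) (dd _ _ _) (A t z) => *; ring.
apply: famO_add => //.
  by apply: famO_le1 (cross_term_famO hd ha'); apply: filterS hE => t [_ _ <-].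
apply: famO_le1 (cross_term_famO (famO_lek (leqnSn _) ha) hd); apply: filterS hE => t [_ _ <-].
by rewrite (mulrC (sg t)).
Qed.

End IterateAmplitude.

Section IntegrationByParts.
Context {R : realType} {T : Type} (F : set_system T) {FF : Filter F}.
Local Notation pt := 'rV[R]_2.
Variable S : T -> set pt.
Hypothesis oS : forall t, open (S t).
Variables (mu la : T -> R) (n : R).
Hypothesis hml : \forall t \near F, 0 < mu t /\ mu t <= la t.
Hypothesis n1 : 1 <= n.

Let la0 : \forall t \near F, 0 < la t.
Proof. by apply: filterS hml => t [m0 ml]; exact: lt_le_trans ml. Qed.
Let mula : \forall t \near F, mu t <= la t.
Proof. by apply: filterS hml => t []. Qed.
Let nn : \forall t \near F, forall b : bool, `|n| <= n.
Proof. by apply: nearW => t b; rewrite ger0_norm // (le_trans ler01). Qed.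

Local Notation th t z := (la t * phase (fun=> n) z).

(** [r cos] equals the [false]-derivative of [r sin / (n la)] minus [(dd false r / (n la)) sin],
    whose amplitude is smaller by [mu / la]. Sine and cosine alternate, hence the simultaneous
    induction. Starting from [W = 0], each of the [J] rounds spends one derivative of [r]. *)
Lemma integrate_by_parts J m e r : (\forall t \near F, 0 <= e t) -> famO F S (m.+1 + J) e mu r ->
  (exists2 W, famO F S m.+1 (fun t => e t / la t) la W &
    famO F S m (fun t => e t * (mu t / la t) ^+ J) la (fun t z => dd false (W t) z - r t z * cos (th t z))) /\
  (exists2 W, famO F S m.+1 (fun t => e t / la t) la W &
    famO F S m (fun t => e t * (mu t / la t) ^+ J) la (fun t z => dd false (W t) z - r t z * sin (th t z))).
Proof.
have n0 : n != 0 by rewrite gt_eqF // (lt_le_trans ltr01).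
elim: J e r => [|J IH] e r e0 hr.
  rewrite addn0 in hr.
  have h0 : famO F S m.+1 (fun t => e t / la t) la (fun _ _ => 0).
    apply: (famO_le (e := fun t => `|0|)) ler01 _ (famO_cst oS _ (fun=> 0) _).
      by apply: filterS2 la0 e0 => t l0 e0; rewrite normr0 mul1r divr_ge0 // ltW.
    by apply: filterS la0 => t /ltW.
  have hr' : famO F S m e la r by exact: famO_freq mula (famO_lek (leqnSn _) hr).
  split; exists (fun _ _ => 0) => //.
    apply: (famO_ext oS _ (famO_opp oS (famO_le1 _ (famO_mulcos oS la0 n1 (x := fun _ _ => n) nn hr')))).
      by apply: nearW => t z _; rewrite (is_derive_dd (is_derive_const 0 _ _)) sub0r.
    by apply: nearW => t; rewrite mulr1.
  apply: (famO_ext oS _ (famO_opp oS (famO_le1 _ (famO_mulsin oS la0 n1 (x := fun _ _ => n) nn hr')))).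
    by apply: nearW => t z _; rewrite (is_derive_dd (is_derive_const 0 _ _)) sub0r.
  by apply: nearW => t; rewrite mulr1.
have hml0 : \forall t \near F, 0 <= mu t / la t <= 1.
  apply: filterS2 hml la0 => t [m0 ml] l0.
  by rewrite ltW ?divr_gt0 //= ler_pdivrMr // mul1r.
pose e' t := e t * mu t / la t.
have e'0 : \forall t \near F, 0 <= e' t.
  by apply: filterS2 e0 hml0 => t h1 /andP[h2 _]; rewrite /e' -mulrA mulr_ge0.
have hr' c : famO F S (m.+1 + J) e' mu (fun t z => c / la t * dd false (r t) z).
  rewrite addnS in hr; apply: (famO_divla oS la0); exact: famO_dd.
have hrm : famO F S m.+1 e la r.
  by apply: famO_freq mula _; apply: famO_lek hr; exact: leq_addr.
have ee' : \forall t \near F, e' t / la t <= e t / la t.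
  apply: filterS3 e0 hml0 la0 => t h1 /andP[_ h2] l0; rewrite ler_pM2r ?invr_gt0 //.
  by rewrite /e' -mulrA ler_piMr.
have eJ : \forall t \near F, e' t * (mu t / la t) ^+ J <= e t * (mu t / la t) ^+ J.+1.
  by apply: nearW => t; rewrite exprS /e' !mulrA.
have hd : \forall t \near F, forall z, S t z -> is_derive z (ebas false) (r t) (dd false (r t) z).
  exact: (famO_derivable false hr).
split.
  have [_ [W' hW' hr'']] := IH e' _ e'0 (hr' (- n^-1)).
  exists (fun t z => sosc la (fun _ _ => n) n^-1 r t z + W' t z).
    apply: famO_add => //; first exact: (sosc_famO oS la0 n1 nn).
    exact: famO_le1 hW'.
  apply: (famO_ext oS _ (famO_le1 eJ hr'')).
  apply: filterS3 la0 hd (famO_derivable false hW') => t l0 h1 h2 z; rewrite inE => Sz.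
  have l1 : la t != 0 by rewrite gt_eqF.
  rewrite (is_derive_dd (is_derive_add (is_derive_sosc (fun _ _ => n) n^-1 l1 (h1 z Sz)) (h2 z Sz))).
  by move: (dd _ _ _) (dd _ _ _) (cos _) (sin _) => *; field; rewrite l1.
have [[W' hW' hr''] _] := IH e' _ e'0 (hr' n^-1).
exists (fun t z => cosc la (fun _ _ => n) (- n^-1) r t z + W' t z).
  apply: famO_add => //; first exact: (cosc_famO oS la0 n1 nn).
  exact: famO_le1 hW'.
apply: (famO_ext oS _ (famO_le1 eJ hr'')).
apply: filterS3 la0 hd (famO_derivable false hW') => t l0 h1 h2 z; rewrite inE => Sz.
have l1 : la t != 0 by rewrite gt_eqF.
rewrite (is_derive_dd (is_derive_add (is_derive_cosc (fun _ _ => n) (- n^-1) l1 (h1 z Sz)) (h2 z Sz))).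
by move: (dd _ _ _) (dd _ _ _) (cos _) (sin _) => *; field; rewrite l1.
Qed.

End IntegrationByParts.

(** * The off-diagonal step *)

Lemma metC {R : realType} (u : 'rV[R]_2 -> ax3 -> R) a b z : met u a b z = met u b a z.
Proof. exact: dot3C. Qed.

Lemma bound_sum {R : realType} {T : Type} {F : set_system T} {FF : Filter F}
  (S : T -> set 'rV[R]_2) (f g : T -> 'rV[R]_2 -> R) (e : T -> R) :
  (exists2 C : R, 0 <= C & \forall t \near F, forall z, S t z -> f t z <= C * e t) ->
  (exists2 C : R, 0 <= C & \forall t \near F, forall z, S t z -> g t z <= C * e t) ->
  exists2 C : R, 0 <= C & \forall t \near F, forall z, S t z -> f t z + g t z <= C * e t.
Proof.
move=> [C C0 h] [D D0 h']; exists (C + D); first exact: addr_ge0.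
by apply: filterS2 h h' => t h h' z Sz; rewrite mulrDl lerD ?h ?h'.
Qed.

Section OffDiagonal.
Context {R : realType} {T : Type} (F : set_system T) {FF : Filter F}.
Local Notation pt := 'rV[R]_2.
Variable S : T -> set pt.
Hypothesis oS : forall t, open (S t).
Variables (u : T -> pt -> ax3 -> R) (A : T -> pt -> R).
Variables (sg mu la : T -> R) (J k : nat) (c0 h : R).
Hypothesis hpar : \forall t \near F, [/\ 0 < sg t, sg t <= 1, 0 < mu t & mu t <= la t].
Hypothesis hka : forall e : R, 0 < e -> \forall t \near F, mu t / la t <= e.
Hypothesis hu : \forall t \near F, forall i b z, S t z -> derivable (fun w => u t w i) z (ebas b).
Hypothesis hp : forall b, famODv F S (k + J).+2 (fun t => sg t * mu t) mu (fun t => dv b (u t)).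
Hypothesis c0_gt0 : 0 < c0.
Hypothesis hn : \forall t \near F, forall z, S t z -> c0 <= nsq (u t) z.
Hypothesis h_gt0 : 0 < h.
Hypothesis hA : \forall t \near F, forall z, S t z -> h * sg t ^+ 2 <= A t z.
Hypothesis hAO : famO F S ((k + J).+2 + J).+1 (fun t => sg t ^+ 2) mu A.

Local Notation sq2 := (Num.sqrt (2 : R)).
Local Notation x1 := (fun (_ : T) (_ : bool) => 1 : R).
Local Notation x2 := (fun (_ : T) (_ : bool) => 2 : R).
Let e1 t := sg t ^+ 2 * mu t / la t.
Let la0 := par_la_gt0 hpar.
Let x1X : \forall t \near F, forall b, `|x1 t b| <= 1.
Proof. by apply: nearW => t b; rewrite normr1. Qed.
Let x2X : \forall t \near F, forall b, `|x2 t b| <= 2.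
Proof. by apply: nearW => t b; rewrite ger0_norm. Qed.
Let two_ge1 : (1 : R) <= 2. Proof. by lra. Qed.
Let ml1 : \forall t \near F, 0 <= mu t / la t <= 1.
Proof.
apply: filterS hpar => t [_ _ m0 ml]; have l0 := lt_le_trans m0 ml.
by rewrite ltW ?divr_gt0 //= ler_pdivrMr // mul1r.
Qed.
Let e10 : \forall t \near F, 0 <= e1 t.
Proof. by apply: filterS2 hpar ml1 => t [s0 _ _ _] /andP[x0 _]; rewrite /e1 -mulrA mulr_ge0 // exprn_ge0 // ltW. Qed.
Let e1s : \forall t \near F, e1 t <= sg t ^+ 2.
Proof. by apply: filterS2 hpar ml1 => t [s0 _ _ _] /andP[_ x]; rewrite /e1 -mulrA ler_piMr // exprn_ge0 // ltW. Qed.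
Let s3s2 : \forall t \near F, sg t ^+ 3 <= sg t ^+ 2.
Proof. by apply: filterS hpar => t [s0 s1 _ _]; rewrite exprS ler_piMl // exprn_ge0 // ltW. Qed.

(** The off-diagonal entry is corrected almost exactly, while on the diagonal only the order [sg^2]
    and an upper bound by [2 A] are kept. That bound is one-sided because it serves only to show
    that enough diagonal defect is left for the later steps. *)
Lemma offdiag_exists : exists u1 : T -> pt -> ax3 -> R,
  [/\ [/\ \forall t \near F, forall i b z, S t z -> derivable (fun w => u1 t w i) z (ebas b),
      forall b, famODv F S k (fun t => sg t * la t) la (fun t => dv b (u1 t)),
      forall b i, famO F S k.+1 sg la (fun t z => dv b (u1 t) z i - dv b (u t) z i) &
      forall i, famO F S k.+1 (fun t => sg t / la t) la (fun t z => u1 t z i - u t z i)],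
    famO F S k.+1 (fun t => sg t ^+ 3 + sg t ^+ 2 * (mu t / la t) ^+ J) la
      (fun t z => met (u1 t) false true z - met (u t) false true z - A t z),
    forall b, famO F S k.+1 (fun t => sg t ^+ 2) la (fun t z => met (u1 t) b b z - met (u t) b b z) &
    forall b, exists2 C, 0 <= C & \forall t \near F, forall z, S t z ->
      met (u1 t) b b z - met (u t) b b z - 2 * A t z <= C * (sg t ^+ 2 * (sg t + mu t / la t))].
Proof.
have [a [ha _ hres]] := amplitude_exists oS hpar hka h_gt0 hA hAO.
have kJ : (k.+2 <= (k + J).+2)%N by rewrite !ltnS leq_addr.
have ha2 : famO F S k.+2 sg mu a by apply: famO_lek ha; exact: leqW.
have hda b : famO F S (k + J).+2 (fun t => sg t * mu t) mu (fun t => dd b (a t)) by exact: famO_dd.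
have hb b c : famO F S (k + J).+2 (fun t => sg t * mu t) mu (fun t => bend (u t) b c).
  exact: (bend_famO oS hp c0_gt0 hn).
have k2J : (k.+2 + J)%N = (k + J).+2 by rewrite !addSn.
have hal : famO F S (k + J).+2 sg mu a by exact: famO_lek ha.
(* the three oscillating remainders that the tangential field has to absorb *)
pose rs2 t z := (- 1) / la t * (a t z * dd true (a t) z).
pose rs1 t z := (- sq2) / la t * (a t z * bend (u t) false true z).
have hrs2 : famO F S (k.+2 + J) e1 mu rs2.
  rewrite k2J; apply: (famO_divla oS la0); apply: famO_le1 (famO_mul oS hal (hda true)).
  by apply: nearW => t; rewrite mulrA expr2.
have hrs1 : famO F S (k.+2 + J) e1 mu rs1.
  rewrite k2J; apply: (famO_divla oS la0); apply: famO_le1 (famO_mul oS hal (hb false true)).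
  by apply: nearW => t; rewrite mulrA expr2.
have hrc2 : famO F S (k.+2 + J) e1 mu (cross_term la a).
  rewrite k2J; apply: famO_le1 (cross_term_famO oS hpar ha ha).
  apply: filterS3 hpar ml1 la0 => t [s0 _ _ _] /andP[y0 y1] l0.
  rewrite -expr2 /e1 -mulrA ler_wpM2l ?exprn_ge0 ?(ltW s0) // expr2 ler_piMl //.
have hml : \forall t \near F, 0 < mu t /\ mu t <= la t by apply: filterS hpar => t [].
have [_ [W1 hW1 hW1d]] := integrate_by_parts oS hml two_ge1 e10 hrs2.
have [[W2 hW2 hW2d] _] := integrate_by_parts oS hml two_ge1 e10 hrc2.
have [_ [W3 hW3 hW3d]] := integrate_by_parts oS hml (lexx 1) e10 hrs1.
(* Its [false]-derivative starts with [- a^2 cos (2 theta)], cancelling the oscillation of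
   [2 a^2 cos^2 theta]. What is left oscillating is the [sin (2 theta)] term with [dd true a], the
   [cos (2 theta)] part of the cross term, and the bending term: these are met by [W1], [W2] and
   [W3]. *)
pose Wm := sosc la x2 (- 2^-1) (fun t z => a t z ^+ 2).
pose Wr t z := W1 t z + (W2 t z + W3 t z).
(* The component [false] is zero, so the off-diagonal entry sees only [dd false (W t true)], and all
   the cost goes to the entry [(true, true)]. *)
pose W t (c : bool) z := if c then Wm t z + Wr t z else 0.
have hWr : famO F S k.+2 (fun t => e1 t / la t) la Wr by exact: (famO_add oS hW1 (famO_add oS hW2 hW3)).
have hWm : famO F S k.+2 (fun t => sg t ^+ 2 / la t) la Wm.
  exact: (sosc_famO oS la0 two_ge1 x2X _ (sqr_famO oS hpar ha2)).
have hW c : famO F S k.+2 (fun t => sg t ^+ 2 / la t) la (fun t => W t c).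
  case: c; rewrite /W.
    apply: (famO_add oS hWm); apply: famO_le1 hWr.
    by apply: filterS2 e1s la0 => t h1 l0; rewrite ler_pM2r ?invr_gt0.
  apply: (famO_le (e := fun t => `|0|)) ler01 _ (famO_cst oS _ (fun=> 0) _).
    by apply: filterS2 hpar la0 => t [s0 _ _ _] l0; rewrite normr0 mul1r divr_ge0 ?exprn_ge0 // ltW.
  by apply: filterS la0 => t /ltW.
have hp' b : famODv F S k.+1 (fun t => sg t * mu t) mu (fun t => dv b (u t)).
  move=> i; have [q1 q2] := hp b i; split => [|c]; first exact: famO_lek (leqW kJ) q1.
  exact: famO_lek (leq_trans (leqnSn _) kJ) (q2 c).
pose proof (ruffle_famO oS hpar (lexx 1) x1X ha2) as hphi.
pose u1 t := corrug (u t) (ruffle a x1 la t) (W t).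
pose proof (corrug_met oS hpar hu hp' c0_gt0 hn hphi hW) as hmet.
have hdWr b : famO F S k.+1 e1 la (fun t => dd b (Wr t)).
  apply: famO_le1 (famO_dd b hWr); apply: filterS la0 => t l0.
  by rewrite divfK // gt_eqF.
have hphib b c : famO F S k.+1 e1 la (fun t z => ruffle a x1 la t z * bend (u t) b c z).
  apply: famO_le1 (famO_mul oS (famO_lek (leqnSn _) hphi)
    (famO_freq (par_mula hpar) (famO_lek (leq_trans (leqnSn _) kJ) (hb b c)))).
  by apply: nearW => t; rewrite /e1 expr2 le_eqVlt; apply/orP; left; apply/eqP; ring.
pose proof (ruffle_ruffle oS hpar (lexx 1) x1X ha2) as hphiphi.
have hsqr b : famO F S k.+1 e1 la (fun t z => (- 2^-1) / la t * (dd b (fun z => a t z ^+ 2) z * sin (la t * phase (x2 t) z))).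
  apply: (famO_divla oS la0); exact: (famO_mulsin oS la0 two_ge1 x2X (sqr_dd_famO oS hpar ha2 b)).
have hWm_dd : \forall t \near F, forall b z, S t z ->
    dd b (Wm t) z = - (a t z ^+ 2 * cos (la t * phase (x2 t) z)) + 
      (- 2^-1) / la t * (dd b (fun z => a t z ^+ 2) z * sin (la t * phase (x2 t) z)).
  apply: filterS (nearI la0 (near_bool (fun b => famO_derivable b (sqr_famO oS hpar ha2)))) => t [l0 d] b z Sz.
  rewrite (is_derive_dd (is_derive_sosc x2 (- 2^-1) (lt0r_neq0 l0) (d b z Sz))).
  by congr (_ + _); rewrite mulNr mulVf // mulN1r.
have W_dd : \forall t \near F, forall b z, S t z -> dd b (W t true) z = dd b (Wm t) z + dd b (Wr t) z.
  apply: filterS (nearI (near_bool (fun b => famO_derivable b hWm)) (near_bool (fun b => famO_derivable b hWr))) => t [d1 d2] b z Sz.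
  by rewrite (is_derive_dd (is_derive_add (d1 b z Sz) (d2 b z Sz))).
have W0_dd t b z : dd b (W t false) z = 0.
  by rewrite (is_derive_dd (is_derive_const 0 z (ebas b))).
have cos2 t z : cos (la t * phase (x2 t) z) = 2 * cos (la t * phase (x1 t) z) ^+ 2 - 1.
  rewrite mulr_natl -cos_mulr2n; congr cos; rewrite /phase mulr2n; ring.
have sin2 t z : sin (la t * phase (x2 t) z) = 2 * (cos (la t * phase (x1 t) z) * sin (la t * phase (x1 t) z)).
  rewrite mulr_natl -sin_mulr2n; congr sin; rewrite /phase mulr2n; ring.
exists u1; split.
- split.
  + exact: (corrug_derivable oS hu hp' c0_gt0 hn hphi hW).
  + by move=> b; exact: (corrug_famOD oS hpar hu hp' c0_gt0 hn hphi hW).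
  + by move=> b i; exact: (corrug_dv_sub oS hpar hu hp' c0_gt0 hn hphi hW).
  + by move=> i; exact: (corrug_sub oS hpar hp' c0_gt0 hn hphi hW).
- have EJ : \forall t \near F, e1 t * (mu t / la t) ^+ J <= sg t ^+ 3 + sg t ^+ 2 * (mu t / la t) ^+ J.
    apply: filterS3 hpar e1s ml1 => t [s0 _ _ _] h1 /andP[h2 h3].
    apply: ler_wpDl; first by rewrite exprn_ge0 // ltW.
    by rewrite ler_wpM2r // exprn_ge0.
  have E3 : \forall t \near F, sg t ^+ 3 <= sg t ^+ 3 + sg t ^+ 2 * (mu t / la t) ^+ J.
    apply: filterS2 hpar ml1 => t [s0 _ _ _] /andP[h2 h3].
    by rewrite lerDl mulr_ge0 ?exprn_ge0 // ltW.
  have ER : \forall t \near F, sg t ^+ 2 * (mu t / la t) ^+ (2 * J.+1) <= sg t ^+ 3 + sg t ^+ 2 * (mu t / la t) ^+ J.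
    apply: filterS2 hpar ml1 => t [s0 _ _ _] /andP[h2 h3].
    apply: ler_wpDl; first by rewrite exprn_ge0 // ltW.
    rewrite ler_wpM2l ?exprn_ge0 ?(ltW s0) //; apply: ler_wiXn2l => //.
    by rewrite mulnS mul2n -addnn addnA addnC leq_addr.
  apply: (famO_ext oS _ (famO_add oS (famO_add oS (famO_le1 E3 (hmet false true))
    (famO_le1 ER (famO_freq (par_mula hpar) (famO_lek _ hres))))
    (famO_le1 EJ (famO_add oS hW1d (famO_add oS hW2d hW3d))))); last by rewrite ltnS ltnW // !ltnS leq_addr.
  apply: filterS (nearI (nearI la0 (nearI (ruffle_dd x1 hpar ha2) hWm_dd))
    (nearI W_dd (nearI (near_bool (fun b => famO_derivable b (sqr_famO oS hpar ha2)))
     (nearI (near_bool (fun b => famO_derivable b ha2))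
     (nearI (famO_derivable false hW1) (nearI (famO_derivable false hW2) (famO_derivable false hW3))))))).
  move=> t [[l0 [h1 h2]] [h3 [h4 [h4' [h5 [h6 h7]]]]]] z; rewrite inE => Sz.
  have sqd : dd false (fun z => a t z ^+ 2) z = 2 * (a t z * dd false (a t) z).
    rewrite (_ : (fun z => a t z ^+ 2) = (fun z => a t z * a t z)); last by rewrite funeqE => w; rewrite expr2.
    by rewrite (is_derive_dd (is_derive_mul (h4' false z Sz) (h4' false z Sz))) mulr_natl mulr2n.
  rewrite W0_dd !(h1 _ z Sz) (h3 _ z Sz) (h2 _ z Sz) sqd /rs2 /rs1 /cross_term /ruffle /sosc.
  rewrite (is_derive_dd (is_derive_add (h5 z Sz) (is_derive_add (h6 z Sz) (h7 z Sz)))).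
  rewrite sin2 cos2 -/(u1 t).
  have sc := cos2Dsin2 (la t * phase (x1 t) z).
  have sqq := @sqr_sq2 R; have l1 : la t != 0 by rewrite gt_eqF.
  move: (met _ _ _ _) (met _ _ _ _) (dd false (a t) z) (dd true (a t) z) (dd _ (W1 t) _) (dd _ (W2 t) _)
     (dd _ (W3 t) _) (bend _ _ _ _) (a t z) (A t z) (la t) (cos _) (sin _) sc sqq l1 => {h1 h2 h3 h4 h4' h5 h6 h7 cos2 sin2}.
  move: sq2 => q m1 m0 d0 d1 w1 w2 w3 be aa AA l c s sc qq l1.
  apply/eqP; rewrite -subr_eq0; apply/eqP.
  (* The identity holds modulo [q^2 = 2] and [c^2 + s^2 = 1]; these are the coefficients with which
     the two relations enter. *)
  transitivity (- (q * q - 2) * (aa ^+ 2 * c ^+ 2 + aa * c * s * (d0 + d1) / l + d0 * d1 * s ^+ 2 / l ^+ 2)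
     - 2 * d0 * d1 / l ^+ 2 * (c ^+ 2 + s ^+ 2 - 1)); first by field.
  by rewrite qq sc; ring.
- move=> b.
  have Wbb : famO F S k.+1 (fun t => sg t ^+ 2) la (fun t => dd b (W t b)).
    apply: famO_le1 (famO_dd b (hW b)); apply: filterS la0 => t l0.
    by rewrite divfK // gt_eqF.
  have Pb : famO F S k.+1 sg la (fun t => dd b (ruffle a x1 la t)).
    apply: famO_le1 (famO_dd b hphi); apply: filterS la0 => t l0.
    by rewrite divfK // gt_eqF.
  have PP : famO F S k.+1 (fun t => sg t ^+ 2) la (fun t z => dd b (ruffle a x1 la t) z * dd b (ruffle a x1 la t) z).
    by apply: famO_le1 (famO_mul oS Pb Pb); apply: nearW => t; rewrite expr2.
  apply: (famO_ext oS _ (famO_add oS (famO_le1 s3s2 (hmet b b)) (famO_add oS (famO_add oS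
    (famO_add oS PP Wbb) Wbb) (famO_le1 e1s (hphib b b))))).
  by apply: nearW => t z _; rewrite subrK.
- move=> b.
  pose e t := sg t ^+ 2 * (sg t + mu t / la t).
  have ee : \forall t \near F, sg t ^+ 3 <= e t /\ e1 t <= e t.
    apply: filterS2 hpar ml1 => t [s0 _ _ _] /andP[h2 h3]; rewrite /e mulrDr -exprSr /e1 -mulrA; split.
      by rewrite lerDl mulr_ge0 ?exprn_ge0 // ltW.
    by rewrite lerDr exprn_ge0 // ltW.
  have up f : famO F S k.+1 e la f -> exists2 C : R, 0 <= C & \forall t \near F, forall z, S t z -> f t z <= C * e t.
    move=> /famO_bound[C C0 hC]; exists C => //; apply: filterS hC => t hC z Sz.
    exact: le_trans (ler_norm _) (hC z Sz).
  have e3e : \forall t \near F, sg t ^+ 3 <= e t by apply: filterS ee => t [].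
  have e1e : \forall t \near F, e1 t <= e t by apply: filterS ee => t [].
  have hres' : famO F S k.+1 e la (fun t z => a t z ^+ 2 + cross_term la a t z - A t z).
    apply: famO_le1 (famO_freq (par_mula hpar) (famO_lek (leq_trans (leqnSn _) kJ) hres)).
    apply: filterS3 hpar ml1 e1e => t [s0 _ _ _] /andP[h2 h3] h4; apply: le_trans h4.
    rewrite /e1 -mulrA ler_wpM2l ?exprn_ge0 ?(ltW s0) // mulnS addSn exprS ler_piMr //.
    exact: exprn_ile1.
  have hcr : famO F S k.+1 e la (cross_term la a).
    by apply: famO_le1 e1e (famO_freq (par_mula hpar) (famO_lek _ hrc2)); rewrite k2J (leq_trans (leqnSn _) kJ).
  (* The [false] entry receives [2 a^2 cos^2] from the corrugation alone. In the [true] entry, twice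
     the derivative of [Wm] turns this into [2 a^2 (1 - cos^2)]. *)
  have hb0 : famO F S k.+1 e la (fun t z => met (u1 t) b b z - met (u t) b b z -
     2 * a t z ^+ 2 * (if b then 1 - cos (la t * phase (x1 t) z) ^+ 2 else cos (la t * phase (x1 t) z) ^+ 2)).
    have hrest : famO F S k.+1 e la (fun t z => met (u1 t) b b z - met (u t) b b z -
       2 * (a t z ^+ 2 * cos (la t * phase (x1 t) z) ^+ 2) - 2 * dd b (W t b) z).
      apply: (famO_ext oS _ (famO_add oS (famO_le1 e3e (hmet b b)) (famO_add oS
        (famO_le1 e1e (hphiphi b b)) (famO_le1 e1e (hphib b b))))).
      apply: nearW => t z _; rewrite -/(u1 t).
      move: (met _ _ _ _) (met _ _ _ _) (dd _ (W t b) _) (dd _ _ _) (bend _ _ _ _) (ruffle _ _ _ _ _) (a t z) (cos _) => *.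
      by ring.
    case: b hrest => hrest.
      apply: (famO_ext oS _ (famO_add oS hrest (famO_zscale oS 2 (famO_le1 e1e (famO_add oS (hsqr true) (hdWr true)))))).
      apply: filterS (nearI hWm_dd W_dd) => t [h1 h2] z; rewrite inE => Sz.
      rewrite (h2 _ z Sz) (h1 _ z Sz) cos2.
      move: (met _ _ _ _) (met _ _ _ _) (dd _ (Wr t) _) (_ / _ * _) (a t z) (cos _) => *.
      by ring.
    apply: (famO_ext oS _ hrest); apply: nearW => t z _; rewrite W0_dd.
    move: (met _ _ _ _) (met _ _ _ _) (a t z) (cos _) => *; ring.
  (* The two added families replace [2 a^2] by [2 A] through the amplitude equation; the discarded
     term [2 a^2 (1 - q)] has the favourable sign. *)
  have [C C0 hC] := bound_sum (up _ hb0) (bound_sum (up _ (famO_zscale oS 2 hres')) (up _ (famO_opp oS (famO_zscale oS 2 hcr)))).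
  exists C => //; apply: filterS hC => t hC z Sz; apply: le_trans (hC z Sz).
  set q := (if b then _ else _); have q1 : q <= 1.
    have := cos_geN1 (la t * phase (x1 t) z); have := cos_le1 (la t * phase (x1 t) z); rewrite /q.
    by case: (b) => *; nra.
  have : 0 <= 2 * a t z ^+ 2 * (1 - q) by rewrite mulr_ge0 ?subr_ge0 // mulr_ge0 // sqr_ge0.
  move: (met _ _ _ _) (met _ _ _ _) (cross_term _ _ _ _) (A t z) (a t z ^+ 2) => *.
  by nra.
Qed.

End OffDiagonal.

(** * Averages and mollification *)

Section UnitMean.
Context {R : realType}.
Local Notation mu := (@lebesgue_measure R).
Implicit Types (h H : R -> R).

Definition mean h : R := \int[mu]_(t in `[0%R, 1%R]) h t.

Lemma continuous_integrable01 h (a b : R) : continuous h -> mu.-integrable `[a, b] (EFin \o h).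
Proof.
move=> ch; apply: continuous_compact_integrable; first exact: segment_compact.
exact: continuous_subspaceT.
Qed.

Lemma mean_add h1 h2 : continuous h1 -> continuous h2 ->
  mean (fun t => h1 t + h2 t) = mean h1 + mean h2.
Proof. by move=> c1 c2; apply: RintegralD => //; exact: continuous_integrable01. Qed.

Lemma mean_scale c h : continuous h -> mean (fun t => c * h t) = c * mean h.
Proof. by move=> c1; apply: RintegralZl => //; exact: continuous_integrable01. Qed.

Lemma mean_const c : mean (fun=> c) = c.
Proof.
rewrite /mean Rintegral_cst //.
have e : mu `[0%R, 1%R] = 1%:E by rewrite lebesgue_measure_itv /= lte_fin ltr01 sube0.
by transitivity (c * fine (mu `[0%R, 1%R])); [|rewrite e mulr1].
Qed.

Lemma mean_bound h C : continuous h -> (forall t, 0 <= t <= 1 -> `|h t| <= C) -> `|mean h| <= C.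
Proof.
move=> ch hC; apply: le_trans (le_normr_Rintegral _ _) _ => //; first exact: continuous_integrable01.
rewrite -[leRHS]mean_const; apply: le_Rintegral => //.
- have cn : continuous (fun t => `|h t|) by move=> t; apply: cvg_norm; exact: ch.
  exact: (continuous_integrable01 0 1 cn).
- exact: (continuous_integrable01 0 1 (fun _ => cvg_cst _)).
Qed.

Lemma mean_derive h H : continuous h -> (forall t : R, 0 <= t <= 1 -> is_derive t (1 : R) H (h t)) ->
  mean h = H 1 - H 0.
Proof.
move=> ch dH.
have cH t : 0 <= t <= 1 -> {for t, continuous H}.
  by move=> /dH d; apply: differentiable_continuous; apply/derivable1_diffP; case: d.
rewrite /mean /Rintegral (@continuous_FTC2 _ _ H) //.
- exact: continuous_subspaceT.
- split.
  + move=> t; rewrite in_itv /= => /andP[t0 t1]; have [] := dH t; by rewrite ?ltW.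
  + by apply: cvg_at_right_filter; apply: cH; rewrite lexx ler01.
  + by apply: cvg_at_left_filter; apply: cH; rewrite lexx ler01.
- move=> t; rewrite in_itv /= => /andP[t0 t1]; rewrite derive1E.
  by have [] := dH t _; rewrite ?ltW.
Qed.

Lemma primitive_exists h (c : R) : continuous h -> 0 < c ->
  exists H, forall t : R, `|t| <= c -> is_derive t (1 : R) H (h t).
Proof.
(* The base point lies to the left of [- c], so every point of [[- c, c]] is interior to the
   interval of integration. *)
move=> ch c0; exists (fun y => \int[mu]_(s in `[- c - 1, y]) h s) => t.
rewrite ler_norml => /andP[t1 t2].
have [||||d1 d2] := @continuous_FTC1_closed R h (- c - 1) t (c + 1).
- by apply: le_lt_trans t2 _; rewrite ltrDl.
- exact: continuous_integrable01.
- by apply: lt_le_trans t1; rewrite ltrBlDr ltrDl.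
- exact: ch.
- by apply: DeriveDef; [exact: d1|rewrite -derive1E; exact: d2].
Qed.

End UnitMean.

(** * Averages over coordinate segments *)

Section Averages.
Context {R : realType}.
Local Notation pt := 'rV[R]_2.
Implicit Types (f g : pt -> R) (z w : pt) (b : bool).

(** Lipschitz along coordinate lines only, but on the whole plane: translations and averages
    preserve both constants, and no domain has to be tracked. *)
Definition lips (B L : R) f := (forall z, `|f z| <= B) /\
  (forall b t z, `|f (t *: ebas b + z) - f z| <= L * `|t|).

Lemma lips_line B L f b z : lips B L f -> continuous (fun t : R => f (t *: ebas b + z)).
Proof.
move=> [_ hL] t; have L0 : 0 <= L.
  by have := hL b 1 z; rewrite normr1 mulr1; exact: le_trans.
apply/cvgrPdist_le => /= e e0; near=> s.
have -> : t *: ebas b + z = (t - s) *: ebas b + (s *: ebas b + z).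
  by rewrite addrA -scalerDl subrK.
apply: le_trans (hL _ _ _) _.
apply: (@le_trans _ _ ((L + 1) * `|t - s|)); first by rewrite ler_wpM2r // lerDl.
rewrite -ler_pdivlMl ?ltr_wpDl //.
near: s; apply: (@cvgr_dist_le _ R _ (nbhs t) _ id); first exact: cvg_id.
by rewrite mulr_gt0 // invr_gt0 ltr_wpDl.
Unshelve. all: by end_near. Qed.

(** Convolution with the normalised indicator of a segment of length [r] in direction [b], centred
    at the point. *)
Definition avg b (r : R) f z := mean (fun t => f ((r * (t - 2^-1)) *: ebas b + z)).

Lemma lips_line_r B L f b r z : lips B L f ->
  continuous (fun t : R => f ((r * (t - 2^-1)) *: ebas b + z)).
Proof.
move=> hf t; apply: (@continuous_comp _ _ _ (fun t : R => r * (t - 2^-1)) (fun t => f (t *: ebas b + z))).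
  apply: (@continuousM _ _ (fun=> r) (fun t : R => t - 2^-1)); first exact: cst_continuous.
  by apply: continuousB; [exact: cvg_id|exact: cst_continuous].
exact: lips_line hf _.
Qed.

Lemma lips_add B L B' L' f g : lips B L f -> lips B' L' g -> lips (B + B') (L + L') (fun z => f z + g z).
Proof.
move=> [f1 f2] [g1 g2]; split.
  by move=> z; apply: le_trans (ler_normD _ _) _; exact: lerD.
move=> b t z; rewrite opprD addrACA mulrDl.
by apply: le_trans (ler_normD _ _) _; exact: lerD.
Qed.

Lemma lips_scale B L c f : lips B L f -> lips (`|c| * B) (`|c| * L) (fun z => c * f z).
Proof.
move=> [f1 f2]; split; first by move=> z; rewrite normrM ler_wpM2l.
by move=> b t z; rewrite -mulrBr normrM -mulrA ler_wpM2l.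
Qed.

Lemma lips_const c : lips `|c| 0 (fun=> c).
Proof. by split => // b t z; rewrite subrr normr0 mul0r. Qed.

Lemma lips_ge0 B L f : lips B L f -> 0 <= B /\ 0 <= L.
Proof.
move=> [f1 f2]; split; first exact: le_trans (f1 0).
by have := f2 true 1 0; rewrite normr1 mulr1; exact: le_trans.
Qed.

Lemma lips_mul B L B' L' f g : lips B L f -> lips B' L' g ->
  lips (B * B') (B * L' + B' * L) (fun z => f z * g z).
Proof.
move=> [f1 f2] [g1 g2]; split; first by move=> z; rewrite normrM ler_pM.
move=> b t z; set w := _ + z.
have -> : f w * g w - f z * g z = f w * (g w - g z) + g z * (f w - f z) by ring.
apply: le_trans (ler_normD _ _) _; rewrite !normrM mulrDl -!mulrA.
by apply: lerD; apply: ler_pM => //; [exact: g2|exact: f2].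
Qed.

Lemma lips_trans B L f w : lips B L f -> lips B L (fun z => f (w + z)).
Proof. by move=> [f1 f2]; split => // b t z; rewrite addrCA; exact: f2. Qed.

Lemma avg_lips B L f b r : lips B L f -> lips B L (avg b r f).
Proof.
move=> hf; have [f1 f2] := hf; split.
  by move=> z; apply: mean_bound; [exact: lips_line_r hf|move=> t _; exact: f1].
move=> b' t z; have c1 w : continuous (fun t : R => f ((r * (t - 2^-1)) *: ebas b + w)) by exact: lips_line_r hf.
have c2 : continuous (fun s : R => (-1) * f ((r * (s - 2^-1)) *: ebas b + z)).
  by move=> s; apply: (@continuousM _ _ (fun=> -1)); [exact: cst_continuous|exact: c1].
rewrite /avg -[X in _ + X]mulN1r -mean_scale; last exact: c1.
rewrite -mean_add; [|exact: c1|exact: c2].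
apply: mean_bound => [s|s _]; first by apply: cvgD; [exact: c1|exact: c2].
by rewrite mulN1r addrCA; exact: f2.
Qed.

Lemma avg_add B L B' L' f g b r z : lips B L f -> lips B' L' g ->
  avg b r (fun z => f z + g z) z = avg b r f z + avg b r g z.
Proof. by move=> hf hg; apply: mean_add; [exact: lips_line_r hf|exact: lips_line_r hg]. Qed.

Lemma avg_scale B L f b r c z : lips B L f -> avg b r (fun z => c * f z) z = c * avg b r f z.
Proof. by move=> hf; apply: mean_scale; exact: lips_line_r hf. Qed.

Lemma avg_const b r c z : avg b r (fun=> c) z = c.
Proof. exact: mean_const. Qed.

Lemma avg_trans f b r w z : avg b r (fun z => f (w + z)) z = avg b r f (w + z).
Proof. by rewrite /avg; congr mean; rewrite funeqE => t; rewrite addrCA. Qed.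

Lemma avg_bound B L f b r z C : 0 <= r -> lips B L f ->
  (forall t, `|t| <= r / 2 -> `|f (t *: ebas b + z)| <= C) -> `|avg b r f z| <= C.
Proof.
move=> r0 hf hC; apply: mean_bound; first exact: lips_line_r hf.
move=> t /andP[t0 t1]; apply: hC; rewrite normrM ger0_norm // ler_wpM2l // ler_norml.
by apply/andP; split; lra.
Qed.

Definition dq b (r : R) f z := r^-1 * (f ((r / 2) *: ebas b + z) + (-1) * f ((- (r / 2)) *: ebas b + z)).

(** With a primitive [H] of [f] along the line, the average is
    [(H (s + r / 2) - H (s - r / 2)) / r], whose derivative is the symmetric difference quotient
    [dq]. Averaging a Lipschitz function thus gains one derivative. *)
Lemma avg_dd B L f b r z : 0 < r -> lips B L f -> is_derive z (ebas b) (avg b r f) (dq b r f z).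
Proof.
move=> r0 hf; apply/is_derive_line.
have [|H hH] := primitive_exists (lips_line (b := b) (z := z) hf) (c := r + 1); first exact: addr_gt0.
have key s : `|s| < 2^-1 -> avg b r f (s *: ebas b + z) = r^-1 * (H (s + r / 2) + (-1) * H (s - r / 2)).
  move=> s1.
  have -> : r^-1 * (H (s + r / 2) + (-1) * H (s - r / 2)) =
    r^-1 * H (s + r * (1 - 2^-1)) - r^-1 * H (s + r * (0 - 2^-1)).
    rewrite (_ : r * (1 - 2^-1) = r / 2); last by field.
    by rewrite (_ : r * (0 - 2^-1) = - (r / 2)); [ring|field].
  rewrite /avg; apply: (mean_derive (H := fun t => r^-1 * H (s + r * (t - 2^-1)))).
    exact: lips_line_r hf.
  move=> t /andP[t0 t1].
  have hd : is_derive (s + r * (t - 2^-1)) 1 H (f ((s + r * (t - 2^-1)) *: ebas b + z)).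
    apply: hH; apply: le_trans (ler_normD _ _) _; rewrite normrM (gtr0_norm r0) addrC lerD //.
      rewrite ler_piMr ?(ltW r0) // ler_norml; apply/andP; split; lra.
    by apply: le_trans (ltW s1) _; lra.
  have hin : is_derive t 1 (fun t : R => s + r * (t - 2^-1)) r.
    by apply: is_derive_eq; rewrite /GRing.scale /=; ring.
  have := @is_deriveZ _ _ _ _ r^-1 _ _ _ (@is_derive1_comp R H (fun t => s + r * (t - 2^-1)) t _ _ hd hin).
  move=> h; apply: (is_derive_eq h); rewrite addrA -scalerDl (addrC s).
  by rewrite /GRing.scale /= mulrCA mulVf ?mulr1 // gt_eqF.
have d1 : is_derive (0 : R) (1 : R) (fun s : R => H (s + r / 2)) (f ((r / 2) *: ebas b + z)).
  have hin : is_derive (0:R) (1:R) (fun s : R => s + r / 2) 1 by apply: is_derive_eq; rewrite addr0.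
  have hd : is_derive (0 + r / 2) 1 H (f ((r / 2) *: ebas b + z)).
    rewrite add0r; apply: hH; rewrite ger0_norm ?divr_ge0 ?(ltW r0) //; lra.
  by apply: (is_derive_eq (@is_derive1_comp R H (fun s => s + r / 2) 0 _ _ hd hin)); rewrite mulr1.
have d2 : is_derive (0 : R) (1 : R) (fun s : R => H (s - r / 2)) (f ((- (r / 2)) *: ebas b + z)).
  have hin : is_derive (0:R) (1:R) (fun s : R => s - r / 2) 1 by apply: is_derive_eq; rewrite subr0.
  have hd : is_derive (0 - r / 2) 1 H (f ((- (r / 2)) *: ebas b + z)).
    rewrite sub0r; apply: hH; rewrite normrN ger0_norm ?divr_ge0 ?(ltW r0) //; lra.
  by apply: (is_derive_eq (@is_derive1_comp R H (fun s => s - r / 2) 0 _ _ hd hin)); rewrite mulr1.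
have d3 := @is_deriveZ _ _ _ _ r^-1 _ _ _ (is_deriveD d1 (@is_deriveZ _ _ _ _ (-1) _ _ _ d2)).
apply: near_eq_is_derive d3.
near=> s; rewrite key; first by [].
near: s.
exists 2^-1 => /=; first by rewrite invr_gt0.
by move=> s /=; rewrite sub0r normrN.
Unshelve. all: by end_near. Qed.

(** A quadratic Taylor remainder identifies the derivative. Such bounds survive averaging, which
    avoids differentiation under the integral sign. *)
Lemma is_derive_quadratic f z (v : pt) (d L e : R) : 0 < e ->
  (forall t, `|t| < e -> `|f (t *: v + z) - f z - t * d| <= L * t ^+ 2) -> is_derive z v f d.
Proof.
move=> e0 h; have L0 : 0 <= L.
  have h1 : 0 < e / 2 by rewrite divr_gt0.
  have := h (e / 2) _; rewrite gtr0_norm // => /(_ _)h2.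
  have : 0 <= L * (e / 2) ^+ 2 by apply: le_trans (h2 _) => //; rewrite ltr_pdivrMr // ltr_pMr // ltr1n.
  by rewrite pmulr_lge0 // exprn_gt0.
suff c : (fun t : R => t^-1 *: (f (t *: v + z) - f z)) t @[t --> 0^'] --> d.
  by split; [apply/cvg_ex; exists d|exact: cvg_lim c].
apply/cvgrPdist_le => /= eps eps0; near=> t.
have t0 : t != 0 by near: t; exact: nbhs_dnbhs_neq.
have te : `|t| < e by near: t; apply: dnbhs0_lt.
have tl : `|t| * (L + 1) <= eps.
  rewrite -ler_pdivlMr ?ltr_wpDl //; near: t; apply: dnbhs0_le; rewrite divr_gt0 // ltr_wpDl //.
have -> : d - t^-1 *: (f (t *: v + z) - f z) = - t^-1 * (f (t *: v + z) - f z - t * d).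
  by rewrite /GRing.scale /=; field.
rewrite normrM normrN normfV mulrC ler_pdivrMr ?normr_gt0 //.
apply: le_trans (h t te) _.
have -> : t ^+ 2 = `|t| * `|t| by rewrite -normrM -expr2 ger0_norm // sqr_ge0.
rewrite mulrA ler_wpM2r //; apply: le_trans tl; rewrite mulrC ler_wpM2l //; lra.
Unshelve. all: by end_near. Qed.

Lemma mvt_line f g b z (t : R) :
  (forall x : R, 0 <= x <= 1 -> is_derive ((x * t) *: ebas b + z) (ebas b) f (g ((x * t) *: ebas b + z))) ->
  exists2 x : R, 0 <= x <= 1 & f (t *: ebas b + z) - f z = t * g ((x * t) *: ebas b + z).
Proof.
move=> hd.
have hd1 (x : R) : 0 <= x <= 1 -> is_derive x (1 : R) (fun x : R => f ((x * t) *: ebas b + z))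
    (t * g ((x * t) *: ebas b + z)).
  move=> /hd /is_derive_line h.
  have hs : is_derive x (1 : R) (fun y : R => (y - x) * t) t.
    by apply: is_derive_eq; rewrite /GRing.scale /=; ring.
  have h' : is_derive ((x - x) * t) (1 : R) (fun s : R => f (s *: ebas b + ((x * t) *: ebas b + z)))
      (g ((x * t) *: ebas b + z)) by rewrite subrr mul0r.
  rewrite (_ : t * g ((x * t) *: ebas b + z) = g ((x * t) *: ebas b + z) * t); last exact: mulrC.
  have := @is_derive1_comp R (fun s : R => f (s *: ebas b + ((x * t) *: ebas b + z))) (fun y => (y - x) * t) x _ _ h' hs.
  congr is_derive.
  by rewrite funeqE => y /=; rewrite addrA -scalerDl -mulrDl subrK.
have [||x] := @MVT_segment R (fun x => f ((x * t) *: ebas b + z)) (fun x => t * g ((x * t) *: ebas b + z)) 0 1 ler01.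
- by move=> x; rewrite in_itv /= => /andP[x0 x1]; apply: hd1; rewrite !ltW.
- apply: continuous_in_subspaceT => x; rewrite inE /= in_itv /= => /hd1 d.
  by apply: differentiable_continuous; apply/derivable1_diffP; case: d.
by rewrite in_itv /= mul0r scale0r add0r mul1r subr0 mulr1 => x01 e1; exists x.
Qed.

End Averages.

(** * Iterated averages as a mollifier of finite order *)

Section Smoothing.
Context {R : realType}.
Local Notation pt := 'rV[R]_2.
Implicit Types (f g p : pt -> R) (z w : pt) (b : bool) (i j k : nat) (r : R).

Definition box (c : pt) (s : R) : set pt := [set w | `|w - c| < s].

Lemma box_open c s : open (box c s).
Proof.
have [s0|s0] := ltP 0 s.
  rewrite (_ : box c s = ball c s); first exact: ball_open.
  by rewrite -ball_normE; apply/seteqP; split => w /=; rewrite /box /= distrC.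
rewrite (_ : box c s = set0); first exact: open0.
by apply/seteqP; split => w //=; rewrite /box /= ltNge (le_trans s0).
Qed.

Lemma lips_comb B L B' L' f g (c d : R) : lips B L f -> lips B' L' g ->
  lips (`|c| * B + `|d| * B') (`|c| * L + `|d| * L') (fun z => c * f z + d * g z).
Proof. by move=> hf hg; apply: lips_add; exact: lips_scale. Qed.

Lemma lips_le B L B' L' f : B <= B' -> L <= L' -> lips B L f -> lips B' L' f.
Proof.
move=> BB LL [h1 h2]; split; first by move=> z; exact: le_trans (h1 z) BB.
by move=> b t z; apply: le_trans (h2 b t z) _; rewrite ler_wpM2r.
Qed.

Lemma dq_lips B L f b r : 0 < r -> lips B L f -> lips (B * (2 / r)) (L * (2 / r)) (dq b r f).
Proof.
move=> r0 hf; have h := lips_scale r^-1 (lips_add (lips_trans ((r / 2) *: ebas b) hf)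
  (lips_scale (-1) (lips_trans ((- (r / 2)) *: ebas b) hf))).
by apply: lips_le h; rewrite normrN1 mul1r gtr0_norm ?invr_gt0 //; lra.
Qed.

Lemma dq_bound B L f b r z : 0 < r -> lips B L f -> `|dq b r f z| <= L.
Proof.
move=> r0 [_ h]; rewrite /dq mulN1r normrM gtr0_norm ?invr_gt0 // mulrC ler_pdivrMr //.
have := h b r ((- (r / 2)) *: ebas b + z); rewrite addrA -scalerDl (gtr0_norm r0).
by have -> : r + - (r / 2) = r / 2 by field.
Qed.

Lemma taylor_line f p B L b z t : lips B L p -> (forall w, is_derive w (ebas b) f (p w)) ->
  `|f (t *: ebas b + z) - f z - t * p z| <= L * t ^+ 2.
Proof.
move=> hp hd; have [x /andP[x0 x1] ->] := mvt_line (t := t) (z := z) (fun x _ => hd _).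
rewrite -mulrBr normrM -(real_normK (num_real t)) expr2 mulrCA ler_wpM2l //.
apply: le_trans (hp.2 b (x * t) z) _; rewrite ler_wpM2l //; first by have [] := lips_ge0 hp.
by rewrite normrM ger0_norm // ler_piMl.
Qed.

Lemma avg_derive_other f p B L b b' r z : lips B L p -> (exists B' L', lips B' L' f) ->
  (forall w, is_derive w (ebas b) f (p w)) ->
  is_derive z (ebas b) (avg b' r f) (avg b' r p z).
Proof.
move=> hp [B' [L' hf]] hd.
apply: (@is_derive_quadratic _ _ _ _ _ L 1) => // t t1.
have -> : avg b' r f (t *: ebas b + z) - avg b' r f z - t * avg b' r p z =
  avg b' r (fun w => f (t *: ebas b + w) + ((-1) * f w + (- t) * p w)) z.
  rewrite (avg_add _ _ _ (lips_trans _ hf) (lips_comb _ _ hf hp)).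
  rewrite (avg_add _ _ _ (lips_scale _ hf) (lips_scale _ hp)) avg_trans.
  by rewrite (avg_scale _ _ _ _ hf) (avg_scale _ _ _ _ hp); ring.
have hl := lips_add (lips_trans (t *: ebas b) hf) (lips_comb (-1) (- t) hf hp).
apply: mean_bound; first exact: lips_line_r hl.
move=> s _; set w := _ + z.
by rewrite mulN1r mulNr addrA; exact: taylor_line hp hd.
Qed.

(** Convolution with a product of two B-splines, of orders [i] and [j]. The counts are kept apart
    because a derivative in one direction consumes an average in that direction. *)
Definition smooth i j r f := iter i (avg false r) (iter j (avg true r) f).

Lemma smooth_lips B L f i j r : lips B L f -> lips B L (smooth i j r f).
Proof.
move=> hf; rewrite /smooth; elim: i => [|i IH] /=; last exact: avg_lips.
by elim: j => [|j IH] //=; exact: avg_lips.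
Qed.

Lemma smooth_comb B L B' L' f g i j r (c d : R) : lips B L f -> lips B' L' g ->
  smooth i j r (fun z => c * f z + d * g z) = fun z => c * smooth i j r f z + d * smooth i j r g z.
Proof.
move=> hf hg; have step b f' g' B1 L1 B2 L2 : lips B1 L1 f' -> lips B2 L2 g' ->
    avg b r (fun z => c * f' z + d * g' z) = fun z => c * avg b r f' z + d * avg b r g' z.
  move=> h1 h2; rewrite funeqE => z.
  by rewrite (avg_add _ _ _ (lips_scale _ h1) (lips_scale _ h2)) (avg_scale _ _ _ _ h1) (avg_scale _ _ _ _ h2).
rewrite /smooth; elim: i => [|i IH] /=.
  elim: j => [|j IH] //=; rewrite IH.
  by apply: step; [exact: (smooth_lips 0 j r hf)|exact: (smooth_lips 0 j r hg)].
by rewrite IH; apply: step; [exact: (smooth_lips i j r hf)|exact: (smooth_lips i j r hg)].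
Qed.

Lemma smooth_const i j r c : smooth i j r (fun=> c) = fun=> c.
Proof.
rewrite /smooth; have h b : avg b r (fun=> c) = fun=> c by rewrite funeqE => z; exact: avg_const.
by elim: i => [|i IH] /=; [elim: j => [|j IH] //=|]; rewrite IH.
Qed.

Lemma smooth_trans f i j r w : smooth i j r (fun z => f (w + z)) = fun z => smooth i j r f (w + z).
Proof.
have h b g : avg b r (fun z => g (w + z)) = fun z => avg b r g (w + z).
  by rewrite funeqE => z; exact: avg_trans.
by rewrite /smooth; elim: i => [|i IH] /=; [elim: j => [|j IH] //=|]; rewrite IH h.
Qed.

Lemma smooth_dq B L f i j b r : lips B L f -> smooth i j r (dq b r f) = dq b r (smooth i j r f).
Proof.
move=> hf; rewrite /dq.
have -> : (fun z => r^-1 * (f ((r / 2) *: ebas b + z) + -1 * f (- (r / 2) *: ebas b + z))) =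
  (fun z => r^-1 * f ((r / 2) *: ebas b + z) + (- r^-1) * f (- (r / 2) *: ebas b + z)).
  by rewrite funeqE => z; ring.
rewrite (smooth_comb _ _ _ _ _ (lips_trans _ hf) (lips_trans _ hf)) !smooth_trans.
by rewrite funeqE => z; ring.
Qed.

(** One average in direction [b] is traded for a difference quotient of the unmollified function. *)
Lemma smooth_derive B L f i j r b z : 0 < r -> lips B L f ->
  is_derive z (ebas b) (smooth (i + ~~ b) (j + b) r f) (smooth i j r (dq b r f) z).
Proof.
move=> r0 hf; case: b; rewrite /= ?addn0 ?addn1; last first.
  by rewrite (smooth_dq _ _ _ _ hf) /smooth /=; exact: avg_dd (smooth_lips i j r hf).
(* For [b = true] the consumed average sits inside the outer averages in the other direction; the
   derivative is carried through these one at a time by [avg_derive_other]. *)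
elim: i z => [|i IH] z.
  by rewrite (smooth_dq _ _ _ _ hf) /smooth /=; exact: avg_dd (smooth_lips 0 j r hf).
rewrite /smooth /=; apply: avg_derive_other IH; first exact: smooth_lips (dq_lips _ r0 hf).
by exists B, L; exact: smooth_lips.
Qed.

Lemma smooth_bound B L f i j r z C : 0 <= r -> lips B L f ->
  (forall w, `|w - z| <= (i + j)%:R * r -> `|f w| <= C) -> `|smooth i j r f z| <= C.
Proof.
move=> r0 hf; have key b g (n : nat) z' B' L' : lips B' L' g ->
    (forall w, `|w - z'| <= r -> `|g w| <= C) -> `|avg b r g z'| <= C.
  move=> hg hC; apply: (avg_bound r0 hg) => t tr; apply: hC.
  by rewrite addrK norm_ebas; apply: le_trans tr _; rewrite ler_pdivrMr // ler_peMr // ler1n.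
elim: i z => [|i IH] z hC.
  elim: j z hC => [|j IH] z hC; first by apply: hC; rewrite subrr normr0 mulr_ge0.
  apply: (key _ _ 0%N _ _ _ (smooth_lips 0 j r hf)) => w wz; apply: IH => v vw; apply: hC.
  rewrite -(subrK w v) -addrA; apply: le_trans (ler_normD _ _) _.
  by rewrite !add0n in vw *; rewrite -natr1 mulrDl mul1r lerD.
apply: (key _ _ 0%N _ _ _ (smooth_lips i j r hf)) => w wz; apply: IH => v vw; apply: hC.
rewrite -(subrK w v) -addrA; apply: le_trans (ler_normD _ _) _.
by rewrite addSn -natr1 mulrDl mul1r lerD.
Qed.

Lemma smooth_close B L f i j r z c C : 0 <= r -> lips B L f ->
  (forall w, `|w - z| <= (i + j)%:R * r -> `|f w - c| <= C) -> `|smooth i j r f z - c| <= C.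
Proof.
move=> r0 hf hC.
have -> : smooth i j r f z - c = smooth i j r (fun w => 1 * f w + (-1) * c) z.
  rewrite (smooth_comb _ _ _ 1 (-1) hf (lips_const c)) smooth_const; ring.
apply: smooth_bound r0 (lips_comb 1 (-1) hf (lips_const c)) _ => w /hC.
by rewrite mul1r mulN1r.
Qed.

Lemma pt_decomp w : w = (w 0 0) *: ebas false + (w 0 1) *: ebas true.
Proof.
apply/matrixP => a c; rewrite ord1 !(mxE, eqxx) /=.
by case: c => -[|[|//]] hc; rewrite -!val_eqE /= ?mulr1 ?mulr0 ?addr0 ?add0r; congr (w _ _); apply/val_inj.
Qed.

Lemma lips_dist B L f w z : lips B L f -> `|f w - f z| <= 2 * L * `|w - z|.
Proof.
move=> hf; have [_ L0] := lips_ge0 hf; have [_ h2] := hf.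
have wz (q : 'I_2) : `|(w - z) 0 q| <= `|w - z| by exact: (rV_norm_leP _ (normr_ge0 _)).1.
have e : w = (w - z) 0 0 *: ebas false + ((w - z) 0 1 *: ebas true + z).
  by rewrite addrA -pt_decomp subrK.
rewrite {1}e -(subrK (f ((w - z) 0 1 *: ebas true + z)) (f _)) -addrA.
apply: le_trans (ler_normD _ _) _; rewrite -mulrA mulr_natl mulr2n.
by apply: lerD; apply: le_trans (h2 _ _ _) _; rewrite ler_wpM2l.
Qed.

(** Each derivative replaces an average by a difference quotient, bounded by [2 / r] times the
    previous bound. The quotient looks [r / 2] further, and the spent average gives back [r], so the
    enlarged box on which [f] is bounded suffices at every order. *)
Lemma smooth_Bd B L f i j k r z0 rho C : 0 < r -> lips B L f -> (k <= i)%N -> (k <= j)%N ->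
  (forall w, `|w - z0| <= rho + (i + j)%:R * r -> `|f w| <= C) -> 0 <= C ->
  Bd k (box z0 rho) C (2 / r) (smooth i j r f).
Proof.
move=> r0; elim: k i j B L f C => [|k IH] i j B L f C hf ki kj hC C0.
  split => // z Sz; apply: smooth_bound (ltW r0) hf _ => w wz; apply: hC.
  rewrite -(subrK z w) -addrA; apply: le_trans (ler_normD _ _) _.
  by rewrite [leRHS]addrC; apply: lerD; [exact: wz|exact: ltW].
case: i ki hC => [//|i] ki hC; case: j kj hC => [//|j] kj hC.
apply: (Bd_intro (D := fun b => smooth (i + b) (j + ~~ b) r (dq b r f))) => //.
- exact: box_open.
- move=> z Sz; apply: smooth_bound (ltW r0) hf _ => w wz; apply: hC.
  rewrite -(subrK z w) -addrA; apply: le_trans (ler_normD _ _) _.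
  by rewrite [leRHS]addrC; apply: lerD; [exact: wz|exact: ltW].
- move=> b z Sz; have := smooth_derive (i + b) (j + ~~ b) b z r0 hf.
  by case: b; rewrite /= !(addn0, addn1).
- move=> b; apply: (IH _ _ _ _ _ _ (dq_lips b r0 hf)).
  + by rewrite (leq_trans (n := i)) // leq_addr.
  + by rewrite (leq_trans (n := j)) // leq_addr.
  + move=> w wz; have hw c : `|c| <= r / 2 -> `|f (c *: ebas b + w)| <= C.
      move=> cr; apply: hC; rewrite -addrA; apply: le_trans (ler_normD _ _) _.
      rewrite norm_ebas; apply: (@le_trans _ _ (r / 2 + (rho + (i + b + (j + ~~ b))%:R * r))).
        exact: lerD.
      rewrite addnACA (_ : (b + ~~ b = 1)%N); last by case: (b).
      have -> : (i.+1 + j.+1)%:R = (i + j)%:R + 2 :> R by rewrite addSn addnS -!natr1; lra.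
      by rewrite natrD; move: (i + j)%:R => X; lra.
    have r2 : 0 <= r / 2 by rewrite divr_ge0 // ltW.
    rewrite /dq normrM gtr0_norm ?invr_gt0 // mulN1r mulrC [leRHS]mulrA ler_pM2r ?invr_gt0 //.
    apply: le_trans (ler_normD _ _) _; rewrite normrN mulr_natr mulr2n.
    by apply: lerD; apply: hw; rewrite ?normrN ger0_norm.
  + by rewrite mulr_ge0 // divr_ge0 // ltW.
Qed.

Lemma Bd_local k (S : set pt) C mu f : 0 <= C ->
  (forall z, S z -> exists2 N : set pt, N z & Bd k N C mu f) -> 0 <= mu -> Bd k S C mu f.
Proof.
move=> C0 h mu0; elim: k C f C0 h => [|k IH] C f C0 h; split => //.
- by move=> z /h[N Nz hN]; exact: Bd_bound hN Nz.
- by move=> z /h[N Nz hN]; exact: Bd_bound hN Nz.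
- move=> b; split; first by move=> z /h[N Nz hN]; exact: Bd_derivable hN Nz.
  apply: IH; first exact: mulr_ge0.
  by move=> z /h[N Nz hN]; exists N => //; exact: Bd_dd.
Qed.

Lemma box_center z s : 0 < s -> box z s z.
Proof. by move=> s0; rewrite /box /= subrr normr0. Qed.

Lemma smooth_Bd_global B L f i j k r : 0 < r -> lips B L f -> (k <= i)%N -> (k <= j)%N ->
  Bd k setT B (2 / r) (smooth i j r f).
Proof.
move=> r0 hf ki kj; have [B0 _] := lips_ge0 hf.
apply: Bd_local => // [z _|]; last by rewrite divr_ge0 // ltW.
exists (box z 1); first exact: box_center.
by apply: (smooth_Bd r0 hf ki kj) => // w _; exact: hf.1.
Qed.

(** The first derivative is bounded by the Lipschitz constant, since [dq] of a Lipschitz function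
    is; only the further derivatives cost [2 / r]. *)
Lemma smooth_dd_Bd B L f i j k r b : 0 < r -> lips B L f -> (k < i)%N -> (k < j)%N ->
  Bd k setT L (2 / r) (dd b (smooth i j r f)).
Proof.
move=> r0 hf ki kj; have [B0 L0] := lips_ge0 hf.
case: i ki => // i ki; case: j kj => // j kj.
have hd : lips L (L * (2 / r)) (dq b r f).
  have [_ h] := dq_lips b r0 hf; split => // z; exact: dq_bound r0 hf.
apply: (Bd_ext _ _ (smooth_Bd_global (i := i + b) (j := j + ~~ b) r0 hd _ _)).
- exact: openT.
- move=> z _; have := smooth_derive (i + b) (j + ~~ b) b z r0 hf.
  by move=> h; rewrite -(is_derive_dd h); case: (b); rewrite /= !(addn0, addn1).
- by rewrite (leq_trans (n := i)) // leq_addr.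
- by rewrite (leq_trans (n := j)) // leq_addr.
Qed.

(** The quadratic commutator estimate: the commutator does not change when constants are subtracted
    from [f] and [g]. Near [z0] one subtracts [f z0] and [g z0], after which the factors are of
    order [M r] and [Mg r], and every term is of order [M Mg r^2]. *)
Lemma smooth_commutator m k M Mg B Bg f g r : 0 < r -> (k <= m)%N -> lips B M f -> lips Bg Mg g ->
  Bd k setT ((1 + 2 ^+ k) * (2 * (1 + (m + m)%:R)) ^+ 2 * (M * Mg * r ^+ 2)) (2 / r)
    (fun z => smooth m m r (fun w => f w * g w) z - smooth m m r f z * smooth m m r g z).
Proof.
move=> r0 km hf hg; have [B0 M0] := lips_ge0 hf; have [Bg0 Mg0] := lips_ge0 hg.
have r2 : 0 <= 2 / r by rewrite divr_ge0 // ltW.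
set q := 2 * (1 + (m + m)%:R); have q0 : 0 <= q by rewrite mulr_ge0 // addr_ge0.
apply: Bd_local => // [|z0 _].
  by rewrite mulr_ge0 ?mulr_ge0 ?exprn_ge0 ?(ltW r0) ?addr_ge0 ?exprn_ge0.
exists (box z0 r); first exact: box_center.
pose f0 z := 1 * f z + (-1) * f z0; pose g0 z := 1 * g z + (-1) * g z0.
have hf0 := lips_comb 1 (-1) hf (lips_const (f z0)).
have hg0 := lips_comb 1 (-1) hg (lips_const (g z0)).
have bnd (h : pt -> R) Bh Mh w : lips Bh Mh h -> `|w - z0| <= r + (m + m)%:R * r ->
    `|1 * h w + (-1) * h z0| <= q * (Mh * r).
  move=> hh hw; rewrite mul1r mulN1r; apply: le_trans (lips_dist _ _ hh) _.
  have [_ Mh0] := lips_ge0 hh.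
  have -> : q * (Mh * r) = 2 * Mh * (r + (m + m)%:R * r) by rewrite /q; ring.
  by rewrite ler_wpM2l // mulr_ge0.
have S1 : Bd k (box z0 r) (q * (M * r)) (2 / r) (smooth m m r f0).
  apply: (smooth_Bd r0 hf0 km km) => [w hw|]; first exact: bnd hf hw.
  by rewrite !mulr_ge0 // ltW.
have S2 : Bd k (box z0 r) (q * (Mg * r)) (2 / r) (smooth m m r g0).
  apply: (smooth_Bd r0 hg0 km km) => [w hw|]; first exact: bnd hg hw.
  by rewrite !mulr_ge0 // ltW.
have S3 : Bd k (box z0 r) (q * (M * r) * (q * (Mg * r))) (2 / r) (smooth m m r (fun w => f0 w * g0 w)).
  apply: (smooth_Bd r0 (lips_mul hf0 hg0) km km) => [w hw|].
    by rewrite normrM; apply: ler_pM => //; [exact: bnd hf hw|exact: bnd hg hw].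
  by rewrite !mulr_ge0 // ltW.
have S4 := Bd_add (@box_open z0 r) S3 (Bd_opp (@box_open z0 r) (Bd_mul (@box_open z0 r) r2 S1 S2)).
have -> : (1 + 2 ^+ k) * q ^+ 2 * (M * Mg * r ^+ 2) =
  q * (M * r) * (q * (Mg * r)) + 2 ^+ k * (q * (M * r) * (q * (Mg * r))) by ring.
apply: Bd_ext S4; first exact: box_open.
move=> z _; rewrite /f0 /g0.
rewrite (smooth_comb _ _ _ 1 (-1) hf (lips_const (f z0))) (smooth_comb _ _ _ 1 (-1) hg (lips_const (g z0))) !smooth_const.
have -> : (fun w => (1 * f w + (-1) * f z0) * (1 * g w + (-1) * g z0)) =
  fun w => 1 * (f w * g w) + 1 * ((- g z0) * f w + 1 * ((- f z0) * g w + 1 * (f z0 * g z0))).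
  by rewrite funeqE => w; ring.
have h3 := lips_comb (- f z0) 1 hg (lips_const (f z0 * g z0)).
have h2 := lips_comb (- g z0) 1 hf h3.
rewrite (smooth_comb _ _ _ 1 1 (lips_mul hf hg) h2) (smooth_comb _ _ _ _ _ hf h3).
rewrite (smooth_comb _ _ _ _ _ hg (lips_const _)) smooth_const.
by ring.
Qed.

Lemma smooth_line_taylor B L B' L' f p i j r b z t c C : 0 <= r -> lips B L f -> lips B' L' p ->
  (forall w, `|w - z| <= (i + j)%:R * r -> `|f (t *: ebas b + w) - f w - t * p w - c| <= C) ->
  `|smooth i j r f (t *: ebas b + z) - smooth i j r f z - t * smooth i j r p z - c| <= C.
Proof.
move=> r0 hf hp h.
have h1 := lips_comb (-1) (- t) hf hp.
have e : smooth i j r f (t *: ebas b + z) - smooth i j r f z - t * smooth i j r p z =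
  smooth i j r (fun w => 1 * f (t *: ebas b + w) + 1 * ((-1) * f w + (- t) * p w)) z.
  rewrite (smooth_comb _ _ _ 1 1 (lips_trans _ hf) h1) (smooth_comb _ _ _ _ _ hf hp) smooth_trans.
  ring.
rewrite e; apply: (smooth_close r0 (lips_comb 1 1 (lips_trans _ hf) h1)) => w /h.
by rewrite !mul1r mulN1r mulNr addrA.
Qed.

(** The coordinatewise projection onto the closed box of half-width [s]; composing with it extends
    data from the box to the plane. *)
Definition clamp (s : R) z : pt := \row_j Num.max (- s) (Num.min s (z 0 j)).

Lemma clamp_norm s z : 0 <= s -> `|clamp s z| <= s.
Proof.
move=> s0; apply/rV_norm_leP => // j; rewrite mxE ler_norml le_max lexx /= ge_max ge_min lexx /= andbT.
lra.
Qed.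

Lemma clamp_id s z : `|z| <= s -> clamp s z = z.
Proof.
move=> zs; have s0 := le_trans (normr_ge0 z) zs.
apply/matrixP => a j; rewrite ord1 mxE; have := (rV_norm_leP z s0).1 zs j.
by rewrite ler_norml => /andP[h1 h2]; rewrite min_r // max_r.
Qed.

(** A move along a coordinate line becomes a move along the same line, no longer than before. This
    is why [lips] is phrased with coordinate directions. *)
Lemma clamp_line s z b t : 0 <= s -> exists2 t', `|t'| <= `|t| & 
  clamp s (t *: ebas b + z) = t' *: ebas b + clamp s z.
Proof.
move=> s0; pose j : 'I_2 := if b then 1 else 0.
pose cl (x : R) := Num.max (- s) (Num.min s x).
exists (cl (t + z 0 j) - cl (z 0 j)).
  have cl_le (x y : R) : x <= y -> 0 <= cl y - cl x <= y - x.
    move=> xy; rewrite /cl; case: (leP s x) => sx; case: (leP s y) => sy;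
    rewrite ?(max_r (x := - s) (y := s)); try lra;
    try (case: (leP (- s) x) => xx); try (case: (leP (- s) y) => yy); lra.
  have [t0|t0] := leP 0 t.
    have := cl_le (z 0 j) (t + z 0 j); rewrite lerDr t0 => /(_ isT) /andP[h1 h2].
    by rewrite !ger0_norm //; lra.
  have := cl_le (t + z 0 j) (z 0 j); rewrite gerDr (ltW t0) => /(_ isT) /andP[h1 h2].
  by rewrite ler0_norm ?ltr0_norm //; lra.
apply/matrixP => a k; rewrite ord1 !mxE !eqxx /= /cl /j.
by case: eqP => [->|_]; rewrite ?mulr1 ?mulr0 ?add0r ?subrK // !mxE.
Qed.

Lemma lips_clamp B L s f : 0 <= s -> 0 <= L -> (forall z, `|z| <= s -> `|f z| <= B) ->
  (forall b t z, `|z| <= s -> `|t *: ebas b + z| <= s -> `|f (t *: ebas b + z) - f z| <= L * `|t|) ->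
  lips B L (fun z => f (clamp s z)).
Proof.
move=> s0 L0 h1 h2; split => [z|b t z]; first by apply: h1; exact: clamp_norm.
have [t' tt e] := clamp_line z b t s0; rewrite e.
apply: le_trans (h2 _ _ _ _ _) _; rewrite ?clamp_norm //; first by rewrite -e clamp_norm.
by rewrite ler_wpM2l.
Qed.

End Smoothing.

(** * Mollifying data given on a box *)

Section ClampedData.
Context {R : realType}.
Local Notation pt := 'rV[R]_2.
Implicit Types (f g p : pt -> R) (z w : pt) (b : bool).

Lemma norm_segment z b (t x rho : R) : 0 <= x <= 1 -> `|z| <= rho -> `|t *: ebas b + z| <= rho ->
  `|(x * t) *: ebas b + z| <= rho.
Proof.
move=> /andP[x0 x1] h1 h2.
have -> : (x * t) *: ebas b + z = (1 - x) *: z + x *: (t *: ebas b + z).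
  by rewrite scalerDr scalerA scalerBl scale1r addrCA subrK.
apply: le_trans (ler_normD _ _) _; rewrite !normrZ !ger0_norm ?subr_ge0 //.
by have := ler_wpM2l x0 h2; have : (1 - x) * `|z| <= (1 - x) * rho; [rewrite ler_wpM2l // subr_ge0|lra].
Qed.

Lemma box0P s z : box 0 s z <-> `|z| < s.
Proof. by rewrite /box /= subr0. Qed.

Section C1data.
Variables (s rho L : R) (f : pt -> R).
Hypotheses (rho0 : 0 <= rho) (rhos : rho < s) (L0 : 0 <= L).
Hypothesis fd : forall b z, box 0 s z -> derivable f z (ebas b).
Hypothesis fL : forall b z, box 0 s z -> `|dd b f z| <= L.

Lemma closed_box_incr b t z : `|z| <= rho -> `|t *: ebas b + z| <= rho ->
  `|f (t *: ebas b + z) - f z| <= L * `|t|.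
Proof.
move=> h1 h2; have [|x x01 ->] := @mvt_line R f (dd b f) b z t.
  move=> x x01; apply: derivable_dd; apply: fd; apply/box0P.
  by apply: le_lt_trans rhos; exact: norm_segment.
rewrite normrM mulrC ler_wpM2r // fL //; apply/box0P.
by apply: le_lt_trans rhos; exact: norm_segment.
Qed.

Lemma clamp_lips B : (forall z, `|z| <= rho -> `|f z| <= B) -> lips B L (fun z => f (clamp rho z)).
Proof. by move=> hB; apply: lips_clamp => // b t z; exact: closed_box_incr. Qed.

Lemma clamp_lips_exists : exists B, lips B L (fun z => f (clamp rho z)).
Proof.
exists (`|f 0| + L * rho + L * rho); apply: clamp_lips => z zr.
have hj (j : 'I_2) : `|z 0 j| <= rho by exact: (rV_norm_leP _ rho0).1 zr j.
have h1 : `|(z 0 1) *: ebas true + 0| <= rho by rewrite addr0 norm_ebas.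
have h0 : `|0 : pt| <= rho by rewrite normr0.
have e : z = z 0 0 *: ebas false + ((z 0 1) *: ebas true + 0) by rewrite addr0 -pt_decomp.
have i1 := closed_box_incr h0 h1.
have i2 : `|f z - f ((z 0 1) *: ebas true + 0)| <= L * `|z 0 0|.
  by rewrite {1}e; apply: closed_box_incr => //; rewrite -e.
rewrite -(subrK (f ((z 0 1) *: ebas true + 0)) (f z)) -(subrK (f 0) (f (_ + 0))).
apply: le_trans (ler_normD _ _) _; rewrite addrC; apply: lerD; last first.
  by rewrite subrK; apply: le_trans i2 _; rewrite ler_wpM2l.
apply: le_trans (ler_normD _ _) _; rewrite addrC; apply: lerD => //.
by apply: le_trans i1 _; rewrite ler_wpM2l.
Qed.

(** Mollification commutes with the derivative as long as the averages do not reach the clamped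
    region. The proof averages the quadratic Taylor bound of [f], which the Lipschitz bound of its
    derivative provides. *)
Lemma clamp_smooth_derive b i j r z B M : 0 <= r -> `|z| + (i + j)%:R * r < rho ->
  lips B M (fun z => dd b f (clamp rho z)) ->
  is_derive z (ebas b) (smooth i j r (fun z => f (clamp rho z)))
    (smooth i j r (fun z => dd b f (clamp rho z)) z).
Proof.
move=> r0 zr hp; have [Bf hf] := clamp_lips_exists.
have [_ M0] := lips_ge0 hp.
have e0 : 0 < rho - (`|z| + (i + j)%:R * r) by rewrite subr_gt0.
apply: (is_derive_quadratic (L := M) e0) => t te.
have := @smooth_line_taylor R _ _ _ _ _ _ i j r b z t 0 (M * t ^+ 2) r0 hf hp.
rewrite subr0; apply => w wz; rewrite subr0.
have wr : `|w| + `|t| < rho.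
  have : `|w| <= `|w - z| + `|z| by rewrite -{1}(subrK z w) ler_normD.
  by move: te wz; lra.
have w1 : `|w| <= rho by apply: le_trans (ltW wr); rewrite lerDl.
have w2 : `|t *: ebas b + w| <= rho.
  by apply: le_trans (ler_normD _ _) _; rewrite norm_ebas addrC ltW.
rewrite !clamp_id //.
have [|x x01 ->] := @mvt_line R f (dd b f) b w t.
  move=> x x01; apply: derivable_dd; apply: fd; apply/box0P.
  by apply: le_lt_trans rhos; exact: norm_segment.
have w3 := norm_segment x01 w1 w2; have [x0 x1] := andP x01.
rewrite -mulrBr normrM -(real_normK (num_real t)) expr2 mulrCA ler_wpM2l //.
have := hp.2 b (x * t) w; rewrite !clamp_id // => h; apply: le_trans h _.
by rewrite ler_wpM2l // normrM ger0_norm // ler_piMl.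
Qed.

End C1data.

End ClampedData.

(** * One stage *)

Section SmallnessFilter.
Context {R : realType} {T : Type}.
Variable th : T -> R.

(** Holding near this filter means holding for all [t] with [th t] below one threshold, whatever the
    other components of [t] are. *)
Definition small_filter : set_system T := [set A | exists2 e : R, 0 < e & forall t, th t <= e -> A t].

Global Instance small_filter_filter : Filter small_filter.
Proof.
split; first by exists 1.
- move=> P Q [e e0 h] [e' e'0 h']; exists (Num.min e e'); first by rewrite lt_min e0.
  by move=> t; rewrite le_min => /andP[/h ? /h' ?]; split.
- by move=> P Q PQ [e e0 h]; exists e => // t /h /PQ.
Qed.

End SmallnessFilter.

Section UniformBounds.
Context {R : realType} {T : Type} (F : set_system T) {FF : Filter F}.
Local Notation pt := 'rV[R]_2.
Variables (S : T -> set pt) (e : T -> R).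
Hypothesis e0 : forall t, 0 <= e t.

Lemma near_bound_fin (X : finType) (f : X -> T -> pt -> R) :
  (forall x, exists2 C : R, 0 <= C & \forall t \near F, forall z, S t z -> f x t z <= C * e t) ->
  exists2 C : R, 0 <= C & \forall t \near F, forall z, S t z -> forall x, f x t z <= C * e t.
Proof.
move=> h.
have [s hs] : exists s : seq X, forall x, x \in s by exists (enum X) => x; rewrite mem_enum.
suff [C C0 hC] : exists2 C : R, 0 <= C & \forall t \near F, forall z, S t z -> forall x, x \in s -> f x t z <= C * e t.
  by exists C => //; apply: filterS hC => t hC z Sz x; exact: hC.
elim: s {hs} => [|y s [C C0 hC]]; first by exists 0 => //; apply: nearW.
have [D D0 hD] := h y; exists (C + D); first exact: addr_ge0.
apply: filterS2 hC hD => t hC hD z Sz x; rewrite inE mulrDl => /orP[/eqP ->|xs].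
  by apply: le_trans (hD z Sz) _; rewrite lerDr mulr_ge0.
by apply: le_trans (hC z Sz x xs) _; rewrite lerDl mulr_ge0.
Qed.

Lemma near_bound_ax (X : finType) (f : X -> ax3 -> T -> pt -> R) :
  (forall x i, exists2 C : R, 0 <= C & \forall t \near F, forall z, S t z -> f x i t z <= C * e t) ->
  exists2 C : R, 0 <= C & \forall t \near F, forall z, S t z -> forall x i, f x i t z <= C * e t.
Proof.
move=> h; pose q (o : 'I_3) := match val o with 0%N => ax_x | 1%N => ax_y | _ => ax_z end.
have [C C0 hC] := near_bound_fin (f := fun (x : X * 'I_3) => f x.1 (q x.2)) (fun x => h x.1 (q x.2)).
exists C => //; apply: filterS hC => t hC z Sz x i.
have [k kE] : exists k, q k = i.
  by case: i; [exists (Ordinal (isT : 0 < 3)%N)|exists (Ordinal (isT : 1 < 3)%N)|exists (Ordinal (isT : 2 < 3)%N)].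
by rewrite -kE; exact: (hC z Sz (x, k)).
Qed.

End UniformBounds.

Section StageSetup.
Context {R : realType}.
Local Notation pt := 'rV[R]_2.

(* The residual left after a stage is a multiple of [Hres] rather than of the identity: its positive
   off-diagonal entry is the amount that the cheap (1,1)-oscillation has to supply, so that step is
   never degenerate. *)
Definition Hres (a b : bool) : R := if a == b then 1 else 4^-1.

(* [cu] is the map, defined on the sup-norm box of half-width [cs]; [csg ^ 2] is the size of its metric
   defect and [cdl] that of the next one; [cr] is the mollification radius; the three oscillations of
   the stage have frequencies [cka mu], [cK cka mu] and [cK^2 cka mu] with [mu = 2 / cr]. *)
Record cfg := Cfg { cu : pt -> ax3 -> R; cs : R; csg : R; cdl : R; cr : R; cka : R; cK : R }.

Variables (g : bool -> bool -> pt -> R) (m : nat).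

(** [th] dominates the amplitude, the radius, [1 / cka], the ratio of the next defect to the present
    one and the relative deviation of the defect from [csg^2 Hres]. The bound [th * csg / cr] on
    second derivatives carries a factor [th] so that mollification moves the tangents by
    [O(th * csg)] only. *)
Definition stage_ok (th : R) (c : cfg) : Prop :=
  [/\ [/\ 0 < csg c, csg c <= th, 0 < cr c, cr c <= th & th <= 1],
      [/\ 1 <= th * cka c, 1 <= cK c, 0 <= cdl c, cdl c <= th * csg c ^+ 2 & cr c <= cs c],
      [/\ forall i b z, box 0 (cs c) z -> derivable (fun w => cu c w i) z (ebas b),
          forall i b b' z, box 0 (cs c) z -> derivable (fun w => dv b (cu c) w i) z (ebas b') &
          forall i b b' z, box 0 (cs c) z -> `|dd b' (fun w => dv b (cu c) w i) z| <= th * csg c / cr c] &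
      forall a b z, box 0 (cs c) z -> `|g a b z - met (cu c) a b z - csg c ^+ 2 * Hres a b| <= th * csg c ^+ 2].

(** The index type of the families of a stage: a point is a whole admissible configuration with its
    smallness parameter. *)
Definition scfg := {p : R * cfg | stage_ok p.1 p.2}.
Definition sth (t : scfg) : R := (sval t).1.
Definition su (t : scfg) := cu (sval t).2.
Definition ss (t : scfg) := cs (sval t).2.
Definition ssg (t : scfg) := csg (sval t).2.
Definition sdl (t : scfg) := cdl (sval t).2.
Definition sr (t : scfg) := cr (sval t).2.
Definition ska (t : scfg) := cka (sval t).2.
Definition sK (t : scfg) := cK (sval t).2.

Definition Fth : set_system scfg := small_filter sth.

Global Instance Fth_filter : Filter Fth.
Proof. exact: small_filter_filter. Qed.

Lemma Fth_small e : 0 < e -> \forall t \near Fth, sth t <= e.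
Proof. by move=> e0; exists e. Qed.

Lemma near_Fth (P : scfg -> Prop) : (\forall t \near Fth, P t) ->
  exists2 e : R, 0 < e & forall t, sth t <= e -> P t.
Proof. by []. Qed.

End StageSetup.

Lemma det_close {R : realType} (B e a b d a' b' d' : R) : `|a| <= B -> `|b| <= B -> `|d| <= B ->
  `|a' - a| <= e -> `|b' - b| <= e -> `|d' - d| <= e -> e <= 1 ->
  a * b - d ^+ 2 - e * (4 * B + 2) <= a' * b' - d' ^+ 2.
Proof.
move=> aB bB dB ae be de e1; have e0 := le_trans (normr_ge0 _) ae; have B0 := le_trans (normr_ge0 _) aB.
have -> : a' * b' - d' ^+ 2 = a * b - d ^+ 2 + ((a' - a) * (b' - b) + a * (b' - b) + (a' - a) * b)
  - ((d' - d) * (d' - d) + 2 * (d * (d' - d))) by ring.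
have h (x y X Y : R) : `|x| <= X -> `|y| <= Y -> - (X * Y) <= x * y <= X * Y.
  by move=> hx hy; rewrite -ler_norml normrM; apply: ler_pM.
have /andP[h1 _] := h _ _ _ _ ae be; have /andP[h2 _] := h _ _ _ _ aB be; have /andP[h3 _] := h _ _ _ _ ae bB.
have /andP[_ h4] := h _ _ _ _ de de; have /andP[_ h5] := h _ _ _ _ dB de.
have : e * e <= e by rewrite ler_piMr.
lra.
Qed.

(** * The three oscillations of a stage *)

Section Stage.
Context {R : realType}.
Local Notation pt := 'rV[R]_2.
Variables (g : bool -> bool -> pt -> R) (J : nat) (Bg Lg c0 : R).
Hypothesis hg : forall a b, lips Bg Lg (g a b).
Hypothesis c0_gt0 : 0 < c0.
Hypothesis gdet : forall z, c0 <= g false false z * g true true z - g false true z ^+ 2.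

(** The number of averages in each direction. The off-diagonal step is used with [k = 2], leaving
    derivatives for two more steps, and then asks [2 J + 5] derivatives of the defect: [J] for the
    amplitude passes, [J] for integration by parts, and five more. *)
Definition stm := (2 * J + 8)%N.
Local Notation m := stm.
Local Notation T := (@scfg R g).
Local Notation F := (@Fth R g).
Local Notation H := (@Hres R).
Let rho (t : T) := ss t - sr t.
(** One radius is reserved for clamping at [rho t] and one for each of the [2 * m] averages. *)
Let S (t : T) : set pt := box 0 (ss t - (2 * m).+1%:R * sr t).
Let mu (t : T) := 2 / sr t.

Let oS t : open (S t). Proof. exact: box_open. Qed.

Let Bg0 : 0 <= Bg. Proof. by have [] := lips_ge0 (hg true true). Qed.
Let Lg0 : 0 <= Lg. Proof. by have [] := lips_ge0 (hg true true). Qed.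

Let okP (t : T) : stage_ok g (sth t) (sval t).2. Proof. exact: (svalP t). Qed.

Let sg0 t : 0 < ssg (t : T). Proof. by have [[]] := okP t. Qed.
Let sgth t : ssg (t : T) <= sth t. Proof. by have [[]] := okP t. Qed.
Let r0 t : 0 < sr (t : T). Proof. by have [[]] := okP t. Qed.
Let rth t : sr (t : T) <= sth t. Proof. by have [[]] := okP t. Qed.
Let th1 t : sth (t : T) <= 1. Proof. by have [[]] := okP t. Qed.
Let th0 t : 0 < sth (t : T). Proof. exact: lt_le_trans (sg0 t) (sgth t). Qed.
Let sg1 t : ssg (t : T) <= 1. Proof. exact: le_trans (sgth t) (th1 t). Qed.
Let kath t : 1 <= sth (t : T) * ska t. Proof. by have [_ []] := okP t. Qed.
Let ka1 t : 1 <= ska (t : T).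
Proof. by have h := kath t; have h1 := th0 t; have h2 := th1 t; nra. Qed.
Let K1 t : 1 <= sK (t : T). Proof. by have [_ []] := okP t. Qed.
Let dl0 t : 0 <= sdl (t : T). Proof. by have [_ []] := okP t. Qed.
Let dlth t : sdl (t : T) <= sth t * ssg t ^+ 2. Proof. by have [_ []] := okP t. Qed.
Let rho0 t : 0 <= rho t. Proof. by have [_ []] := okP t; rewrite /rho subr_ge0. Qed.
Let rhos t : rho t < ss t. Proof. by rewrite /rho ltrBlDr ltrDl. Qed.
Let mu0 t : 0 < mu t. Proof. by rewrite divr_gt0. Qed.
Let sg20 t : 0 < ssg (t : T) ^+ 2. Proof. by rewrite exprn_gt0. Qed.
Let sg2th t : ssg (t : T) ^+ 2 <= sth t.
Proof. by rewrite expr2; apply: le_trans (sgth t); rewrite ler_piMl // ltW. Qed.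
Let ud t i b z : box 0 (ss (t : T)) z -> derivable (fun w => su t w i) z (ebas b).
Proof. by have [_ _ [h _ _] _] := okP t; exact: h. Qed.
Let udd t i b b' z : box 0 (ss (t : T)) z -> derivable (fun w => dv b (su t) w i) z (ebas b').
Proof. by have [_ _ [_ h _] _] := okP t; exact: h. Qed.
Let uM t i b b' z : box 0 (ss (t : T)) z -> `|dd b' (fun w => dv b (su t) w i) z| <= sth t * ssg t / sr t.
Proof. by have [_ _ [_ _ h] _] := okP t; exact: h. Qed.
Let umet t a b z : box 0 (ss (t : T)) z -> `|g a b z - met (su t) a b z - ssg t ^+ 2 * H a b| <= sth t * ssg t ^+ 2.
Proof. by have [_ _ _ h] := okP t; exact: h. Qed.
Let M0 t : 0 <= sth (t : T) * ssg t / sr t.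
Proof. by rewrite divr_ge0 ?mulr_ge0 // ltW. Qed.

Let inb t z : `|z| <= rho t -> box 0 (ss t) z.
Proof. by move=> h; apply/box0P; exact: le_lt_trans h (rhos t). Qed.

Lemma dv_bound (t : T) b i (z : pt) : box 0 (ss t) z -> `|dv b (su t) z i| <= Bg + 1.
Proof.
move=> Sz; have h := umet b b Sz; have hB := (hg b b).1 z.
have h2 : dv b (su t) z i ^+ 2 <= met (su t) b b z.
  rewrite /met /dot3; have := sqr_ge0 (dv b (su t) z ax_x); have := sqr_ge0 (dv b (su t) z ax_y).
  by have := sqr_ge0 (dv b (su t) z ax_z); case: (i); rewrite !expr2; lra.
have h3 : met (su t) b b z <= Bg.
  move: h hB; rewrite !ler_norml /Hres eqxx mulr1 => /andP[h _] /andP[_ hB].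
  have : sth t * ssg t ^+ 2 <= ssg t ^+ 2 by rewrite ler_piMl // ltW.
  by move: h hB; lra.
have := sqr_ge0 (`|dv b (su t) z i| - 1); rewrite -real_normK ?num_real // in h2.
by move: h2 h3; move: `|dv b (su t) z i| (met _ _ _ _) => x y; rewrite !expr2 => *; nra.
Qed.

Let P t b i z := dv b (su t) (clamp (rho t) z) i.

Lemma P_lips (t : T) b i : lips (Bg + 1) (sth t * ssg t / sr t) (P t b i).
Proof.
apply: (clamp_lips (s := ss t) (f := fun w => dv b (su t) w i)) => //.
- by move=> b' z hz; exact: udd.
- by move=> b' z hz; exact: uM.
- by move=> z hz; apply: dv_bound; exact: inb.
Qed.

Let gc t a b z := g a b (clamp (rho t) z).

Lemma gc_lips (t : T) a b : lips Bg Lg (gc t a b).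
Proof.
have [h1 h2] := hg a b.
by apply: lips_clamp => // b' t' z _ _; exact: h2.
Qed.

Let ut t z i := smooth m m (sr t) (fun z => su t (clamp (rho t) z) i) z.
Let Sg t a b := smooth m m (sr t) (gc t a b).

Let Srho t z : S t z -> `|z| + (m + m)%:R * sr t < rho t.
Proof.
move=> /box0P; rewrite /rho (_ : (2 * m).+1%:R = (m + m)%:R + 1 :> R); last by rewrite -natr1 mul2n addnn.
by rewrite mulrDl mul1r; lra.
Qed.

Let Sbox t z : S t z -> box 0 (ss t) z.
Proof.
move=> /Srho h; apply: inb; apply: ltW; apply: le_lt_trans h.
by rewrite lerDl mulr_ge0 // ltW.
Qed.

Lemma ut_derive (t : T) i b (z : pt) : S t z -> is_derive z (ebas b) (fun w => ut t w i) (smooth m m (sr t) (P t b i) z).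
Proof.
move=> /Srho hz; apply: (clamp_smooth_derive (s := ss t) (f := fun w => su t w i) (L := Bg + 1)) => //.
- by rewrite addr_ge0.
- by move=> b' w hw; exact: ud.
- by move=> b' w hw; exact: dv_bound.
- exact: ltW.
- exact: P_lips.
Qed.

Lemma ut_dv (t : T) i b (z : pt) : S t z -> dv b (ut t) z i = smooth m m (sr t) (P t b i) z.
Proof. by move=> Sz; rewrite /dv (is_derive_dd (ut_derive i b Sz)). Qed.

Lemma ut_famOD k b : (k.+1 < m)%N -> famODv F S k (fun t => ssg t * mu t) mu (fun t => dv b (ut t)).
Proof.
move=> km i; have e t : {in S t, smooth m m (sr t) (P t b i) =1 (fun z => dv b (ut t) z i)}.
  by move=> z; rewrite inE => Sz; rewrite ut_dv.
split.
  exists (Bg + 1); first by rewrite addr_ge0.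
  apply: nearW => t; split; first exact: ltW.
  rewrite mulr1; apply: Bd_ext (@oS t) (e t) _; apply: (Bd_sub (S := setT)) => //.
  by apply: smooth_Bd_global (r0 t) (P_lips t b i) _ _; exact: ltnW.
move=> c; exists 1 => //; apply: nearW => t; split; first exact: ltW.
apply: (Bd_ext (@oS t) (f := dd c (smooth m m (sr t) (P t b i)))).
  by move=> z; rewrite inE => Sz; apply: dd_ext (@oS t) _ Sz; exact: e.
apply: (Bd_sub (S := setT)) => //.
have h := smooth_dd_Bd c (r0 t) (P_lips t b i) (ltnW km) (ltnW km).
apply: Bd_leC h; first exact: ltW (mu0 t).
rewrite mul1r /mu mulrA ler_pM2r ?invr_gt0 // mulrC ler_pM2l //.
by apply: le_trans (th1 t) _; rewrite ler1n.
Qed.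

(** The metric to be added in the stage. The target is the mollified metric [Sg], since many
    derivatives are needed and [g] is merely Lipschitz here; what is left over on purpose is the
    next defect [sdl * H]. *)
Let A t a b z := Sg t a b z - met (ut t) a b z - sdl t * H a b.

Lemma H_bound a b : 0 <= H a b <= 1.
Proof. by rewrite /Hres; case: eqP => _; rewrite ?ler01 ?lexx // invr_ge0 ler0n invf_le1 // ler1n. Qed.

(** The difference is the mollification of [g - met u - sg^2 H], which [stage_ok] bounds, plus
    commutators of products of first derivatives, minus the next defect. All three are of order
    [th * sg^2], at every order of differentiation. *)
Lemma A_famO k a b : (k <= m)%N -> famO F S k (fun t => sth t * ssg t ^+ 2) mu (fun t z => A t a b z - ssg t ^+ 2 * H a b).
Proof.
move=> km; pose M t := sth t * ssg t / sr t.
pose Q t z := 1 * gc t a b z + 1 * ((-1) * (P t a ax_x z * P t b ax_x z) + 1 * ((-1) * (P t a ax_y z * P t b ax_y z)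
   + 1 * ((-1) * (P t a ax_z z * P t b ax_z z) + 1 * (- (ssg t ^+ 2 * H a b))))).
have lP t i := lips_mul (P_lips t a i) (P_lips t b i).
have l4 t := lips_comb (-1) 1 (lP t ax_z) (lips_const (- (ssg t ^+ 2 * H a b))).
have l3 t := lips_comb (-1) 1 (lP t ax_y) (l4 t).
have l2 t := lips_comb (-1) 1 (lP t ax_x) (l3 t).
have l1 t := lips_comb 1 1 (gc_lips t a b) (l2 t).
have lQ t : exists L, lips (sth t * ssg t ^+ 2) L (Q t).
  have [_ h2] := l1 t; eexists; split; last exact: h2.
  move=> z; have := umet a b (inb (clamp_norm z (rho0 t))).
  rewrite /met /dot3 /Q /P /gc; congr (`|_| <= _); move: (dv _ _ _) (dv _ _ _) (g _ _ _) (H _ _) => *; ring.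
have hQ : famO F S k (fun t => sth t * ssg t ^+ 2) mu (fun t => smooth m m (sr t) (Q t)).
  exists 1 => //; apply: nearW => t; split; first exact: ltW.
  apply: (Bd_sub (S := setT)) => //; rewrite mul1r; have [L hL] := lQ t.
  exact: (smooth_Bd_global (r0 t) hL km km).
have hC i : famO F S k (fun t => sth t * ssg t ^+ 2) mu (fun t z => smooth m m (sr t) (fun w => P t a i w * P t b i w) z
     - smooth m m (sr t) (P t a i) z * smooth m m (sr t) (P t b i) z).
  exists ((1 + 2 ^+ k) * (2 * (1 + (m + m)%:R)) ^+ 2).
    by rewrite mulr_ge0 ?exprn_ge0 ?addr_ge0 ?exprn_ge0.
  apply: nearW => t; split; first exact: ltW.
  apply: (Bd_sub (S := setT)) => //.
  apply: Bd_leC (smooth_commutator (r0 t) km (P_lips t a i) (P_lips t b i)); first exact: ltW (mu0 t).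
  apply: ler_wpM2l; first by rewrite mulr_ge0 ?exprn_ge0 ?addr_ge0 ?exprn_ge0.
  (* The commutator is of order [M^2 r^2] with [M = th sg / r]; the square of the radius cancels
     exactly. *)
  have -> : sth t * ssg t / sr t * (sth t * ssg t / sr t) * sr t ^+ 2 = sth t * (sth t * ssg t ^+ 2).
    by field; rewrite gt_eqF.
  by rewrite ler_piMl // mulr_ge0 // ltW.
have hdl : famO F S k (fun t => sth t * ssg t ^+ 2) mu (fun t _ => - (sdl t * H a b)).
  apply: famO_le1 (famO_cst oS k (fun t => - (sdl t * H a b)) _); last by apply: nearW => t; exact: ltW.
  apply: nearW => t; have /andP[h1 h2] := H_bound a b.
  rewrite normrN ger0_norm ?mulr_ge0 //; apply: le_trans (dlth t); exact: ler_piMr.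
apply: (famO_ext oS _ (famO_add oS (famO_add oS hQ hdl) (famO_add oS (famO_add oS (hC ax_x) (hC ax_y)) (hC ax_z)))).
apply: nearW => t z; rewrite inE => Sz.
rewrite /A /met /dot3 !(ut_dv _ _ Sz) /Q.
rewrite (smooth_comb _ _ _ 1 1 (gc_lips t a b) (l2 t)) (smooth_comb _ _ _ (-1) 1 (lP t ax_x) (l3 t)).
rewrite (smooth_comb _ _ _ (-1) 1 (lP t ax_y) (l4 t)) (smooth_comb _ _ _ (-1) 1 (lP t ax_z) (lips_const _)) smooth_const.
rewrite /Sg; move: (smooth _ _ _ _ _) (smooth _ _ _ _ _) (smooth _ _ _ _ _) (smooth _ _ _ _ _) (smooth _ _ _ _ _)
  (smooth _ _ _ _ _) (smooth _ _ _ _ _) (smooth _ _ _ _ _) (smooth _ _ _ _ _) (smooth _ _ _ _ _) (H a b) => *.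
by ring.
Qed.

Lemma Sg_close (t : T) a b (z : pt) : S t z -> `|Sg t a b z - g a b z| <= 2 * Lg * (m + m)%:R * sr t.
Proof.
move=> /Srho hz; apply: (smooth_close (ltW (r0 t)) (gc_lips t a b)) => w wz.
have wr : `|w| <= rho t.
  by have : `|w| <= `|w - z| + `|z|; [rewrite -{1}(subrK z w) ler_normD|move: wz hz; lra].
rewrite /gc clamp_id //; apply: le_trans (lips_dist _ _ (hg a b)) _.
by rewrite -[leRHS]mulrA ler_wpM2l // mulr_ge0.
Qed.

Let thsmall e : 0 < e -> \forall t \near F, sth t <= e.
Proof. by move=> e0; exact: Fth_small. Qed.

(** The condition [a ==> b] enumerates the three independent entries of a symmetric matrix. *)
Definition metclose (v : T -> pt -> ax3 -> R) := forall a b, a ==> b ->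
  exists2 C : R, 0 <= C & \forall t \near F, forall z, S t z -> `|met (v t) a b z - g a b z| <= C * sth t.

(** The determinant of a metric close to [g] is close to that of [g]. This supplies the
    nondegeneracy hypothesis of each of the three steps with the same constant [c0 / 2]. *)
Lemma metclose_nsq v : metclose v -> \forall t \near F, forall z, S t z -> c0 / 2 <= nsq (v t) z.
Proof.
move=> hv; have [C1 C10 h1] := hv false false isT; have [C2 C20 h2] := hv true true isT.
have [C3 C30 h3] := hv false true isT; pose C := C1 + C2 + C3 + 1.
have C0 : 0 < C by rewrite /C; lra.
have e1 : 0 < C^-1 by rewrite invr_gt0.
have B0 : 0 < 4 * Bg + 2 by have := Bg0; lra.
have e2 : 0 < c0 / 2 / (C * (4 * Bg + 2)) by rewrite divr_gt0 // ?divr_gt0 // mulr_gt0.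
apply: filterS3 (nearI h1 h2) (nearI h3 (thsmall e1)) (thsmall e2) => t [k1 k2] [k3 t1] t2 z Sz.
have tt : 0 <= sth t by exact: ltW.
have le1 : C * sth t <= 1 by rewrite mulrC -ler_pdivlMr // mul1r.
have le2 : C * sth t * (4 * Bg + 2) <= c0 / 2.
  rewrite -mulrA mulrCA -ler_pdivlMr //; exact: mulr_gt0.
have up D : D <= C -> D * sth t <= C * sth t by move=> DC; rewrite ler_wpM2r.
have := det_close ((hg false false).1 z) ((hg true true).1 z) ((hg false true).1 z)
  (le_trans (k1 z Sz) (up _ _)) (le_trans (k2 z Sz) (up _ _)) (le_trans (k3 z Sz) (up _ _)) le1.
rewrite -nsqE => h; apply: le_trans (h _ _ _); last 3 first; try by rewrite /C; lra.
by have := gdet z; lra.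
Qed.

Lemma metclose_step v v' : metclose v ->
  (forall a b, a ==> b -> exists2 C : R, 0 <= C & \forall t \near F, forall z, S t z ->
     `|met (v' t) a b z - met (v t) a b z| <= C * ssg t ^+ 2) -> metclose v'.
Proof.
move=> hv h a b ab; have [C C0 h1] := hv a b ab; have [D D0 h2] := h a b ab.
exists (C + D); first exact: addr_ge0.
apply: filterS2 h1 h2 => t k1 k2 z Sz.
rewrite (_ : _ - g a b z = (met (v t) a b z - g a b z) + (met (v' t) a b z - met (v t) a b z)); last first.
  by rewrite [RHS]addrC subrKA.
apply: le_trans (ler_normD _ _) _; rewrite mulrDl; apply: lerD; first exact: k1.
apply: le_trans (k2 z Sz) _; apply: ler_wpM2l => //; exact: sg2th.
Qed.

Lemma metclose_ut : metclose ut.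
Proof.
move=> a b _; have [C C0 h] := famO_bound (A_famO a b (leq0n m)).
pose X := 2 * Lg * (m + m)%:R; have X0 : 0 <= X by rewrite !mulr_ge0.
exists (X + 1 + C + 1); first by rewrite !addr_ge0.
apply: filterS h => t h z Sz.
have h1 : `|Sg t a b z - g a b z| <= X * sr t := Sg_close a b Sz; have h2 := h z Sz; have /andP[H0 H1] := H_bound a b; move: (X) X0 h1 => {}X X0 h1.
have -> : met (ut t) a b z - g a b z = (Sg t a b z - g a b z) - sdl t * H a b
   - (A t a b z - ssg t ^+ 2 * H a b) - ssg t ^+ 2 * H a b by rewrite /A; ring.
apply: le_trans (ler_normB _ _) _; rewrite !mulrDl !mul1r; apply: lerD; last first.
  rewrite ger0_norm; last by rewrite mulr_ge0 // ltW.
  by apply: le_trans (sg2th t); rewrite ler_piMr // ltW.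
apply: le_trans (ler_normB _ _) _; apply: lerD; last first.
  apply: le_trans h2 _; rewrite mulrA -[leRHS]mulr1; apply: ler_wpM2l; first by rewrite mulr_ge0 // ltW.
  by apply: le_trans (sg2th t) (th1 t).
apply: le_trans (ler_normB _ _) _; apply: lerD.
  by apply: le_trans h1 _; exact: ler_wpM2l.
rewrite ger0_norm ?mulr_ge0 //; apply: (@le_trans _ _ (sdl t)); first by rewrite ler_piMr.
apply: le_trans (dlth t) _; rewrite -[leRHS]mulr1; apply: ler_wpM2l; first exact: ltW.
by apply: le_trans (sg2th t) (th1 t).
Qed.

Let la1 (t : T) := ska t * mu t.
Let la2 (t : T) := sK t * la1 t.
Let la3 (t : T) := sK t * la2 t.

Let la1_gt0 t : 0 < la1 t. Proof. by rewrite mulr_gt0 // (lt_le_trans ltr01). Qed.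
Let la2_gt0 t : 0 < la2 t. Proof. by rewrite mulr_gt0 // (lt_le_trans ltr01). Qed.
Let la3_gt0 t : 0 < la3 t. Proof. by rewrite mulr_gt0 // (lt_le_trans ltr01). Qed.
Let mula1 t : mu t <= la1 t. Proof. by rewrite ler_peMl // ltW. Qed.
Let la12 t : la1 t <= la2 t. Proof. by rewrite ler_peMl // ltW. Qed.
Let la23 t : la2 t <= la3 t. Proof. by rewrite ler_peMl // ltW. Qed.

Let par1 : \forall t \near F, [/\ 0 < ssg t, ssg t <= 1, 0 < mu t & mu t <= la1 t].
Proof. by apply: nearW => t; split. Qed.
Let par2 : \forall t \near F, [/\ 0 < ssg t, ssg t <= 1, 0 < la1 t & la1 t <= la2 t].
Proof. by apply: nearW => t; split. Qed.
Let par3 : \forall t \near F, [/\ 0 < ssg t, ssg t <= 1, 0 < la2 t & la2 t <= la3 t].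
Proof. by apply: nearW => t; split. Qed.

Let mula1E t : mu t / la1 t = (ska t)^-1.
Proof. by rewrite /la1 invfM mulrCA mulfV ?mulr1 // gt_eqF. Qed.
Let la12E t : la1 t / la2 t = (sK t)^-1.
Proof. by rewrite /la2 invfM mulrCA mulfV ?mulr1 // gt_eqF. Qed.
Let la23E t : la2 t / la3 t = (sK t)^-1.
Proof. by rewrite /la3 invfM mulrCA mulfV ?mulr1 // gt_eqF. Qed.
Let kaV t : (ska (t : T))^-1 <= sth t.
Proof. by rewrite -[leLHS]mul1r ler_pdivrMr // (lt_le_trans ltr01). Qed.
Let kaV0 t : 0 <= (ska (t : T))^-1.
Proof. by rewrite invr_ge0 (le_trans ler01). Qed.
Let KV01 t : 0 <= (sK (t : T))^-1 <= 1.
Proof. by rewrite invr_ge0 (le_trans ler01) //= invf_le1 // (lt_le_trans ltr01). Qed.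

Definition stage_error (t : T) := ssg t ^+ 2 * ((ska t)^-1 ^+ J + (sK t)^-1 + ssg t).

Lemma stage_error_le t x : x <= (ska t)^-1 ^+ J + (sK t)^-1 + ssg t -> ssg t ^+ 2 * x <= stage_error t.
Proof. by move=> h; rewrite /stage_error ler_wpM2l // ltW. Qed.

Let ut_derivable : \forall t \near F, forall i b z, S t z -> derivable (fun w => ut t w i) z (ebas b).
Proof. by apply: nearW => t i b z Sz; have [] := ut_derive i b Sz. Qed.

Let c02 : 0 < c0 / 2. Proof. by rewrite divr_gt0. Qed.

(** The (1,1)-step treats the entry [A t false true]; the diagonal defects it leaves then serve as
    squared amplitudes of two steps along the coordinate axes. The three terms of [stage_error] are
    the integration by parts error, the ratio [1 / K] of an ordinary step, and the cubic error. *)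
Lemma stage_exists : exists v : T -> pt -> ax3 -> R,
  [/\ \forall t \near F, forall i b z, S t z -> derivable (fun w => v t w i) z (ebas b),
      forall b, famODv F S 0 (fun t => ssg t * la3 t) la3 (fun t => dv b (v t)),
      forall b i, exists2 C : R, 0 <= C & \forall t \near F, forall z, S t z ->
         `|dv b (v t) z i - dv b (ut t) z i| <= C * ssg t,
      forall i, exists2 C : R, 0 <= C & \forall t \near F, forall z, S t z ->
         `|v t z i - ut t z i| <= C * sr t &
      forall a b, a ==> b -> exists2 C : R, 0 <= C & \forall t \near F, forall z, S t z ->
         `|met (v t) a b z - (Sg t a b z - sdl t * H a b)| <= C * stage_error t].
Proof.
have hp0 b := @ut_famOD (2 + J).+2 b.
have km : ((2 + J).+3 < m)%N by rewrite /m /stm; lia.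
have hA01 : famO F S ((2 + J).+2 + J).+1 (fun t => ssg t ^+ 2) mu (fun t => A t false true).
  have kA : (((2 + J).+2 + J).+1 <= m)%N by rewrite /m /stm; lia.
  apply: (famO_ext oS _ (famO_add oS (famO_le1 _ (A_famO false true kA))
     (famO_le1 _ (famO_cst oS _ (fun t => ssg t ^+ 2 * H false true) _)))).
  - by apply: nearW => t z _; rewrite subrK.
  - by apply: nearW => t; rewrite ler_piMl // ltW.
  - apply: nearW => t; have /andP[h1 h2] := H_bound false true.
    by rewrite ger0_norm; [rewrite ler_piMr // ltW|rewrite mulr_ge0 // ltW].
  - by apply: nearW => t; exact: ltW.
have hAlow a b : exists2 C : R, 0 <= C & \forall t \near F, forall z, S t z ->
    `|A t a b z - ssg t ^+ 2 * H a b| <= C * (sth t * ssg t ^+ 2).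
  exact: (famO_bound (A_famO a b (leq0n m))).
(* [Hres false true = 1 / 4]; half of it is sacrificed to the error of order [th * sg^2]. *)
have hA8 : \forall t \near F, forall z, S t z -> 8^-1 * ssg t ^+ 2 <= A t false true z.
  have [C C0 hC] := hAlow false true.
  have e0 : 0 < 8^-1 / (C + 1) by rewrite divr_gt0 ?invr_gt0 // ltr_wpDl.
  apply: filterS2 hC (thsmall e0) => t hC hth z Sz.
  have := hC z Sz; rewrite ler_norml => /andP[h _]; move: h; rewrite /Hres /=.
  have : (C + 1) * sth t <= 8^-1 by rewrite mulrC -ler_pdivlMr // ltr_wpDl.
  have s2 := sg20 t; have tt := th0 t; move: (ssg t ^+ 2) s2 => x x0 h1 h2.
  have : C * sth t * x <= 8^-1 * x by rewrite ler_wpM2r ?(ltW x0) //; lra.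
  by move: h2; rewrite mulrA; lra.
have hka : forall e : R, 0 < e -> \forall t \near F, mu t / la1 t <= e.
  by move=> e e0; apply: filterS (thsmall e0) => t h; rewrite mula1E; exact: le_trans (kaV t) h.
have e8 : 0 < (8^-1 : R) by rewrite invr_gt0.
have [u1 [[u1d u1O u1dv u1s] u1off u1diag u1up]] :=
  offdiag_exists oS par1 hka ut_derivable (fun b => hp0 b km) c02 (metclose_nsq metclose_ut) e8 hA8 hA01.
have close1 : metclose u1.
  apply: metclose_step metclose_ut _ => a b ab.
  have [eab|[-> ->]] : a = b \/ (a = false /\ b = true) by case: (a) (b) ab => -[]; auto.
    by rewrite -eab; exact: (famO_bound (u1diag a)).
  have q : famO F S 0 (fun t => ssg t ^+ 2) la1 (fun t z => met (u1 t) false true z - met (ut t) false true z).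
    apply: (famO_ext oS _ (famO_add oS (famO_le (c := 2) _ _ (famO_lek (leq0n _) u1off))
      (famO_freq _ (famO_lek (leq0n _) hA01)))).
    + by apply: nearW => t z _; rewrite subrK.
    + by [].
    + apply: nearW => t; rewrite mulr_natl mulr2n; apply: lerD.
        by rewrite exprS ler_piMl // ltW.
      rewrite mula1E; apply: ler_piMr; first exact: ltW.
      by apply: exprn_ile1; [exact: kaV0|exact: le_trans (kaV t) (th1 t)].
    + exact: nearW.
  exact: (famO_bound q).
(* The diagonal defect remaining after the off-diagonal step. *)
pose D b t z := A t b b z - (met (u1 t) b b z - met (ut t) b b z).
have hD b : famO F S 3 (fun t => ssg t ^+ 2) la1 (D b).
  rewrite /D; apply: (famO_sub oS _ (u1diag b)).
  have kA : (3 <= m)%N by rewrite /m /stm; lia.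
  apply: (famO_ext oS _ (famO_add oS (famO_freq _ (famO_le1 _ (A_famO b b kA)))
     (famO_le1 _ (famO_cst oS _ (fun t => ssg t ^+ 2 * H b b) _)))).
  - by apply: nearW => t z _; rewrite subrK.
  - exact: nearW.
  - by apply: nearW => t; rewrite ler_piMl // ltW.
  - apply: nearW => t; have /andP[h1 h2] := H_bound b b.
    by rewrite ger0_norm; [rewrite ler_piMr // ltW|rewrite mulr_ge0 // ltW].
  - by apply: nearW => t; exact: ltW.
(* [A t b b] is about [sg^2], and the first step added at most about [2 A t false true], that is
   [sg^2 / 2]. A quarter of [sg^2] therefore survives the small errors. *)
have hD4 b : \forall t \near F, forall z, S t z -> 4^-1 * ssg t ^+ 2 <= D b t z.
  have [C C0 hC] := hAlow b b; have [C1 C10 hC1] := hAlow false true; have [C2 C20 hC2] := u1up b.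
  pose Q := C + 2 * C1 + 2 * C2 + 1; have Q0 : 0 < Q by rewrite /Q; lra.
  have e0 : 0 < 4^-1 / Q by rewrite divr_gt0 ?invr_gt0.
  apply: filterS3 (nearI hC hC1) hC2 (thsmall e0) => t [k1 k2] k3 hth z Sz.
  have := k1 z Sz; have := k2 z Sz; have := k3 z Sz; rewrite !ler_norml /D /Hres eqxx /=.
  have : Q * sth t <= 4^-1 by rewrite mulrC -ler_pdivlMr.
  have : ssg t + mu t / la1 t <= 2 * sth t by rewrite mula1E; have := kaV t; have := sgth t; lra.
  have s2 := sg20 t; have tt := th0 t.
  move: (met _ _ _ _) (met _ _ _ _) (A t b b z) (A t false true z) (ssg t + _) => m1 m0 a1 a2 w hw hQ k3' /andP[_ k2'] /andP[k1' _].
  have : C2 * (ssg t ^+ 2 * w) <= C2 * (ssg t ^+ 2 * (2 * sth t)) by rewrite ler_wpM2l // ler_wpM2l // ltW.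
  move: k1' k2' k3'; move: (ssg t ^+ 2) s2 => x x0 k1' k2' k3' k4.
  have : Q * sth t * x <= 4^-1 * x by rewrite ler_wpM2r // ltW.
  have : 0 <= sth t * x by rewrite mulr_ge0 // ltW.
  by rewrite /Q; lra.
pose a b t z := Num.sqrt (D b t z).
have e4 : 0 < (4^-1 : R) by rewrite invr_gt0.
have ha b : famO F S 3 (fun t => ssg t) la1 (a b).
  exact: (famO_sqrt_scaled oS par2 e4 (hD4 b) (hD b)).
have ha2 b : \forall t \near F, forall z, S t z -> a b t z ^+ 2 = D b t z.
  apply: filterS (hD4 b) => t h z Sz; rewrite sqr_sqrtr //; apply: le_trans (h z Sz).
  by rewrite mulr_ge0 ?ltW.
pose x b (t : T) (c : bool) : R := (c == b)%:R.
have hx b : \forall t \near F, forall c, `|x b t c| <= 1.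
  by apply: nearW => t c; rewrite /x; case: eqP => _; rewrite ?normr1 ?normr0.
have [u2 [u2d u2O u2dv u2s u2met]] := prim_exists oS par2 u1d u1O c02 (metclose_nsq close1) (lexx 1) (hx false) (ha false).
have err la la' (h : forall t, la t / la' t = (sK t)^-1) : \forall t \near F,
    ssg t ^+ 2 * la t / la' t + ssg t ^+ 3 <= stage_error t.
  apply: nearW => t; rewrite -mulrA h (exprSr _ 2) -mulrDr; apply: stage_error_le.
  by rewrite -addrA lerDr exprn_ge0.
have u2met' b c : famO F S 0 stage_error la2 (fun t z => met (u2 t) b c z - met (u1 t) b c z - a false t z ^+ 2 * (x false t b * x false t c)).
  exact: (famO_le1 (err _ _ la12E) (famO_lek (leq0n _) (u2met b c))).
have err2 : \forall t \near F, stage_error t <= 3 * ssg t ^+ 2.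
  apply: nearW => t; rewrite /stage_error mulrC ler_wpM2r ?(ltW (sg20 t)) //.
  have /andP[_ h1] := KV01 t; have h2 := sg1 t.
  have : (ska t)^-1 ^+ J <= 1 by apply: exprn_ile1; [exact: kaV0|exact: le_trans (kaV t) (th1 t)].
  by lra.
have bndsq b c d : exists2 C : R, 0 <= C & \forall t \near F, forall z, S t z ->
    `|a d t z ^+ 2 * (x d t b * x d t c)| <= C * ssg t ^+ 2.
  have [C C0 hC] := famO_bound (hD d).
  exists C => //; apply: filterS2 hC (ha2 d) => t h1 h2 z Sz; rewrite h2 // normrM.
  apply: le_trans (h1 z Sz); rewrite ler_piMr // /x; case: eqP => _; case: eqP => _;
  by rewrite ?mulr1 ?mulr0 ?mul0r ?normr1 ?normr0.
have close2 : metclose u2.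
  apply: metclose_step close1 _ => b c _.
  have [C C0 hC] := famO_bound (u2met' b c); have [C' C'0 hC'] := bndsq b c false.
  exists (C * 3 + C'); first by rewrite addr_ge0 // mulr_ge0.
  apply: filterS3 hC hC' err2 => t h1 h2 h3 z Sz.
  rewrite -(subrK (a false t z ^+ 2 * (x false t b * x false t c)) (_ - _)).
  apply: le_trans (ler_normD _ _) _; rewrite mulrDl; apply: lerD; last exact: h2.
  by apply: le_trans (h1 z Sz) _; rewrite -mulrA ler_wpM2l.
have ha' : famO F S 2 (fun t => ssg t) la2 (a true).
  by apply: famO_freq (famO_lek (leqnSn 2) (ha true)); exact: nearW.
have [u3 [u3d u3O u3dv u3s u3met]] := prim_exists oS par3 u2d u2O c02 (metclose_nsq close2) (lexx 1) (hx true) ha'.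
have u3met' b c : famO F S 0 stage_error la3 (fun t z => met (u3 t) b c z - met (u2 t) b c z - a true t z ^+ 2 * (x true t b * x true t c)).
  exact: (famO_le1 (err _ _ la23E) (famO_lek (leq0n _) (u3met b c))).
exists u3; split => //.
- move=> b i; have [C1 C10 h1] := famO_bound (u1dv b i); have [C2 C20 h2] := famO_bound (u2dv b i).
  have [C3 C30 h3] := famO_bound (u3dv b i).
  exists (C1 + C2 + C3); first by rewrite !addr_ge0.
  apply: filterS3 h1 h2 h3 => t h1 h2 h3 z Sz; have := h1 z Sz; have := h2 z Sz; have := h3 z Sz.
  have -> : dv b (u3 t) z i - dv b (ut t) z i = (dv b (u3 t) z i - dv b (u2 t) z i)
    + (dv b (u2 t) z i - dv b (u1 t) z i) + (dv b (u1 t) z i - dv b (ut t) z i) by ring.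
  move=> k3 k2 k1; apply: le_trans (ler_normD _ _) _; apply: le_trans (lerD (ler_normD _ _) (lexx _)) _.
  by rewrite !mulrDl; lra.
- move=> i; have [C1 C10 h1] := famO_bound (u1s i); have [C2 C20 h2] := famO_bound (u2s i).
  have [C3 C30 h3] := famO_bound (u3s i).
  have sl t l : mu t <= l -> ssg t / l <= sr t.
    move=> ml; have l0 := lt_le_trans (mu0 t) ml.
    rewrite ler_pdivrMr //; apply: le_trans (sg1 t) _; apply: (@le_trans _ _ (sr t * mu t)); last by rewrite ler_wpM2l // ltW.
    by rewrite /mu mulrCA mulfV ?mulr1 ?ler1n // gt_eqF.
  exists (C1 + C2 + C3); first by rewrite !addr_ge0.
  apply: filterS3 h1 h2 h3 => t h1 h2 h3 z Sz; have := h1 z Sz; have := h2 z Sz; have := h3 z Sz.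
  have -> : u3 t z i - ut t z i = (u3 t z i - u2 t z i) + (u2 t z i - u1 t z i) + (u1 t z i - ut t z i) by ring.
  have s1 := ler_wpM2l C10 (sl _ _ (mula1 t)); have s2 := ler_wpM2l C20 (sl _ _ (le_trans (mula1 t) (la12 t))).
  have s3 := ler_wpM2l C30 (sl _ _ (le_trans (mula1 t) (le_trans (la12 t) (la23 t)))).
  move=> k3 k2 k1; apply: le_trans (ler_normD _ _) _; apply: le_trans (lerD (ler_normD _ _) (lexx _)) _.
  by rewrite !mulrDl; lra.
- move=> b c bc.
  (* Adding the two primitive metrics to [met u1]: on the diagonal the target is hit exactly by the
     definition of [D], while off the diagonal both contributions vanish, a coordinate direction
     having a zero component, and the error of the first step remains. *)
  have main b' c' : b' ==> c' -> exists2 C : R, 0 <= C & \forall t \near F, forall z, S t z ->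
      `|met (u1 t) b' c' z + a false t z ^+ 2 * (x false t b' * x false t c') + a true t z ^+ 2 * (x true t b' * x true t c')
        - (Sg t b' c' z - sdl t * H b' c')| <= C * stage_error t.
    move=> bc'; have [ebc|[-> ->]] : b' = c' \/ (b' = false /\ c' = true) by case: (b') (c') bc' => -[]; auto.
      exists 0 => //; apply: filterS (nearI (ha2 false) (ha2 true)) => t [h1 h2] z Sz.
      rewrite mul0r -ebc normr_le0; apply/eqP; case: (b').
        have alg (m1 m0 q w aF aT xF xT : R) : xF = 0 -> xT = 1 -> aT = q - m0 - w - (m1 - m0) ->
          m1 + aF * (xF * xF) + aT * (xT * xT) - (q - w) = 0 by move=> -> -> ->; ring.
        exact: (alg _ _ _ _ _ _ _ _ erefl erefl (h2 z Sz)).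
      have alg (m1 m0 q w aF aT xF xT : R) : xF = 1 -> xT = 0 -> aF = q - m0 - w - (m1 - m0) ->
        m1 + aF * (xF * xF) + aT * (xT * xT) - (q - w) = 0 by move=> -> -> ->; ring.
      exact: (alg _ _ _ _ _ _ _ _ erefl erefl (h1 z Sz)).
    have [C C0 hC] := famO_bound u1off; exists C => //; apply: filterS hC => t hC z Sz.
    have xx c'' : x c'' t false * x c'' t true = 0 by rewrite /x; case: c''; rewrite ?mulr0 ?mul0r.
    have alg (m1 m0 q w aF aT xF xT B : R) : xF = 0 -> xT = 0 -> `|m1 - m0 - (q - m0 - w)| <= B ->
      `|m1 + aF * xF + aT * xT - (q - w)| <= B.
      by move=> -> ->; rewrite !mulr0 !addr0; congr (`|_| <= _); ring.
    apply: le_trans (alg _ _ _ _ _ _ _ _ _ (xx false) (xx true) (hC z Sz)) _.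
    rewrite ler_wpM2l // mula1E exprS mulrC -mulrDr; apply: stage_error_le.
    by have /andP[h _] := KV01 t; lra.
  have [C1 C10 h1] := famO_bound (u2met' b c); have [C2 C20 h2] := famO_bound (u3met' b c).
  have [C3 C30 h3] : exists2 C : R, 0 <= C & \forall t \near F, forall z, S t z ->
      `|met (u1 t) b c z + a false t z ^+ 2 * (x false t b * x false t c) + a true t z ^+ 2 * (x true t b * x true t c)
        - (Sg t b c z - sdl t * H b c)| <= C * stage_error t.
    exact: main.
  exists (C1 + C2 + C3); first by rewrite !addr_ge0.
  apply: filterS3 h1 h2 h3 => t h1 h2 h3 z Sz.
  have alg (m3 m2 m1 a1 a2 q e : R) : `|m2 - m1 - a1| <= C1 * e -> `|m3 - m2 - a2| <= C2 * e ->
    `|m1 + a1 + a2 - q| <= C3 * e -> `|m3 - q| <= (C1 + C2 + C3) * e.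
    move=> k1 k2 k3; have -> : m3 - q = (m2 - m1 - a1) + (m3 - m2 - a2) + (m1 + a1 + a2 - q) by ring.
    rewrite !mulrDl; apply: le_trans (ler_normD _ _) _; apply: lerD => //.
    by apply: le_trans (ler_normD _ _) _; apply: lerD.
  exact: (alg _ _ _ _ _ _ _ (h1 z Sz) (h2 z Sz) (h3 z Sz)).
Qed.

Hypothesis gsym : forall z, g true false z = g false true z.

(** Reads the family statement back as one with explicit constants: [C] and [eps] come from finitely
    many applications of the filter and are the same for every configuration. Passing from mollified
    data to [cu] and [g] adds the terms in [cr]. *)
Lemma stage_step : exists C eps : R, [/\ 1 <= C, 0 < eps, eps <= 1 & forall c, stage_ok g eps c ->
  exists v : pt -> ax3 -> R, forall z, box 0 (cs c - (2 * m).+1%:R * cr c) z ->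
  [/\ forall i b, derivable (fun w => v w i) z (ebas b),
      forall i b b', derivable (fun w => dv b v w i) z (ebas b') /\
        `|dd b' (fun w => dv b v w i) z| <= C * (csg c * (cK c ^+ 2 * cka c) / cr c),
      forall i b, `|dv b v z i - dv b (cu c) z i| <= C * csg c,
      forall i, `|v z i - cu c z i| <= C * cr c &
      forall a b, `|g a b z - met v a b z - cdl c * H a b| <=
        C * (csg c ^+ 2 * ((cka c)^-1 ^+ J + (cK c)^-1 + csg c) + cr c)]].
Proof.
have [v [vd vO vdv vs vmet]] := stage_exists.
have e1 t : 0 <= ssg (t : T) * la3 t by rewrite mulr_ge0 // ltW.
have [C1 C10 h1] : exists2 C : R, 0 <= C & \forall t \near F, forall z, S t z -> forall (x : bool * bool) i,
    `|dd x.2 (fun w => dv x.1 (v t) w i) z| <= C * (ssg t * la3 t).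
  by apply: near_bound_ax => // x i; exact: (famO_bound ((vO x.1 i).2 x.2)).
have h1d : \forall t \near F, forall b i b' z, S t z -> derivable (fun w => dv b (v t) w i) z (ebas b').
  apply: near_bool => b; apply: near_ax3 => i; apply: near_bool => b'.
  by apply: filterS (famO_derivable b' (vO b i).1) => t h z Sz; case: (h z Sz).
have [C2 C20 h2] : exists2 C : R, 0 <= C & \forall t \near F, forall z, S t z -> forall b i,
    `|dv b (v t) z i - dv b (ut t) z i| <= C * ssg t.
  by apply: near_bound_ax => // t; exact: ltW.
have [C3 C30 h3] : exists2 C : R, 0 <= C & \forall t \near F, forall z, S t z -> forall (x : bool) i,
    `|v t z i - ut t z i| <= C * sr t.
  by apply: near_bound_ax => // t; exact: ltW.
have se0 t : 0 <= stage_error t.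
  rewrite /stage_error mulr_ge0 ?addr_ge0 ?exprn_ge0 //; try exact: ltW.
  by have /andP[] := KV01 t.
have [C4 C40 h4] : exists2 C : R, 0 <= C & \forall t \near F, forall z, S t z -> forall (x : bool * bool),
    (if x.1 ==> x.2 then `|met (v t) x.1 x.2 z - (Sg t x.1 x.2 z - sdl t * H x.1 x.2)| else 0) <= C * stage_error t.
  apply: near_bound_fin => // -[a b]; case ab : (a ==> b); first exact: vmet.
  by exists 0 => //; apply: nearW => t z _; rewrite mul0r.
have [e e0 he] := near_Fth (nearI (nearI vd h1d) (nearI (nearI h1 h2) (nearI h3 h4))).
pose X := 2 * Lg * (m + m)%:R; have X0 : 0 <= X by rewrite !mulr_ge0.
pose Y := 2 * (m + m)%:R : R; have Y0 : 0 <= Y by rewrite mulr_ge0.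
pose C := 2 * C1 + (C2 + Y) + (C3 + 2 * (Bg + 1) * (m + m)%:R) + (C4 + X) + 1.
have Z0 : 0 <= 2 * (Bg + 1) * (m + m)%:R by rewrite !mulr_ge0 // addr_ge0.
exists C, (Num.min e 1); split.
- by rewrite /C; lra.
- by rewrite lt_min e0 ltr01.
- by rewrite ge_min lexx orbT.
(* The given configuration, paired with its smallness parameter, is itself a point of the index
   type. *)
move=> c hc; pose t : T := exist _ (Num.min e 1, c) hc.
have [|[k1 k2] [[k3 k4] [k5 k6]]] := he t; first by rewrite /sth /= ge_min lexx.
exists (v t) => z Sz; have Szt : S t z by [].
split.
- by move=> i b; exact: k1.
- move=> i b b'; split; first exact: k2.
  apply: le_trans (k3 z Szt (b, b') i) _; rewrite /la3 /la2 /la1 /mu.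
  have -> : ssg t * (sK t * (sK t * (ska t * (2 / sr t)))) = 2 * (csg c * (cK c ^+ 2 * cka c) / cr c).
    by rewrite /ssg /sK /ska /sr /=; field; have := r0 t; rewrite /sr /= => /gt_eqF ->.
  rewrite mulrA; apply: ler_wpM2r; last by rewrite /C; lra.
  rewrite divr_ge0 //; last exact: ltW (r0 t).
  apply: mulr_ge0; first exact: ltW (sg0 t).
  apply: mulr_ge0; first exact: sqr_ge0.
  exact: le_trans ler01 (ka1 t).
- move=> i b; apply: (@le_trans _ _ ((C2 + Y) * csg c)); last first.
    by apply: ler_wpM2r; [exact: ltW (sg0 t)|rewrite /C; lra].
  rewrite -(subrKA (dv b (ut t) z i)); apply: le_trans (ler_normD _ _) _; rewrite mulrDl.
  apply: lerD; first exact: (k4 z Szt b i).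
  rewrite (ut_dv i b Szt).
  have zr : `|z| <= rho t by apply: ltW; apply: le_lt_trans (Srho Szt); rewrite lerDl mulr_ge0 // ltW.
  have eP : P t b i z = dv b (cu c) z i by rewrite /P clamp_id.
  rewrite -eP; apply: (smooth_close (ltW (r0 t)) (P_lips t b i)) => w wz.
  apply: le_trans (lips_dist _ _ (P_lips t b i)) _.
  apply: (@le_trans _ _ (2 * (sth t * ssg t / sr t) * ((m + m)%:R * sr t))).
    by rewrite ler_wpM2l // mulr_ge0.
  have -> : 2 * (sth t * ssg t / sr t) * ((m + m)%:R * sr t) = sth t * (Y * ssg t).
    by rewrite /Y; field; rewrite gt_eqF.
  by rewrite ler_piMl // mulr_ge0 // ltW.
- move=> i; apply: (@le_trans _ _ ((C3 + 2 * (Bg + 1) * (m + m)%:R) * cr c)); last first.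
    by apply: ler_wpM2r; [exact: ltW (r0 t)|rewrite /C; lra].
  rewrite -(subrKA (ut t z i)); apply: le_trans (ler_normD _ _) _; rewrite mulrDl.
  apply: lerD; first exact: (k5 z Szt true i).
  have zr : `|z| <= rho t by apply: ltW; apply: le_lt_trans (Srho Szt); rewrite lerDl mulr_ge0 // ltW.
  have [|B hB] := @clamp_lips_exists R (ss t) (rho t) (Bg + 1) (fun w => su t w i) (rho0 t) (rhos t) _ (fun b w => @ud t i b w) (fun b w => @dv_bound t b i w).
    by rewrite addr_ge0.
  have eU : su t (clamp (rho t) z) i = cu c z i by rewrite clamp_id.
  rewrite -eU; apply: (smooth_close (ltW (r0 t)) hB) => w wz.
  apply: le_trans (lips_dist _ _ hB) _.
  by rewrite -[leRHS]mulrA ler_wpM2l // mulr_ge0 // addr_ge0.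
- have main a b : a ==> b -> `|g a b z - met (v t) a b z - cdl c * H a b| <=
        C * (csg c ^+ 2 * ((cka c)^-1 ^+ J + (cK c)^-1 + csg c) + cr c).
    move=> ab; have := k6 z Szt (a, b); rewrite ab /= => k.
    have alg (x y q w : R) : x - y - w = - (y - (q - w)) - (q - x) by ring.
    rewrite (alg _ _ (Sg t a b z)); apply: le_trans (ler_normB _ _) _; rewrite normrN.
    have k' := Sg_close a b Szt.
    apply: (@le_trans _ _ (C4 * stage_error t + X * sr t)); first exact: lerD.
    rewrite mulrDr; apply: lerD; apply: ler_wpM2r => //; try (by rewrite /C; lra).
    exact: ltW (r0 t).
  move=> a b; case: a; case: b; try exact: main.
  by rewrite gsym metC; exact: main.
Qed.

End Stage.

(** * Iteration and passage to the limit *)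

Section GeometricLimits.
Context {R : realType}.
Local Notation pt := 'rV[R]_2.

Lemma geometric_tail (x : nat -> R) A l n k : 0 <= A -> 0 <= l -> l < 1 ->
  (forall n, `|x n.+1 - x n| <= A * l ^+ n) -> `|x (n + k)%N - x n| <= A * l ^+ n / (1 - l).
Proof.
move=> A0 l0 l1 h; have d0 : 0 < 1 - l by rewrite subr_gt0.
have B0 : 0 <= A * l ^+ n by rewrite mulr_ge0 // exprn_ge0.
suff : `|x (n + k)%N - x n| <= A * l ^+ n / (1 - l) * (1 - l ^+ k).
  move=> h1; apply: le_trans h1 _; apply: ler_piMr; last by rewrite gerBl exprn_ge0.
  by rewrite divr_ge0 // ltW.
elim: k => [|k IH]; first by rewrite addn0 subrr normr0 expr0 subrr mulr0.
rewrite addnS -(subrKA (x (n + k)%N)); apply: le_trans (ler_normD _ _) _.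
apply: le_trans (lerD (h _) IH) _; rewrite exprD exprS.
by rewrite le_eqVlt; apply/orP; left; apply/eqP; field; rewrite gt_eqF.
Qed.

Lemma geometric_cvg (x : nat -> R) A l : 0 <= A -> 0 <= l -> l < 1 ->
  (forall n, `|x n.+1 - x n| <= A * l ^+ n) -> x @ \oo --> lim (x @ \oo).
Proof.
move=> A0 l0 l1 h; apply/cvg_ex.
have c : cvgn (series (telescope x)).
  apply: normed_cvg; apply: (series_le_cvg (v_ := geometric A l)).
  - by move=> n; exact: normr_ge0.
  - by move=> n; apply: mulr_ge0 => //; exact: exprn_ge0.
  - by move=> n; exact: h.
  - by apply: is_cvg_geometric_series; rewrite ger0_norm.
have -> : x = (fun n => x 0%N + series (telescope x) n).
  by apply/funext => n; rewrite -eq_sum_telescope.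
by exists (x 0%N + lim (series (telescope x) @ \oo)); apply: cvgD => //; exact: cvg_cst.
Qed.

Lemma geometric_lim_dist (x : nat -> R) A l n : 0 <= A -> 0 <= l -> l < 1 ->
  (forall n, `|x n.+1 - x n| <= A * l ^+ n) -> `|lim (x @ \oo) - x n| <= A * l ^+ n / (1 - l).
Proof.
move=> A0 l0 l1 h; have c := geometric_cvg A0 l0 l1 h.
have h1 : (fun k => `|x k - x n|) @ \oo --> `|lim (x @ \oo) - x n|.
  exact: (cvg_norm (cvgB c (cvg_cst (x n)))).
apply: (ler_cvg_to h1 (cvg_cst (A * l ^+ n / (1 - l)))).
by exists n => // k /= nk; rewrite -(subnKC nk); exact: geometric_tail.
Qed.

(** [x] is the product of its powers [1 - al] and [al], and each factor uses one of the two
    bounds. *)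
Lemma powR_interpolate (x a b al : R) : 0 <= x -> x <= a -> x <= b -> 0 <= al -> al <= 1 ->
  x <= a `^ (1 - al) * b `^ al.
Proof.
move=> x0 xa xb al0 al1; have [->|xn] := eqVneq x 0; first by rewrite mulr_ge0 // powR_ge0.
have {1}-> : x = x `^ (1 - al) * x `^ al.
  by rewrite -powRD ?subrK ?powRr1 // xn implybT.
apply: ler_pM; rewrite ?powR_ge0 //; apply: ge0_ler_powR; rewrite ?subr_ge0 ?nnegrE //.
  exact: le_trans x0 xa.
exact: le_trans x0 xb.
Qed.

Lemma is_derive_holder (f : pt -> R) z (v : pt) (d Q al e : R) : 0 < e -> 0 < al -> 0 <= Q ->
  (forall t, `|t| < e -> `|f (t *: v + z) - f z - t * d| <= `|t| * (Q * `|t| `^ al)) -> is_derive z v f d.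
Proof.
move=> e0 al0 Q0 h.
suff c : (fun t : R => t^-1 *: (f (t *: v + z) - f z)) t @[t --> 0^'] --> d.
  by split; [apply/cvg_ex; exists d|exact: cvg_lim c].
apply/cvgrPdist_le => /= eps eps0.
have E0 : 0 < eps / (Q + 1) by rewrite divr_gt0 // ltr_wpDl.
near=> t.
have t0 : t != 0 by near: t; exact: nbhs_dnbhs_neq.
have te : `|t| < e by near: t; apply: dnbhs0_lt.
have tl : `|t| <= (eps / (Q + 1)) `^ al^-1.
  by near: t; apply: dnbhs0_le; rewrite powR_gt0.
have tl2 : `|t| `^ al <= eps / (Q + 1).
  apply: le_trans (ge0_ler_powR (ltW al0) _ _ tl) _; rewrite ?nnegrE ?powR_ge0 //.
  by rewrite -powRrM mulVf ?gt_eqF // powRr1 // ltW.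
have -> : d - t^-1 *: (f (t *: v + z) - f z) = - t^-1 * (f (t *: v + z) - f z - t * d).
  by rewrite /GRing.scale /=; field.
rewrite normrM normrN normfV mulrC ler_pdivrMr ?normr_gt0 //.
apply: le_trans (h t te) _; rewrite mulrC ler_wpM2r //.
apply: (@le_trans _ _ ((Q + 1) * (eps / (Q + 1)))); last by rewrite mulrCA mulfV ?mulr1 // gt_eqF // ltr_wpDl.
by apply: ler_pM; rewrite ?powR_ge0 // lerDl.
Unshelve. all: by end_near. Qed.

Lemma box_lipschitz (f : pt -> R) s M w z : 0 <= M ->
  (forall b z, box 0 s z -> derivable f z (ebas b)) -> (forall b z, box 0 s z -> `|dd b f z| <= M) ->
  box 0 s w -> box 0 s z -> `|f w - f z| <= 2 * M * `|w - z|.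
Proof.
move=> M0 fd fM /box0P ws /box0P zs; pose rho := Num.max `|w| `|z|.
have rs : rho < s by rewrite gt_max ws.
have r0 : 0 <= rho by rewrite le_max normr_ge0.
have [B hB] := clamp_lips_exists r0 rs M0 fd fM.
have := lips_dist w z hB; rewrite !clamp_id //.
  by rewrite le_max lexx orbT.
by rewrite le_max lexx.
Qed.

End GeometricLimits.

(** * Iterating the stage *)

Section Iteration.
Context {R : realType}.
Local Notation pt := 'rV[R]_2.
Variables (g : bool -> bool -> pt -> R) (J : nat) (C eps : R).
Hypotheses (C1 : 1 <= C) (eps0 : 0 < eps) (eps1 : eps <= 1).

Definition stage_goal (c : @cfg R) (v : pt -> ax3 -> R) : Prop :=
  forall z, box 0 (cs c - (2 * stm J).+1%:R * cr c) z ->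
  [/\ forall i b, derivable (fun w => v w i) z (ebas b),
      forall i b b', derivable (fun w => dv b v w i) z (ebas b') /\
        `|dd b' (fun w => dv b v w i) z| <= C * (csg c * (cK c ^+ 2 * cka c) / cr c),
      forall i b, `|dv b v z i - dv b (cu c) z i| <= C * csg c,
      forall i, `|v z i - cu c z i| <= C * cr c &
      forall a b, `|g a b z - met v a b z - cdl c * Hres a b| <=
        C * (csg c ^+ 2 * ((cka c)^-1 ^+ J + (cK c)^-1 + csg c) + cr c)].

Hypothesis Hst : forall c, stage_ok g eps c -> exists v, stage_goal c v.

Variables (ka K om Ga s0 s1 sg0 M0 : R).
Hypotheses (ka1 : 1 <= eps * ka) (KE : K = ka ^+ J) (K1 : 1 <= K) (om0 : 0 < om) (om2 : om <= 1 / 2)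
  (omE : om ^+ 2 * (eps * K) = 4 * C) (ome : om ^+ 2 <= eps) (Ga1 : 1 <= Ga) (omGa : 1 <= om * Ga)
  (GaE : Ga * eps = C * (K ^+ 2 * ka)).
Hypotheses (s10 : 0 <= s1) (s01 : s1 < s0) (sg00 : 0 < sg0) (sge : sg0 <= eps) (sgK : sg0 * K <= 1)
  (MK : K <= M0 * sg0) (M0r : (2 * stm J).+1%:R * (eps * sg0 / M0) <= (s0 - s1) / 2).

(** Stage [n] has defect amplitude [sgq n] and second derivatives at most [Mq n]. The radius [rq n]
    solves [Mq n = eps * sgq n / rq n], the bound asked by [stage_ok], and the boxes shrink
    geometrically towards half-width [s1]. *)
Let sgq n := sg0 * om ^+ n.
Let Mq n := M0 * Ga ^+ n.
Let rq n := eps * sgq n / Mq n.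
Let sq n := s1 + (s0 - s1) / 2 ^+ n.

Definition iter_inv (n : nat) (u : pt -> ax3 -> R) : Prop := forall z, box 0 (sq n) z ->
  [/\ forall i b, derivable (fun w => u w i) z (ebas b),
      forall i b b', derivable (fun w => dv b u w i) z (ebas b'),
      forall i b b', `|dd b' (fun w => dv b u w i) z| <= Mq n &
      forall a b, `|g a b z - met u a b z - sgq n ^+ 2 * Hres a b| <= eps * sgq n ^+ 2].

Let K0 : 0 < K. Proof. exact: lt_le_trans K1. Qed.
Let Ga0 : 0 < Ga. Proof. exact: lt_le_trans Ga1. Qed.
Let om1 : om <= 1. Proof. by apply: le_trans om2 _; lra. Qed.
Let M00 : 0 < M0. Proof. by rewrite -(pmulr_lgt0 _ sg00); exact: lt_le_trans MK. Qed.
Let sgq0 n : 0 < sgq n. Proof. by rewrite mulr_gt0 // exprn_gt0. Qed.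
Let Mq0 n : 0 < Mq n. Proof. by rewrite mulr_gt0 // exprn_gt0. Qed.
Let rq0 n : 0 < rq n. Proof. by rewrite divr_gt0 // mulr_gt0. Qed.
Let sgq_le n : sgq n <= sg0. Proof. by apply: ler_piMr; [exact: ltW|apply: exprn_ile1 => //; exact: ltW]. Qed.
Let Msg n : K <= Mq n * sgq n.
Proof.
apply: le_trans MK _; have -> : Mq n * sgq n = M0 * sg0 * (om * Ga) ^+ n by rewrite /Mq /sgq exprMn; ring.
by apply: ler_peMr; [exact: ltW (mulr_gt0 M00 sg00)|exact: exprn_ege1].
Qed.
Let sgqE n : sgq n.+1 = om * sgq n. Proof. by rewrite /sgq exprS; ring. Qed.
Let MqE n : Mq n.+1 = Ga * Mq n. Proof. by rewrite /Mq exprS; ring. Qed.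
Let sgqV n : sgq n <= K^-1.
Proof. by rewrite -[leRHS]mul1r ler_pdivlMr //; apply: le_trans sgK; rewrite ler_wpM2r // ltW. Qed.
(** Since [om * Ga >= 1], the product [Mq n * sgq n] stays above [K]. Hence the mollification error,
    linear in the radius, hides below the oscillation error [sgq n ^+ 2 / K]. *)
Let rqK n : rq n <= sgq n ^+ 2 / K.
Proof.
rewrite /rq ler_pdivrMr // mulrAC ler_pdivlMr //.
apply: (@le_trans _ _ (sgq n * (Mq n * sgq n))); last by rewrite le_eqVlt; apply/orP; left; apply/eqP; ring.
rewrite -mulrA; apply: (@le_trans _ _ (sgq n * K)); last first.
  by apply: ler_wpM2l; [exact: ltW|exact: Msg].
by apply: ler_piMl => //; exact: ltW (mulr_gt0 (sgq0 n) K0).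
Qed.
Let rq_half n : rq n <= (eps * sg0 / M0) * (1 / 2) ^+ n.
Proof.
have -> : rq n = (eps * sg0 / M0) * (om / Ga) ^+ n.
  by rewrite /rq /sgq /Mq expr_div_n; field; rewrite !gt_eqF // exprn_gt0.
apply: ler_wpM2l; first by rewrite divr_ge0 ?mulr_ge0 // ltW.
apply: lerXn2r; rewrite ?nnegrE ?divr_ge0 ?(ltW om0) ?(ltW Ga0) //.
rewrite ler_pdivrMr //; apply: le_trans om2 _; rewrite ler_peMr //.
Qed.
Let sq_step n : sq n.+1 <= sq n - (2 * stm J).+1%:R * rq n.
Proof.
have h := ler_wpM2l (ler0n R (2 * stm J).+1) (rq_half n).
have h2 : 0 <= (1 / 2 : R) ^+ n by rewrite exprn_ge0.
have h3 : (2 * stm J).+1%:R * (eps * sg0 / M0 * (1 / 2) ^+ n) <= (s0 - s1) / 2 * (1 / 2) ^+ n.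
  by rewrite mulrA; exact: ler_wpM2r.
have e : (s0 - s1) / 2 ^+ n = (s0 - s1) * (1 / 2) ^+ n by rewrite mul1r exprVn.
have e' : (s0 - s1) / 2 ^+ n.+1 = (s0 - s1) / 2 * (1 / 2) ^+ n.
  by rewrite mul1r exprVn exprS; field.
rewrite /sq e e'; have := le_trans h h3; move: (_ * rq n) ((1 / 2) ^+ n) => x y; lra.
Qed.
Let sq_gt n : s1 < sq n.
Proof. by rewrite /sq ltrDl divr_gt0 ?subr_gt0 // exprn_gt0. Qed.

Lemma iter_step n u : iter_inv n u -> exists v, iter_inv n.+1 v /\ forall z, box 0 s1 z ->
  (forall i b, `|dv b v z i - dv b u z i| <= C * sgq n) /\ (forall i, `|v z i - u z i| <= C * rq n).
Proof.
(* The next defect [cdl] is the square of the next amplitude, so the stage aims at the invariant of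
   index [n + 1]. *)
move=> hu; pose c := Cfg u (sq n) (sgq n) (sgq n.+1 ^+ 2) (rq n) ka K.
have Mge1 : sgq n <= Mq n.
  have h1 : sgq n <= 1 by apply: le_trans (sgq_le n) _; exact: le_trans eps1.
  apply: le_trans h1 _; apply: le_trans K1 _; apply: le_trans (Msg n) _.
  by apply: ler_piMr; [exact: ltW|apply: le_trans (sgq_le n) _; exact: le_trans eps1].
have rse : rq n <= eps.
  by rewrite /rq ler_pdivrMr // ler_wpM2l // ltW.
have ok : stage_ok g eps c.
  split; rewrite /=.
  - by split => //; apply: le_trans (sgq_le n) _.
  - split => //; first exact: sqr_ge0.
      by rewrite sgqE exprMn ler_wpM2r // sqr_ge0.
    have := sq_step n; have := sq_gt n.+1.
    have : rq n <= (2 * stm J).+1%:R * rq n by rewrite ler_peMl ?ler1n // ltW.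
    move: (_ * rq n) => x; have := s10; lra.
  - split.
    + by move=> i b z hz; have [h _ _ _] := hu z hz; exact: h.
    + by move=> i b b' z hz; have [_ h _ _] := hu z hz; exact: h.
    + move=> i b b' z hz; have [_ _ h _] := hu z hz; apply: le_trans (h i b b') _.
      rewrite /rq le_eqVlt; apply/orP; left; apply/eqP; field.
      by rewrite !gt_eqF // ?mulr_gt0.
  - by move=> a b z hz; have [_ _ _ h] := hu z hz; exact: h.
have [v hv] := Hst ok; exists v; split; last first.
  move=> z hz; have [|_ _ h3 h4 _] := hv z; last by split.
  by move: hz; rewrite !box0P /= => hz; apply: lt_le_trans hz _; apply: le_trans (sq_step n); exact: ltW.
move=> z hz; have [|h1 h2 _ _ h5] := hv z.
  by move: hz; rewrite !box0P /= => hz; exact: lt_le_trans hz (sq_step n).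
split => //.
- by move=> i b b'; have [] := h2 i b b'.
- move=> i b b'; have [_ h] := h2 i b b'; apply: le_trans h _.
  rewrite MqE /= le_eqVlt; apply/orP; left; apply/eqP.
  have alg (x y G Q : R) : 0 < x -> 0 < y -> G * eps = C * Q -> C * (x * Q / (eps * x / y)) = G * y.
    move=> x0 y0 e; have -> : G = C * Q / eps by rewrite -e mulfK // gt_eqF.
    by field; rewrite !gt_eqF.
  exact: alg.
(* The error budget: [ka^(-J)], [1 / K] and [sgq n] are each at most [1 / K], and the radius adds a
   fourth such term. By [omE], [4 C sgq^2 / K] is exactly [eps (om sgq)^2]. *)
- move=> a b; apply: le_trans (h5 a b) _; rewrite /= exprVn -KE sgqE (exprMn _ om).
  have -> : eps * (om ^+ 2 * sgq n ^+ 2) = C * (sgq n ^+ 2 * (4 / K)).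
    have -> : C = om ^+ 2 * (eps * K) / 4 by rewrite omE mulrAC mulfV ?mul1r.
    by field; rewrite gt_eqF.
  apply: ler_wpM2l; first exact: le_trans C1.
  have h : sgq n ^+ 2 * (K^-1 + K^-1 + sgq n) <= sgq n ^+ 2 * (3 / K).
    by apply: ler_wpM2l; [exact: sqr_ge0|have := sgqV n; lra].
  have := rqK n; lra.
Qed.

Variables (u0 : pt -> ax3 -> R) (al : R).
Hypotheses (al0 : 0 < al) (al1 : al <= 1) (lam1 : om `^ (1 - al) * Ga `^ al < 1).
Hypothesis u0_inv : iter_inv 0 u0.

Let lam := om `^ (1 - al) * Ga `^ al.
Let lam0 : 0 <= lam. Proof. by rewrite mulr_ge0 // powR_ge0. Qed.

Lemma iter_sequence : exists U : nat -> pt -> ax3 -> R,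
  [/\ U 0 = u0, forall n, iter_inv n (U n) &
   forall n z, box 0 s1 z -> (forall i b, `|dv b (U n.+1) z i - dv b (U n) z i| <= C * sgq n) /\
      (forall i, `|U n.+1 z i - U n z i| <= C * rq n)].
Proof.
have /choice [F hF] : forall nu : nat * (pt -> ax3 -> R), exists v, iter_inv nu.1 nu.2 ->
   iter_inv nu.1.+1 v /\ forall z, box 0 s1 z ->
  (forall i b, `|dv b v z i - dv b nu.2 z i| <= C * sgq nu.1) /\ (forall i, `|v z i - nu.2 z i| <= C * rq nu.1).
  move=> [n u]; have [h|h] := pselect (iter_inv n u); last by exists u.
  by have [v hv] := iter_step h; exists v.
pose U := nat_rect (fun=> pt -> ax3 -> R) u0 (fun n u => F (n, u)).
have hU n : iter_inv n (U n).
  by elim: n => [|n IH] //; have [] := hF (n, U n) IH.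
exists U; split => // n z hz; have [_ h] := hF (n, U n) (hU n); exact: h.
Qed.

Lemma iter_limit : exists u : pt -> ax3 -> R, exists p : bool -> pt -> ax3 -> R, exists2 Q : R, 0 <= Q &
  [/\ forall b i z, box 0 s1 z -> is_derive z (ebas b) (fun w => u w i) (p b z i),
      forall a b z, box 0 s1 z -> dot3 (p a z) (p b z) = g a b z,
      forall i z, box 0 s1 z -> `|u z i - u0 z i| <= 2 * (C * (eps * sg0 / M0)) &
      forall b i z w, box 0 s1 z -> box 0 s1 w -> `|p b z i - p b w i| <= Q * `|z - w| `^ al].
Proof.
have [U [U0 hU hd]] := iter_sequence.
have C0 : 0 <= C by exact: le_trans C1.
have half01 : 0 <= (1 / 2 : R) /\ (1 / 2 : R) < 1 by split; lra.
pose q n b z i := dv b (U n) z i.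
pose p b z i := lim ((fun n => q n b z i) @ \oo).
pose u z i := lim ((fun n => U n z i) @ \oo).
have sub z n : box 0 s1 z -> box 0 (sq n) z by rewrite !box0P => h; exact: lt_trans (sq_gt n).
have om11 : om < 1 by apply: le_lt_trans om2 _; lra.
have dq b i z n : box 0 s1 z -> `|q n.+1 b z i - q n b z i| <= C * sg0 * om ^+ n.
  by move=> hz; have [h _] := hd n z hz; rewrite -mulrA; exact: h.
have dU i z n : box 0 s1 z -> `|U n.+1 z i - U n z i| <= C * (eps * sg0 / M0) * (1 / 2) ^+ n.
  move=> hz; have [_ h] := hd n z hz; apply: le_trans (h i) _.
  by rewrite -mulrA; apply: ler_wpM2l.
have Csg0 : 0 <= C * sg0 by rewrite mulr_ge0 // ltW.
have Cr0 : 0 <= C * (eps * sg0 / M0) by rewrite mulr_ge0 // ltW // divr_gt0 // mulr_gt0.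
have cp b i z : box 0 s1 z -> (fun n => q n b z i) @ \oo --> p b z i.
  by move=> hz; apply: (geometric_cvg Csg0 (ltW om0) om11) => n; exact: dq.
have cu i z : box 0 s1 z -> (fun n => U n z i) @ \oo --> u z i.
  by move=> hz; apply: (geometric_cvg Cr0 half01.1 half01.2) => n; exact: dU.
have qd b i z n : box 0 s1 z -> is_derive z (ebas b) (fun w => U n w i) (q n b z i).
  by move=> hz; apply: derivable_dd; have [h _ _ _] := hU n z (sub _ n hz); exact: h.
have qlip b i z w n : box 0 s1 z -> box 0 s1 w -> `|q n b z i - q n b w i| <= 2 * Mq n * `|z - w|.
  move=> hz hw; apply: (@box_lipschitz _ _ (sq n)); [exact: ltW|..| exact: sub| exact: sub].
  - by move=> b' y hy; have [_ h _ _] := hU n y hy; exact: h.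
  - by move=> b' y hy; have [_ _ h _] := hU n y hy; exact: h.
(* The interpolated constant: [2 C sg0] comes from the two uniform bounds on gradient differences,
   and [4 M0 Ga] from the Lipschitz constants of levels [n] and [n + 1]. *)
pose A := (2 * (C * sg0)) `^ (1 - al) * (4 * M0 * Ga) `^ al.
have A0 : 0 <= A by rewrite mulr_ge0 // powR_ge0.
have hol_step b i z w n : box 0 s1 z -> box 0 s1 w ->
   `|(q n.+1 b z i - q n.+1 b w i) - (q n b z i - q n b w i)| <= A * `|z - w| `^ al * lam ^+ n.
  move=> hz hw.
  have h1 : `|(q n.+1 b z i - q n.+1 b w i) - (q n b z i - q n b w i)| <= 2 * (C * sg0) * om ^+ n.
    have -> : (q n.+1 b z i - q n.+1 b w i) - (q n b z i - q n b w i) =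
       (q n.+1 b z i - q n b z i) - (q n.+1 b w i - q n b w i) by ring.
    by apply: le_trans (ler_normB _ _) _; have := dq b i z n hz; have := dq b i w n hw; lra.
  have h2 : `|(q n.+1 b z i - q n.+1 b w i) - (q n b z i - q n b w i)| <= (4 * M0 * Ga * Ga ^+ n) * `|z - w|.
    apply: le_trans (ler_normB _ _) _; apply: le_trans (lerD (qlip b i z w n.+1 hz hw) (qlip b i z w n hz hw)) _.
    rewrite -mulrDl; apply: ler_wpM2r => //; rewrite MqE.
    have -> : 4 * M0 * Ga * Ga ^+ n = 4 * (Ga * Mq n) by rewrite /Mq; ring.
    have : Mq n <= Ga * Mq n by apply: ler_peMl => //; exact: ltW.
    by lra.
  apply: le_trans (powR_interpolate (normr_ge0 _) h1 h2 (ltW al0) al1) _.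
  have e1 : 0 <= om ^+ n by rewrite exprn_ge0 // ltW.
  have e2 : 0 <= Ga ^+ n by rewrite exprn_ge0 // ltW.
  have e3 : 0 <= 4 * M0 * Ga by rewrite !mulr_ge0 // ltW.
  have alg (X Y x y t : R) : 0 <= X -> 0 <= Y -> 0 <= x -> 0 <= y -> 0 <= t ->
    (X * x) `^ (1 - al) * (Y * y * t) `^ al = X `^ (1 - al) * Y `^ al * t `^ al * (x `^ (1 - al) * y `^ al).
    by move=> X0 Y0 x0 y0 t0; rewrite !powRM ?mulr_ge0 //; ring.
  have powX (x b' : R) : 0 <= x -> (x ^+ n) `^ b' = (x `^ b') ^+ n.
    by move=> x0; rewrite -powR_mulrn // powRAC powR_mulrn // powR_ge0.
  rewrite alg // ?(mulr_ge0 _ Csg0) // (powX om) ?(ltW om0) // (powX Ga) ?(ltW Ga0) //.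
  by rewrite -exprMn.
pose H0 := 2 * M0 * (2 * s1) `^ (1 - al).
have H00 : 0 <= H0 by rewrite !mulr_ge0 ?powR_ge0 // ltW.
have hol0 b i z w : box 0 s1 z -> box 0 s1 w -> `|q 0%N b z i - q 0%N b w i| <= H0 * `|z - w| `^ al.
  move=> hz hw; apply: le_trans (qlip b i z w 0%N hz hw) _.
  rewrite /Mq expr0 mulr1 /H0 -[leRHS]mulrA; apply: ler_wpM2l; first by rewrite mulr_ge0 // ltW.
  have h : `|z - w| <= 2 * s1.
    by apply: le_trans (ler_normB _ _) _; move: hz hw; rewrite !box0P; lra.
  exact: (powR_interpolate (normr_ge0 _) h (lexx _) (ltW al0) al1).
pose Q := H0 + A / (1 - lam).
have lam11 : 0 < 1 - lam by rewrite subr_gt0.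
have Q0 : 0 <= Q by rewrite addr_ge0 // divr_ge0 // ltW.
have holn b i z w n : box 0 s1 z -> box 0 s1 w -> `|q n b z i - q n b w i| <= Q * `|z - w| `^ al.
  move=> hz hw; pose x n := q n b z i - q n b w i.
  have B0 : 0 <= A * `|z - w| `^ al by rewrite mulr_ge0 // powR_ge0.
  have h := @geometric_tail R x _ lam 0%N n B0 lam0 lam1 (fun n => hol_step b i z w n hz hw).
  rewrite add0n expr0 mulr1 in h.
  rewrite -[q n b z i - _]/(x n) -(subrK (x 0%N) (x n)); apply: le_trans (ler_normD _ _) _.
  apply: le_trans (lerD h (hol0 b i z w hz hw)) _.
  by rewrite /Q mulrDl addrC lerD2l mulrAC.
exists u, p, Q => //; split.
- move=> b i z hz; pose e := s1 - `|z|.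
  have e0 : 0 < e by rewrite subr_gt0; move: hz; rewrite box0P.
  apply: (is_derive_holder e0 al0 Q0) => t te.
  have seg x : 0 <= x <= 1 -> box 0 s1 ((x * t) *: ebas b + z).
    move=> /andP[x0 x1]; rewrite box0P; apply: le_lt_trans (ler_normD _ _) _; rewrite norm_ebas normrM ger0_norm //.
    have : x * `|t| <= `|t| by apply: ler_piMl.
    by rewrite /e in te; lra.
  have hzt : box 0 s1 (t *: ebas b + z) by have := seg 1; rewrite mul1r; apply; rewrite ler01 lexx.
  (* The mean value theorem at level [n] and the uniform Hölder bound control the Taylor remainder
     independently of [n], so the estimate passes to the limit and identifies the limit of the
     gradients as the gradient of the limit. *)
  have bound n : `|U n (t *: ebas b + z) i - U n z i - t * q n b z i| <= `|t| * (Q * `|t| `^ al).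
    have [x x01 ->] := @mvt_line R (fun w => U n w i) (fun w => q n b w i) b z t (fun x x01 => qd b i _ n (seg x x01)).
    rewrite -mulrBr normrM; apply: ler_wpM2l => //.
    apply: le_trans (holn b i _ _ n (seg x x01) hz) _; apply: ler_wpM2l => //.
    rewrite addrK norm_ebas; apply: ge0_ler_powR; rewrite ?nnegrE //; first exact: ltW.
    by case/andP: x01 => x0 x1; rewrite normrM ger0_norm //; apply: ler_piMl.
  have lim1 : (fun n => `|U n (t *: ebas b + z) i - U n z i - t * q n b z i|) @ \oo -->
      `|u (t *: ebas b + z) i - u z i - t * p b z i|.
    apply: cvg_norm; apply: (cvgB (cvgB (cu i _ hzt) (cu i _ hz))).
    exact: (cvgM (cvg_cst t) (cp b i z hz)).
  by apply: (ler_cvg_to lim1 (cvg_cst _)); apply: nearW.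
- move=> a b z hz.
  have lim1 : (fun n => `|g a b z - dot3 (q n a z) (q n b z)|) @ \oo --> `|g a b z - dot3 (p a z) (p b z)|.
    apply: cvg_norm; apply: (cvgB (cvg_cst _)).
    have cc i : (fun n => q n a z i * q n b z i) @ \oo --> p a z i * p b z i.
      exact: (cvgM (cp a i z hz) (cp b i z hz)).
    rewrite /dot3; exact: (cvgD (cvgD (cc ax_x) (cc ax_y)) (cc ax_z)).
  have bound n : `|g a b z - dot3 (q n a z) (q n b z)| <= geometric (2 * sg0 ^+ 2) om n.
    have [_ _ _ h] := hU n z (sub z n hz); have {}h := h a b.
    have H1 : `|Hres a b : R| <= 1.
      by rewrite /Hres; case: eqP => _; rewrite ger0_norm //; lra.
    have s2 : sgq n ^+ 2 <= sg0 ^+ 2 * om ^+ n.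
      rewrite expr2 expr2 -mulrA; apply: ler_pM => //; exact: ltW.
    have h3 : `|sgq n ^+ 2 * Hres a b| <= sgq n ^+ 2.
      by rewrite normrM ger0_norm ?sqr_ge0 // ler_piMr // sqr_ge0.
    have h4 : eps * sgq n ^+ 2 <= sgq n ^+ 2 by rewrite ler_piMl // sqr_ge0.
    rewrite -(subrK (sgq n ^+ 2 * Hres a b) (_ - _)); apply: le_trans (ler_normD _ _) _.
    have -> : geometric (2 * sg0 ^+ 2) om n = sg0 ^+ 2 * om ^+ n + sg0 ^+ 2 * om ^+ n.
      by rewrite /geometric /=; ring.
    by apply: lerD; [exact: le_trans (le_trans h h4) s2|exact: le_trans h3 s2].
  have lim2 : geometric (2 * sg0 ^+ 2) om @ \oo --> (0 : R).
    by apply: cvg_geometric; rewrite ger0_norm // ltW.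
  have : `|g a b z - dot3 (p a z) (p b z)| <= 0.
    by apply: (ler_cvg_to lim1 lim2); apply: nearW.
  by rewrite normr_le0 subr_eq0 => /eqP.
- move=> i z hz; have := geometric_lim_dist 0 Cr0 half01.1 half01.2 (fun n => dU i z n hz).
  have -> : (1 - 1 / 2 : R) = 2^-1 by field.
  by rewrite U0 expr0 mulr1 -/(u z i) invrK mulrC.
- move=> b i z w hz hw.
  have lim1 : (fun n => `|q n b z i - q n b w i|) @ \oo --> `|p b z i - p b w i|.
    by apply: cvg_norm; apply: cvgB; exact: cp.
  by apply: (ler_cvg_to lim1 (cvg_cst _)); apply: nearW => n; exact: holn.
Qed.

End Iteration.

(** * Choice of the parameters *)

Section NashIteration.
Context {R : realType}.
Local Notation pt := 'rV[R]_2.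

(* Everything is a power of [ka] up to constants: [om ^ 2 ~ ka ^ (- J')] and [Ga ~ ka ^ (2 J' + 1)] with
   [J' = J.+1]; so [om ^ (1 - al) * Ga ^ al] decays as [ka] grows exactly when [2 al < J' (1 - 5 al)]. *)
Lemma iteration_parameters (C eps al : R) (J : nat) : 1 <= C -> 0 < eps -> eps <= 1 -> 0 < al ->
  2 * al < J.+1%:R * (1 - 5 * al) ->
  exists ka K om Ga : R, [/\ [/\ 1 <= eps * ka, K = ka ^+ J.+1 & 1 <= K],
    [/\ 0 < om, om <= 1 / 2, om ^+ 2 * (eps * K) = 4 * C & om ^+ 2 <= eps],
    [/\ 1 <= Ga, 1 <= om * Ga & Ga * eps = C * (K ^+ 2 * ka)] & om `^ (1 - al) * Ga `^ al < 1].
Proof.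
move=> C1 eps0 eps1 al0 hJ; have C0 : 0 < C by exact: lt_le_trans C1.
(* With [y = ln ka], the logarithm of [om^(1 - al) * Ga^al] is [c - d * y]; the hypothesis on [J] is
   the positivity of [d]. *)
pose d := (J.+1%:R * (1 - 5 * al) - 2 * al) / 2.
have d0 : 0 < d by rewrite divr_gt0 // subr_gt0.
pose c := (1 - al) / 2 * ln (4 * C / eps) + al * ln (C / eps).
have q1 : 0 < 16 * C / eps ^+ 2 by rewrite divr_gt0 ?mulr_gt0 // exprn_gt0.
have q2 : 0 < 4 * C / eps by rewrite divr_gt0 // mulr_gt0.
have q3 : 0 < C / eps by rewrite divr_gt0.
(* Large enough to beat [c / d] and to give [ka >= 16 C / eps^2], which implies the other
   inequalities. *)
pose y := `|c / d| + `|ln (16 * C / eps ^+ 2)| + 1.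
have y0 : 0 <= y by rewrite !addr_ge0.
have yc : c < d * y.
  rewrite mulrC -ltr_pdivrMr // /y; have := ler_norm (c / d); have := normr_ge0 (ln (16 * C / eps ^+ 2)); lra.
pose ka := expR y; pose K := ka ^+ J.+1.
have KE : K = expR (J.+1%:R * y) by rewrite /K expRM_natl.
have ka1 : 1 <= ka by rewrite -expR0 ler_expR.
have kaK : ka <= K by rewrite /K; apply: ler_eXnr.
have kab : 16 * C / eps ^+ 2 <= ka.
  rewrite -[leLHS]lnK ?posrE // ler_expR /y.
  have := ler_norm (ln (16 * C / eps ^+ 2)); have := normr_ge0 (c / d); lra.
have K0 : 0 < K by exact: lt_le_trans (lt_le_trans ltr01 ka1) kaK.
have ka0 : 0 < ka by exact: lt_le_trans ka1.
have eka : 16 * C <= ka * eps ^+ 2 by rewrite -ler_pdivrMr // exprn_gt0.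
pose om := expR ((ln (4 * C / eps) - J.+1%:R * y) / 2).
have om2 : om ^+ 2 = 4 * C / eps / K.
  by rewrite -expRM_natl mulrCA mulfV // mulr1 expRB lnK ?posrE // KE.
pose Ga := expR (ln (C / eps) + (2 * J.+1%:R + 1) * y).
have GaE : Ga = C / eps * (K ^+ 2 * ka).
  rewrite /Ga expRD lnK ?posrE //; congr (_ * _); rewrite mulrDl mul1r expRD -/ka.
  by rewrite KE -expRM_natl mulrA.
have eka1 : 1 <= eps * ka.
  have : ka * eps ^+ 2 <= eps * ka.
    by rewrite expr2 mulrCA; apply: ler_wpM2l; [exact: ltW|apply: ler_piMr => //; exact: ltW].
  lra.
have K1 : 1 <= K by exact: le_trans ka1 kaK.
have om2s : om ^+ 2 <= eps / 4.
  rewrite om2 ler_pdivrMr // ler_pdivrMr //.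
  have : ka * eps ^+ 2 <= K * eps ^+ 2 by rewrite ler_wpM2r // sqr_ge0.
  have -> : eps / 4 * K * eps = K * eps ^+ 2 / 4 by ring.
  by lra.
have om0 : 0 < om by exact: expR_gt0.
have Ga1 : 1 <= Ga.
  rewrite GaE; have h1 : 1 <= C / eps by rewrite ler_pdivlMr // mul1r; lra.
  have h2 : 1 <= K ^+ 2 * ka by rewrite mulr_ege1 // exprn_ege1.
  exact: mulr_ege1.
have omGa : 1 <= om * Ga.
  have h : 0 <= om * Ga by rewrite mulr_ge0 // ltW // expR_gt0.
  have : 1 <= (om * Ga) ^+ 2.
    rewrite exprMn om2 GaE.
    have -> : 4 * C / eps / K * (C / eps * (K ^+ 2 * ka)) ^+ 2 = (4 * (C / eps)) * (C / eps) ^+ 2 * (K ^+ 3 * ka ^+ 2).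
      by field; rewrite !gt_eqF.
    have h1 : 1 <= C / eps by rewrite ler_pdivlMr // mul1r; lra.
    apply: mulr_ege1; last by apply: mulr_ege1; exact: exprn_ege1.
    by apply: mulr_ege1; [lra|exact: exprn_ege1].
  by rewrite expr_ge1.
exists ka, K, om, Ga; split; [by split|split => //|split => //|].
- have h : om ^+ 2 <= (1 / 2) ^+ 2 by rewrite expr_div_n expr1n; lra.
  by move: h; rewrite ler_pXn2r // ?nnegrE ?(ltW om0) // divr_ge0.
- by rewrite om2; field; rewrite !gt_eqF.
- by apply: le_trans om2s _; lra.
- by rewrite GaE; field; rewrite gt_eqF.
- rewrite /om /Ga -!expRM -expRD expR_lt1.
  have -> : (ln (4 * C / eps) - J.+1%:R * y) / 2 * (1 - al) + (ln (C / eps) + (2 * J.+1%:R + 1) * y) * al = c - d * y.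
    by rewrite /c /d; field.
  by rewrite subr_lt0.
Qed.

Variables (g : bool -> bool -> pt -> R) (Bg Lg c0 : R).
Hypothesis hg : forall a b, lips Bg Lg (g a b).
Hypothesis c0_gt0 : 0 < c0.
Hypothesis gdet : forall z, c0 <= g false false z * g true true z - g false true z ^+ 2.
Hypothesis gsym : forall z, g true false z = g false true z.

(** The threshold [e] is fixed before [M] and [eta]: an initial map with arbitrarily large second
    derivatives is admissible, because [M0] can be raised freely, and raising it also makes the
    total displacement small. *)
Theorem nash_iteration (al s0 s1 : R) : 0 < al -> al < 1 / 5 -> 0 <= s1 -> s1 < s0 ->
  exists2 e : R, 0 < e & forall sg0 M (u0 : pt -> ax3 -> R), 0 < sg0 -> sg0 <= e ->
  (forall z, box 0 s0 z ->
  [/\ forall i b, derivable (fun w => u0 w i) z (ebas b),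
      forall i b b', derivable (fun w => dv b u0 w i) z (ebas b'),
      forall i b b', `|dd b' (fun w => dv b u0 w i) z| <= M &
      forall a b, `|g a b z - met u0 a b z - sg0 ^+ 2 * Hres a b| <= e * sg0 ^+ 2]) ->
  forall eta, 0 < eta ->
  exists u : pt -> ax3 -> R, exists p : bool -> pt -> ax3 -> R, exists2 Q : R, 0 <= Q &
  [/\ forall b i z, box 0 s1 z -> is_derive z (ebas b) (fun w => u w i) (p b z i),
      forall a b z, box 0 s1 z -> dot3 (p a z) (p b z) = g a b z,
      forall i z, box 0 s1 z -> `|u z i - u0 z i| <= eta &
      forall b i z w, box 0 s1 z -> box 0 s1 w -> `|p b z i - p b w i| <= Q * `|z - w| `^ al].
Proof.
move=> al0 al5 s10 s01; have a5 : 0 < 1 - 5 * al by lra.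
(* The slack [1 - 5 al] is positive, so a large [J] makes the cost of the cheap step negligible. *)
have [J hJ] : exists J : nat, 2 * al < J.+1%:R * (1 - 5 * al).
  exists (Num.truncn (2 * al / (1 - 5 * al))); rewrite -ltr_pdivrMr //.
  have h : 0 <= 2 * al / (1 - 5 * al) by rewrite divr_ge0 // ltW // mulr_gt0.
  by have /andP[] := truncn_itv h.
have [C [eps [C1 eps0 eps1 hst]]] := stage_step J.+1 hg c0_gt0 gdet gsym.
have [ka [K [om [Ga [[p1 p2 p3] [p4 p5 p6 p7] [p8 p9 p10] p11]]]]] := iteration_parameters C1 eps0 eps1 al0 hJ.
have K0 : 0 < K by exact: lt_le_trans p3.
exists (Num.min eps K^-1); first by rewrite lt_min eps0 invr_gt0.
move=> sg0 M u0 sg00; rewrite le_min => /andP[sge sgK] hu eta eta0.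
pose N : R := (2 * stm J.+1).+1%:R.
have s010 : 0 < s0 - s1 by rewrite subr_gt0.
pose X := N * (eps * sg0) * 2 / (s0 - s1).
pose Y := 2 * C * (eps * sg0) / eta.
have X0 : 0 <= X by rewrite divr_ge0 ?(ltW s010) // !mulr_ge0 // ltW.
have C0 : 0 <= C by exact: le_trans C1.
have Y0 : 0 <= Y by rewrite divr_ge0 ?(ltW eta0) // !mulr_ge0 // ltW.
have Z0 : 0 < K / sg0 by rewrite divr_gt0.
(* One summand for each demand on the initial bound: dominating [M], keeping [M0 * sg0 >= K],
   shrinking the boxes by less than the room between [s0] and [s1], and moving the map by at most
   [eta]. *)
pose M0 := `|M| + K / sg0 + X + Y.
have MM := ler_norm M.
have M00 : 0 < M0 by rewrite /M0; have := normr_ge0 M; lra.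
have q1 : sg0 * K <= 1 by rewrite -ler_pdivlMr // div1r.
have q2 : K <= M0 * sg0 by rewrite -ler_pdivrMr // /M0; have := normr_ge0 M; lra.
have q3 : N * (eps * sg0 / M0) <= (s0 - s1) / 2.
  have : X <= M0 by rewrite /M0; have := normr_ge0 M; lra.
  by rewrite /X ler_pdivrMr // => h; rewrite mulrA ler_pdivrMr //; lra.
have q4 : 2 * (C * (eps * sg0 / M0)) <= eta.
  have : Y <= M0 by rewrite /M0; have := normr_ge0 M; lra.
  by rewrite /Y ler_pdivrMr // => h; rewrite !mulrA ler_pdivrMr //; lra.
have al1 : al <= 1 by lra.
have inv0 : iter_inv g eps om Ga s0 s1 sg0 M0 0 u0.
  move=> z; rewrite !expr0 divr1 subrKC => hz; have [h1 h2 h3 h4] := hu z hz; split => //.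
    move=> i b b'; apply: le_trans (h3 i b b') _; rewrite mulr1 /M0; lra.
  move=> a b; rewrite mulr1; apply: le_trans (h4 a b) _; apply: ler_wpM2r; first exact: sqr_ge0.
  by rewrite ge_min lexx.
have [u [p [Q Q0 [h1 h2 h3 h4]]]] := iter_limit C1 eps0 eps1 hst p1 p2 p3 p4 p5 p6 p7 p8 p9 p10 s10 s01
  sg00 sge q1 q2 q3 al0 al1 p11 inv0.
exists u, p, Q => //; split => // i z hz; exact: le_trans (h3 i z hz) q4.
Qed.

End NashIteration.

(** * Adding a positive metric to a map *)

Lemma dot3_close {R : realType} (p q p' q' : ax3 -> R) (B e : R) :
  (forall i, `|p i - p' i| <= e) -> (forall i, `|q i - q' i| <= e) ->
  (forall i, `|p' i| <= B) -> (forall i, `|q i| <= B) -> `|dot3 p q - dot3 p' q'| <= 6 * B * e.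
Proof.
move=> h1 h2 h3 h4.
have key i : `|p i * q i - p' i * q' i| <= 2 * (B * e).
  rewrite (_ : _ - _ = (p i - p' i) * q i + p' i * (q i - q' i)); last by ring.
  apply: le_trans (ler_normD _ _) _; rewrite !normrM.
  rewrite (_ : 2 * (B * e) = e * B + B * e); last by ring.
  by apply: lerD; apply: ler_pM.
have alg (a b c a' b' c' M : R) : `|a - a'| <= M -> `|b - b'| <= M -> `|c - c'| <= M ->
    `|a + b + c - (a' + b' + c')| <= 3 * M.
  move=> k1 k2 k3; rewrite (_ : _ - _ = (a - a') + (b - b') + (c - c')); last by ring.
  apply: le_trans (ler_normD _ _) _; apply: le_trans (lerD (ler_normD _ _) (lexx _)) _; lra.
rewrite (_ : 6 * B * e = 3 * (2 * (B * e))); last by ring.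
exact: alg.
Qed.

Lemma dot3_bound {R : realType} (p q : ax3 -> R) (B : R) :
  (forall i, `|p i| <= B) -> (forall i, `|q i| <= B) -> `|dot3 p q| <= 3 * B ^+ 2.
Proof.
move=> h1 h2; have key i : `|p i * q i| <= B ^+ 2 by rewrite normrM expr2 ler_pM.
apply: le_trans (ler_normD _ _) _; apply: le_trans (lerD (ler_normD _ _) (lexx _)) _.
have := key ax_x; have := key ax_y; have := key ax_z; lra.
Qed.

(** * One primitive step with constants independent of the map *)

Section PrimitiveFamily.
Context {R : realType}.
Local Notation pt := 'rV[R]_2.

Record pcfg := PCfg { pcu : pt -> ax3 -> R; pcs : R; pcsg : R; pcr : R }.

Variables (B c0 smax Ca mu0 : R) (a : pt -> R) (xi : bool -> R).
Hypotheses (c0_gt0 : 0 < c0) (mu0_ge0 : 0 <= mu0).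
Hypothesis aB : Bd 2 (box 0 smax) Ca mu0 a.
Variable m : nat.
Hypothesis m_gt2 : (2 < m)%N.

(** The bound [pcsg^3 / pcr] on second derivatives lets mollification at radius [pcr] change the
    metric by a cubic amount only; [mu0 * pcr <= 2] places the frequency of [a] below [2 / pcr]. *)
Definition prim_ok (th : R) (c : pcfg) : Prop :=
  [/\ [/\ 0 < pcsg c, pcsg c <= th & th <= 1],
      [/\ 0 < pcr c, mu0 * pcr c <= 2, pcr c <= pcs c & pcs c <= smax],
      [/\ forall i b z, box 0 (pcs c) z -> derivable (fun w => pcu c w i) z (ebas b),
          forall i b b' z, box 0 (pcs c) z -> derivable (fun w => dv b (pcu c) w i) z (ebas b') &
          forall i b b' z, box 0 (pcs c) z -> `|dd b' (fun w => dv b (pcu c) w i) z| <= pcsg c ^+ 3 / pcr c] &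
      (forall i b z, box 0 (pcs c) z -> `|dv b (pcu c) z i| <= B) /\
      (forall z, box 0 (pcs c) z -> c0 <= nsq (pcu c) z)].

Definition psub := {p : R * pcfg | prim_ok p.1 p.2}.
Local Notation T := psub.
Let th (t : T) : R := (sval t).1.
Let u (t : T) := pcu (sval t).2.
Let s (t : T) := pcs (sval t).2.
Let sg (t : T) := pcsg (sval t).2.
Let r (t : T) := pcr (sval t).2.
Local Notation F := (small_filter th).
Let rho (t : T) := s t - r t.
Let S (t : T) : set pt := box 0 (s t - (2 * m).+1%:R * r t).
Let mu (t : T) := 2 / r t.
(** The ratio [1 / sg] makes the oscillation error [sg^2 mu / la] equal to [sg^3]. Growth of
    frequencies is of no concern in this phase. *)
Let la (t : T) := mu t / sg t.

Let oS t : open (S t). Proof. exact: box_open. Qed.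
Let okP (t : T) : prim_ok (th t) (sval t).2. Proof. exact: (svalP t). Qed.
Let sg0 t : 0 < sg (t : T). Proof. by have [[]] := okP t. Qed.
Let sgth t : sg (t : T) <= th t. Proof. by have [[]] := okP t. Qed.
Let th1 t : th (t : T) <= 1. Proof. by have [[]] := okP t. Qed.
Let sg1 t : sg (t : T) <= 1. Proof. exact: le_trans (sgth t) (th1 t). Qed.
Let r0 t : 0 < r (t : T). Proof. by have [_ []] := okP t. Qed.
Let mu0r t : mu0 * r (t : T) <= 2. Proof. by have [_ []] := okP t. Qed.
Let rs t : r (t : T) <= s t. Proof. by have [_ []] := okP t. Qed.
Let ssmax t : s (t : T) <= smax. Proof. by have [_ []] := okP t. Qed.
Let rho0 t : 0 <= rho t. Proof. by rewrite subr_ge0. Qed.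
Let rhos t : rho t < s t. Proof. by rewrite /rho ltrBlDr ltrDl. Qed.
Let mu_gt0 t : 0 < mu t. Proof. by rewrite divr_gt0. Qed.
Let la_gt0 t : 0 < la t. Proof. by rewrite divr_gt0. Qed.
Let mula t : mu t <= la t.
Proof. by rewrite /la ler_pdivlMr // ler_piMr // ltW. Qed.
Let ud t i b z : box 0 (s (t : T)) z -> derivable (fun w => u t w i) z (ebas b).
Proof. by have [_ _ [h _ _] _] := okP t; exact: h. Qed.
Let udd t i b b' z : box 0 (s (t : T)) z -> derivable (fun w => dv b (u t) w i) z (ebas b').
Proof. by have [_ _ [_ h _] _] := okP t; exact: h. Qed.
Let uM t i b b' z : box 0 (s (t : T)) z -> `|dd b' (fun w => dv b (u t) w i) z| <= sg t ^+ 3 / r t.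
Proof. by have [_ _ [_ _ h] _] := okP t; exact: h. Qed.
Let uB t i b z : box 0 (s (t : T)) z -> `|dv b (u t) z i| <= B.
Proof. by have [_ _ _ [h _]] := okP t; exact: h. Qed.
Let un t z : box 0 (s (t : T)) z -> c0 <= nsq (u t) z.
Proof. by have [_ _ _ [_ h]] := okP t; exact: h. Qed.
Let sg30 t : 0 < sg (t : T) ^+ 3. Proof. by rewrite exprn_gt0. Qed.
Let M0 t : 0 <= sg (t : T) ^+ 3 / r t. Proof. by rewrite divr_ge0 // ltW. Qed.
Let B0 (t : T) : 0 <= B.
Proof.
have h : box 0 (s t) (0 : pt) by apply/box0P; rewrite normr0; exact: lt_le_trans (r0 t) (rs t).
exact: le_trans (normr_ge0 _) (uB ax_x true h).
Qed.

Let inb t z : `|z| <= rho t -> box 0 (s t) z.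
Proof. by move=> h; apply/box0P; exact: le_lt_trans h (rhos t). Qed.

Let P t b i z := dv b (u t) (clamp (rho t) z) i.

Let P_lips (t : T) b i : lips B (sg t ^+ 3 / r t) (P t b i).
Proof.
apply: (clamp_lips (s := s t) (f := fun w => dv b (u t) w i)) => //.
- by move=> b' z hz; exact: udd.
- by move=> b' z hz; exact: uM.
- by move=> z hz; apply: uB; exact: inb.
Qed.

Let ut t z i := smooth m m (r t) (fun z => u t (clamp (rho t) z) i) z.

Let Srho t z : S t z -> `|z| + (m + m)%:R * r t < rho t.
Proof.
move=> /box0P; rewrite /rho (_ : (2 * m).+1%:R = (m + m)%:R + 1 :> R); last by rewrite -natr1 mul2n addnn.
by rewrite mulrDl mul1r; lra.
Qed.

Let Sbox t z : S t z -> box 0 (s t) z.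
Proof.
move=> /Srho h; apply: inb; apply: ltW; apply: le_lt_trans h.
by rewrite lerDl mulr_ge0 // ltW.
Qed.

Let ut_derive (t : T) i b (z : pt) : S t z -> is_derive z (ebas b) (fun w => ut t w i) (smooth m m (r t) (P t b i) z).
Proof.
move=> /Srho hz.
apply: (@clamp_smooth_derive R (s t) (rho t) B (fun w => u t w i) (rho0 t) (rhos t) _ _ _ b m m (r t) z B (sg t ^+ 3 / r t)) => //.
- exact: B0 t.
- by move=> b' w hw; exact: ud.
- by move=> b' w hw; exact: uB.
- exact: ltW.
- exact: P_lips.
Qed.

Let ut_dv (t : T) i b (z : pt) : S t z -> dv b (ut t) z i = smooth m m (r t) (P t b i) z.
Proof. by move=> Sz; rewrite /dv (is_derive_dd (ut_derive i b Sz)). Qed.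

Let ut_famOD b : famODv F S 1 (fun t => sg t * mu t) mu (fun t => dv b (ut t)).
Proof.
move=> i; have e t : {in S t, smooth m m (r t) (P t b i) =1 (fun z => dv b (ut t) z i)}.
  by move=> z; rewrite inE => Sz; rewrite ut_dv.
split.
  exists (`|B|) => //; apply: nearW => t; split; first exact: ltW.
  rewrite mulr1; apply: Bd_ext (@oS t) (e t) _; apply: (Bd_sub (S := setT)) => //.
  rewrite (ger0_norm (B0 t)); exact: smooth_Bd_global (r0 t) (P_lips t b i) (ltnW m_gt2) (ltnW m_gt2).
move=> c; exists 1 => //; apply: nearW => t; split; first exact: ltW.
apply: (Bd_ext (@oS t) (f := dd c (smooth m m (r t) (P t b i)))).
  by move=> z; rewrite inE => Sz; apply: dd_ext (@oS t) _ Sz; exact: e.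
apply: (Bd_sub (S := setT)) => //.
have h := @smooth_dd_Bd _ _ _ _ m m 1 (r t) c (r0 t) (P_lips t b i) (ltnW m_gt2) (ltnW m_gt2).
apply: Bd_leC h; first exact: ltW (mu_gt0 t).
rewrite mul1r /mu mulrA ler_pM2r ?invr_gt0 //.
have h3 : sg t ^+ 3 <= sg t by rewrite exprS ler_piMr ?exprn_ile1 // ltW.
have := sg0 t; lra.
Qed.

Let ut_close t b i z : S t z -> `|dv b (ut t) z i - dv b (u t) z i| <= 2 * (m + m)%:R * sg t ^+ 3.
Proof.
move=> Sz; rewrite (ut_dv i b Sz).
have zr : `|z| <= rho t by apply: ltW; apply: le_lt_trans (Srho Sz); rewrite lerDl mulr_ge0 // ltW.
have eP : P t b i z = dv b (u t) z i by rewrite /P clamp_id.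
rewrite -eP; apply: (smooth_close (ltW (r0 t)) (P_lips t b i)) => w wz.
apply: le_trans (lips_dist _ _ (P_lips t b i)) _.
apply: (@le_trans _ _ (2 * (sg t ^+ 3 / r t) * ((m + m)%:R * r t))).
  by rewrite ler_wpM2l // mulr_ge0.
by rewrite le_eqVlt; apply/orP; left; apply/eqP; field; rewrite gt_eqF.
Qed.

Let ut_B t b i z : S t z -> `|dv b (ut t) z i| <= B.
Proof. by move=> Sz; rewrite (ut_dv i b Sz); have [h _] := smooth_lips m m (r t) (P_lips t b i); exact: h. Qed.

Let ut_met t b c z : S t z -> `|met (ut t) b c z - met (u t) b c z| <= 12 * (m + m)%:R * B * sg t ^+ 3.
Proof.
move=> Sz; apply: le_trans (dot3_close (fun i => ut_close b i Sz) (fun i => ut_close c i Sz)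
  (fun i => uB i b (Sbox Sz)) (fun i => ut_B c i Sz)) _.
by rewrite le_eqVlt; apply/orP; left; apply/eqP; ring.
Qed.

Let thsmall e : 0 < e -> \forall t \near F, th t <= e.
Proof. by move=> e0; exists e. Qed.

Let sg3th t : sg (t : T) ^+ 3 <= th t.
Proof.
apply: le_trans (sgth t); rewrite exprS; apply: ler_piMr; first exact: ltW.
by apply: exprn_ile1 => //; exact: ltW.
Qed.

Let met_bound t b c z : S t z -> `|met (u t) b c z| <= 3 * B ^+ 2.
Proof. by move=> Sz; apply: dot3_bound => i; apply: uB; exact: Sbox. Qed.

Let ut_nsq : \forall t \near F, forall z, S t z -> c0 / 2 <= nsq (ut t) z.
Proof.
pose b := `|B|; pose D := 12 * (m + m)%:R * b * (12 * b ^+ 2 + 2) + 1; pose D' := 12 * (m + m)%:R * b + 1.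
have b2 : 0 <= b ^+ 2 by exact: sqr_ge0.
have b0 : 0 <= b by exact: normr_ge0.
have D0 : 0 < D by rewrite ltr_wpDl // !mulr_ge0 // addr_ge0 // mulr_ge0.
have D'0 : 0 < D' by rewrite ltr_wpDl // mulr_ge0.
have e1 : 0 < c0 / 2 / D by rewrite !divr_gt0.
have e2 : 0 < D'^-1 by rewrite invr_gt0.
apply: filterS2 (thsmall e1) (thsmall e2) => t h1 h2 z Sz.
have bE : b = B by rewrite /b ger0_norm // (B0 t).
have s3 : 0 <= sg t ^+ 3 by exact: ltW.
have s1 : 12 * (m + m)%:R * B * sg t ^+ 3 <= 1.
  rewrite -bE; apply: (@le_trans _ _ (D' * th t)).
    by apply: ler_pM => //; [exact: mulr_ge0|rewrite /D' lerDl].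
  by rewrite mulrC -ler_pdivlMr // div1r.
have s2 : 12 * (m + m)%:R * B * sg t ^+ 3 * (4 * (3 * B ^+ 2) + 2) <= c0 / 2.
  apply: (@le_trans _ _ (D * th t)); last by rewrite mulrC -ler_pdivlMr.
  rewrite -bE (_ : 12 * (m + m)%:R * b * sg t ^+ 3 * (4 * (3 * b ^+ 2) + 2) = 12 * (m + m)%:R * b * (12 * b ^+ 2 + 2) * sg t ^+ 3); last by ring.
  apply: ler_pM => //; [by rewrite !mulr_ge0 // addr_ge0 // mulr_ge0|by rewrite /D lerDl].
have := det_close (met_bound false false Sz) (met_bound true true Sz) (met_bound false true Sz)
  (ut_met false false Sz) (ut_met true true Sz) (ut_met false true Sz) s1.
rewrite -!nsqE; have := un (Sbox Sz); lra.
Qed.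

Let c02 : 0 < c0 / 2. Proof. by rewrite divr_gt0. Qed.

Lemma prim_once : exists C eps : R, [/\ 1 <= C, 0 < eps, eps <= 1 & forall c, prim_ok eps c ->
  exists v : pt -> ax3 -> R, forall z, box 0 (pcs c - (2 * m).+1%:R * pcr c) z ->
  [/\ forall i b, derivable (fun w => v w i) z (ebas b),
      forall i b b', derivable (fun w => dv b v w i) z (ebas b') /\
        `|dd b' (fun w => dv b v w i) z| <= C / pcr c,
      forall i, `|v z i - pcu c z i| <= C * pcr c &
      forall b b', `|met v b b' z - met (pcu c) b b' z - pcsg c ^+ 2 * (a z ^+ 2 * (xi b * xi b'))| <=
        C * pcsg c ^+ 3]].
Proof.
pose X := 1 + `|xi false| + `|xi true|.
have X1 : 1 <= X by rewrite /X; have := normr_ge0 (xi false); have := normr_ge0 (xi true); lra.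
have xX : \forall t \near F, forall b, `|(fun _ : T => xi) t b| <= X.
  by apply: nearW => t b; rewrite /X; case: b; have := normr_ge0 (xi false); have := normr_ge0 (xi true); lra.
have hpar : \forall t \near F, [/\ 0 < sg t, sg t <= 1, 0 < mu t & mu t <= la t].
  by apply: nearW => t; split.
have utd : \forall t \near F, forall i b z, S t z -> derivable (fun w => ut t w i) z (ebas b).
  by apply: nearW => t i b z Sz; have [] := ut_derive i b Sz.
have Ca0 := Bd_ge0 aB.
have ha : famO F S 2 sg mu (fun t z => sg t * a z).
  exists Ca => //; apply: nearW => t; split; first exact: ltW.
  have Sm : S t `<=` box 0 smax.
    by move=> z /Sbox /box0P h; apply/box0P; exact: lt_le_trans (ssmax t).
  have h1 := Bd_scale (sg t) (@oS t) mu0_ge0 (Bd_sub Sm aB).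
  have mm : mu0 <= mu t by rewrite /mu ler_pdivlMr.
  have := Bd_lemu mu0_ge0 mm h1; rewrite (gtr0_norm (sg0 t)) mulrC; exact.
have [v [vd vO vdv vs vmet]] := prim_exists oS hpar utd ut_famOD c02 ut_nsq X1 xX ha.
have e1 t : 0 <= sg (t : T) * la t by rewrite mulr_ge0 // ltW.
have [C1 C10 h1] : exists2 C : R, 0 <= C & \forall t \near F, forall z, S t z -> forall (x : bool * bool) i,
    `|dd x.2 (fun w => dv x.1 (v t) w i) z| <= C * (sg t * la t).
  by apply: near_bound_ax => // x i; exact: (famO_bound ((vO x.1 i).2 x.2)).
have h1d : \forall t \near F, forall b i b' z, S t z -> derivable (fun w => dv b (v t) w i) z (ebas b').
  apply: near_bool => b; apply: near_ax3 => i; apply: near_bool => b'.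
  by apply: filterS (famO_derivable b' (vO b i).1) => t h z Sz; case: (h z Sz).
have e3 t : 0 <= sg (t : T) / la t by rewrite divr_ge0 // ltW.
have [C3 C30 h3] : exists2 C : R, 0 <= C & \forall t \near F, forall z, S t z -> forall (x : bool) i,
    `|v t z i - ut t z i| <= C * (sg t / la t).
  by apply: near_bound_ax => // x i; exact: (famO_bound (vs i)).
have e4 t : 0 <= sg (t : T) ^+ 2 * mu t / la t + sg t ^+ 3.
  apply: addr_ge0; last exact: ltW.
  by rewrite divr_ge0 ?(ltW (la_gt0 t)) // mulr_ge0 ?sqr_ge0 // ltW.
have [C4 C40 h4] : exists2 C : R, 0 <= C & \forall t \near F, forall z, S t z -> forall (x : bool * bool),
    `|met (v t) x.1 x.2 z - met (ut t) x.1 x.2 z - (sg t * a z) ^+ 2 * (xi x.1 * xi x.2)| <=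
      C * (sg t ^+ 2 * mu t / la t + sg t ^+ 3).
  by apply: near_bound_fin => // x; exact: (famO_bound (vmet x.1 x.2)).
have [e e0 he] : exists2 e : R, 0 < e & forall t, th t <= e -> _ := nearI (nearI vd h1d) (nearI h1 (nearI h3 h4)).
pose b := `|B|; have b0 : 0 <= b by exact: normr_ge0.
have nb0 : 0 <= (m + m)%:R * b by rewrite mulr_ge0.
pose C := 2 * C1 + (C3 + 2 * (m + m)%:R * b) + (2 * C4 + 12 * (m + m)%:R * b) + 1.
exists C, (Num.min e 1); split.
- by rewrite /C; lra.
- by rewrite lt_min e0 ltr01.
- by rewrite ge_min lexx orbT.
move=> c hc; pose t : T := exist _ (Num.min e 1, c) hc.
have bE : b = B by rewrite /b ger0_norm // (B0 t).
have [|[k1 k2] [k3 [k5 k6]]] := he t; first by rewrite /th /= ge_min lexx.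
have rc : 0 < pcr c := r0 t; have sgc : 0 < pcsg c := sg0 t; have sgc1 : pcsg c <= 1 := sg1 t.
exists (v t) => z Sz; have Szt : S t z by [].
split.
- by move=> i d; exact: k1.
- move=> i d d'; split; first exact: k2.
  apply: le_trans (k3 z Szt (d, d') i) _.
  have -> : sg t * la t = 2 / pcr c by rewrite /la /mu /r /=; field; rewrite !gt_eqF.
  by rewrite mulrA; apply: ler_wpM2r; [rewrite invr_ge0 ltW|rewrite /C; lra].
- move=> i; apply: (@le_trans _ _ ((C3 + 2 * (m + m)%:R * b) * pcr c)); last first.
    by apply: ler_wpM2r; [exact: ltW|rewrite /C; lra].
  rewrite -(subrKA (ut t z i)); apply: le_trans (ler_normD _ _) _; rewrite mulrDl.
  apply: lerD.
    apply: le_trans (k5 z Szt true i) _; apply: ler_wpM2l => //.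
    have -> : sg t / la t = pcsg c ^+ 2 / 2 * pcr c by rewrite /la /mu /r /sg /=; field; rewrite !gt_eqF.
    apply: ler_piMl; first exact: ltW.
    have : pcsg c ^+ 2 <= 1 by apply: exprn_ile1 => //; exact: ltW.
    lra.
  have zr : `|z| <= rho t by apply: ltW; apply: le_lt_trans (Srho Szt); rewrite lerDl mulr_ge0 // ltW.
  have [|B' hB] := @clamp_lips_exists R (s t) (rho t) B (fun w => u t w i) (rho0 t) (rhos t) _ (fun b w => @ud t i b w) (fun b w => @uB t i b w).
    exact: B0 t.
  have eU : u t (clamp (rho t) z) i = pcu c z i by rewrite clamp_id.
  rewrite -eU; apply: (smooth_close (ltW (r0 t)) hB) => w wz.
  apply: le_trans (lips_dist _ _ hB) _; rewrite bE.
  have -> : 2 * (m + m)%:R * B * pcr c = 2 * B * ((m + m)%:R * r t) by rewrite /r /=; ring.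
  by apply: ler_wpM2l => //; rewrite mulr_ge0 // (B0 t).
- move=> d d'; have k := k6 z Szt (d, d'); have k' := ut_met d d' Szt.
  rewrite (_ : sg t ^+ 2 * mu t / la t + sg t ^+ 3 = 2 * pcsg c ^+ 3) in k; last first.
    by rewrite /la /sg /=; field; rewrite !gt_eqF.
  have -> : met (v t) d d' z - met (pcu c) d d' z - pcsg c ^+ 2 * (a z ^+ 2 * (xi d * xi d')) =
     (met (v t) d d' z - met (ut t) d d' z - (pcsg c * a z) ^+ 2 * (xi d * xi d')) + (met (ut t) d d' z - met (pcu c) d d' z).
    by rewrite exprMn; move: (met _ _ _ _) (met _ _ _ _) (met _ _ _ _) => *; ring.
  apply: le_trans (ler_normD _ _) _; apply: le_trans (lerD k k') _.
  rewrite -bE /sg /= mulrA -mulrDl; apply: ler_wpM2r; last by rewrite /C; lra.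
  by rewrite exprn_ge0 // ltW.
Qed.

End PrimitiveFamily.

(** * Adding finite sums of primitive metrics *)

Section MetricIncrements.
Context {R : realType}.
Local Notation pt := 'rV[R]_2.

Definition C2on (s M : R) (u : pt -> ax3 -> R) : Prop := forall z, box 0 s z ->
  [/\ forall i b, derivable (fun w => u w i) z (ebas b),
      forall i b b', derivable (fun w => dv b u w i) z (ebas b') &
      forall i b b', `|dd b' (fun w => dv b u w i) z| <= M].

(** [C] and [e] are chosen before the map, its domain and its second derivative bound [M]. This is
    what allows many successive steps, along which [M] grows without control. *)
Definition prim_spec (smax B c0 : R) (a : pt -> R) (xi : bool -> R) (C e : R) : Prop :=
  forall sg u s M eta, 0 < sg -> sg <= e -> C2on s M u ->
  (forall i b z, box 0 s z -> `|dv b u z i| <= B) -> (forall z, box 0 s z -> c0 <= nsq u z) ->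
  0 < eta -> eta < s -> s <= smax ->
  exists v, exists2 M', C2on (s - eta) M' v & forall z, box 0 (s - eta) z ->
    (forall i, `|v z i - u z i| <= eta) /\
    (forall b b', `|met v b b' z - met u b b' z - sg ^+ 2 * (a z ^+ 2 * (xi b * xi b'))| <= C * sg ^+ 3).

Lemma prim_specP (smax B c0 Ca mu0 : R) (a : pt -> R) (xi : bool -> R) : 0 < c0 -> 0 <= mu0 ->
  Bd 2 (box 0 smax) Ca mu0 a -> exists C e : R, [/\ 1 <= C, 0 < e, e <= 1 & prim_spec smax B c0 a xi C e].
Proof.
move=> c00 mu00 aB.
have [C [e [C1 e0 e1 h]]] := @prim_once R B c0 smax Ca mu0 a xi c00 mu00 aB 3 isT.
exists C, e; split => // sg u s M eta sg0 sge hu hB hn eta0 etas ssm.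
have s30 : 0 < sg ^+ 3 by rewrite exprn_gt0.
pose N : R := (2 * 3).+1%:R; have N0 : 0 < N by rewrite ltr0n.
have C0 : 0 < C by exact: lt_le_trans C1.
(* The radius obeys three limits: displacement and loss of domain below [eta], second derivatives at
   most [sg^3 / r], and a mollification frequency above that of the amplitude. *)
pose r := Num.min (eta / (N + C)) (Num.min (sg ^+ 3 / (`|M| + 1)) (2 / (mu0 + 1))).
have NC0 : 0 < N + C by exact: addr_gt0.
have M0 : 0 < `|M| + 1 by rewrite ltr_wpDl.
have m0 : 0 < mu0 + 1 by rewrite ltr_wpDl.
have r0 : 0 < r by rewrite !lt_min !divr_gt0.
have r1 : r * (N + C) <= eta by rewrite -ler_pdivlMr // ge_min lexx.
have r2 : r * (`|M| + 1) <= sg ^+ 3 by rewrite -ler_pdivlMr // !ge_min lexx orbT.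
have r3 : r * (mu0 + 1) <= 2 by rewrite -ler_pdivlMr // !ge_min lexx !orbT.
have rN : N * r <= eta by have : 0 <= r * C := ltW (mulr_gt0 r0 C0); lra.
have rC : C * r <= eta by have : 0 <= r * N := ltW (mulr_gt0 r0 N0); lra.
have N1 : 1 <= N by rewrite ler1n.
have rr : r <= N * r by rewrite ler_peMl // ltW.
have [|v hv] := h (PCfg u s sg r).
  split; rewrite /=.
  - by split.
  - split => //; first by move: r3; lra.
    by apply: ltW; apply: le_lt_trans etas; exact: le_trans rN.
  - split; [by move=> i b z /hu[]|by move=> i b b' z /hu[]|move=> i b b' z /hu[_ _ k]].
    apply: le_trans (k i b b') _; rewrite ler_pdivlMr //; apply: le_trans r2.
    by rewrite mulrC; apply: ler_wpM2l; [exact: ltW|have := ler_norm M; lra].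
  - by [].
exists v, (C / r) => z hz.
  have [|h1 h2 _ _] := hv z.
    move: hz; rewrite !box0P /= -/N => hz; apply: lt_le_trans hz _; lra.
  by split => // i b b'; have [] := h2 i b b'.
have [|_ _ h3 h4] := hv z; last by split => // i; apply: le_trans (h3 i) _.
move: hz; rewrite !box0P /= -/N => hz; apply: lt_le_trans hz _; lra.
Qed.

Lemma prim_spec_le smax B c0 a xi C e C' e' : C <= C' -> e' <= e ->
  prim_spec smax B c0 a xi C e -> prim_spec smax B c0 a xi C' e'.
Proof.
move=> CC ee h sg u s M eta sg0 sge hu hB hn eta0 etas ssm.
have [v [M' h1 h2]] := h sg u s M eta sg0 (le_trans sge ee) hu hB hn eta0 etas ssm.
exists v, M' => // z /h2[h3 h4]; split => // b b'; apply: le_trans (h4 b b') _.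
by apply: ler_wpM2r => //; rewrite exprn_ge0 // ltW.
Qed.

Lemma uniform_fin (I : finType) (P : I -> R -> R -> Prop) :
  (forall i C e C' e', C <= C' -> e' <= e -> P i C e -> P i C' e') ->
  (forall i, exists C e, [/\ 1 <= C, 0 < e, e <= 1 & P i C e]) ->
  exists C e, [/\ 1 <= C, 0 < e, e <= 1 & forall i, P i C e].
Proof.
move=> mono h.
suff [C [e [h1 h2 h3 h4]]] : exists C e, [/\ 1 <= C, 0 < e, e <= 1 & forall i, i \in enum I -> P i C e].
  by exists C, e; split => // i; apply: h4; rewrite mem_enum.
elim: (enum I) => [|i l [C [e [h1 h2 h3 h4]]]]; first by exists 1, 1; split.
have [C' [e' [k1 k2 k3 k4]]] := h i.
exists (C + C'), (Num.min e e'); split.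
- by lra.
- by rewrite lt_min h2.
- by rewrite ge_min h3.
- move=> j; rewrite inE => /orP[/eqP ->|jl].
    by apply: mono k4; [lra|rewrite ge_min lexx orbT].
  by apply: mono (h4 j jl); [lra|rewrite ge_min lexx].
Qed.

Lemma sqr_dv_le (u : pt -> ax3 -> R) b i z : dv b u z i ^+ 2 <= met u b b z.
Proof.
rewrite /met /dot3 !expr2; move: (dv b u z) => p.
by have := sqr_ge0 (p ax_x); have := sqr_ge0 (p ax_y); have := sqr_ge0 (p ax_z); rewrite !expr2; case: i; lra.
Qed.

Lemma dv_le (u : pt -> ax3 -> R) b i z B : 0 <= B -> met u b b z <= B ^+ 2 -> `|dv b u z i| <= B.
Proof.
move=> B0 h; have := le_trans (sqr_dv_le u b i z) h.
by rewrite -(real_normK (num_real (dv b u z i))) ler_pXn2r.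
Qed.

(** The gain in determinant is [c] times the squared length of [y p - x q], hence nonnegative. Along
    a chain of steps the determinant can therefore drop only through the cubic errors. *)
Lemma det_rank_one (u : pt -> ax3 -> R) z (c x y : R) : 0 <= c ->
  nsq u z <= (met u false false z + c * (x * x)) * (met u true true z + c * (y * y))
    - (met u false true z + c * (x * y)) ^+ 2.
Proof.
move=> c0; rewrite nsqE /met /dot3; move: (dv false u z) (dv true u z) => p q.
have h (s t : R) : 0 <= c * (y * s - x * t) ^+ 2 by rewrite mulr_ge0 // sqr_ge0.
have := h (p ax_x) (q ax_x); have := h (p ax_y) (q ax_y); have := h (p ax_z) (q ax_z).
move: (p ax_x) (p ax_y) (p ax_z) (q ax_x) (q ax_y) (q ax_z) => p1 p2 p3 q1 q2 q3 h3 h2 h1.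
rewrite -subr_ge0; apply: le_trans (addr_ge0 (addr_ge0 h1 h2) h3) _.
by rewrite le_eqVlt; apply/orP; left; apply/eqP; ring.
Qed.

Lemma sum_flatten_nseq (I : finType) (h : I -> R) N :
  \sum_(i <- flatten (nseq N (enum I))) h i = N%:R * \sum_i h i.
Proof.
elim: N => [|N IH]; first by rewrite big_nil mul0r.
by rewrite /= big_cat /= IH big_enum /= -natr1 mulrDl mul1r addrC.
Qed.

Section Chain.
Variables (I : finType) (a : I -> pt -> R) (xi : I -> bool -> R) (smax B c0 D C e : R).
Hypotheses (B0 : 0 <= B) (D0 : 0 <= D) (C1 : 1 <= C) (e1 : e <= 1) (eC : C * e <= 1).
Hypothesis spec : forall i, prim_spec smax B c0 (a i) (xi i) C e.
Hypothesis aD : forall i b b' z, box 0 smax z -> `|a i z ^+ 2 * (xi i b * xi i b')| <= D.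
Let C' := C * (4 * (3 * B ^+ 2 + D) + 2).

(** [K] grows by at most [sg^2 D + C sg^3] per step and keeps the gradients below [B]; [ka] drops by
    at most [C' sg^3] and stays above [c0]. So the values of [B] and [c0] on which the constants of
    [prim_spec] depend remain valid along the whole list. The first step takes half of [eta] and
    leaves the other half to the tail. *)
Lemma chain (l : seq I) sg u s M eta K ka : 0 < sg -> sg <= e -> C2on s M u ->
  (forall b z, box 0 s z -> met u b b z <= K) -> K + (size l)%:R * (sg ^+ 2 * D + C * sg ^+ 3) <= B ^+ 2 ->
  (forall z, box 0 s z -> ka <= nsq u z) -> c0 + (size l)%:R * (C' * sg ^+ 3) <= ka ->
  0 < eta -> eta < s -> s <= smax ->
  exists v, exists2 M', C2on (s - eta) M' v & forall z, box 0 (s - eta) z ->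
    (forall i, `|v z i - u z i| <= eta) /\
    (forall b b', `|met v b b' z - met u b b' z - sg ^+ 2 * (\sum_(i <- l) a i z ^+ 2 * (xi i b * xi i b'))|
      <= (size l)%:R * (C * sg ^+ 3)).
Proof.
have B20 : 0 <= B ^+ 2 by exact: sqr_ge0.
move=> sg0 sge; have s30 : 0 < sg ^+ 3 by rewrite exprn_gt0.
have s20 : 0 < sg ^+ 2 by rewrite exprn_gt0.
have C0 : 0 < C by exact: lt_le_trans C1.
have q0 : 0 <= sg ^+ 2 * D + C * sg ^+ 3 by rewrite addr_ge0 ?mulr_ge0 // ltW.
have C'0 : 0 <= C' by rewrite mulr_ge0 ?addr_ge0 ?mulr_ge0 ?addr_ge0 ?mulr_ge0 // ltW.
have q1 : 0 <= C' * sg ^+ 3 by rewrite mulr_ge0 // ltW.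
elim: l u s M eta K ka => [|i l IH] u s M eta K ka hu hK hB hn hk eta0 etas ssm.
  exists u, M => [z hz|z hz]; first by apply: hu; move: hz; rewrite !box0P; lra.
  split => [i|b b']; first by rewrite subrr normr0 ltW.
  by rewrite big_nil mulr0 subrr subr0 normr0 mul0r.
have n0 : 0 <= (size l)%:R :> R by exact: ler0n.
have nq0 := mulr_ge0 n0 q0; have nq1 := mulr_ge0 n0 q1.
rewrite /= -natr1 mulrDl mul1r in hB; rewrite /= -natr1 mulrDl mul1r in hk.
have hBu j b z : box 0 s z -> `|dv b u z j| <= B.
  by move=> hz; apply: dv_le => //; apply: le_trans (hK b z hz) _; lra.
have hnu z : box 0 s z -> c0 <= nsq u z by move=> hz; apply: le_trans (hn z hz); lra.
have eta2 : 0 < eta / 2 by rewrite divr_gt0.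
have etas2 : eta / 2 < s by lra.
have [v [M' hv hv']] := @spec i _ _ _ _ _ sg0 sge hu hBu hnu eta2 etas2 ssm.
have sub z : box 0 (s - eta / 2) z -> box 0 s z by rewrite !box0P; lra.
have subm z : box 0 (s - eta / 2) z -> box 0 smax z by move=> /sub; rewrite !box0P => h; exact: lt_le_trans ssm.
have vK b z : box 0 (s - eta / 2) z -> met v b b z <= K + (sg ^+ 2 * D + C * sg ^+ 3).
  move=> hz; have [_ h] := hv' z hz; have {}h := h b b; have k := hK b z (sub z hz).
  have d := aD i b b (subm z hz).
  move: h; rewrite ler_norml => /andP[_ h]; move: d; rewrite ler_norml => /andP[_ d].
  have := ler_wpM2l (ltW s20) d; lra.
have vn z : box 0 (s - eta / 2) z -> ka - C' * sg ^+ 3 <= nsq v z.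
  move=> hz; have [_ h] := hv' z hz; have k := hn z (sub z hz).
  have mb b b' : `|met u b b' z + sg ^+ 2 * (a i z ^+ 2 * (xi i b * xi i b'))| <= 3 * B ^+ 2 + D.
    apply: le_trans (ler_normD _ _) _; apply: lerD.
      by apply: dot3_bound => j; apply: hBu; exact: sub.
    rewrite normrM (gtr0_norm s20); apply: le_trans (aD i b b' (subm z hz)).
    rewrite ler_piMl // exprn_ile1 ?(ltW sg0) //; exact: le_trans sge e1.
  have h' b b' : `|met v b b' z - (met u b b' z + sg ^+ 2 * (a i z ^+ 2 * (xi i b * xi i b')))| <= C * sg ^+ 3.
    by rewrite opprD addrA.
  have small : C * sg ^+ 3 <= 1.
    apply: le_trans eC; apply: ler_wpM2l; first exact: ltW.
    apply: (le_trans _ sge); rewrite exprS; apply: ler_piMr; first exact: ltW.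
    by apply: exprn_ile1; [exact: ltW|exact: le_trans sge e1].
  have := det_close (mb false false) (mb true true) (mb false true) (h' false false) (h' true true) (h' false true) small.
  rewrite -nsqE.
  have c0' : 0 <= sg ^+ 2 * a i z ^+ 2 by rewrite mulr_ge0 ?sqr_ge0.
  have := det_rank_one u z (xi i false) (xi i true) c0'; rewrite -!mulrA.
  move: k; rewrite /C'; move: (nsq u z) (nsq v z) (X in X - _) => x y w; lra.
have e2 : s - eta / 2 - eta / 2 = s - eta by field.
have k1 : K + (sg ^+ 2 * D + C * sg ^+ 3) + (size l)%:R * (sg ^+ 2 * D + C * sg ^+ 3) <= B ^+ 2 by lra.
have k2 : c0 + (size l)%:R * (C' * sg ^+ 3) <= ka - C' * sg ^+ 3 by lra.
have f1 : eta / 2 < s - eta / 2 by rewrite ltrBrDr -splitr.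
have f2 : s - eta / 2 <= smax by apply: le_trans _ ssm; rewrite gerBl ltW.
have [w [M'' hw hw']] := IH v (s - eta / 2) M' (eta / 2) _ _ hv vK k1 vn k2 eta2 f1 f2.
rewrite e2 in hw hw'.
exists w, M'' => // z hz; have [h1 h2] := hw' z hz.
have [|h3 h4] := hv' z.
  by move: hz; rewrite !box0P => hz; apply: lt_le_trans hz _; rewrite lerD2l lerN2 ler_pdivrMr // ler_peMr ?ler1n // ltW.
split => [j|b b'].
  rewrite -(subrKA (v z j)); apply: le_trans (ler_normD _ _) _.
  by rewrite [leRHS]splitr; exact: lerD (h1 j) (h3 j).
rewrite big_cons mulrDr /=.
have alg (x y w' p q P Q : R) : `|w' - y - q| <= Q -> `|y - x - p| <= P -> `|w' - x - (p + q)| <= Q + P.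
  move=> g1 g2; rewrite (_ : _ - _ - _ = (w' - y - q) + (y - x - p)); last by ring.
  by apply: le_trans (ler_normD _ _) _; exact: lerD.
by rewrite -natr1 mulrDl mul1r; apply: alg (h2 b b') (h4 b b').
Qed.

End Chain.

(** With [sg = N^(-1/2)] and every term repeated [N] times, the quadratic contributions sum to the
    full metric because [N sg^2 = 1], while the cubic errors sum to [C sg] times the number of
    terms. *)
Lemma add_metric (I : finType) (a : I -> pt -> R) (xi : I -> bool -> R) (smax : R) (u : pt -> ax3 -> R) (s M K ka e0 eta : R) :
  (forall i, exists Ca, exists2 mu0, 0 <= mu0 & Bd 2 (box 0 smax) Ca mu0 (a i)) ->
  C2on s M u -> (forall b z, box 0 s z -> met u b b z <= K) -> 0 < ka -> (forall z, box 0 s z -> ka <= nsq u z) ->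
  0 < e0 -> 0 < eta -> eta < s -> s <= smax ->
  exists v, exists2 M', C2on (s - eta) M' v & forall z, box 0 (s - eta) z ->
    (forall i, `|v z i - u z i| <= eta) /\
    (forall b b', `|met v b b' z - met u b b' z - \sum_i a i z ^+ 2 * (xi i b * xi i b')| <= e0).
Proof.
move=> ha hu hK ka0 hn e00 eta0 etas ssm.
have [D [_ [D1 _ _ aD]]] : exists D e : R, [/\ 1 <= D, 0 < e, e <= 1 & forall i,
    (fun i D e => forall b b' z, box 0 smax z -> `|a i z ^+ 2 * (xi i b * xi i b')| <= D) i D e].
  apply: uniform_fin => [i C e C' e' CC _ h b b' z hz|i]; first exact: le_trans (h b b' z hz) CC.
  have [Ca [mu0 _ h]] := ha i; have Ca0 := Bd_ge0 h.
  pose X := `|xi i false| + `|xi i true|.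
  have hX b : `|xi i b| <= X by rewrite /X; case: b; have := normr_ge0 (xi i false); have := normr_ge0 (xi i true); lra.
  have X0 := le_trans (normr_ge0 _) (hX true).
  exists (Ca ^+ 2 * (X * X) + 1), 1; split => //; first by rewrite lerDr mulr_ge0 ?sqr_ge0 ?mulr_ge0.
  move=> b b' z hz; rewrite normrM normrX normrM ler_wpDr //.
  apply: ler_pM; rewrite ?exprn_ge0 ?mulr_ge0 //; last exact: ler_pM.
  by rewrite lerXn2r // ?nnegrE //; exact: Bd_bound h hz.
have D0 : 0 <= D by exact: le_trans D1.
pose n : R := #|I|%:R; have n0 : 0 <= n by exact: ler0n.
have nD0 : 0 <= n * D by exact: mulr_ge0.
pose B := `|K| + n * D + 1; have B1 : 1 <= B by rewrite /B; have := normr_ge0 K; lra.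
have B0 : 0 <= B by exact: le_trans B1.
have BB : K + n * D + 1 <= B ^+ 2.
  by apply: (@le_trans _ _ B); [rewrite /B; have := ler_norm K; lra|rewrite expr2 ler_peMl].
pose c0 := ka / 2; have c00 : 0 < c0 by rewrite divr_gt0.
have [C [e [C1 ep0 e1 hspec]]] : exists C e : R, [/\ 1 <= C, 0 < e, e <= 1 & forall i,
    prim_spec smax B c0 (a i) (xi i) C e].
  apply: uniform_fin => [i C e C' e'|i]; first exact: prim_spec_le.
  by have [Ca [mu0 mu00 h]] := ha i; exact: prim_specP h.
have C0 : 0 < C by exact: lt_le_trans C1.
pose C' := C * (4 * (3 * B ^+ 2 + D) + 2).
have C'0 : 0 < C' by rewrite mulr_gt0 // ltr_wpDl // mulr_ge0 // addr_ge0 // mulr_ge0 // sqr_ge0.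
pose e' := Num.min e C^-1; have e'0 : 0 < e' by rewrite lt_min ep0 invr_gt0.
have e'1 : e' <= 1 by rewrite ge_min e1.
have eC : C * e' <= 1 by rewrite mulrC -ler_pdivlMr // div1r ge_min lexx orbT.
(* The amplitude threshold: admissible for each step, at most half of the determinant spent, at most
   1 of the slack in [B^2], and final error at most [e0]. *)
pose t := Num.min e' (Num.min (c0 / (n * C' + 1)) (Num.min (n * C + 1)^-1 (e0 / (n * C + 1)))).
have p1 : 0 < n * C' + 1 by rewrite ltr_wpDl // mulr_ge0 // ltW.
have p2 : 0 < n * C + 1 by rewrite ltr_wpDl // mulr_ge0 // ltW.
have t0 : 0 < t by rewrite !lt_min ep0 !invr_gt0 C0 p2 !divr_gt0.
pose N := (Num.truncn (t ^-2)).+1.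
have tN : t ^- 2 < N%:R.
  have h : 0 <= t ^- 2 by rewrite invr_ge0 exprn_ge0 // ltW.
  by have /andP[] := truncn_itv h.
have N0 : 0 < N%:R :> R by rewrite ltr0n.
pose sg := Num.sqrt (N%:R^-1 : R).
have sg0 : 0 < sg by rewrite sqrtr_gt0 invr_gt0.
have sg2 : sg ^+ 2 = N%:R^-1 by rewrite sqr_sqrtr // invr_ge0 ltW.
have sgt : sg <= t.
  rewrite -(ler_pXn2r (n := 2)) ?nnegrE ?(ltW sg0) ?(ltW t0) // sg2.
  by rewrite -[leRHS]invrK lef_pV2 ?posrE ?invr_gt0 ?exprn_gt0 // ltW.
have Nsg2 : N%:R * sg ^+ 2 = 1 by rewrite sg2 mulfV // gt_eqF.
have Nsg3 : N%:R * sg ^+ 3 = sg by rewrite exprSr mulrA Nsg2 mul1r.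
have s1 : sg * (n * C' + 1) <= c0 by rewrite -ler_pdivlMr //; apply: le_trans sgt _; rewrite !ge_min lexx orbT.
have s2 : sg * (n * C + 1) <= 1 by rewrite -ler_pdivlMr // div1r; apply: le_trans sgt _; rewrite !ge_min lexx !orbT.
have s3 : sg * (n * C + 1) <= e0 by rewrite -ler_pdivlMr //; apply: le_trans sgt _; rewrite !ge_min lexx !orbT.
have s4 : sg <= e' by apply: le_trans sgt _; rewrite ge_min lexx.
pose l := flatten (nseq N (enum I)).
have sl : (size l)%:R = N%:R * n.
  by rewrite /l size_flatten /shape map_nseq sumn_nseq -cardE natrM mulrC.
have suml (h : I -> R) : \sum_(i <- l) h i = N%:R * \sum_i h i.
  exact: sum_flatten_nseq.
have hB : K + (size l)%:R * (sg ^+ 2 * D + C * sg ^+ 3) <= B ^+ 2.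
  rewrite sl; have -> : N%:R * n * (sg ^+ 2 * D + C * sg ^+ 3) = n * (N%:R * sg ^+ 2) * D + n * C * (N%:R * sg ^+ 3) by ring.
  by rewrite Nsg2 Nsg3; lra.
have hk : c0 + (size l)%:R * (C' * sg ^+ 3) <= ka.
  rewrite sl; have -> : N%:R * n * (C' * sg ^+ 3) = n * C' * (N%:R * sg ^+ 3) by ring.
  by rewrite Nsg3; rewrite /c0 in s1 *; lra.
have spec' i : prim_spec smax B c0 (a i) (xi i) C e'.
  by apply: prim_spec_le (hspec i) => //; rewrite ge_min lexx.
have [v [M' hv hv']] := chain B0 D0 C1 e'1 eC spec' aD sg0 s4 hu hK hB hn hk eta0 etas ssm.
exists v, M' => // z /hv'[h1 h2]; split => // b b'; have := h2 b b'.
have e5 x : sg ^+ 2 * (N%:R * x) = x by rewrite mulrCA mulrA Nsg2 mul1r.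
rewrite suml e5 => h; apply: le_trans h _.
rewrite sl; have -> : N%:R * n * (C * sg ^+ 3) = n * C * (N%:R * sg ^+ 3) by ring.
by rewrite Nsg3; lra.
Qed.

End MetricIncrements.

(** * The initial map *)

Section MollifyC1.
Context {R : realType}.
Local Notation pt := 'rV[R]_2.

Lemma is_derive_close (f : pt -> R) z (v : pt) (d c e del : R) : 0 < del -> is_derive z v f d ->
  (forall t, `|t| < del -> `|f (t *: v + z) - f z - t * c| <= e * `|t|) -> `|d - c| <= e.
Proof.
move=> del0 [fd <-] h.
have fd' : (fun t : R => t^-1 *: (f (t *: v + z) - f z)) t @[t --> 0^'] --> 'D_v f z := fd.
have lim1 : (fun t : R => `|t^-1 *: (f (t *: v + z) - f z) - c|) t @[t --> 0^'] --> `|'D_v f z - c|.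
  by apply: cvg_norm; apply: cvgB fd' _; exact: cvg_cst.
apply: (ler_cvg_to lim1 (cvg_cst e)); near=> t.
have t0 : t != 0 by near: t; exact: nbhs_dnbhs_neq.
have te : `|t| < del by near: t; apply: dnbhs0_lt.
have -> : t^-1 *: (f (t *: v + z) - f z) - c = t^-1 * (f (t *: v + z) - f z - t * c).
  by rewrite /GRing.scale /=; field.
rewrite normrM normfV mulrC ler_pdivrMr ?normr_gt0 //; exact: h.
Unshelve. all: by end_near. Qed.

(** [p] has no Lipschitz bound, only a modulus of continuity. The derivative of the mollified
    function is therefore compared with [p] through increments of [f], each of which is [t] times a
    value of [p] at a nearby point. All small radii work, so several functions can share one. *)
Lemma mollify_C1 (f : pt -> R) (p : bool -> pt -> R) (s s' B e : R) :
  0 <= s' -> s' < s -> 0 < e ->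
  (forall b z, box 0 s z -> is_derive z (ebas b) f (p b z)) ->
  (forall b z, box 0 s z -> `|p b z| <= B) ->
  (forall e, 0 < e -> exists2 d, 0 < d & forall b z w, box 0 s z -> box 0 s w -> `|z - w| <= d -> `|p b z - p b w| <= e) ->
  exists r0, [/\ 0 < r0 & forall r, 0 < r -> r <= r0 -> exists2 v : pt -> R,
    exists C, Bd 3 setT C (2 / r) v & forall z, box 0 s' z -> `|v z - f z| <= e /\ forall b, `|dd b v z - p b z| <= e].
Proof.
move=> s'0 s's e0 fd pB pu.
pose rho := (s + s') / 2; have rho0 : 0 <= rho by rewrite /rho; lra.
have rs : rho < s by rewrite /rho; lra.
have B0 : 0 <= B.
  by apply: le_trans (normr_ge0 (p true 0)) (pB _ _ _); apply/box0P; rewrite normr0; exact: le_lt_trans s's.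
have fder b z : box 0 s z -> derivable f z (ebas b) by move=> /(fd b)[].
have fB b z : box 0 s z -> `|dd b f z| <= B by move=> hz; rewrite (is_derive_dd (fd b z hz)); exact: pB.
have [Bf hf] := clamp_lips_exists rho0 rs B0 fder fB.
have [d d0 hd] := pu e e0.
pose q := Num.min d (rho - s'); have q0 : 0 < q by rewrite lt_min d0 /rho; lra.
exists (Num.min (q / 16) (e / (16 * B + 1))); split.
  by rewrite lt_min !divr_gt0 // ltr_wpDl // mulr_ge0.
move=> r r0; rewrite le_min => /andP[rq re].
have rq' : 16 * r <= q by rewrite mulrC -ler_pdivlMr.
have re' : r * (16 * B + 1) <= e by rewrite -ler_pdivlMr // ltr_wpDl // mulr_ge0.
have qd : q <= d by rewrite ge_min lexx.
have qr : q <= rho - s' by rewrite ge_min lexx orbT.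
have hB := smooth_Bd_global r0 hf (isT : (3 <= 4)%N) (isT : (3 <= 4)%N).
exists (smooth 4 4 r (fun z => f (clamp rho z))); first by exists Bf.
have n8 : (4 + 4)%:R = 8 :> R by [].
move=> z /box0P hz; have zr : `|z| <= rho by apply: ltW; apply: lt_trans hz _; rewrite /rho; lra.
split.
  have eU : f (clamp rho z) = f z by rewrite clamp_id.
  rewrite -eU; apply: (smooth_close (ltW r0) hf) => w wz.
  apply: le_trans (lips_dist _ _ hf) _; rewrite n8 in wz.
  have : 2 * B * `|w - z| <= 2 * B * (8 * r) by rewrite ler_wpM2l // mulr_ge0.
  have := ltW r0; lra.
move=> b; apply: (@is_derive_close _ z (ebas b) _ _ _ (q / 2)); first exact: divr_gt0.
  apply: derivable_dd; exact: Bd_derivable hB I.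
move=> t tq.
have := @smooth_line_taylor R _ _ _ _ _ _ 4 4 r b z t (t * p b z) (e * `|t|) (ltW r0) hf (lips_const 0).
rewrite smooth_const mulr0 subr0; apply => w; rewrite n8 => wz; rewrite ?mulr0 subr0.
have w1 : `|w| <= s' + q / 2.
  by rewrite -(subrK z w); apply: le_trans (ler_normD _ _) _; lra.
have w2 : `|w| <= rho by lra.
have w3 : `|t *: ebas b + w| <= rho.
  by apply: le_trans (ler_normD _ _) _; rewrite norm_ebas; lra.
rewrite !clamp_id //.
have [|x x01 ->] := @mvt_line R f (p b) b w t.
  move=> x x01; apply: fd; apply/box0P; apply: le_lt_trans rs; exact: norm_segment.
have w4 := norm_segment x01 w2 w3; have [x0 x1] := andP x01.
rewrite -mulrBr normrM mulrC ler_wpM2r //; apply: hd.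
- by apply/box0P; exact: le_lt_trans rs.
- by apply/box0P; exact: le_lt_trans rs.
rewrite -addrA; apply: le_trans (ler_normD _ _) _; rewrite norm_ebas normrM ger0_norm //.
have : x * `|t| <= `|t| by apply: ler_piMl.
lra.
Qed.

End MollifyC1.

(** * Decomposition into primitive metrics *)

Section MetricDecomposition.
Context {R : realType}.
Local Notation pt := 'rV[R]_2.

(* [y ^+ k i * (1 - y) ^+ l i] is the law of a random walk with [n] steps [+h] (probability [y]) or [-h];
   as [n h] stays fixed the slopes stay bounded while the variance tends to [0]. *)
Lemma slope_weights (n : nat) (h : R) : exists (I : finType) (k l : I -> nat) (eta : I -> R), forall y : R,
  [/\ \sum_i y ^+ k i * (1 - y) ^+ l i = 1,
      \sum_i y ^+ k i * (1 - y) ^+ l i * eta i = n%:R * h * (2 * y - 1) &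
      \sum_i y ^+ k i * (1 - y) ^+ l i * eta i ^+ 2 =
        (n%:R * h * (2 * y - 1)) ^+ 2 + 4 * n%:R * h ^+ 2 * (y * (1 - y))].
Proof.
elim: n => [|n [I [k [l [eta IH]]]]].
  exists unit, (fun=> 0%N), (fun=> 0%N), (fun=> 0) => y.
  by rewrite !big_const card_unit /= !addr0 !expr0; split; ring.
exists (I * bool)%type, (fun i : I * bool => k i.1 + i.2)%N, (fun i : I * bool => l i.1 + ~~ i.2)%N,
  (fun i : I * bool => eta i.1 + (if i.2 then h else - h)) => y.
have [h1 h2 h3] := IH y.
have sp (F : I -> bool -> R) : \sum_(i : I * bool) F i.1 i.2 = \sum_i (F i true + F i false).
  by rewrite -(pair_bigA _ F) /=; apply: eq_bigr => i _; rewrite big_bool.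
split.
- rewrite (sp (fun i b => y ^+ (k i + b) * (1 - y) ^+ (l i + ~~ b))) -[RHS]h1.
  by apply: eq_bigr => i _; rewrite /= addn0 addn1 addn0 addn1 !exprS; ring.
- rewrite (sp (fun i b => y ^+ (k i + b) * (1 - y) ^+ (l i + ~~ b) * (eta i + (if b then h else - h)))).
  transitivity (\sum_i (y ^+ k i * (1 - y) ^+ l i * eta i + h * (2 * y - 1) * (y ^+ k i * (1 - y) ^+ l i))).
    by apply: eq_bigr => i _; rewrite /= addn0 addn1 addn0 addn1 !exprS; ring.
  by rewrite big_split /= -mulr_sumr h1 h2 -natr1; ring.
- rewrite (sp (fun i b => y ^+ (k i + b) * (1 - y) ^+ (l i + ~~ b) * (eta i + (if b then h else - h)) ^+ 2)).
  transitivity (\sum_i (y ^+ k i * (1 - y) ^+ l i * eta i ^+ 2 + (2 * h * (2 * y - 1) * (y ^+ k i * (1 - y) ^+ l i * eta i)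
     + h ^+ 2 * (y ^+ k i * (1 - y) ^+ l i)))).
    by apply: eq_bigr => i _; rewrite /= addn0 addn1 addn0 addn1 !exprS; ring.
  by rewrite !big_split /= -!mulr_sumr h1 h2 h3 -natr1; ring.
Qed.

(** Divided by [P], the matrix asks for a law of slopes with mean [Q / P], the direction of slope
    [eta] being [(1, eta)]. The walk of [slope_weights] has that mean and a small variance, and the
    positive surplus in the last entry goes to the direction [(0, 1)]. The weights are polynomials
    in [y], hence as regular as [P] and [Q]. *)
Lemma metric_decomposition (S : set pt) (C mu c1 c2 : R) (P Q W : pt -> R) : open S -> 0 <= mu -> 0 < c1 -> 0 < c2 ->
  Bd 2 S C mu P -> Bd 2 S C mu Q -> Bd 2 S C mu W ->
  (forall z, S z -> c1 <= P z) -> (forall z, S z -> c2 <= P z * W z - Q z ^+ 2) ->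
  exists (I : finType) (a : I -> pt -> R) (xi : I -> bool -> R),
  (forall i, exists Ca, Bd 2 S Ca mu (a i)) /\
  forall z, S z -> [/\ \sum_i a i z ^+ 2 * (xi i false * xi i false) = P z,
      \sum_i a i z ^+ 2 * (xi i false * xi i true) = Q z & \sum_i a i z ^+ 2 * (xi i true * xi i true) = W z].
Proof.
move=> oS mu0 c10 c20 hP hQ hW Pc det.
have C0 := Bd_ge0 hP; pose D := C + 1; have D0 : 0 < D by exact: ltr_wpDl.
pose B2 (f : pt -> R) := exists Cf, Bd 2 S Cf mu f.
have bc c : B2 (fun=> c) by exists `|c|; exact: Bd_const.
have ba f g : B2 f -> B2 g -> B2 (fun z => f z + g z).
  by move=> [C1 h1] [C2 h2]; exists (C1 + C2); exact: Bd_add.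
have bm f g : B2 f -> B2 g -> B2 (fun z => f z * g z).
  by move=> [C1 h1] [C2 h2]; exists (2 ^+ 2 * (C1 * C2)); exact: Bd_mul.
have bo f : B2 f -> B2 (fun z => - f z) by move=> [C1 h1]; exists C1; exact: Bd_opp.
have bx f k : B2 f -> B2 (fun z => f z ^+ k).
  move=> hf; elim: k => [|k IH]; first exact: bc.
  have [C1 h1] := bm _ _ hf IH; exists C1; apply: Bd_ext oS _ h1.
  by move=> z _; rewrite exprS.
have bi f c : 0 < c -> (forall z, S z -> c <= f z) -> B2 f -> B2 (fun z => (f z)^-1).
  by move=> c0 fc [C1 h1]; have [C2 _ h] := Bd_inv 2 C1 c0; exists C2; exact: h h1 fc.
have bs f c : 0 < c -> (forall z, S z -> c <= f z) -> B2 f -> B2 (fun z => Num.sqrt (f z)).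
  by move=> c0 fc [C1 h1]; have [C2 _ h] := Bd_sqrt 2 C1 c0; exists C2; exact: h h1 fc.
have bP : B2 P by exists C. have bQ : B2 Q by exists C. have bW : B2 W by exists C.
(* [X] bounds the mean slope [Q / P]. *)
pose X := D / c1; have X0 : 0 < X by rewrite divr_gt0.
(* Chosen so that the variance term [4 n h^2 y (1 - y) P] is at most [c2 / (2 D)], half of the lower
   bound for the Schur complement [W - Q^2 / P]. *)
pose n := (Num.truncn (8 * X ^+ 2 * D ^+ 2 / c2)).+1.
have n0 : 0 < n%:R :> R by rewrite ltr0n.
have hn : 8 * X ^+ 2 * D ^+ 2 <= n%:R * c2.
  rewrite -ler_pdivrMr //; apply: ltW; rewrite /n.
  have h : 0 <= 8 * X ^+ 2 * D ^+ 2 / c2 by rewrite divr_ge0 ?(ltW c20) // mulr_ge0 ?sqr_ge0 // mulr_ge0 ?sqr_ge0.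
  by have /andP[] := truncn_itv h.
pose h := 2 * X / n%:R.
have nh : n%:R * h = 2 * X by rewrite /h mulrCA mulfV ?mulr1 // gt_eqF.
have [I [k [l [eta hw]]]] := slope_weights n h.
(* Solves [2 X (2 y - 1) = Q / P]. As slopes up to [2 X] are allowed, [y] stays in [[1/4, 3/4]]: the
   weights are bounded below and their square roots are differentiable. *)
pose y z := 1 / 2 + (4 * X)^-1 * (Q z * (P z)^-1).
have by_ : B2 y by apply: (ba _ _ (bc (1 / 2))); apply: (bm _ _ (bc _)); apply: (bm _ _ bQ); exact: bi Pc bP.
have PD z : S z -> P z <= D.
  by move=> Sz; have := Bd_bound hP Sz; have := ler_norm (P z); rewrite /D; lra.
have P0 z : S z -> 0 < P z by move=> Sz; exact: lt_le_trans (Pc z Sz).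
have yq z : S z -> 2 * X * (2 * y z - 1) = Q z / P z.
  by move=> Sz; rewrite /y; field; rewrite !gt_eqF // P0.
have yb z : S z -> 1 / 4 <= y z <= 3 / 4.
  move=> Sz; have : `|Q z / P z| <= X.
    rewrite normrM normfV (gtr0_norm (P0 z Sz)) /X ler_pdivrMr ?P0 // mulrAC ler_pdivlMr //.
    apply: ler_pM => //; first exact: ltW.
      by apply: le_trans (Bd_bound hQ Sz) _; rewrite /D lerDl.
    exact: Pc.
  rewrite ler_norml -(yq z Sz) => /andP[q1 q2].
  have a1 : X * (1 - 4 * y z) <= 0 by lra.
  have a2 : X * (4 * y z - 3) <= 0 by lra.
  by move: a1 a2; rewrite !pmulr_rle0 // => a1 a2; apply/andP; split; lra.
pose A i z := P z * (y z ^+ k i * (1 - y z) ^+ l i).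
(* What the law of slopes leaves of the last entry: the Schur complement minus the variance. *)
pose E z := W z - Q z * (Q z * (P z)^-1) - (4 * n%:R * h ^+ 2) * (y z * (1 - y z) * P z).
have bA i : B2 (A i).
  by apply: (bm _ _ bP); apply: bm; [exact: bx|apply: bx; exact: ba _ _ (bc 1) (bo _ by_)].
have cA i z : S z -> c1 * ((1 / 4) ^+ k i * (1 / 4) ^+ l i) <= A i z.
  move=> Sz; have /andP[y1 y2] := yb z Sz.
  have q (m : nat) : 0 <= (1 / 4 : R) ^+ m by rewrite exprn_ge0 // divr_ge0.
  apply: ler_pM; rewrite ?mulr_ge0 ?(ltW c10) ?q ?Pc //; apply: ler_pM; rewrite ?q //.
    by apply: lerXn2r => //; rewrite nnegrE; lra.
  by apply: lerXn2r; rewrite ?nnegrE; lra.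
have A0 i : 0 < c1 * ((1 / 4) ^+ k i * (1 / 4) ^+ l i) by rewrite !mulr_gt0 // exprn_gt0 // divr_gt0.
have bE : B2 E.
  have b1 : B2 (fun z => y z * (1 - y z) * P z) by apply: (bm _ _ _ bP); exact: bm _ _ by_ (ba _ _ (bc 1) (bo _ by_)).
  have b2 : B2 (fun z => Q z * (Q z * (P z)^-1)) by apply: (bm _ _ bQ); apply: (bm _ _ bQ); exact: bi Pc bP.
  exact: ba _ _ (ba _ _ bW (bo _ b2)) (bo _ (bm _ _ (bc _) b1)).
have E0 : 0 < c2 / (2 * D) by rewrite divr_gt0 // mulr_gt0.
have cE z : S z -> c2 / (2 * D) <= E z.
  move=> Sz; have p0 := P0 z Sz.
  have e1 : c2 / D <= W z - Q z * (Q z * (P z)^-1).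
    have -> : W z - Q z * (Q z * (P z)^-1) = (P z * W z - Q z ^+ 2) / P z by field; rewrite gt_eqF.
    apply: ler_pM; rewrite ?(ltW c20) ?invr_ge0 ?(ltW D0) ?det //.
    by rewrite lef_pV2 ?posrE // PD.
  have e2 : 4 * n%:R * h ^+ 2 = 16 * X ^+ 2 / n%:R by rewrite /h; field; rewrite gt_eqF.
  have e3 : y z * (1 - y z) * P z <= D / 4.
    have y1 : y z * (1 - y z) <= 1 / 4 by have := sqr_ge0 (y z - 1 / 2); rewrite expr2; lra.
    have y0 : 0 <= y z * (1 - y z) by have /andP[a1 a2] := yb z Sz; rewrite mulr_ge0 //; lra.
    have := ler_pM y0 (ltW p0) y1 (PD z Sz); lra.
  have e4 : 16 * X ^+ 2 / n%:R * (D / 4) <= c2 / (2 * D).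
    rewrite ler_pdivlMr ?mulr_gt0 //.
    have -> : 16 * X ^+ 2 / n%:R * (D / 4) * (2 * D) = 8 * X ^+ 2 * D ^+ 2 / n%:R by field; rewrite gt_eqF.
    by rewrite ler_pdivrMr // (mulrC c2).
  have q0 : 0 <= 16 * X ^+ 2 / n%:R by rewrite divr_ge0 // mulr_ge0 ?sqr_ge0.
  rewrite /E e2; have := le_trans (ler_wpM2l q0 e3) e4.
  have : c2 / D = 2 * (c2 / (2 * D)) by field; rewrite gt_eqF.
  move: e1; move: (_ * (_ * P z)) (c2 / D) (c2 / (2 * D)) => u v w; lra.
pose a (i : I + unit) z := match i with inl i => Num.sqrt (A i z) | inr _ => Num.sqrt (E z) end.
pose xi (i : I + unit) (b : bool) : R := match i with inl i => if b then eta i else 1 | inr _ => b%:R end.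
exists (I + unit)%type, a, xi; split.
  by case=> [i|[]]; [exact: (bs _ _ (A0 i) (cA i) (bA i))|exact: (bs _ _ E0 cE bE)].
move=> z Sz; have p0 := P0 z Sz; have [w1 w2 w3] := hw (y z).
have sa i : Num.sqrt (A i z) ^+ 2 = A i z by rewrite sqr_sqrtr //; exact: le_trans (ltW (A0 i)) (cA i z Sz).
have se : Num.sqrt (E z) ^+ 2 = E z by rewrite sqr_sqrtr //; exact: le_trans (ltW E0) (cE z Sz).
have tot b b' : \sum_i a i z ^+ 2 * (xi i b * xi i b') =
   P z * (\sum_i (y z ^+ k i * (1 - y z) ^+ l i) * (xi (inl i) b * xi (inl i) b')) + E z * (b%:R * b'%:R).
  rewrite big_sumType /= big_const card_unit /= addr0 se; congr (_ + _).
  by rewrite mulr_sumr; apply: eq_bigr => i _; rewrite sa /A -!mulrA.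
rewrite !tot /= !mulr0 ?mul0r ?mulr0 !mulr1 !addr0; split.
- by rewrite (eq_bigr (fun i => y z ^+ k i * (1 - y z) ^+ l i)) ?w1 ?mulr1 // => i _; rewrite !mulr1.
- rewrite (eq_bigr (fun i => y z ^+ k i * (1 - y z) ^+ l i * eta i)); last by move=> i _; rewrite mul1r.
  by rewrite w2 nh yq // mulrCA mulfV ?mulr1 // gt_eqF.
- rewrite (eq_bigr (fun i => y z ^+ k i * (1 - y z) ^+ l i * eta i ^+ 2)); last by move=> i _; rewrite expr2.
  by rewrite w3 nh yq // /E; field; rewrite gt_eqF.
Qed.

End MetricDecomposition.

Lemma le_sum3 {R : realType} (a b c : R) : 0 <= a -> 0 <= b -> 0 <= c ->
  [/\ a <= a + b + c, b <= a + b + c & c <= a + b + c].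
Proof. by move=> *; split; lra. Qed.

Lemma bool_ax3_bounded {R : realType} (C : bool * ax3 -> R) : (forall x, 0 <= C x) -> exists T, forall x, C x <= T.
Proof.
move=> C0; pose D b := C (b, ax_x) + C (b, ax_y) + C (b, ax_z).
have CD b i : C (b, i) <= D b by have [h1 h2 h3] := le_sum3 (C0 (b, ax_x)) (C0 (b, ax_y)) (C0 (b, ax_z)); case: i.
have D0 b : 0 <= D b by exact: le_trans (C0 _) (CD b ax_x).
exists (D true + D false) => -[b i]; apply: le_trans (CD b i) _.
by case: b; [rewrite lerDl|rewrite lerDr].
Qed.

Lemma half_close {R : realType} (c x y w : R) : c <= x -> x - w <= y -> w <= c / 2 -> c / 2 <= y.
Proof. by move=> *; lra. Qed.

(** * From a strictly short map to the start of the iteration *)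

Section ShortInitial.
Context {R : realType}.
Local Notation pt := 'rV[R]_2.
Variables (g : bool -> bool -> pt -> R) (Bg Lg : R).
Hypothesis hg : forall a b, lips Bg Lg (g a b).
Hypothesis gsym : forall z, g true false z = g false true z.
Variables (ub : pt -> ax3 -> R) (p : bool -> pt -> ax3 -> R) (s B c1 c2 ka : R).
Hypotheses (c10 : 0 < c1) (c20 : 0 < c2) (ka0 : 0 < ka).
Hypothesis ubd : forall b i z, box 0 s z -> is_derive z (ebas b) (fun w => ub w i) (p b z i).
Hypothesis pB : forall b i z, box 0 s z -> `|p b z i| <= B.
Hypothesis pu : forall e, 0 < e -> exists2 d, 0 < d & forall b i z w, box 0 s z -> box 0 s w ->
  `|z - w| <= d -> `|p b z i - p b w i| <= e.
Local Notation E a b z := (g a b z - dot3 (p a z) (p b z)).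
Hypothesis E1 : forall z, box 0 s z -> c1 <= E false false z.
Hypothesis E2 : forall z, box 0 s z -> c2 <= E false false z * E true true z - E false true z ^+ 2.
Hypothesis pk : forall z, box 0 s z ->
  ka <= dot3 (p false z) (p false z) * dot3 (p true z) (p true z) - dot3 (p false z) (p true z) ^+ 2.

(** Strict shortness leaves room: after mollification and subtraction of [sg0^2 Hres], the defect is
    still uniformly positive definite and can be added as a sum of primitive metrics. What remains
    is [sg0^2 Hres] up to a tolerance chosen after [sg0]; the second derivatives are whatever
    results. *)
Lemma short_initial (s0 e eta : R) : 0 < s0 -> s0 < s -> 0 < e -> 0 < eta ->
  exists sg0 M u0, [/\ 0 < sg0, sg0 <= e, C2on s0 M u0,
    forall z a b, box 0 s0 z -> `|g a b z - met u0 a b z - sg0 ^+ 2 * Hres a b| <= e * sg0 ^+ 2 &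
    forall z i, box 0 s0 z -> `|u0 z i - ub z i| <= eta].
Proof.
move=> s00 s0s e0 eta0; pose s' := (s0 + s) / 2.
have s's : s' < s by rewrite /s'; lra.
have s0s' : s0 < s' by rewrite /s'; lra.
have s'0 : 0 < s' by lra.
have B0 : 0 <= B.
  by apply: le_trans (normr_ge0 (p true 0 ax_x)) (pB _ _ _); apply/box0P; rewrite normr0; lra.
have Bg0 : 0 <= Bg by have [] := lips_ge0 (hg true true).
have Lg0 : 0 <= Lg by have [] := lips_ge0 (hg true true).
have B20 : 0 <= B ^+ 2 by exact: sqr_ge0.
pose BE := Bg + 3 * B ^+ 2; have BE0 : 0 <= BE by rewrite addr_ge0 // mulr_ge0.
have q1 : 0 < 4 * BE + 2 by rewrite ltr_wpDl // mulr_ge0.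
have q2 : 0 < 4 * (3 * B ^+ 2) + 2 by rewrite ltr_wpDl // !mulr_ge0.
pose tau3 := Num.min 1 (Num.min (c1 / 2) (c2 / 2 / (4 * BE + 2))).
have tau30 : 0 < tau3 by rewrite !lt_min ltr01 !divr_gt0.
have t1 : tau3 <= 1 by rewrite ge_min lexx.
have t2 : tau3 <= c1 / 2 by rewrite !ge_min lexx orbT.
have t3 : tau3 * (4 * BE + 2) <= c2 / 2 by rewrite -ler_pdivlMr // !ge_min lexx !orbT.
pose tau := tau3 / 3; have tau0 : 0 < tau by rewrite divr_gt0.
have tau3E : tau + tau + tau = tau3 by rewrite /tau; field.
(* Fixed before the radius and before the number of steps, so that both can be made precise relative
   to [sg0^2]. *)
pose sg0 := Num.min e (Num.min tau 1).
have sg00 : 0 < sg0 by rewrite !lt_min e0 tau0 ltr01.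
have sge : sg0 <= e by rewrite ge_min lexx.
have sgt : sg0 <= tau by rewrite !ge_min lexx orbT.
have sg1 : sg0 <= 1 by rewrite !ge_min lexx !orbT.
have sg20 : 0 < sg0 ^+ 2 by rewrite exprn_gt0.
have sg2 : sg0 ^+ 2 <= tau by rewrite expr2; apply: (le_trans _ sgt); rewrite ler_piMl // ltW.
pose kt := Num.min tau (Num.min 1 (ka / 2 / (4 * (3 * B ^+ 2) + 2))).
have kt0 : 0 < kt by rewrite !lt_min tau0 ltr01 !divr_gt0.
have k1 : kt <= tau by rewrite ge_min lexx.
have k2 : kt <= 1 by rewrite !ge_min lexx orbT.
have k3 : kt * (4 * (3 * B ^+ 2) + 2) <= ka / 2 by rewrite -ler_pdivlMr // !ge_min lexx !orbT.
have q3 : 0 < 6 * (B + 1) by rewrite mulr_gt0 // ltr_wpDl.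
pose e1 := Num.min (kt / (6 * (B + 1))) (Num.min 1 (eta / 2)).
have e10 : 0 < e1 by rewrite !lt_min ltr01 !divr_gt0.
have e11 : 6 * (B + 1) * e1 <= kt by rewrite mulrC -ler_pdivlMr // ge_min lexx.
have e12 : e1 <= 1 by rewrite !ge_min lexx orbT.
have e13 : e1 <= eta / 2 by rewrite !ge_min lexx !orbT.
have /choice[r0 hr0] : forall i : ax3, exists r0, 0 < r0 /\ forall r, 0 < r -> r <= r0 -> exists v : pt -> R,
    (exists C, Bd 3 setT C (2 / r) v) /\ forall z, box 0 s' z -> `|v z - ub z i| <= e1 /\ forall b, `|dd b v z - p b z i| <= e1.
  move=> i.
  have [r0 [r00 h]] := @mollify_C1 R (fun w => ub w i) (fun b z => p b z i) s s' B e1 (ltW s'0) s's e10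
    (fun b z => @ubd b i z) (fun b z => @pB b i z) (fun e e0 => let: ex_intro2 d d0 hd := pu e0 in
       ex_intro2 _ _ d d0 (fun b z w => hd b i z w)).
  by exists r0; split => // r rp rr; have [v hv hv'] := h r rp rr; exists v.
have tol0 : 0 < Num.min tau (e * sg0 ^+ 2 / 2) by rewrite lt_min tau0 divr_gt0 // mulr_gt0.
have q4 : 0 < 16 * Lg + 1 by rewrite ltr_wpDl // mulr_ge0.
(* One radius for the metric and the three components; [16 * Lg * r] bounds the mollification error
   of [g], four averages being taken in each direction. *)
pose r := Num.min (Num.min tau (e * sg0 ^+ 2 / 2) / (16 * Lg + 1)) (Num.min (r0 ax_x) (Num.min (r0 ax_y) (r0 ax_z))).
have r0p i : 0 < r0 i by have [] := hr0 i.
have rp : 0 < r by rewrite !lt_min !r0p divr_gt0.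
have rr i : r <= r0 i by rewrite /r; case: i; rewrite !ge_min lexx ?orbT.
have rg : 16 * Lg * r <= Num.min tau (e * sg0 ^+ 2 / 2).
  have : r * (16 * Lg + 1) <= Num.min tau (e * sg0 ^+ 2 / 2) by rewrite -ler_pdivlMr // ge_min lexx.
  by have := rp; move: (Num.min _ _) => x; lra.
have /choice[v hv] : forall i : ax3, exists v : pt -> R,
    (exists C, Bd 3 setT C (2 / r) v) /\ forall z, box 0 s' z -> `|v z - ub z i| <= e1 /\ forall b, `|dd b v z - p b z i| <= e1.
  by move=> i; have [_ h] := hr0 i; exact: h r rp (rr i).
pose u1 (z : pt) i := v i z.
pose Sg a b := smooth 4 4 r (g a b).
have Sgc a b z : `|Sg a b z - g a b z| <= Num.min tau (e * sg0 ^+ 2 / 2).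
  apply: (smooth_close (ltW rp) (hg a b)) => w wz; apply: le_trans (lips_dist _ _ (hg a b)) _.
  apply: le_trans _ rg; rewrite (_ : (4 + 4)%:R = 8 :> R) // in wz.
  have : 2 * Lg * `|w - z| <= 2 * Lg * (8 * r) by rewrite ler_wpM2l // mulr_ge0.
  lra.
have SgB a b : Bd 2 setT Bg (2 / r) (Sg a b).
  exact: smooth_Bd_global rp (hg a b) (isT : (2 <= 4)%N) (isT : (2 <= 4)%N).
have mu0 : 0 <= 2 / r by rewrite divr_ge0 // ltW.
have oT : open (setT : set pt) by exact: openT.
have dvB b i : exists C, Bd 2 setT C (2 / r) (fun z => dv b u1 z i).
  by have [[C hC] _] := hv i; exists (C * (2 / r)); exact: Bd_dd b hC.
have metB a b : exists C, Bd 2 setT C (2 / r) (met u1 a b).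
  have m i : exists C, Bd 2 setT C (2 / r) (fun z => dv a u1 z i * dv b u1 z i).
    have [C h] := dvB a i; have [C' h'] := dvB b i.
    by exists (2 ^+ 2 * (C * C')); exact: Bd_mul.
  have [C h] := m ax_x; have [C' h'] := m ax_y; have [C'' h''] := m ax_z.
  by exists (C + C' + C''); exact: (Bd_add oT (Bd_add oT h h') h'').
(* The metric to add. The mollified metric stands in for [g] because [metric_decomposition] requires
   two derivatives. *)
pose G a b z := Sg a b z - met u1 a b z - sg0 ^+ 2 * Hres a b.
have GB a b : exists C, Bd 2 setT C (2 / r) (G a b).
  have [C h] := metB a b; eexists.
  exact: (Bd_add oT (Bd_add oT (SgB a b) (Bd_opp oT h)) (Bd_opp oT (Bd_const 2 (sg0 ^+ 2 * Hres a b) oT mu0))).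
have hp b i z : box 0 s' z -> `|dv b u1 z i - p b z i| <= e1.
  by move=> hz; have [_ h] := hv i; have [_ {}h] := h z hz; exact: h.
have ss z : box 0 s' z -> box 0 s z by rewrite !box0P => h; exact: lt_trans s's.
have u1B b i z : box 0 s' z -> `|dv b u1 z i| <= B + 1.
  move=> hz; rewrite -(subrK (p b z i) (dv b u1 z i)) addrC; apply: le_trans (ler_normD _ _) _.
  by apply: lerD; [apply: pB; exact: ss|apply: le_trans (hp b i z hz) _].
have pB' b i z : box 0 s' z -> `|p b z i| <= B + 1.
  by move=> hz; apply: le_trans (pB _ _ (ss z hz)) _; rewrite lerDl.
have mp a b z : box 0 s' z -> `|met u1 a b z - dot3 (p a z) (p b z)| <= kt.
  move=> hz; apply: (le_trans _ e11); apply: dot3_close => i; [exact: hp|exact: hp|exact: pB'|exact: u1B].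
have GE a b z : box 0 s' z -> `|G a b z - E a b z| <= tau3.
  move=> hz; have m := le_trans (mp a b z hz) k1.
  have l : `|Sg a b z - g a b z| <= tau by apply: le_trans (Sgc a b z) _; rewrite ge_min lexx.
  have hh : `|sg0 ^+ 2 * Hres a b| <= tau.
    have /andP[h0 h1] := H_bound (R := R) a b.
    rewrite normrM (gtr0_norm sg20) (ger0_norm h0); apply: (le_trans _ sg2).
    by apply: ler_piMr => //; exact: ltW.
  rewrite -tau3E /G; move: m l hh; move: (met _ _ _ _) (dot3 _ _) (Sg _ _ _) (g _ _ _) (_ * _) => x y w q t h1 h2 h3.
  rewrite (_ : _ - _ = (w - q) - (x - y) - t); last by ring.
  apply: le_trans (ler_normB _ _) _; apply: lerD => //.
  by apply: le_trans (ler_normB _ _) _; apply: lerD.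
have EB a b z : box 0 s' z -> `|E a b z| <= BE.
  move=> hz; apply: le_trans (ler_normB _ _) _; apply: lerD; first exact: (hg a b).1.
  by apply: dot3_bound => i; apply: pB; exact: ss.
have G1 z : box 0 s' z -> c1 / 2 <= G false false z.
  move=> hz; apply: (half_close (E1 (ss z hz)) _ t2).
  exact: (ler_distlCBl (GE false false z hz)).
have G2 z : box 0 s' z -> c2 / 2 <= G false false z * G true true z - G false true z ^+ 2.
  move=> hz; exact: half_close (E2 (ss z hz)) (det_close (EB false false z hz) (EB true true z hz) (EB false true z hz)
    (GE false false z hz) (GE true true z hz) (GE false true z hz) t1) t3.
have nu1 z : box 0 s' z -> ka / 2 <= nsq u1 z.
  move=> hz; have db a b : `|dot3 (p a z) (p b z)| <= 3 * B ^+ 2 by apply: dot3_bound => i; apply: pB; exact: ss.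
  rewrite nsqE; exact: half_close (pk (ss z hz)) (det_close (db false false) (db true true) (db false true)
    (mp false false z hz) (mp true true z hz) (mp false true z hz) k2) k3.
have [C1 g1] := GB false false; have [C2 g2] := GB false true; have [C3 g3] := GB true true.
have [C1p C2p C3p] : [/\ 0 <= C1, 0 <= C2 & 0 <= C3] by split; [exact: Bd_ge0 g1|exact: Bd_ge0 g2|exact: Bd_ge0 g3].
have sub (f : pt -> R) Cf : Bd 2 setT Cf (2 / r) f -> Cf <= C1 + C2 + C3 -> Bd 2 (box 0 s') (C1 + C2 + C3) (2 / r) f.
  by move=> h1 h2; apply: (Bd_sub (S := setT)) => //; exact: Bd_leC h1.
have c1' : 0 < c1 / 2 by rewrite divr_gt0.
have c2' : 0 < c2 / 2 by rewrite divr_gt0.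
have [l1 l2 l3] := le_sum3 C1p C2p C3p.
have [I [a [xi [ha hsum]]]] := metric_decomposition (@box_open _ 0 s') mu0 c1' c2' (sub _ _ g1 l1) (sub _ _ g2 l2) (sub _ _ g3 l3) G1 G2.
have ka2 : 0 < ka / 2 by rewrite divr_gt0.
have he0 : 0 < e * sg0 ^+ 2 / 2 by rewrite divr_gt0 // mulr_gt0.
pose eta' := Num.min (eta / 2) (s' - s0).
have eta'0 : 0 < eta' by rewrite lt_min divr_gt0 // subr_gt0.
have eta1 : eta' <= eta / 2 by rewrite ge_min lexx.
have eta2 : eta' <= s' - s0 by rewrite ge_min lexx orbT.
have eta's : eta' < s' by apply: le_lt_trans eta2 _; rewrite ltrBlDr ltrDl.
have ha' i : exists Ca, exists2 mu0, 0 <= mu0 & Bd 2 (box 0 s') Ca mu0 (a i).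
  by have [Ca h] := ha i; exists Ca, (2 / r).
have [M hM] : exists M, C2on s' M u1.
  have k b i := dvB b i.
  have /choice[C hC] : forall x : bool * ax3, exists C, Bd 2 setT C (2 / r) (fun z => dv x.1 u1 z x.2) by move=> x.
  have Cp x : 0 <= C x by exact: Bd_ge0 (hC x).
  have [T CT] := bool_ax3_bounded Cp.
  exists (T * (2 / r)) => z hz; split.
  - by move=> i b; have [[C' h] _] := hv i; exact: (@Bd_derivable _ 2 setT C' (2 / r) (v i) z b h Logic.I).
  - by move=> i b b'; exact: Bd_derivable (hC (b, i)) Logic.I.
  - move=> i b b'; apply: le_trans (Bd_bound (Bd_dd b' (hC (b, i))) Logic.I) _.
    by apply: ler_wpM2r => //; exact: CT.
have hK b z : box 0 s' z -> met u1 b b z <= 3 * (B + 1) ^+ 2.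
  by move=> hz; apply: le_trans (ler_norm _) _; apply: dot3_bound => i; exact: u1B.
have [w [M' hw hw']] := @add_metric R I a xi s' u1 s' M _ _ _ _ ha' hM hK ka2 nu1 he0 eta'0 eta's (lexx s').
have s0sub z : box 0 s0 z -> box 0 (s' - eta') z by rewrite !box0P => h; apply: lt_le_trans h _; rewrite lerBrDr addrC -lerBrDr.
have s0s'' z : box 0 s0 z -> box 0 s' z by rewrite !box0P => h; exact: lt_trans s0s'.
exists sg0, M', w; split => //.
- by move=> z /s0sub; exact: hw.
- have main a0 b0 z : a0 ==> b0 -> box 0 s0 z -> `|g a0 b0 z - met w a0 b0 z - sg0 ^+ 2 * Hres a0 b0| <= e * sg0 ^+ 2.
    move=> ab hz; have [_ h] := hw' z (s0sub z hz); have {}h := h a0 b0.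
    have gs : \sum_i a i z ^+ 2 * (xi i a0 * xi i b0) = G a0 b0 z.
      have [h1 h2 h3] := hsum z (s0s'' z hz).
      by case: a0 ab {h} => ab; case: b0 ab => ab; [exact: h3|discriminate ab|exact: h2|exact: h1].
    have l : `|Sg a0 b0 z - g a0 b0 z| <= e * sg0 ^+ 2 / 2 by apply: le_trans (Sgc a0 b0 z) _; rewrite ge_min lexx orbT.
    have alg (x y w0 q t d : R) : `|x - y - (w0 - y - t)| <= d / 2 -> `|w0 - q| <= d / 2 -> `|q - x - t| <= d.
      move=> h1 h2; rewrite (_ : q - x - t = - (w0 - q) - (x - y - (w0 - y - t))); last by ring.
      by apply: le_trans (ler_normB _ _) _; rewrite normrN [leRHS]splitr; exact: lerD.
    by rewrite gs in h; exact: alg h l.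
  move=> z a0 b0 hz; case: a0; case: b0; try exact: main.
  by rewrite gsym metC; exact: main.
- move=> z i hz; have [h _] := hw' z (s0sub z hz); have [_ h'] := hv i; have [{}h' _] := h' z (s0s'' z hz).
  rewrite -(subrKA (u1 z i)); apply: le_trans (ler_normD _ _) _; rewrite [leRHS]splitr; apply: lerD.
    exact: le_trans (h i) eta1.
  exact: le_trans h' e13.
Qed.

End ShortInitial.

(** * From the disk to a box and back *)

Section CompactBox.
Context {R : realType}.
Local Notation pt := 'rV[R]_2.

Lemma closed_box_compact (s : R) : compact [set z : pt | `|z| <= s].
Proof.
apply: bounded_closed_compact.
  by exists s; split; [exact: num_real|move=> x sx z /= zs; exact: le_trans zs (ltW sx)].
have -> : [set z : pt | `|z| <= s] = (fun z : pt => `|z|) @^-1` [set x : R | x <= s] by [].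
by apply: closed_comp => [z _|]; [exact: norm_continuous|exact: closed_le].
Qed.

Section Extrema.
Variables (s : R) (f : pt -> R).
Hypothesis s0 : 0 <= s.
Hypothesis fc : forall z, `|z| <= s -> {for z, continuous f}.

Let within_box : {within [set z : pt | `|z| <= s], continuous f}.
Proof. by apply: continuous_in_subspaceT => z; rewrite inE => zs; exact: fc. Qed.

Let box_neq0 : [set z : pt | `|z| <= s] !=set0.
Proof. by exists 0 => /=; rewrite normr0. Qed.

Lemma closed_box_bounded : exists2 B, 0 <= B & forall z, `|z| <= s -> `|f z| <= B.
Proof.
have [c _ hc] := EVT_max_rV box_neq0 (@closed_box_compact s) within_box.
have [d _ hd] := EVT_min_rV box_neq0 (@closed_box_compact s) within_box.
exists (`|f c| + `|f d|); first exact: addr_ge0.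
move=> z zs; have h1 : f z <= f c by apply: hc; rewrite inE.
have h2 : f d <= f z by apply: hd; rewrite inE.
have := ler_norm (f c); have := ler_norm (- f d); rewrite normrN ler_norml.
by have := normr_ge0 (f c); have := normr_ge0 (f d); lra.
Qed.

Lemma closed_box_pos : (forall z, `|z| <= s -> 0 < f z) -> exists2 c, 0 < c & forall z, `|z| <= s -> c <= f z.
Proof.
move=> fp; have [d ds hd] := EVT_min_rV box_neq0 (@closed_box_compact s) within_box.
rewrite inE in ds; exists (f d); first exact: fp.
by move=> z zs; apply: hd; rewrite inE.
Qed.

(** Heine-Cantor, from the covering form of compactness applied to the filter of small positive
    [d]. *)
Lemma closed_box_uniform e : 0 < e -> exists2 d, 0 < d &
  forall z w, `|z| <= s -> `|w| <= s -> `|z - w| <= d -> `|f z - f w| <= e.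
Proof.
move=> e0; have /compact_near_coveringP cov := @closed_box_compact s.
have := cov R (0 : R)^'+ (fun d z => forall w, `|w| <= s -> `|z - w| <= d -> `|f z - f w| <= e) _.
case=> [x xs|d /= d0 h].
  have /cvgrPdist_le /(_ (e / 2)) := fc xs; rewrite divr_gt0 // => /(_ isT) /nbhs_ballP [r /= r0 hr].
  have r2 : 0 < r / 2 by rewrite divr_gt0.
  exists (ball x (r / 2), [set d | d < r / 2]) => [|[z d] /= [xz dr] w ws zw].
    split; first exact: nbhsx_ballx.
    by near=> d; near: d; exact: nbhs_right_lt.
  move: xz; rewrite -ball_normE /= => xz.
  have h1 : `|f x - f z| <= e / 2 by apply: hr; rewrite -ball_normE /=; lra.
  have h2 : `|f x - f w| <= e / 2.
    apply: hr; rewrite -ball_normE /= -(subrKA z); apply: le_lt_trans (ler_normD _ _) _; lra.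
  rewrite -(subrKA (f x)); apply: le_trans (ler_normD _ _) _; rewrite [leRHS]splitr.
  by apply: lerD => //; rewrite distrC.
exists (d / 2); first by rewrite divr_gt0.
move=> z w zs ws zw; apply: (h (d / 2)) zw => //=; last by rewrite divr_gt0.
by rewrite sub0r normrN gtr0_norm ?divr_gt0 // ltr_pdivrMr // ltr_pMr // ltr1n.
Unshelve. all: by end_near. Qed.

End Extrema.
End CompactBox.

Section ShortMaps.
Context {R : realType}.
Local Notation pt := 'rV[R]_2.

(* The boxes are nested with the disks of the theorem: the closed unit disk lies in the box of
   half-width 11/10 and the box of half-width 7/5 in the open disk of radius 2. *)
Theorem short_box_approximation (g : bool -> bool -> pt -> R) (ub : pt -> ax3 -> R) (p : bool -> pt -> ax3 -> R) (al eta : R) :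
  0 < al -> al < 1 / 5 -> 0 < eta ->
  (forall a b c z, box 0 (7 / 5) z -> derivable (g a b) z (ebas c)) ->
  (forall a b c z, box 0 (7 / 5) z -> {for z, continuous (dd c (g a b))}) ->
  (forall a b z, box 0 (7 / 5) z -> {for z, continuous (g a b)}) ->
  (forall z, box 0 (7 / 5) z -> g true false z = g false true z) ->
  (forall z, box 0 (7 / 5) z -> 0 < g false false z * g true true z - g false true z ^+ 2) ->
  (forall b i z, box 0 (7 / 5) z -> is_derive z (ebas b) (fun w => ub w i) (p b z i)) ->
  (forall b i z, box 0 (7 / 5) z -> {for z, continuous (fun w => p b w i)}) ->
  (forall z, box 0 (7 / 5) z -> 0 < g false false z - dot3 (p false z) (p false z)) ->
  (forall z, box 0 (7 / 5) z -> 0 < (g false false z - dot3 (p false z) (p false z)) * (g true true z - dot3 (p true z) (p true z))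
     - (g false true z - dot3 (p false z) (p true z)) ^+ 2) ->
  (forall z, box 0 (7 / 5) z -> 0 < dot3 (p false z) (p false z) * dot3 (p true z) (p true z) - dot3 (p false z) (p true z) ^+ 2) ->
  exists u : pt -> ax3 -> R, exists q : bool -> pt -> ax3 -> R, exists2 Q : R, 0 <= Q &
  [/\ forall b i z, box 0 (11 / 10) z -> is_derive z (ebas b) (fun w => u w i) (q b z i),
      forall a b z, box 0 (11 / 10) z -> dot3 (q a z) (q b z) = g a b z,
      forall i z, box 0 (11 / 10) z -> `|u z i - ub z i| <= eta &
      forall b i z w, box 0 (11 / 10) z -> box 0 (11 / 10) w -> `|q b z i - q b w i| <= Q * `|z - w| `^ al].
Proof.
move=> al0 al5 eta0 gd gdc gc gs gdet ubd pc e1 e2 e3.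
(* The continuity hypotheses live on an open box; the closed box of half-width [s] inside it is
   compact and turns strict inequalities into uniform ones. The half-widths are
   [11/10 < 6/5 < 51/40 < 13/10 < 7/5]. *)
pose s : R := 13 / 10; have s0 : 0 <= s by rewrite /s; lra.
have s75 : s < 7 / 5 by rewrite /s; lra.
have inb z : `|z| <= s -> box 0 (7 / 5) z by rewrite box0P => h; exact: le_lt_trans s75.
have bins z : box 0 s z -> `|z| <= s by rewrite box0P => /ltW.
have cp b i z : `|z| <= s -> {for z, continuous (fun w => p b w i)} by move=> /inb; exact: pc.
have cg a b z : `|z| <= s -> {for z, continuous (g a b)} by move=> /inb; exact: gc.
have cdot a b z : `|z| <= s -> {for z, continuous (fun w => dot3 (p a w) (p b w))}.
  move=> zs; have c i : {for z, continuous (fun w => p a w i * p b w i)}.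
    by apply: continuousM; exact: cp.
  rewrite /dot3; exact: (continuousD (continuousD (c ax_x) (c ax_y)) (c ax_z)).
have cE a b z : `|z| <= s -> {for z, continuous (fun w => g a b w - dot3 (p a w) (p b w))}.
  by move=> zs; apply: continuousB; [exact: cg|exact: cdot].
have cdet (f1 f2 f3 : pt -> R) z : {for z, continuous f1} -> {for z, continuous f2} -> {for z, continuous f3} ->
    {for z, continuous (fun w => f1 w * f2 w - f3 w ^+ 2)}.
  move=> h1 h2 h3; apply: continuousB; first exact: continuousM.
  by rewrite (_ : (fun w => f3 w ^+ 2) = (fun w => f3 w * f3 w)); [exact: continuousM|apply/funext => w; rewrite expr2].
have [c1 c10 hc1] := closed_box_pos s0 (fun z => @cE false false z) (fun z zs => e1 z (inb z zs)).
have [c2 c20 hc2] := closed_box_pos s0 (fun z zs => cdet _ _ _ z (@cE false false z zs) (@cE true true z zs) (@cE false true z zs))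
   (fun z zs => e2 z (inb z zs)).
have [ka ka0 hka] := closed_box_pos s0 (fun z zs => cdet _ _ _ z (@cdot false false z zs) (@cdot true true z zs) (@cdot false true z zs))
   (fun z zs => e3 z (inb z zs)).
have [c0 c00 hc0] := closed_box_pos s0 (fun z zs => cdet _ _ _ z (@cg false false z zs) (@cg true true z zs) (@cg false true z zs))
   (fun z zs => gdet z (inb z zs)).
have [B hB] : exists B, forall b i z, `|z| <= s -> `|p b z i| <= B.
  have /choice[C hC] : forall x : bool * ax3, exists B, 0 <= B /\ forall z, `|z| <= s -> `|p x.1 z x.2| <= B.
    by move=> x; have [B B0 h] := closed_box_bounded s0 (fun z => @cp x.1 x.2 z); exists B.
  have [T hT] := bool_ax3_bounded (fun x => (hC x).1).
  by exists T => b i z zs; apply: le_trans (hT (b, i)); exact: (hC (b, i)).2.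
have hu e : 0 < e -> exists2 d, 0 < d & forall b i z w, box 0 s z -> box 0 s w -> `|z - w| <= d -> `|p b z i - p b w i| <= e.
  move=> e0; have /choice[d hd] : forall x : bool * ax3, exists d, 0 < d /\
      forall z w, `|z| <= s -> `|w| <= s -> `|z - w| <= d -> `|p x.1 z x.2 - p x.1 w x.2| <= e.
    by move=> x; have [d d0 h] := closed_box_uniform (fun z => @cp x.1 x.2 z) e0; exists d.
  pose m b := Num.min (d (b, ax_x)) (Num.min (d (b, ax_y)) (d (b, ax_z))).
  have m0 b : 0 < m b by rewrite !lt_min !(hd _).1.
  exists (Num.min (m true) (m false)); first by rewrite lt_min !m0.
  move=> b i z w zs ws zw; apply: ((hd (b, i)).2 z w (bins z zs) (bins w ws)).
  by apply: le_trans zw _; case: b; case: i; rewrite !ge_min lexx ?orbT.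
have [L [L0 hL]] : exists L, 0 <= L /\ forall a b c z, `|z| <= s -> `|dd c (g a b) z| <= L.
  have /choice[C hC] : forall x : bool * bool * bool, exists B, 0 <= B /\ forall z, `|z| <= s -> `|dd x.2 (g x.1.1 x.1.2) z| <= B.
    move=> x; have [D D0 h] := closed_box_bounded s0 (fun z zs => gdc x.1.1 x.1.2 x.2 z (inb z zs)).
    by exists D.
  exists (\sum_x C x); split; first by apply: sumr_ge0 => x _; exact: (hC x).1.
  move=> a b c z zs; apply: le_trans ((hC (a, b, c)).2 z zs) _.
  by rewrite (bigD1 (a, b, c)) //= lerDl sumr_ge0 // => x _; exact: (hC x).1.
(* Clamping at [rho] extends the metric to the plane with global bounds, as the iteration requires,
   without changing it on the box where the map is built. *)
pose rho : R := 51 / 40.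
have rho0 : 0 <= rho by rewrite /rho; lra.
have rs : rho < s by rewrite /rho /s; lra.
pose G a b z := g a b (clamp rho z).
have hG : exists BG, forall a b, lips BG L (G a b).
  have /choice[C hC] : forall x : bool * bool, exists D, lips D L (G x.1 x.2).
    move=> x; apply: (@clamp_lips_exists R s rho L (g x.1 x.2)) => //.
      by move=> c z hz; apply: gd; exact: inb (bins z hz).
    by move=> c z hz; apply: hL; exact: bins.
  have C0 x : 0 <= C x by have [] := lips_ge0 (hC x).
  exists (\sum_x C x) => a b; apply: lips_le (hC (a, b)) => //.
  by rewrite (bigD1 (a, b)) //= lerDl sumr_ge0.
have [BG {}hG] := hG.
have crho z : `|clamp rho z| <= s by apply: le_trans (clamp_norm z rho0) _; exact: ltW.
have Gs z : G true false z = G false true z by apply: gs; apply: inb; exact: crho.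
have Gdet z : c0 <= G false false z * G true true z - G false true z ^+ 2 by apply: hc0; exact: crho.
have GE a b z : box 0 rho z -> G a b z = g a b z by rewrite box0P => /ltW h; rewrite /G clamp_id.
have rsub z : box 0 rho z -> `|z| <= s by rewrite box0P => h; apply: ltW; exact: (lt_trans h rs).
have l10 : 0 <= 11 / 10 :> R by lra.
have l11 : 11 / 10 < 6 / 5 :> R by lra.
have l12 : 6 / 5 < rho by rewrite /rho; lra.
have l13 : 0 < 6 / 5 :> R by lra.
have [e e0 he] := nash_iteration hG c00 Gdet Gs al0 al5 l10 l11.
have eta2 : 0 < eta / 2 by rewrite divr_gt0.
have rbox z : box 0 rho z -> box 0 (7 / 5) z by move=> /rsub /inb.
have hu' e' : 0 < e' -> exists2 d, 0 < d & forall b i z w, box 0 rho z -> box 0 rho w -> `|z - w| <= d -> `|p b z i - p b w i| <= e'.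
  move=> e'0; have [d d0 h] := hu e' e'0; exists d => // b i z w /box0P hz /box0P hw.
  by apply: (h b i z w) => //; apply/box0P; [exact: lt_trans hz rs|exact: lt_trans hw rs].
have E1 z : box 0 rho z -> c1 <= G false false z - dot3 (p false z) (p false z).
  by move=> hz; rewrite GE //; apply: hc1; exact: rsub.
have E2 z : box 0 rho z -> c2 <= (G false false z - dot3 (p false z) (p false z)) * (G true true z - dot3 (p true z) (p true z))
     - (G false true z - dot3 (p false z) (p true z)) ^+ 2.
  by move=> hz; rewrite !GE //; apply: hc2; exact: rsub.
have [sg0 [M [u0 [sg00 sge hu0 hmet hclose]]]] := short_initial hG Gs c10 c20 ka0
  (fun b i z hz => ubd b i z (rbox z hz)) (fun b i z hz => hB b i z (rsub z hz)) hu' E1 E2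
  (fun z hz => hka z (rsub z hz)) l13 l12 e0 eta2.
have [|u [q [Q Q0 [h1 h2 h3 h4]]]] := he sg0 M u0 sg00 sge _ _ eta2.
  by move=> z hz; have [k1 k2 k3] := hu0 z hz; split => // a b; exact: hmet.
have sub (z : pt) : box 0 (11 / 10) z -> box 0 (6 / 5) z by move=> /box0P h; apply/box0P; exact: lt_trans h l11.
have sub2 (z : pt) : box 0 (11 / 10) z -> box 0 rho z by move=> /sub/box0P h; apply/box0P; exact: lt_trans h l12.
exists u, q, Q => //; split => //.
- by move=> a b z hz; rewrite h2 // GE //; exact: sub2.
- move=> i z hz; rewrite -(subrKA (u0 z i)); apply: le_trans (ler_normD _ _) _; rewrite [leRHS]splitr.
  by apply: lerD; [exact: h3|apply: hclose; exact: sub].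
Qed.

End ShortMaps.

(** * Passing between Euclidean disks and boxes *)

Section EuclideanDisk.
Context {R : realType}.
Local Notation pt := 'rV[R]_2.

Lemma norm_coord_le_enorm n (x : 'rV[R]_n) j : `|x 0 j| <= enorm x.
Proof.
rewrite /enorm -sqrtr_sqr ler_wsqrtr // /dot (bigD1 j) //= -expr2 lerDl.
by apply: sumr_ge0 => k _; rewrite -expr2 sqr_ge0.
Qed.

Lemma enorm_le n (x : 'rV[R]_n) (B : R) : 0 <= B -> (forall k, `|x 0 k| <= B) -> enorm x <= Num.sqrt n%:R * B.
Proof.
move=> B0 h; rewrite -[B in leRHS]ger0_norm // -sqrtr_sqr -sqrtrM //; apply: ler_wsqrtr.
apply: (@le_trans _ _ (\sum_(k < n) B ^+ 2)); last by rewrite sumr_const card_ord mulr_natl.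
by apply: ler_sum => k _; rewrite -expr2 -(real_normK (num_real (x 0 k))) lerXn2r ?nnegrE.
Qed.

Lemma norm_le_enorm (x : pt) : `|x| <= enorm x.
Proof. by apply/rV_norm_leP; [exact: sqrtr_ge0|exact: norm_coord_le_enorm]. Qed.

Lemma enormZ n (c : R) (x : 'rV[R]_n) : enorm (c *: x) = `|c| * enorm x.
Proof.
rewrite /enorm (_ : dot (c *: x) (c *: x) = c ^+ 2 * dot x x); first by rewrite sqrtrM ?sqr_ge0 // sqrtr_sqr.
by rewrite /dot mulr_sumr; apply: eq_bigr => k _; rewrite !mxE; ring.
Qed.

Lemma enorm_continuous : continuous (@enorm R 2).
Proof.
move=> x; rewrite /enorm; apply: (@continuous_comp _ _ _ (fun y : pt => dot y y)); last exact: sqrt_continuous.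
rewrite /dot (_ : (fun y : pt => _) = (fun y : pt => y 0 0 * y 0 0 + y 0 1 * y 0 1)); last first.
  apply/funext => y; rewrite !big_ord_recl big_ord0 addr0.
  by rewrite (_ : lift ord0 ord0 = 1 :> 'I_2) //; apply/val_inj.
by apply: continuousD; apply: continuousM; exact: coord_continuous.
Qed.

Lemma odisk_open r : open (@odisk R r).
Proof.
rewrite (_ : odisk r = @enorm R 2 @^-1` [set t | t < r]) //.
by apply: open_comp => [x _|]; [exact: enorm_continuous|exact: open_lt].
Qed.

(** The Euclidean length is at most [sqrt 2 * 7 / 5], and [2 * 49 / 25 < 4]. *)
Lemma box_odisk (z : pt) : box 0 (7 / 5) z -> odisk 2 z.
Proof.
move=> /box0P hz; rewrite /odisk /=.
have h k : `|z 0 k| <= 7 / 5 by apply: le_trans (ltW hz); exact: (rV_norm_leP _ (normr_ge0 _)).1 (lexx _) k.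
have h0 : 0 <= 7 / 5 :> R by lra.
apply: le_lt_trans (enorm_le h0 h) _.
rewrite -[X in _ * X]ger0_norm // -sqrtr_sqr -sqrtrM //.
by rewrite -[ltRHS]ger0_norm // -[ltRHS]sqrtr_sqr ltr_sqrt ?exprn_gt0 // !expr2; lra.
Qed.

Lemma cdisk_box (x : pt) : cdisk 1 x -> box 0 (11 / 10) x.
Proof. by move=> h; apply/box0P; apply: le_lt_trans (norm_le_enorm x) _; rewrite /cdisk /= in h; lra. Qed.

(** Makes the filter in [pd] proper at boundary points too, so that its limit is determined there.
    The approximating points are [(1 - t) *: x]. *)
Lemma odisk_closure (x : pt) : cdisk 1 x -> closure (odisk 1) x.
Proof.
move=> x1 A /nbhs_ballP[r /= r0 hr].
have q0 : 0 < 2 * (`|x| + 1) by rewrite mulr_gt0 // ltr_wpDl.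
pose t := Num.min 1 (r / (2 * (`|x| + 1))).
have t0 : 0 < t by rewrite lt_min ltr01 divr_gt0.
have t1 : t <= 1 by rewrite ge_min lexx.
have tr : t * (2 * (`|x| + 1)) <= r by rewrite -ler_pdivlMr // ge_min lexx orbT.
exists ((1 - t) *: x); split.
  rewrite /odisk /= enormZ ger0_norm ?subr_ge0 //.
  by apply: (@le_lt_trans _ _ (1 - t)); [rewrite ler_piMr // subr_ge0|rewrite ltrBlDr ltrDl].
apply: hr; rewrite -ball_normE /= scalerBl scale1r opprB addrC subrK normrZ gtr0_norm //.
by have := mulr_ge0 (ltW t0) (normr_ge0 x); lra.
Qed.

Lemma C1_interior (V : normedModType R) r (f : pt -> V) i x : C1 r f -> odisk r x ->
  {for x, continuous ('D_(delta_mx 0 i) f)} /\ pd r i f x = 'D_(delta_mx 0 i) f x.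
Proof.
move=> [_ _ h3] rx; have := h3 x i; rewrite /pd within_interior; last first.
  by rewrite (interior_id _).1 //; exact: odisk_open.
move=> /(_ (ltW rx)) /cvg_ex[l hl].
(* The neighbourhoods are not punctured, so the value at [x] itself is within every [e] of the
   limit. *)
have e : l = 'D_(delta_mx 0 i) f x.
  apply/eqP; rewrite -subr_eq0 -normr_le0; apply/ler_addgt0Pr => e e0; rewrite add0r.
  by have /cvgrPdist_le /(_ e e0) h := hl; exact: (nbhs_singleton h).
split; first by rewrite /prop_for /continuous_at -e.
by rewrite (cvg_lim _ hl) ?e.
Qed.

Lemma C1_continuous (V : normedModType R) r (f : pt -> V) x : C1 r f -> odisk r x -> {for x, continuous f}.
Proof.
move=> [h1 _ _] rx; have := (subspace_continuousP (cdisk r) f).1 h1 x (ltW rx).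
rewrite within_interior //; apply: (@interiorS _ (odisk r)) => [y /ltW //|].
by rewrite (interior_id _).1 //; exact: odisk_open.
Qed.

(** The test vectors are [(1, 0)] and [(- A 0 1, A 0 0)]; on the latter the form equals [A 0 0]
    times the determinant. *)
Lemma posdef2 (A : 'M[R]_2) : A^T = A -> posdef A -> 0 < A 0 0 /\ 0 < A 0 0 * A 1 1 - A 0 1 ^+ 2.
Proof.
move=> sA pA; have A10 : A 1 0 = A 0 1 by rewrite -{1}sA mxE.
have q (a b : R) : (a != 0) || (b != 0) -> 0 < a * a * A 0 0 + 2 * (a * b) * A 0 1 + b * b * A 1 1.
  move=> ab; pose v : 'rV[R]_2 := \row_k (if k == 0 then a else b).
  have v0 : v != 0.
    apply/eqP => /rowP v0; move: ab; have := v0 0; have := v0 1; rewrite !mxE /= => -> ->.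
    by rewrite eqxx.
  have := pA v v0; rewrite !mxE !big_ord_recl big_ord0 !mxE !big_ord_recl !big_ord0 /= !mxE /=.
  have -> : lift ord0 ord0 = 1 :> 'I_2 by apply/val_inj.
  have -> : ord0 = 0 :> 'I_2 by apply/val_inj.
  by rewrite A10; congr (0 < _); ring.
have a0 : 0 < A 0 0 by have := q 1 0; rewrite oner_neq0 => /(_ isT); rewrite !mulr0 !mul0r !mul1r !addr0.
split => //; have := q (- A 0 1) (A 0 0); rewrite (gt_eqF a0) orbT => /(_ isT).
rewrite (_ : _ + _ = A 0 0 * (A 0 0 * A 1 1 - A 0 1 ^+ 2)); last by ring.
by rewrite pmulr_rgt0.
Qed.

End EuclideanDisk.

Definition ax_ord (i : ax3) : 'I_3 :=
  match i with ax_x => @Ordinal 3 0 isT | ax_y => @Ordinal 3 1 isT | ax_z => @Ordinal 3 2 isT end.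
Definition ord_ax (k : 'I_3) : ax3 := match val k with 0%N => ax_x | 1%N => ax_y | _ => ax_z end.

Lemma ax_ordK i : ord_ax (ax_ord i) = i. Proof. by case: i. Qed.
Lemma ord_axK k : ax_ord (ord_ax k) = k.
Proof. by case: k => -[|[|[|//]]] hk; apply/val_inj. Qed.

Lemma dot_ax3 {R : realType} (v w : 'rV[R]_3) : dot v w = dot3 (fun i => v 0 (ax_ord i)) (fun i => w 0 (ax_ord i)).
Proof.
rewrite /dot !big_ord_recl big_ord0 addr0 addrA /dot3.
by congr (v _ _ * w _ _ + v _ _ * w _ _ + v _ _ * w _ _); apply/val_inj.
Qed.

Definition bool_ord (b : bool) : 'I_2 := if b then 1 else 0.

Lemma bool_ordK (i : 'I_2) : bool_ord (i == 1) = i.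
Proof. by case: i => -[|[|//]] hi; apply/val_inj. Qed.

Section FromDisk.
Context {R : realType}.
Local Notation pt := 'rV[R]_2.

Lemma near_box (s : R) (z : pt) : box 0 s z -> \forall y \near z, box 0 s y.
Proof. by move=> hz; apply: open_nbhs_nbhs; split => //; exact: box_open. Qed.

Lemma C1_entry m n (f : pt -> 'M[R]_(m, n)) i j b z : C1 2 f -> box 0 (7 / 5) z ->
  [/\ is_derive z (ebas b) (fun w => f w i j) ('D_(ebas b) f z i j),
      {for z, continuous (fun w => 'D_(ebas b) f w i j)} & {for z, continuous (fun w => f w i j)}].
Proof.
move=> hf hz; have oz := box_odisk hz; have [_ fd _] := hf.
have entry (h : pt -> 'M[R]_(m, n)) : {for z, continuous h} -> {for z, continuous (fun w => h w i j)}.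
  by move=> hc; exact: (@continuous_comp _ _ _ h (fun M : 'M[R]_(m, n) => M i j) z hc (@coord_continuous _ _ _ i j _)).
split.
- have h := fd z (bool_ord b) oz; rewrite -/(ebas b) in h; rewrite (derive_mx h) mxE.
  by apply: derivableP; exact: (derivable_mxP _ _ _).1 h i j.
- by apply: entry; have [] := C1_interior (bool_ord b) hf oz.
- by apply: entry; exact: C1_continuous oz.
Qed.

End FromDisk.

Section ToDisk.
Context {R : realType}.
Local Notation pt := 'rV[R]_2.

Lemma row_continuous n (F : pt -> 'rV[R]_n) x :
  (forall k, {for x, continuous (fun y => F y 0 k)}) -> {for x, continuous F}.
Proof.
move=> h; apply: (proj2 (@cvgrPdist_le _ _ _ (nbhs x) (nbhs_filter x) F (F x))) => e e0.
have H : \forall y \near x, forall k, `|F x 0 k - F y 0 k| <= e.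
  apply: (@filter_forall _ _ _ (nbhs x)) => k.
  by have := h k; rewrite /prop_for /continuous_at => /cvgrPdist_le; apply.
apply: (@filterS _ (nbhs x) _ _ _ _ H) => y hy.
rewrite [leLHS]/Num.Def.normr /= mx_normrE (bigmax_le _ (ltW e0)) //= => -[i k] _.
by rewrite !mxE /= ord1.
Qed.

Lemma holder_continuous (f : pt -> R) (s Q al : R) x : 0 < al -> 0 <= Q -> box 0 s x ->
  (forall y, box 0 s y -> `|f x - f y| <= Q * `|x - y| `^ al) -> {for x, continuous f}.
Proof.
move=> al0 Q0 hx h; apply: (proj2 (@cvgrPdist_le _ _ _ (nbhs x) (nbhs_filter x) f (f x))) => e e0.
have E0 : 0 < e / (Q + 1) by rewrite divr_gt0 // ltr_wpDl.
have r0 : 0 < (e / (Q + 1)) `^ al^-1 by rewrite powR_gt0.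
near=> y; apply: le_trans (h y _) _; first by near: y; exact: near_box.
have xy : `|x - y| <= (e / (Q + 1)) `^ al^-1.
  near: y; apply/nbhs_ballP; exists ((e / (Q + 1)) `^ al^-1) => //= w.
  by rewrite -ball_normE /= => /ltW.
have : `|x - y| `^ al <= e / (Q + 1).
  apply: le_trans (ge0_ler_powR (ltW al0) _ _ xy) _; rewrite ?nnegrE ?powR_ge0 //.
  by rewrite -powRrM mulVf ?gt_eqF // powRr1 // ltW.
rewrite ler_pdivlMr ?ltr_wpDl // => k.
by have := powR_ge0 `|x - y| al; lra.
Unshelve. all: by end_near. Qed.

Variables (u : pt -> ax3 -> R) (q : bool -> pt -> ax3 -> R) (Q al : R).
Hypotheses (al0 : 0 < al) (Q0 : 0 <= Q).
Hypothesis ud : forall b i z, box 0 (11 / 10) z -> is_derive z (ebas b) (fun w => u w i) (q b z i).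
Hypothesis qh : forall b i z w, box 0 (11 / 10) z -> box 0 (11 / 10) w ->
  `|q b z i - q b w i| <= Q * `|z - w| `^ al.

Definition row_map (x : pt) : 'rV[R]_3 := \row_k u x (ord_ax k).
Let dU (i : 'I_2) (x : pt) : 'rV[R]_3 := \row_k q (i == 1) x (ord_ax k).

Let s0 : 0 <= 11 / 10 :> R. Proof. lra. Qed.

Lemma row_map_derive i x : box 0 (11 / 10) x ->
  derivable row_map x (delta_mx 0 i) /\ 'D_(delta_mx 0 i) row_map x = dU i x.
Proof.
move=> hx; have e k : (fun y => row_map y 0 k) = (fun y => u y (ord_ax k)) by apply/funext => y; rewrite mxE.
have eb : delta_mx 0 i = ebas (i == 1) :> pt by rewrite /ebas -/(bool_ord _) bool_ordK.
have d k := ud (i == 1) (ord_ax k) hx.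
have h : derivable row_map x (delta_mx 0 i).
  by apply/derivable_mxP => j k; rewrite ord1 e eb; have [] := d k.
split => //; rewrite (derive_mx h); apply/rowP => k; rewrite !mxE e eb.
by have [_ ->] := d k.
Qed.

Lemma row_map_continuous x : box 0 (11 / 10) x -> {for x, continuous row_map}.
Proof.
move=> hx; apply: row_continuous => k; rewrite (_ : (fun y => _) = (fun y => u y (ord_ax k))); last first.
  by apply/funext => y; rewrite mxE.
pose i := ord_ax k; pose M := `|q true 0 i| + `|q false 0 i| + Q * (11 / 10) `^ al.
have M0 : 0 <= M by rewrite !addr_ge0 // mulr_ge0 // powR_ge0.
have b0 : box 0 (11 / 10) (0 : pt) by apply/box0P; rewrite normr0; lra.
apply: (@holder_continuous _ (11 / 10) (2 * M) 1) => //; first by rewrite mulr_ge0.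
move=> y hy; rewrite powRr1 //; apply: (@box_lipschitz R (fun w => u w i) (11 / 10) M x y M0) => //.
  by move=> b z hz; have [] := ud b i hz.
move=> b z hz; rewrite (is_derive_dd (ud b i hz)) -(subrK (q b 0 i) (q b z i)) addrC.
apply: le_trans (ler_normD _ _) _; apply: lerD.
  by case: b; rewrite ?lerDl ?lerDr.
apply: le_trans (qh b i hz b0) _; apply: ler_wpM2l => //; rewrite subr0.
by apply: ge0_ler_powR; rewrite ?nnegrE ?(ltW al0) //; apply: ltW; exact/box0P.
Qed.

Lemma row_map_pd_cvg i x : cdisk 1 x -> 'D_(delta_mx 0 i) row_map y @[y --> within (odisk 1) (nbhs x)] --> dU i x.
Proof.
move=> /cdisk_box hx; have c : {for x, continuous (dU i)}.
  apply: row_continuous => k; rewrite (_ : (fun y => _) = (fun y => q (i == 1) y (ord_ax k))); last first.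
    by apply/funext => y; rewrite mxE.
  by apply: (holder_continuous al0 Q0 hx) => y hy; exact: qh.
apply: cvg_trans c; apply: cvg_trans (cvg_app _ (cvg_within _)) _.
apply: near_eq_cvg; apply: filterS (near_box hx) => y hy.
by have [_ ->] := row_map_derive i hy.
Qed.

Lemma row_map_pd i x : cdisk 1 x -> pd 1 i row_map x = \row_k q (i == 1) x (ord_ax k).
Proof.
move=> hx; have PF : ProperFilter (within (odisk 1) (nbhs x)).
  by apply: within_nbhs_proper; exact: odisk_closure.
by rewrite /pd; apply: cvg_lim => //; exact: row_map_pd_cvg.
Qed.

Lemma row_map_C1_holder : C1_holder 1 al row_map.
Proof.
split.
  split.
  - apply: continuous_in_subspaceT => x; rewrite inE => hx.
    by apply: row_map_continuous; exact: cdisk_box.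
  - by move=> x i hx; have [] := row_map_derive i (cdisk_box (ltW hx)).
  - by move=> x i hx; apply/cvg_ex; exists (dU i x); exact: row_map_pd_cvg.
exists (Num.sqrt 3%:R * Q) => i x y hx hy; rewrite !row_map_pd // -mulrA.
apply: le_trans (@enorm_le _ 3 _ (Q * `|x - y| `^ al) _ _) _.
- by rewrite mulr_ge0 // powR_ge0.
- by move=> k; rewrite !mxE; apply: qh; exact: cdisk_box.
- apply: ler_wpM2l; first exact: sqrtr_ge0.
  apply: ler_wpM2l => //; apply: ge0_ler_powR; rewrite ?nnegrE ?(ltW al0) //; first exact: sqrtr_ge0.
  exact: norm_le_enorm.
Qed.

Lemma row_map_dot i j x : cdisk 1 x -> dot (pd 1 i row_map x) (pd 1 j row_map x) = dot3 (q (i == 1) x) (q (j == 1) x).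
Proof. by move=> hx; rewrite !row_map_pd // dot_ax3 /dot3 !mxE !ax_ordK. Qed.

End ToDisk.

Theorem theorem1p1 (R : realType) (g : 'rV[R]_2 -> 'M[R]_2)
    (ubar : 'rV[R]_2 -> 'rV[R]_3)
    (hg : C2_metric 2 g) (hubar : short_immersion 2 g ubar)
    (delta : R) (hdelta : 0 < delta < 1 / 5) (eps : R) (heps : 0 < eps) :
  exists u : 'rV[R]_2 -> 'rV[R]_3,
    [/\ C1_holder 1 (1 / 5 - delta) u,
        isometric_immersion 1 g u
      & (C0norm 1 (fun x => ubar x - u x)%R < eps%:E)%E].
Proof.
have [[gC1 _] gp] := hg; have [[uC1 _] us] := hubar; have /andP[d0 d1] := hdelta.
pose al := 1 / 5 - delta; have al0 : 0 < al by rewrite subr_gt0.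
have al5 : al < 1 / 5 by rewrite ltrBlDr ltrDl.
pose G a b (z : 'rV[R]_2) := g z (bool_ord a) (bool_ord b).
pose ub (z : 'rV[R]_2) i := ubar z 0 (ax_ord i).
pose p b (z : 'rV[R]_2) i := 'D_(ebas b) ubar z 0 (ax_ord i).
(* The coordinates are approximated within [eps / 4]; the Euclidean norm costs at most
   [sqrt 3 <= 2], so the supremum is at most [eps / 2] and the final inequality is strict. *)
have eta0 : 0 < eps / 4 by rewrite divr_gt0.
have box_cdisk (z : 'rV[R]_2) : box 0 (7 / 5) z -> cdisk 2 z by move=> /box_odisk /ltW.
have bo0 : bool_ord false = 0 by []. have bo1 : bool_ord true = 1 by [].
have gE a b z : box 0 (7 / 5) z -> dot3 (p a z) (p b z) = induced_metric 2 ubar z (bool_ord a) (bool_ord b).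
  move=> hz; rewrite [RHS]mxE dot_ax3.
  by have [_ ->] := C1_interior (bool_ord a) uC1 (box_odisk hz); have [_ ->] := C1_interior (bool_ord b) uC1 (box_odisk hz).
have gS z : box 0 (7 / 5) z -> (g z)^T = g z by move=> /box_cdisk hz; have [] := gp z hz.
have iS z : (induced_metric 2 ubar z)^T = induced_metric 2 ubar z.
  apply/matrixP => i j; rewrite [LHS]mxE [LHS]mxE [RHS]mxE.
  by apply: eq_bigr => k _; exact: mulrC.
have gP z : box 0 (7 / 5) z -> 0 < g z 0 0 /\ 0 < g z 0 0 * g z 1 1 - g z 0 1 ^+ 2.
  by move=> hz; apply: posdef2; [exact: gS|have [] := gp z (box_cdisk z hz)].
have iP z : box 0 (7 / 5) z -> 0 < induced_metric 2 ubar z 0 0 /\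
    0 < induced_metric 2 ubar z 0 0 * induced_metric 2 ubar z 1 1 - induced_metric 2 ubar z 0 1 ^+ 2.
  by move=> hz; apply: posdef2; [exact: iS|have [] := us z (box_cdisk z hz)].
have eP z : box 0 (7 / 5) z -> 0 < (g z - induced_metric 2 ubar z) 0 0 /\
    0 < (g z - induced_metric 2 ubar z) 0 0 * (g z - induced_metric 2 ubar z) 1 1 - (g z - induced_metric 2 ubar z) 0 1 ^+ 2.
  move=> hz; apply: posdef2; last by have [] := us z (box_cdisk z hz).
  by rewrite linearB /= iS gS.
have eE a b z : box 0 (7 / 5) z -> G a b z - dot3 (p a z) (p b z) = (g z - induced_metric 2 ubar z) (bool_ord a) (bool_ord b).
  by move=> hz; rewrite gE // [in RHS]mxE [in X in _ = _ + X]mxE.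
have alg (x y w x' y' w' : R) : x = x' -> y = y' -> w = w' -> 0 < x' * y' - w' ^+ 2 -> 0 < x * y - w ^+ 2.
  by move=> -> -> ->.
have [||||||||||u [q [Q Q0 [h1 h2 h3 h4]]]] := @short_box_approximation R G ub p al (eps / 4) al0 al5 eta0.
- by move=> a b c z hz; have [[h _] _ _] := C1_entry (bool_ord a) (bool_ord b) c gC1 hz.
- move=> a b c z hz; have [_ h _] := C1_entry (bool_ord a) (bool_ord b) c gC1 hz.
  rewrite /prop_for /continuous_at.
  have e y : box 0 (7 / 5) y -> dd c (G a b) y = 'D_(ebas c) g y (bool_ord a) (bool_ord b).
    by move=> hy; have [h' _ _] := C1_entry (bool_ord a) (bool_ord b) c gC1 hy; exact: is_derive_dd h'.
  rewrite e //; apply: (cvg_trans (near_eq_cvg (F := nbhs z) _) h).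
  by apply: (@filterS _ (nbhs z) _ _ _ _ (near_box hz)) => y hy; rewrite e.
- by move=> a b z hz; have [_ _ h] := C1_entry (bool_ord a) (bool_ord b) true gC1 hz.
- by move=> z hz; rewrite /G -{1}(gS z hz) mxE.
- by move=> z hz; have [] := gP z hz.
- by move=> b i z hz; have [] := C1_entry 0 (ax_ord i) b uC1 hz.
- by move=> b i z hz; have [] := C1_entry 0 (ax_ord i) b uC1 hz.
- by move=> z hz; rewrite eE //; have [] := eP z hz.
- by move=> z hz; rewrite (eE false false z hz) (eE true true z hz) (eE false true z hz); have [] := eP z hz.
- by move=> z hz; have [_ h] := iP z hz; exact: alg (gE false false z hz) (gE true true z hz) (gE false true z hz) h.
have holder := row_map_C1_holder al0 Q0 h1 h4.
have iso x i j : cdisk 1 x -> dot (pd 1 i (row_map u) x) (pd 1 j (row_map u) x) = g x i j.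
  move=> hx; rewrite (row_map_dot al0 Q0 h1 h4) // h2; last exact: cdisk_box.
  by rewrite /G !bool_ordK.
exists (row_map u); split => //.
- split => //; split; first by have [] := holder.
  move=> x hx; apply: inj_row_free => v vJ; apply/eqP; apply: contraT => v0.
  have x2 : cdisk 2 x by rewrite /cdisk /= in hx *; apply: le_trans hx _; rewrite ler1n.
  have [_ /(_ v v0)] := gp x x2.
  (* Isometry says that [g x] is the Gram matrix of the Jacobian; a nonzero left kernel vector of
     the Jacobian would then annihilate a positive definite form. *)
  have -> : g x = Defs.jacobian 1 (row_map u) x *m (Defs.jacobian 1 (row_map u) x)^T.
    apply/matrixP => i j; rewrite -iso // [RHS]mxE; apply: eq_bigr => k _.
    by congr (_ * _); [rewrite [RHS]mxE|rewrite [RHS]mxE [RHS]mxE].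
  by rewrite mulmxA vJ !mul0mx mxE ltxx.
- apply: (@le_lt_trans _ _ (Num.sqrt 3%:R * (eps / 4))%:E).
    apply: ge_ereal_sup => _ [x hx <-]; rewrite lee_fin; apply: enorm_le => [|k]; first exact: ltW.
    rewrite !mxE distrC -{2}(ord_axK k); apply: h3; exact: cdisk_box.
  rewrite lte_fin.
  have : Num.sqrt 3%:R <= 2 :> R.
    by rewrite -[leRHS]ger0_norm // -[leRHS]sqrtr_sqr ler_wsqrtr // expr2; lra.
  by move=> /(ler_wpM2r (ltW eta0)); lra.
Qed.
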